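(* Let $D_B\supseteq D_A=D$, $\dim\ker A=n<\infty$, let $\lambda A+B$ be a regular pencil of index $\nu$, and let $f\in C(\mathbb R_+\times D,Y)$ have the structure $$f(t,x)=(Q_1+Q_{20})f(t,x)+\sum_{s=1}^{\nu-2}Q_{2\Sigma,s}f\Big(t,\sum_{j=1}^{\nu-1}x_{2j}^{(j+1)}+\sum_{j=s}^{\nu-2}x_{2\wedge,j}\Big)+\sum_{s=1}^{\nu-1}Q_{2s}^{(s+1)}f\Big(t,\sum_{j=s}^{\nu-1}x_{2j}^{(j+1)}\Big).$$ Assume that there exist open sets $M_{20}\subseteq D_{20}$, $M_{2j}^{(j+1)}\subseteq D_{2j}^{(j+1)}$ and $M_{2\wedge,j}\subseteq D_{2\wedge,j}$ ($j=1,\dots,\nu-2$), $M_{2(\nu-1)}=M_{2(\nu-1)}^{(\nu)}\subseteq D_{2(\nu-1)}$ such that, for $s=1,\dots,\nu-2$, $$Q_{2s}^{(s+1)}f\in C^{\nu-2}\Big(\mathbb R_+\times\big(\dot{+}_{i=s}^{\nu-1}M_{2i}^{(i+1)}\big),Y_{2s}^{(s+1)}\Big),\quad Q_{2\Sigma,s}f\in C^s\Big(\mathbb R_+\times\big(\dot{+}_{i=1}^{\nu-1}M_{2i}^{(i+1)}\,\dot{+}\,\dot{+}_{i=s}^{\nu-2}M_{2\wedge,i}\big),Y_{2\Sigma,s}\Big),$$ and $Q_{2(\nu-1)}f\in C^{\nu-1}(\mathbb R_+\times M_{2(\nu-1)},Y_{2(\nu-1)})$, and such that, with $M_{2\Sigma}=\dot{+}_{i=1}^{\nu-1}M_{2i}^{(i+1)}\,\dot{+}\,\dot{+}_{i=1}^{\nu-2}M_{2\wedge,i}$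 and $M=D_1\dot{+}M_{20}\dot{+}M_{2\Sigma}$, the following conditions hold. 1.a. For each $t\in\mathbb R_+$ there exists a unique $x_{2(\nu-1)}\in M_{2(\nu-1)}$ such that $F_{2(\nu-1)}(t,x_{2(\nu-1)})=0$. 1.b. For each $s=1,\dots,\nu-2$: for each $t\in\mathbb R_+$, $x_{2j}^{(j+1)}\in M_{2j}^{(j+1)}$, $j=s+1,\dots,\nu-1$, there exists a unique $x_{2s}^{(s+1)}\in M_{2s}^{(s+1)}$ such that $F_{2s}^{(s+1)}=0$ at $(t,x_{2j}^{(j+1)},j=s,\dots,\nu-1)$. 1.c. For each $t\in\mathbb R_+$, $x_{2j}^{(j+1)}\in M_{2j}^{(j+1)}$, $j=1,\dots,\nu-1$, $d_{2(\nu-1)}\in D_{2(\nu-1)}$ there exists a unique $x_{2\wedge,\nu-2}\in M_{2\wedge,\nu-2}$ such that $F_{2\Sigma,\nu-2}=0$ at these values. 1.d. For each $s=1,\dots,\nu-3$: for each $t\in\mathbb R_+$, $x_{2j}^{(j+1)}\in M_{2j}^{(j+1)}$, $j=1,\dots,\nu-1$, $x_{2\wedge,i}\in M_{2\wedge,i}$, $i=s+1,\dots,\nu-2$, $d_{2\wedge,s+1}\in D_{2\wedge,s+1}$, $d_{2(s+1)}^{(s+2)}\in D_{2(s+1)}^{(s+2)}$ there exists a unique $x_{2\wedge,s}\in M_{2\wedge,s}$ such that $F_{2\Sigma,s}=0$ at these values. 1.e. For each $t\in\mathbb R_+$, $x_1\in D_1$, $x_{2\Sigma}\in M_{2\Sigma}$,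 $d_{2\wedge,1}\in D_{2\wedge,1}$, $d_{21}^{(2)}\in D_{21}^{(2)}$ there exists a unique $x_{20}\in M_{20}$ such that $F_{20}=0$ at these values. 2.a. For any fixed $\hat t\in\mathbb R_+$, $\hat x_{2(\nu-1)}\in M_{2(\nu-1)}$ satisfying $F_{2(\nu-1)}=0$, the operator $[\partial_x(Q_{2(\nu-1)}f)(\hat t,\hat x_{2(\nu-1)})-Q_{2(\nu-1)}B]P_{2(\nu-1)}|_{D_{2(\nu-1)}}:D_{2(\nu-1)}\to Y_{2(\nu-1)}$ has an inverse in $\mathrm L(Y_{2(\nu-1)},D_{2(\nu-1)})$. 2.b. For each $s=1,\dots,\nu-2$: for any fixed $\hat t\in\mathbb R_+$, $\hat x_{2i}^{(i+1)}\in M_{2i}^{(i+1)}$, $i=s,\dots,\nu-1$, satisfying $F_{2s}^{(s+1)}=0$, the operator $[\partial_x(Q_{2s}^{(s+1)}f)(\hat t,\sum_{i=s}^{\nu-1}\hat x_{2i}^{(i+1)})-Q_{2s}^{(s+1)}B]P_{2s}^{(s+1)}|_{D_{2s}^{(s+1)}}:D_{2s}^{(s+1)}\to Y_{2s}^{(s+1)}$ has an inverse in $\mathrm L(Y_{2s}^{(s+1)},D_{2s}^{(s+1)})$. 2.c. For any fixed $\hat t\in\mathbb R_+$, $\hat x_{2j}^{(j+1)}\in M_{2j}^{(j+1)}$, $j=1,\dots,\nu-1$, $\hat x_{2\wedge,\nu-2}\in M_{2\wedge,\nu-2}$, $\hat d_{2(\nu-1)}\in D_{2(\nu-1)}$ satisfying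 $F_{2\Sigma,\nu-2}=0$, the operator $[\partial_x(Q_{2\Sigma,\nu-2}f)(\hat t,\sum_{j=1}^{\nu-1}\hat x_{2j}^{(j+1)}+\hat x_{2\wedge,\nu-2})-Q_{2\Sigma,\nu-2}B]P_{2\wedge,\nu-2}|_{D_{2\wedge,\nu-2}}:D_{2\wedge,\nu-2}\to Y_{2\Sigma,\nu-2}$ has an inverse in $\mathrm L(Y_{2\Sigma,\nu-2},D_{2\wedge,\nu-2})$. 2.d. For each $s=1,\dots,\nu-3$: for any fixed $\hat t\in\mathbb R_+$, $\hat x_{2j}^{(j+1)}\in M_{2j}^{(j+1)}$, $j=1,\dots,\nu-1$, $\hat x_{2\wedge,i}\in M_{2\wedge,i}$, $i=s,\dots,\nu-2$, $\hat d_{2\wedge,s+1}\in D_{2\wedge,s+1}$, $\hat d_{2(s+1)}^{(s+2)}\in D_{2(s+1)}^{(s+2)}$ satisfying $F_{2\Sigma,s}=0$, the operator $[\partial_x(Q_{2\Sigma,s}f)(\hat t,\sum_{j=1}^{\nu-1}\hat x_{2j}^{(j+1)}+\sum_{i=s}^{\nu-2}\hat x_{2\wedge,i})-Q_{2\Sigma,s}B]P_{2\wedge,s}|_{D_{2\wedge,s}}:D_{2\wedge,s}\to Y_{2\Sigma,s}$ has an inverse in $\mathrm L(Y_{2\Sigma,s},D_{2\wedge,s})$. 2.e. One of the following two conditions holds. (i) The components $Q_1f(t,x_1+x_{20}+x_{2\Sigma})$ and $Q_{20}f(t,x_1+x_{20}+x_{2\Sigma})$ satisfy locally a Lipschitz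 condition with respect to $x_1+x_{20}$ on $\mathbb R_+\times M$; and for any fixed $\hat t\in\mathbb R_+$, $\hat x_1\in D_1$, $\hat x_{20}\in M_{20}$, $\hat x_{2\Sigma}\in M_{2\Sigma}$ (put $\hat x=\hat x_1+\hat x_{20}+\hat x_{2\Sigma}$), $\hat d_{21}^{(2)}\in D_{21}^{(2)}$, $\hat d_{2\wedge,1}\in D_{2\wedge,1}$ satisfying $F_{20}=0$ there exist open neighborhoods $U_{\delta_1}(\hat t)\times U_{\delta_2}(\hat x_1)\times U_{\delta_3}(\hat x_{2\Sigma})\times U_{\delta_4}(\hat d_{21}^{(2)})\times U_{\delta_5}(\hat d_{2\wedge,1})=U_\delta(\hat t,\hat x_1,\hat x_{2\Sigma},\hat d_{21}^{(2)},\hat d_{2\wedge,1})\subset\mathbb R_+\times D_1\times D_{2\Sigma}\times D_{21}^{(2)}\times D_{2\wedge,1}$ and $U_\varepsilon(\hat x_{20})\subset D_{20}$ and an operator $\mathrm Z\in\mathrm L(D_{20},Y_{20})$ (depending on $\hat t,\hat x,\hat d_{21}^{(2)},\hat d_{2\wedge,1}$) having an inverse $\mathrm Z^{-1}\in\mathrm L(Y_{20},D_{20})$ such that for each $(t,x_1,x_{2\Sigma},d_{21}^{(2)},d_{2\wedge,1})$ in the former neighborhood and each $x_{20}',x_{20}''\in U_\varepsilon(\hat x_{20})$ $$\big\|F_{20}(t,x_1,x_{20}',x_{2\Sigma},d_{21}^{(2)},d_{2\wedge,1})-F_{20}(t,x_1,x_{20}'',x_{2\Sigma},d_{21}^{(2)},d_{2\wedge,1})-\mathrm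 Z[x_{20}'-x_{20}'']\big\|\le k(\delta,\varepsilon)\|x_{20}'-x_{20}''\|,$$ where $k(\delta,\varepsilon)$ is such that $\lim_{\delta,\varepsilon\to0}k(\delta,\varepsilon)<\|\mathrm Z^{-1}\|^{-1}$ (the numbers $\delta,\varepsilon>0$ depend on the choice of $\hat t,\hat x,\hat d_{21}^{(2)},\hat d_{2\wedge,1}$). (ii) The components $Q_1f(t,x)$ and $Q_{20}f(t,x)$ have continuous partial derivatives with respect to $x$ on $\mathbb R_+\times M$; and for any fixed $\hat t,\hat x_1,\hat x_{20},\hat x_{2\Sigma},\hat d_{21}^{(2)},\hat d_{2\wedge,1}$ as in (i) satisfying $F_{20}=0$, the operator $[\partial_x(Q_{20}f)(\hat t,\hat x)-Q_{20}B]P_{20}|_{D_{20}}:D_{20}\to Y_{20}$ has an inverse in $\mathrm L(Y_{20},D_{20})$. 3. For any fixed $a_1,a_2>0$, $\displaystyle\sup_{t\in[0,a_1],\ x\in M,\ \|x_1\|\le a_2}\|Q_1f(t,x)\|<\infty$ ($x=x_1+x_{20}+x_{2\Sigma}$). 4. There exists an open set $\widetilde\Omega_1\subseteq Y_1$ such that the component $P_1x(t)=x_1(t)$ of each solution $x(t)$ with initial values $t_0\in\mathbb R_+$, $x_{0,1}\in\Omega_1=\widetilde A^{-1}\widetilde\Omega_1$ remains in $\Omega_1$ for all $t$ from the maximal interval of existence of $x(t)$. 5. There exist a functional $V(w_1)=\min_{i=1,\dots,m}V_i(w_1)$, where $w_1=\widetilde Ax_1\in Y_1$ and $V_i\in C(Y_1,\mathbb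 R_+)$, $i=1,\dots,m$, are positive and continuously differentiable functionals on $\widetilde\Omega_1$, and functionals $U\in C((0,\infty),(0,\infty))$, $\psi:\mathbb R_+\to\mathbb R_+$ such that $\psi$ is integrable on each finite interval in $\mathbb R_+$, $$\int^\infty\frac{du}{U(u)}<\infty,\qquad\int^\infty\psi(t)\,dt=\infty,$$ and for each $t\in\mathbb R_+$, $x_{20}\in M_{20}$, $x_{2\Sigma}\in M_{2\Sigma}$, $w_1\in\widetilde\Omega_1$ $$\big\langle Q_1f(t,\widetilde A^{-1}w_1+x_{20}+x_{2\Sigma})-Q_1B\widetilde A^{-1}w_1,\ \partial_{w_1}V_{j(w_1)}(w_1)\big\rangle\ge U(V(w_1))\psi(t),$$ where $j(w_1)\in\{1,\dots,m\}$ is any index for which $V(w_1)=V_{j(w_1)}(w_1)$ for the given $w_1$. Then for each $t_0\in\mathbb R_+$, $x_{0,1}\in\Omega_1$ there exists $t_{max}<\infty$ such that the initial value problem $\frac{d}{dt}[Ax]+Bx=f(t,x)$, $P_1x(t_0)=x_{0,1}$, has a unique solution $x(t)$ on the maximal interval of existence $[t_0,t_{max})$ and $\lim_{t\to t_{max}-0}\|AP_1x(t)\|=\infty$. In addition, if $D=X$ or the operator $A$ is bounded, then $\lim_{t\to t_{max}-0}\|x(t)\|=\infty$ (the solution blows up in finite time).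
   Context: Notation: $\mathbb R_+=[0,\infty)$; $\mathrm L(E,F)$ is the space of bounded linear operators; $\dot{+}$ is direct sum (for subsets of the summands, the set of sums). $\int^\infty h(u)\,du=\infty$ (resp. $<\infty$) means that $\int_{u_0}^\infty h(u)\,du$ diverges (resp. converges) for any $u_0>0$. $\partial_wV(w)$ is the gradient (derivative) of the functional $V$ and $\langle y,\partial_wV(w)\rangle$ its value on $y$. Setting: $X,Y$ are Banach spaces; $A:D_A\to Y$, $B:D_B\to Y$ are closed linear operators with domains dense in $X$; $\operatorname{range}(A)$ is closed; $D=D_A\cap D_B\neq\{0\}$. The abstract differential-algebraic equation (ADAE) is $\frac{d}{dt}[Ax]+Bx=f(t,x)$, $t>0$. A solution on an interval $J\subseteq\mathbb R_+$ is $x\in C(J,X)$ with $Ax\in C^1(J,Y)$ (if $J=\mathbb R_+$: $Ax\in C^1((0,\infty),Y)$), $x(t)\in D$, satisfying the equation for every $t\in J$. An interval $J$ is the maximal interval of existence of $x(t)$ (in a set $S$) if $x$ cannot be extended (to the right) to a strictly larger interval so that it remains a solution (with values in $S$). As in the underlying local result, solutions of the initial value problem are considered in $M$ (values in $M$). Regular pencil of index $\nu\in\mathbb N$: there is $R>0$ such that for every complex $\lambda$ with $|\lambda|>R$ the operator $\lambda A+B:D\to Y$ has an inverse in $\mathrm L(Y,X)$, and $(A+\mu B)^{-1}$ has a pole of order $\nu$ at $\mu=0$ (equivalently, $(\lambda A+B)^{-1}$ has at $\lambda=\infty$ a pole of order $\nu-1$, or a removable singularity if $\nu=1$). For real spaces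 this is understood via complexification. Projectors: let $\{\varphi_i^1\}_{i=1}^n$ be a basis of $\ker A\cap D$, and $\{\varphi_i^j\}_{i=1,\dots,n}^{j=1,\dots,m_i}\subset D$ a canonical system of root vectors of $A+\mu B$ at $\mu=0$: $A\varphi_i^1=0$, $A\varphi_i^j=-B\varphi_i^{j-1}$ ($j=2,\dots,m_i$), $1\le m_i\le\nu$, $\max_i m_i=\nu$; let $q_i^j\in D_{A^*}\cap D_{B^*}$ satisfy $A^*q_i^{m_i}=0$, $A^*q_i^j=-B^*q_i^{j+1}$ ($j<m_i$), $\langle B\varphi_i^j,q_k^l\rangle=\delta_{ik}\delta_{jl}$. Such systems exist and are fixed. For $s=0,\dots,\nu-1$, $j=s+1,\dots,\nu$: $P_{2s}^{(j)}=\sum_{i:m_i=j}\langle\cdot,B^*q_i^{s+1}\rangle\varphi_i^{s+1}$, $Q_{2s}^{(j)}=\sum_{i:m_i=j}\langle\cdot,q_i^{s+1}\rangle B\varphi_i^{s+1}$, $P_{2s}=\sum_{j=s+1}^\nu P_{2s}^{(j)}$, $Q_{2s}=\sum_{j=s+1}^\nu Q_{2s}^{(j)}$; $P_2=\sum_{s=0}^{\nu-1}P_{2s}$, $Q_2=\sum_{s=0}^{\nu-1}Q_{2s}$, $P_1=I-P_2$, $Q_1=I-Q_2$, $P_{2\Sigma}=\sum_{s=1}^{\nu-1}P_{2s}$; $P_{2\wedge,s}=P_{2s}-P_{2s}^{(s+1)}$, $Q_{2\Sigma,s}=Q_{2s}-Q_{2s}^{(s+1)}$ ($s=0,\dots,\nu-2$).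 These are bounded projectors on $X$ (the $P$'s) and $Y$ (the $Q$'s). $D$ and $Y$ with an index denote the images of $D$ and $Y$ under the projector with the same index: $D_1=P_1D$, $D_{2s}=P_{2s}D$, $D_{2s}^{(j)}=P_{2s}^{(j)}D$, $D_{2\wedge,s}=P_{2\wedge,s}D$, $D_{2\Sigma}=P_{2\Sigma}D$, $Y_1=Q_1Y$, $Y_{2s}=Q_{2s}Y$, $Y_{2s}^{(j)}=Q_{2s}^{(j)}Y$, $Y_{2\Sigma,s}=Q_{2\Sigma,s}Y$; similarly $x_1=P_1x$, $x_{2s}=P_{2s}x$, $x_{2s}^{(j)}=P_{2s}^{(j)}x$, $x_{2\wedge,s}=P_{2\wedge,s}x$, $x_{2\Sigma}=P_{2\Sigma}x$. Thus $x=x_1+x_{20}+x_{2\Sigma}$, $x_{2\Sigma}=\sum_{j=1}^{\nu-1}x_{2j}^{(j+1)}+\sum_{j=1}^{\nu-2}x_{2\wedge,j}$, $x_{2(\nu-1)}=x_{2(\nu-1)}^{(\nu)}$, $Q_{2(\nu-1)}=Q_{2(\nu-1)}^{(\nu)}$. Norms on direct sums are sums of the norms of components. $\widetilde A=A+\sum_{i=1}^n\langle\cdot,B^*q_i^1\rangle B\varphi_i^{m_i}:D\to Y$ has an inverse $\widetilde A^{-1}\in\mathrm L(Y,X)$; it coincides with $A$ on $D_1$ and maps $D_1$ onto $Y_1$. Functions: $F_{2(\nu-1)}(t,x_{2(\nu-1)})=Q_{2(\nu-1)}f(t,x_{2(\nu-1)})-Bx_{2(\nu-1)}$ (used for $\nu\ge2$);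 $F_{2s}^{(s+1)}(t,x_{2j}^{(j+1)},j=s,\dots,\nu-1)=Q_{2s}^{(s+1)}f(t,\sum_{j=s}^{\nu-1}x_{2j}^{(j+1)})-Bx_{2s}^{(s+1)}$, $s=1,\dots,\nu-2$ ($\nu\ge3$); $F_{2\Sigma,\nu-2}(t,x_{2j}^{(j+1)},j=1,\dots,\nu-1,x_{2\wedge,\nu-2},d_{2(\nu-1)})=Q_{2\Sigma,\nu-2}f(t,\sum_{j=1}^{\nu-1}x_{2j}^{(j+1)}+x_{2\wedge,\nu-2})-Bx_{2\wedge,\nu-2}-Ad_{2(\nu-1)}$ ($\nu\ge3$); $F_{2\Sigma,s}(t,x_{2j}^{(j+1)},j=1,\dots,\nu-1,x_{2\wedge,i},i=s,\dots,\nu-2,d_{2(s+1)}^{(s+2)},d_{2\wedge,s+1})=Q_{2\Sigma,s}f(t,\sum_{j=1}^{\nu-1}x_{2j}^{(j+1)}+\sum_{i=s}^{\nu-2}x_{2\wedge,i})-Bx_{2\wedge,s}-A[d_{2(s+1)}^{(s+2)}+d_{2\wedge,s+1}]$, $s=1,\dots,\nu-3$ ($\nu\ge4$); $F_{20}(t,x_1,x_{20},x_{2\Sigma},d_{21}^{(2)},d_{2\wedge,1})=Q_{20}f(t,x_1+x_{20}+x_{2\Sigma})-Bx_{20}-Q_{20}A[d_{21}^{(2)}+d_{2\wedge,1}]$. Sums, objects and conditions with index ranges that are empty for the given $\nu$ are absent: for $\nu=2$, $x_{2\wedge,1}=d_{2\wedge,1}=0$; for $\nu=1$, $x_{2\Sigma}=0$,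 $d_{21}^{(2)}=d_{2\wedge,1}=0$ and, among the data and conditions of types 1 and 2, only $M_{20}$ and the conditions involving $F_{20}$ remain. Locally Lipschitz with respect to $x$ on $J\times M$: for each $(t',x')\in J\times M$ there are open neighborhoods of $t'$, $x'$ and $L\ge0$ with $\|g(t,x^1)-g(t,x^2)\|\le L\|x^1-x^2\|$ for $t$, $x^1,x^2$ in them; ''with respect to $x_1+x_{20}$'' means this for $x^1,x^2$ having the same component $x_{2\Sigma}$. Neighborhoods of an endpoint of a time interval are semi-open intervals. *)

(* Defs.v *)
From HB Require Import structures.
From mathcomp Require Import all_boot all_order all_algebra.
From mathcomp Require Import complex.
From mathcomp Require Import all_classical all_reals all_analysis.

Set Implicit Arguments.
Unset Strict Implicit.
Unset Printing Implicit Defensive.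

Import Order.TTheory GRing.Theory Num.Theory.
Import numFieldNormedType.Exports.

Local Open Scope classical_set_scope.
Local Open Scope ring_scope.

(* A Banach space is real or complex: it is a complete normed module over
   [scalar_field R c], which is R or R[i] according to c. *)
Variant scalar_kind := RealScalars | ComplexScalars.

Definition scalar_field (R : realType) (c : scalar_kind) : numFieldType :=
  match c with RealScalars => R | ComplexScalars => R[i] end.

Definition of_real (R : realType) (c : scalar_kind) : R -> scalar_field R c :=
  match c return R -> scalar_field R c with
  | RealScalars => fun r => r
  | ComplexScalars => fun r => r%:C%C
  end.

Definition re_scalar (R : realType) (c : scalar_kind) : scalar_field R c -> R :=
  match c return scalar_field R c -> R with
  | RealScalars => fun a => a
  | ComplexScalars => fun a => complex.Re a
  end.

(* `|x| lives in the scalar field (and is real); [nrm x] is the same number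
   in R. *)
Definition nrm (R : realType) (c : scalar_kind)
    (E : normedModType (scalar_field R c)) (x : E) : R := re_scalar `|x|.

Section Sets.
Variables (R : realType) (c : scalar_kind).
Variable E : normedModType (scalar_field R c).

Definition linear_subspace (W : set E) : Prop :=
  W 0 /\ forall (a : scalar_field R c) x y, W x -> W y -> W (a *: x + y).

Definition rel_open (W M : set E) : Prop :=
  exists2 O : set E, open O & M = O `&` W.

Definition addset (S T : set E) : set E :=
  [set z | exists x y, [/\ S x, T y & z = x + y]].

(* S_lo + ... + S_(hi-1); it is [set 0] when hi <= lo. *)
Definition sumset (lo hi : nat) (S : nat -> set E) : set E :=
  [set z | exists2 u : nat -> E, (forall j, (lo <= j < hi)%N -> S j (u j))
                               & z = \sum_(lo <= j < hi) u j].

End Sets.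

Section Operators.
Variables (R : realType) (c c' : scalar_kind).
Variables (E : normedModType (scalar_field R c)).
Variables (F : normedModType (scalar_field R c')).

Definition rlinear_on (W : set E) (T : E -> F) : Prop :=
  forall (a : R) x y, W x -> W y ->
    T (of_real c a *: x + y) = of_real c' a *: T x + T y.

Definition bounded_on (W : set E) (T : E -> F) : Prop :=
  exists C : R, forall x, W x -> nrm (T x) <= C * nrm x.

Definition maps_to (W : set E) (V : set F) (T : E -> F) : Prop :=
  forall x, W x -> V (T x).

Definition opnorm (W : set E) (T : E -> F) : R :=
  sup [set nrm (T x) | x in [set x | W x /\ nrm x <= 1]].

(* L is the Frechet derivative at x of g restricted to S, where S is
   relatively open in the subspace W. Derivatives are taken over the reals,
   also when the spaces are complex. *)
Definition is_frechet (S W : set E) (g : E -> F) (x : E) (L : E -> F) : Prop :=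
  [/\ rlinear_on W L, bounded_on W L &
      forall e : R, 0 < e -> exists2 d : R, 0 < d &
        forall y, S y -> nrm (y - x) < d ->
          nrm (g y - g x - L (y - x)) <= e * nrm (y - x)].

(* dg is continuous on S for the operator norm of L(W, F). *)
Definition opnorm_continuous (S W : set E) (dg : E -> E -> F) : Prop :=
  forall x, S x -> forall e : R, 0 < e -> exists2 d : R, 0 < d &
    forall y, S y -> nrm (y - x) < d ->
    forall h, W h -> nrm (dg y h - dg x h) <= e * nrm h.

(* Same for a family depending on a time t in [0, +oo). *)
Definition opnorm_continuous_t (S W : set E) (dg : R -> E -> E -> F) : Prop :=
  forall (t : R) x, 0 <= t -> S x -> forall e : R, 0 < e -> exists2 d : R, 0 < d &
    forall (t' : R) y, 0 <= t' -> `|t' - t| < d -> S y -> nrm (y - x) < d ->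
    forall h, W h -> nrm (dg t' y h - dg t x h) <= e * nrm h.

Definition continuous_partial (S W : set E) (g : R -> E -> F) : Prop :=
  exists dg : R -> E -> E -> F,
    (forall (t : R) x, 0 <= t -> S x -> is_frechet S W (g t) x (dg t x)) /\
    opnorm_continuous_t S W dg.

Definition tnrm (h : R * E) : R := `|h.1| + nrm h.2.

(* g is in C^k([0, +oo) x S), S relatively open in the subspace W:
   [G j t x hs] is the value of the j-th Frechet derivative at (t, x) on the
   j = size hs directions hs in R x W (one-sided in t at t = 0); the j-linear
   operators carry the operator norm. *)
Definition Ck (k : nat) (S W : set E) (g : R -> E -> F) : Prop :=
  exists G : nat -> R -> E -> seq (R * E) -> F,
  let dirs j (hs : seq (R * E)) :=
    size hs = j /\ forall h, h \in hs -> W h.2 in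
  let size_of (hs : seq (R * E)) := \prod_(h <- hs) tnrm h in
  [/\ forall (t : R) x, 0 <= t -> S x -> G 0%N t x [::] = g t x,
      forall j (t : R) x hs, (j < k)%N -> 0 <= t -> S x -> dirs j hs ->
        forall (a : R) h h', W h.2 -> W h'.2 ->
          G j.+1 t x ((a * h.1 + h'.1, of_real c a *: h.2 + h'.2) :: hs)
          = of_real c' a *: G j.+1 t x (h :: hs) + G j.+1 t x (h' :: hs),
      forall j (t : R) x, (j <= k)%N -> 0 <= t -> S x ->
        exists C : R, forall hs, dirs j hs -> nrm (G j t x hs) <= C * size_of hs,
      forall j (t : R) x, (j < k)%N -> 0 <= t -> S x ->
        forall e : R, 0 < e -> exists2 d : R, 0 < d &
        forall (t' : R) y, 0 <= t' -> S y -> tnrm (t' - t, y - x) < d ->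
        forall hs, dirs j hs ->
          nrm (G j t' y hs - G j t x hs - G j.+1 t x ((t' - t, y - x) :: hs))
          <= e * tnrm (t' - t, y - x) * size_of hs
    & forall (t : R) x, 0 <= t -> S x ->
        forall e : R, 0 < e -> exists2 d : R, 0 < d &
        forall (t' : R) y, 0 <= t' -> S y -> tnrm (t' - t, y - x) < d ->
        forall hs, dirs k hs ->
          nrm (G k t' y hs - G k t x hs) <= e * size_of hs].

End Operators.

Section Inverses.
Variables (R : realType) (c c' : scalar_kind).
Variables (E : normedModType (scalar_field R c)).
Variables (F : normedModType (scalar_field R c')).

Definition is_bounded_inverse (W : set E) (V : set F) (T : E -> F)
    (S : F -> E) : Prop :=
  [/\ rlinear_on V S, bounded_on V S, maps_to V W S &
      (forall x, W x -> S (T x) = x) /\ (forall y, V y -> T (S y) = y)].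

Definition has_bounded_inverse (W : set E) (V : set F) (T : E -> F) : Prop :=
  maps_to W V T /\ exists S, is_bounded_inverse W V T S.

End Inverses.

Section KOperators.
Variables (R : realType) (c : scalar_kind).
Local Notation K := (scalar_field R c).
Variables E F : normedModType K.

Definition klinear_on (W : set E) (T : E -> F) : Prop :=
  forall (a : K) x y, W x -> W y -> T (a *: x + y) = a *: T x + T y.

Definition closed_densely_defined (D : set E) (T : E -> F) : Prop :=
  [/\ linear_subspace D, klinear_on D T, dense D &
      closed [set p : E * F | D p.1 /\ p.2 = T p.1]].

Definition dual_element (q : E -> K^o) : Prop :=
  (forall (a : K) x y, q (a *: x + y) = a *: q x + q y) /\ bounded_on setT q.

End KOperators.

Section Adjoint.
Variables (R : realType) (c : scalar_kind).
Local Notation K := (scalar_field R c).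
Variables E F : normedModType K.

Definition is_adjoint (D : set E) (T : E -> F) (q : F -> K^o) (p : E -> K^o) :=
  dual_element p /\ forall x, D x -> p x = q (T x).

Definition dom_adjoint (D : set E) (T : E -> F) : set (F -> K^o) :=
  [set q | dual_element q /\ exists p, is_adjoint D T q p].

(* T^* q; unique on dom_adjoint when D is dense. *)
Definition adjoint (D : set E) (T : E -> F) (q : F -> K^o) : E -> K^o :=
  xget (fun=> 0) [set p | is_adjoint D T q p].

End Adjoint.

Section RegularPencil.
Variable R : realType.

(* Complex vector spaces presented by their scalings and norms, so that the
   complexification of a real space is an instance. *)
Section Complex.
Variables (X Y : zmodType) (sX : R[i] -> X -> X) (sY : R[i] -> Y -> Y).
Variables (nX : X -> R) (nY : Y -> R).
Variables (D : set X) (A B : X -> Y).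

Definition bounded_operator (S : Y -> X) : Prop :=
  (forall (a : R[i]) y z, S (sY a y + z) = sX a (S y) + S z) /\
  exists C : R, forall y, nX (S y) <= C * nY y.

Definition is_inverse (T : X -> Y) (S : Y -> X) : Prop :=
  [/\ bounded_operator S, forall y, D (S y),
      forall x, D x -> S (T x) = x & forall y, T (S y) = y].

(* (A + mu B)^-1 = \sum_(k >= 0) mu^(k - nu) C_k near mu = 0, with C_0 != 0,
   the series converging in operator norm. *)
Definition pole_at_0 (nu : nat) : Prop :=
  exists (r : R) (C : nat -> Y -> X),
  [/\ 0 < r, forall k, bounded_operator (C k), exists y, C 0%N y != 0 &
      forall mu : R[i], 0 < `|mu| < r%:C%C ->
      exists2 S : Y -> X, is_inverse (fun x => A x + sY mu (B x)) S &
        forall e : R, 0 < e -> exists N : nat, forall l, (N <= l)%N ->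
        forall y,
          nX (S y - \sum_(0 <= k < l) sX (mu ^ (k%:Z - nu%:Z)) (C k y))
          <= e * nY y].

Definition regular_pencil_over_C (nu : nat) : Prop :=
  [/\ (0 < nu)%N,
      exists2 r : R, 0 < r & forall la : R[i], r%:C%C < `|la| ->
        exists S, is_inverse (fun x => sY la (A x) + B x) S
    & pole_at_0 nu].

End Complex.

Definition cplx_scale (X : lmodType R) (a : R[i]) (p : X * X) : X * X :=
  (complex.Re a *: p.1 - complex.Im a *: p.2,
   complex.Re a *: p.2 + complex.Im a *: p.1).

Definition regular_pencil (c : scalar_kind) :
    forall (X Y : normedModType (scalar_field R c)) (D : set X) (A B : X -> Y)
      (nu : nat), Prop :=
  match c with
  | ComplexScalars => fun X Y D A B nu =>
      @regular_pencil_over_C X Y (fun a x => a *: x) (fun a y => a *: y)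
        (@nrm R ComplexScalars X) (@nrm R ComplexScalars Y) D A B nu
  | RealScalars => fun X Y D A B nu =>
      @regular_pencil_over_C (X * X)%type (Y * Y)%type
        (@cplx_scale X) (@cplx_scale Y)
        (fun p => @nrm R RealScalars X p.1 + @nrm R RealScalars X p.2)
        (fun p => @nrm R RealScalars Y p.1 + @nrm R RealScalars Y p.2)
        [set p | D p.1 /\ D p.2]
        (fun p => (A p.1, A p.2)) (fun p => (B p.1, B p.2)) nu
  end.

End RegularPencil.

(* The data of d/dt[Ax] + Bx = f(t, x): operators A, B with their domains
   (the values of opA, opB outside the domains are irrelevant), the index nu,
   the number n of chains, their lengths m_i, the root vectors
   phi_i^j = root_vec i j and the functionals q_i^j = root_fun i j
   (relevant for 1 <= j <= m_i), and f. *)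
Record adae (R : realType) (c : scalar_kind)
    (X Y : normedModType (scalar_field R c)) := Adae {
  domA : set X;
  opA : X -> Y;
  domB : set X;
  opB : X -> Y;
  nu : nat;
  nchains : nat;
  chain_len : 'I_nchains -> nat;
  root_vec : 'I_nchains -> nat -> X;
  root_fun : 'I_nchains -> nat -> Y -> (scalar_field R c)^o;
  rhs : R -> X -> Y
}.

Section Adae.
Variables (R : realType) (c : scalar_kind).
Local Notation K := (scalar_field R c).
Variables (X Y : normedModType K) (S : adae X Y).

Local Notation A := (opA S).
Local Notation B := (opB S).
Local Notation ν := (nu S).
Local Notation n := (nchains S).
Local Notation m := (@chain_len _ _ _ _ S).
Local Notation φ := (@root_vec _ _ _ _ S).
Local Notation q := (@root_fun _ _ _ _ S).
Local Notation f := (rhs S).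

Definition dom : set X := domA S `&` domB S.

Definition standing_assumptions : Prop :=
  [/\ closed_densely_defined (domA S) A, closed_densely_defined (domB S) B,
      closed [set A x | x in domA S] & exists2 x, dom x & x != 0].

Definition root_system : Prop :=
  [/\ (forall i, (1 <= m i <= ν)%N) /\ (exists i, m i = ν),
      [/\ forall i j, (1 <= j <= m i)%N -> dom (φ i j),
          forall i, A (φ i 1%N) = 0,
          forall i j, (2 <= j <= m i)%N -> A (φ i j) = - B (φ i j.-1)
        & forall x, dom x -> A x = 0 ->
            exists! a : {ffun 'I_n -> K}, x = \sum_(i < n) a i *: φ i 1%N],
      [/\ forall i j, (1 <= j <= m i)%N ->
            dom_adjoint (domA S) A (q i j) /\ dom_adjoint (domB S) B (q i j),
          forall i x, adjoint (domA S) A (q i (m i)) x = 0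
        & forall i j, (1 <= j < m i)%N -> forall x,
            adjoint (domA S) A (q i j) x = - adjoint (domB S) B (q i j.+1) x]
    & forall i j k l, (1 <= j <= m i)%N -> (1 <= l <= m k)%N ->
        q k l (B (φ i j)) = ((i == k) && (j == l))%:R].

(* <., B^* q_i^j> *)
Definition Bq (i : 'I_n) (j : nat) : X -> K^o := adjoint (domB S) B (q i j).

(* P2sj s j and Q2sj s j are P_{2s}^{(j)} and Q_{2s}^{(j)}. *)
Definition P2sj (s j : nat) (x : X) : X :=
  \sum_(i < n | m i == j) Bq i s.+1 x *: φ i s.+1.
Definition Q2sj (s j : nat) (y : Y) : Y :=
  \sum_(i < n | m i == j) q i s.+1 y *: B (φ i s.+1).
Definition P2s (s : nat) (x : X) : X := \sum_(s.+1 <= j < ν.+1) P2sj s j x.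
Definition Q2s (s : nat) (y : Y) : Y := \sum_(s.+1 <= j < ν.+1) Q2sj s j y.
Definition P2 (x : X) : X := \sum_(0 <= s < ν) P2s s x.
Definition Q2 (y : Y) : Y := \sum_(0 <= s < ν) Q2s s y.
Definition P1 (x : X) : X := x - P2 x.
Definition Q1 (y : Y) : Y := y - Q2 y.
(* P2S is P_{2 Sigma}; P2w s and Q2S s are P_{2 wedge, s}, Q_{2 Sigma, s};
   P2d s and Q2d s are P_{2s}^{(s+1)} and Q_{2s}^{(s+1)}. *)
Definition P2S (x : X) : X := \sum_(1 <= s < ν) P2s s x.
Definition P2w (s : nat) (x : X) : X := P2s s x - P2sj s s.+1 x.
Definition Q2S (s : nat) (y : Y) : Y := Q2s s y - Q2sj s s.+1 y.
Definition P2d (s : nat) : X -> X := P2sj s s.+1.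
Definition Q2d (s : nat) : Y -> Y := Q2sj s s.+1.

Definition D1 : set X := P1 @` dom.
Definition D2s (s : nat) : set X := P2s s @` dom.
Definition D2d (s : nat) : set X := P2d s @` dom.
Definition D2w (s : nat) : set X := P2w s @` dom.
Definition D2S : set X := P2S @` dom.
Definition Y1 : set Y := range Q1.
Definition Y2s (s : nat) : set Y := range (Q2s s).
Definition Y2d (s : nat) : set Y := range (Q2d s).
Definition Y2S (s : nat) : set Y := range (Q2S s).

Definition At (x : X) : Y :=
  A x + \sum_(i < n) Bq i 1%N x *: B (φ i (m i)).
Definition At_inv (y : Y) : X := xget 0 [set x | dom x /\ At x = y].

(* An interval J in [0, +oo) with left endpoint t0 in J and J != {t0}. *)
Definition interval_from (t0 : R) (J : set R) : Prop :=
  [/\ is_interval J, 0 <= t0, J t0, forall (t : R), J t -> t0 <= t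
    & exists2 t, J t & t0 < t].

Definition is_tderiv (J : set R) (g : R -> Y) (t : R) (l : Y) : Prop :=
  (fun s => of_real c (s - t)^-1 *: (g s - g t)) @ within J t^' --> l.

Definition solution (J : set R) (x : R -> X) : Prop :=
  let J' := [set t | J t /\ (J = [set s | 0 <= s] -> 0 < t)] in
  [/\ {within J, continuous x}, forall (t : R), J t -> dom (x t) &
      exists y' : R -> Y,
        [/\ forall (t : R), J' t -> is_tderiv J' (A \o x) t (y' t),
            {within J', continuous y'} &
            forall (t : R), J' t -> y' t + B (x t) = f t (x t)]].

Definition solution_in (M : set X) (J : set R) (x : R -> X) : Prop :=
  solution J x /\ forall (t : R), J t -> M (x t).

Definition maximal_solution_in (M : set X) (t0 : R) (J : set R)
    (x : R -> X) : Prop :=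
  [/\ interval_from t0 J, solution_in M J x &
      forall J' x', interval_from t0 J' -> J `<=` J' -> solution_in M J' x' ->
        (forall (t : R), J t -> x' t = x t) -> J' = J].

Definition rhs_continuous : Prop :=
  {within [set p : R * X | 0 <= p.1 /\ dom p.2],
    continuous (fun p => f p.1 p.2)}.

Definition rhs_structure : Prop :=
  forall (t : R) x, 0 <= t -> dom x ->
    f t x = (Q1 (f t x) + Q2s 0 (f t x))
      + \sum_(1 <= s < ν.-1)
          Q2S s (f t (\sum_(1 <= j < ν) P2d j x + \sum_(s <= j < ν.-1) P2w j x))
      + \sum_(1 <= s < ν) Q2d s (f t (\sum_(s <= j < ν) P2d j x)).

(* The sets M_{20}, M_{2j}^{(j+1)} = M2d j (1 <= j <= nu - 1) and
   M_{2 wedge, j} = M2w j (1 <= j <= nu - 2). *)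
Variables (M20 : set X) (M2d M2w : nat -> set X).

Definition M_open : Prop :=
  [/\ rel_open (D2s 0) M20,
      forall j, (1 <= j < ν)%N -> rel_open (D2d j) (M2d j)
    & forall j, (1 <= j < ν.-1)%N -> rel_open (D2w j) (M2w j)].

Definition MS : set X := addset (sumset 1 ν M2d) (sumset 1 ν.-1 M2w).
Definition MM : set X := addset (addset D1 M20) MS.

Definition rhs_smooth : Prop :=
  [/\ forall s, (1 <= s < ν.-1)%N ->
        Ck (ν - 2) (sumset s ν M2d) (sumset s ν D2d) (fun t x => Q2d s (f t x)),
      forall s, (1 <= s < ν.-1)%N ->
        Ck s (addset (sumset 1 ν M2d) (sumset s ν.-1 M2w))
             (addset (sumset 1 ν D2d) (sumset s ν.-1 D2w))
             (fun t x => Q2S s (f t x))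
    & (2 <= ν)%N ->
        Ck ν.-1 (M2d ν.-1) (D2s ν.-1) (fun t x => Q2s ν.-1 (f t x))].

(* A family u : nat -> X stands for the x_{2j}^{(j+1)} = u j and w for the
   x_{2 wedge, j} = w j. *)

Definition F2last (t : R) (x : X) : Y := Q2s ν.-1 (f t x) - B x.
Definition F2d (s : nat) (t : R) (u : nat -> X) : Y :=
  Q2d s (f t (\sum_(s <= j < ν) u j)) - B (u s).
Definition F2S_last (t : R) (u : nat -> X) (w d : X) : Y :=
  Q2S (ν - 2) (f t (\sum_(1 <= j < ν) u j + w)) - B w - A d.
Definition F2S (s : nat) (t : R) (u w : nat -> X) (d dw : X) : Y :=
  Q2S s (f t (\sum_(1 <= j < ν) u j + \sum_(s <= i < ν.-1) w i))
    - B (w s) - A (d + dw).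
Definition F20 (t : R) (x1 x20 x2S d21 dw1 : X) : Y :=
  Q2s 0 (f t (x1 + x20 + x2S)) - B x20 - Q2s 0 (A (d21 + dw1)).

Definition condition_1a : Prop := (2 <= ν)%N ->
  forall (t : R), 0 <= t -> exists! x, M2d ν.-1 x /\ F2last t x = 0.

Definition condition_1b : Prop := forall s, (1 <= s < ν.-1)%N ->
  forall (t : R) u, 0 <= t -> (forall j, (s < j < ν)%N -> M2d j (u j)) ->
  exists! v, M2d s v /\ F2d s t [eta u with s |-> v] = 0.

Definition condition_1c : Prop := (3 <= ν)%N ->
  forall (t : R) u d, 0 <= t -> (forall j, (1 <= j < ν)%N -> M2d j (u j)) ->
  D2s ν.-1 d ->
  exists! w, M2w (ν - 2) w /\ F2S_last t u w d = 0.

Definition condition_1d : Prop := forall s, (1 <= s < ν - 2)%N ->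
  forall (t : R) u w dw d, 0 <= t -> (forall j, (1 <= j < ν)%N -> M2d j (u j)) ->
  (forall i, (s < i < ν.-1)%N -> M2w i (w i)) ->
  D2w s.+1 dw -> D2d s.+1 d ->
  exists! v, M2w s v /\ F2S s t u [eta w with s |-> v] d dw = 0.

Definition condition_1e : Prop :=
  forall (t : R) x1 x2S dw1 d21, 0 <= t -> D1 x1 -> MS x2S -> D2w 1 dw1 ->
  D2d 1 d21 ->
  exists! x20, M20 x20 /\ F20 t x1 x20 x2S d21 dw1 = 0.

Definition condition_2a : Prop := (2 <= ν)%N ->
  forall (t : R) x, 0 <= t -> M2d ν.-1 x -> F2last t x = 0 ->
  exists2 L, is_frechet (M2d ν.-1) (D2s ν.-1) (Q2s ν.-1 \o f t) x L &
    has_bounded_inverse (D2s ν.-1) (Y2s ν.-1)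
      (fun h => L (P2s ν.-1 h) - Q2s ν.-1 (B (P2s ν.-1 h))).

Definition condition_2b : Prop := forall s, (1 <= s < ν.-1)%N ->
  forall (t : R) u, 0 <= t -> (forall i, (s <= i < ν)%N -> M2d i (u i)) ->
  F2d s t u = 0 ->
  exists2 L, is_frechet (sumset s ν M2d) (sumset s ν D2d) (Q2d s \o f t)
               (\sum_(s <= i < ν) u i) L &
    has_bounded_inverse (D2d s) (Y2d s)
      (fun h => L (P2d s h) - Q2d s (B (P2d s h))).

Definition condition_2c : Prop := (3 <= ν)%N ->
  forall (t : R) u w d, 0 <= t -> (forall j, (1 <= j < ν)%N -> M2d j (u j)) ->
  M2w (ν - 2) w -> D2s ν.-1 d -> F2S_last t u w d = 0 ->
  exists2 L, is_frechet (addset (sumset 1 ν M2d) (M2w (ν - 2)))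
               (addset (sumset 1 ν D2d) (D2w (ν - 2))) (Q2S (ν - 2) \o f t)
               (\sum_(1 <= j < ν) u j + w) L &
    has_bounded_inverse (D2w (ν - 2)) (Y2S (ν - 2))
      (fun h => L (P2w (ν - 2) h) - Q2S (ν - 2) (B (P2w (ν - 2) h))).

Definition condition_2d : Prop := forall s, (1 <= s < ν - 2)%N ->
  forall (t : R) u w dw d, 0 <= t -> (forall j, (1 <= j < ν)%N -> M2d j (u j)) ->
  (forall i, (s <= i < ν.-1)%N -> M2w i (w i)) ->
  D2w s.+1 dw -> D2d s.+1 d -> F2S s t u w d dw = 0 ->
  exists2 L, is_frechet (addset (sumset 1 ν M2d) (sumset s ν.-1 M2w))
               (addset (sumset 1 ν D2d) (sumset s ν.-1 D2w)) (Q2S s \o f t)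
               (\sum_(1 <= j < ν) u j + \sum_(s <= i < ν.-1) w i) L &
    has_bounded_inverse (D2w s) (Y2S s)
      (fun h => L (P2w s h) - Q2S s (B (P2w s h))).

Definition locally_lipschitz_x1_x20 (g : R -> X -> Y) : Prop :=
  forall (t' : R) x', 0 <= t' -> MM x' -> exists d L : R, [/\ 0 < d, 0 <= L &
    forall (t : R) x y, 0 <= t -> `|t - t'| < d -> MM x -> MM y ->
      nrm (x - x') < d -> nrm (y - x') < d -> P2S x = P2S y ->
      nrm (g t x - g t y) <= L * nrm (x - y)].

(* Hypothesis on F20 near a point: Z is independent of the radii
   d1, ..., d5, e of the neighbourhoods, the bound k depends on them, and
   k tends to kl as the radii tend to 0. *)
Definition strong_approximation (t0 : R) (x1 x20 x2S d21 dw1 : X) : Prop :=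
  exists (Z : X -> Y) (Zi : Y -> X) (k : R -> R -> R -> R -> R -> R -> R)
    (b kl : R),
  let small r d1 d2 d3 d4 d5 e :=
    [/\ 0 < d1 <= r, 0 < d2 <= r & 0 < d3 <= r] /\
    [/\ 0 < d4 <= r, 0 < d5 <= r & 0 < e <= r] in
  [/\ [/\ rlinear_on (D2s 0) Z, bounded_on (D2s 0) Z,
          maps_to (D2s 0) (Y2s 0) Z
        & is_bounded_inverse (D2s 0) (Y2s 0) Z Zi],
      0 < b,
      forall d1 d2 d3 d4 d5 e : R, small b d1 d2 d3 d4 d5 e ->
        forall (t : R) y1 y2S g21 gw1 y y',
        [/\ 0 <= t, `|t - t0| < d1, D1 y1 & nrm (y1 - x1) < d2] ->
        D2S y2S -> nrm (y2S - x2S) < d3 ->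
        D2d 1 g21 -> nrm (g21 - d21) < d4 ->
        D2w 1 gw1 -> nrm (gw1 - dw1) < d5 ->
        D2s 0 y -> nrm (y - x20) < e -> D2s 0 y' -> nrm (y' - x20) < e ->
        nrm (F20 t y1 y y2S g21 gw1 - F20 t y1 y' y2S g21 gw1 - Z (y - y'))
        <= k d1 d2 d3 d4 d5 e * nrm (y - y'),
      forall eta : R, 0 < eta -> exists2 r : R, 0 < r &
        forall d1 d2 d3 d4 d5 e : R, small r d1 d2 d3 d4 d5 e ->
        `|k d1 d2 d3 d4 d5 e - kl| < eta
    & kl < (opnorm (Y2s 0) Zi)^-1].

Definition condition_2e_i : Prop :=
  [/\ locally_lipschitz_x1_x20 (fun t x => Q1 (f t x)),
      locally_lipschitz_x1_x20 (fun t x => Q2s 0 (f t x)) &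
      forall (t : R) x1 x20 x2S d21 dw1, 0 <= t -> D1 x1 -> M20 x20 -> MS x2S ->
        D2d 1 d21 -> D2w 1 dw1 -> F20 t x1 x20 x2S d21 dw1 = 0 ->
        strong_approximation t x1 x20 x2S d21 dw1].

Definition condition_2e_ii : Prop :=
  [/\ continuous_partial MM dom (fun t x => Q1 (f t x)),
      continuous_partial MM dom (fun t x => Q2s 0 (f t x)) &
      forall (t : R) x1 x20 x2S d21 dw1, 0 <= t -> D1 x1 -> M20 x20 -> MS x2S ->
        D2d 1 d21 -> D2w 1 dw1 -> F20 t x1 x20 x2S d21 dw1 = 0 ->
        exists2 L, is_frechet MM dom (Q2s 0 \o f t) (x1 + x20 + x2S) L &
          has_bounded_inverse (D2s 0) (Y2s 0)
            (fun h => L (P2s 0 h) - Q2s 0 (B (P2s 0 h)))].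

Definition condition_3 : Prop := forall a1 a2 : R, 0 < a1 -> 0 < a2 ->
  (ereal_sup [set (nrm (Q1 (f p.1 p.2)))%:E | p in
     [set p : R * X | (0 <= p.1 <= a1)%R /\ MM p.2 /\ (nrm (P1 p.2) <= a2)%R]]
   < +oo)%E.

Variable tOmega1 : set Y.

Definition Omega1 : set X := At_inv @` tOmega1.

Definition condition_4 : Prop :=
  forall t0 J x, maximal_solution_in MM t0 J x -> Omega1 (P1 (x t0)) ->
  forall (t : R), J t -> Omega1 (P1 (x t)).

Definition condition_5 : Prop :=
  exists (k : nat) (V : 'I_k.+1 -> Y -> (R^o : normedModType R))
    (dV : 'I_k.+1 -> Y -> Y -> (R^o : normedModType R)) (U psi : R -> R),
  let Vmin w := \big[Order.min/V ord0 w]_(i < k.+1) V i w in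
  let mu := @lebesgue_measure R in
  [/\ forall i, [/\ {within Y1, continuous (V i)},
                    forall w, Y1 w -> 0 <= V i w
                  & forall w, tOmega1 w -> 0 < V i w],
      forall i, (forall w, tOmega1 w ->
          @is_frechet R c RealScalars Y (R^o : normedModType R)
            tOmega1 Y1 (V i) w (dV i w)) /\
        @opnorm_continuous R c RealScalars Y (R^o : normedModType R)
            tOmega1 Y1 (dV i),
      [/\ {within [set u : R | 0 < u], continuous U},
          forall u : R, 0 < u -> 0 < U u,
          forall (t : R), 0 <= t -> 0 <= psi t
        & forall a b : R, 0 <= a <= b ->
            mu.-integrable `[a, b] (EFin \o psi)],
      forall u0 : R, 0 < u0 ->
        (\int[mu]_(u in `[u0, +oo[) ((U u)^-1)%:E < +oo)%E /\
        (\int[mu]_(t in `[u0, +oo[) (psi t)%:E = +oo)%E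
    & forall (t : R) x20 x2S w, 0 <= t -> M20 x20 -> MS x2S -> tOmega1 w ->
        forall j, V j w = Vmin w ->
        U (Vmin w) * psi t
        <= dV j w (Q1 (f t (At_inv w + x20 + x2S)) - Q1 (B (At_inv w)))].

End Adae.

(* Main.v *)
(* A solution x of the ADAE with values in M is determined by w = A x_1. Applying
   the projectors Q_{2s}^{(s+1)} and Q_{2 Sigma, s} to the equation, for s = nu - 1
   downwards, gives equations without derivatives of unknowns: each component of
   x_{2 Sigma} is an implicitly defined curve, C^s in t, hence its image under A is
   differentiable and may be substituted at level s - 1. (The components range over
   finite-dimensional spaces, so linear implicit equations are solved by Cramer's
   rule, which keeps the smoothness.) The projector Q_{20} then gives x_{20} as a
   function of (t, x_1), continuous and locally Lipschitz in x_1, by a Newton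
   iteration. What is left is an ordinary differential equation w' = F(t, w) in Y_1
   with F continuous and locally Lipschitz in w, so solutions are unique, and one
   that exists only up to T < oo has |w(t)| -> oo at T, since F is bounded on bounded
   sets by condition 3. A global solution is impossible: if G is a primitive of 1/U,
   then G(V(w(t))) grows at least like the divergent integral of psi, while G stays
   bounded. The minimum V of the V_i is only Lipschitz along w; the growth estimate
   is obtained by dominated convergence of truncated difference quotients. *)

From HB Require Import structures.
From Pilot Require Import Defs.
From Stdlib Require PeanoNat.
From mathcomp Require Import all_boot all_order all_algebra.
From mathcomp Require Import perm complex zify ring lra.
From mathcomp Require Import all_classical all_reals all_analysis measurable_realfun.

Set Implicit Arguments.
Unset Strict Implicit.
Unset Printing Implicit Defensive.

Import Order.TTheory GRing.Theory Num.Theory.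
Import numFieldNormedType.Exports.

Local Open Scope classical_set_scope.
Local Open Scope ring_scope.

(** * Real scalars *)

(** The operators A and B are unbounded, so nothing about A^{-1} on Y_1 comes for free. The range of
    A is closed, hence so is A(D_1), and the closed graph theorem bounds both A^{-1} and B A^{-1}
    there; solving (A + mu B) x = y for small real mu and projecting then shows that A(D_1) is all
    of Y_1. Every space is restricted to real scalars, since the derivatives in the hypotheses are
    real ones; real and complex spaces are thus treated at once. Continuous curves are integrated by
    means of Cousin's lemma. The loss of derivatives dictates the exponents: level s uses the
    derivative of level s + 1, so C^{s+1} there gives C^s here. The inverses in conditions 2.a to
    2.d are given point by point, without any regularity in t, so the smoothness of an implicit
    curve is bootstrapped through the linear equation for its derivative. On J = [0, oo) the
    equation is not imposed at t = 0, and continuity of x does not give that of A x_1; the latter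
    must be proved at 0 before uniqueness can be claimed. *)

Section ModuleExpressions.
Variables (K : comNzRingType) (V : lmodType K).

Inductive mexpr := MAtom of nat | MZero | MAdd of mexpr & mexpr | MOpp of mexpr
  | MScale of K & mexpr.

Fixpoint meval (s : seq V) (e : mexpr) : V :=
  match e with
  | MAtom i => nth 0 s i
  | MZero => 0
  | MAdd e1 e2 => meval s e1 + meval s e2
  | MOpp e1 => - meval s e1
  | MScale a e1 => a *: meval s e1
  end.

(** [PeanoNat.Nat.eqb] rather than [==]: on numerals it is evaluated by [cbn], which leaves plain
    ring identities between coefficients. *)
Fixpoint mcoef (i : nat) (e : mexpr) : K :=
  match e with
  | MAtom j => if PeanoNat.Nat.eqb i j then 1 else 0
  | MZero => 0
  | MAdd e1 e2 => mcoef i e1 + mcoef i e2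
  | MOpp e1 => - mcoef i e1
  | MScale a e1 => a * mcoef i e1
  end.

Lemma mevalE (s : seq V) e :
  meval s e = \sum_(i < size s) mcoef i e *: nth 0 s i.
Proof.
elim: e => [j||e1 IH1 e2 IH2|e IH|a e IH] /=.
- have [js|js] := ltnP j (size s).
    rewrite (bigD1 (Ordinal js)) //= PeanoNat.Nat.eqb_refl scale1r big1 ?addr0// => i /eqP ij.
    by case: PeanoNat.Nat.eqb_spec => [e|_]; [case: ij; exact: val_inj|rewrite scale0r].
  rewrite nth_default// big1// => i _; case: PeanoNat.Nat.eqb_spec => [e|_]; last by rewrite scale0r.
  by move: js; rewrite -e leqNgt ltn_ord.
- by rewrite big1// => i _; rewrite scale0r.
- by rewrite IH1 IH2 -big_split; apply: eq_bigr => i _; rewrite scalerDl.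
- by rewrite IH -sumrN; apply: eq_bigr => i _; rewrite scaleNr.
- by rewrite IH scaler_sumr; apply: eq_bigr => i _; rewrite scalerA.
Qed.

Fixpoint mcoef_eq (n : nat) (e1 e2 : mexpr) : Prop :=
  if n is n'.+1 then mcoef n' e1 = mcoef n' e2 /\ mcoef_eq n' e1 e2 else True.

Lemma meval_eq (s : seq V) e1 e2 : mcoef_eq (size s) e1 e2 -> meval s e1 = meval s e2.
Proof.
rewrite !mevalE; elim: (size s) => [|n IH] /= H; first by rewrite !big_ord0.
by case: H => H1 H2; rewrite !big_ord_recr /= H1 IH.
Qed.
End ModuleExpressions.

(* [lmod_over] decides equalities between linear combinations, up to [ring]
   identities between the coefficients. *)
Ltac mindex x s :=
  lazymatch s with
  | x :: _ => constr:(0%N)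
  | _ :: ?s' => let i := mindex x s' in constr:(i.+1)
  end.
Ltac matoms t s :=
  lazymatch t with
  | GRing.add ?a ?b => let s1 := matoms a s in matoms b s1
  | GRing.opp ?a => matoms a s
  | GRing.scale _ ?a => matoms a s
  | GRing.zero => s
  | _ => match s with
         | context [t :: _] => s
         | _ => constr:(t :: s)
         end
  end.
Ltac mreify K t s :=
  lazymatch t with
  | GRing.add ?a ?b => let e1 := mreify K a s in let e2 := mreify K b s in
      constr:(@MAdd K e1 e2)
  | GRing.opp ?a => let e := mreify K a s in constr:(@MOpp K e)
  | GRing.scale ?k ?a => let e := mreify K a s in constr:(@MScale K k e)
  | GRing.zero => constr:(@MZero K)
  | _ => let i := mindex t s in constr:(@MAtom K i)
  end.
Ltac lmod_over K V :=
  lazymatch goal with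
  | |- @eq ?T ?a ?b =>
      let s0 := matoms a (@nil T) in
      let s := matoms b s0 in
      let e1 := mreify K a s in
      let e2 := mreify K b s in
      refine (@meval_eq K V s e1 e2 _);
      cbn [mcoef_eq mcoef size Nat.eqb];
      repeat (split; [ring|]); exact I
  end.

Section Scalars.
Variables (R : realType) (c : scalar_kind).
Local Notation K := (scalar_field R c).

Lemma of_real0 : of_real c 0 = 0 :> K. Proof. by case: c. Qed.
Lemma of_real1 : of_real c 1 = 1 :> K. Proof. by case: c. Qed.
Lemma of_realD (a b : R) : of_real c (a + b) = of_real c a + of_real c b.
Proof. by case: c => //=; rewrite rmorphD. Qed.
Lemma of_realM (a b : R) : of_real c (a * b) = of_real c a * of_real c b.
Proof. by case: c => //=; rewrite rmorphM. Qed.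
Lemma ler_of_real (a b : R) : (of_real c a <= of_real c b) = (a <= b).
Proof. by case: c => //=; rewrite lecR. Qed.
Lemma ltr_of_real (a b : R) : (of_real c a < of_real c b) = (a < b).
Proof. by case: c => //=; rewrite ltcR. Qed.
Lemma of_realK (a : R) : re_scalar (of_real c a) = a.
Proof. by case: c. Qed.
Lemma re_scalarK (a : K) : 0 <= a -> of_real c (re_scalar a) = a.
Proof.
case: c a => //= a; case: a => x y /=.
by rewrite lecE /= => /andP[/eqP -> _].
Qed.
Lemma normr_of_real (a : R) : `|of_real c a| = of_real c `|a|.
Proof. by case: c => //=; rewrite normc_def /= expr0n addr0 sqrtr_sqr. Qed.
End Scalars.

Section Realify.
Variables (R : realType) (c : scalar_kind).
Local Notation K := (scalar_field R c).

Section Nrm.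
Variable E : normedModType K.
Lemma nrm_ofE (x : E) : of_real c (nrm x) = `|x|.
Proof. exact: re_scalarK. Qed.
Lemma nrm_triangle (x y : E) : nrm (x + y) <= nrm x + nrm y.
Proof. by rewrite -(ler_of_real c) of_realD !nrm_ofE ler_normD. Qed.
Lemma nrm0_eq0 (x : E) : nrm x = 0 -> x = 0.
Proof.
by move=> x0; apply/normr0_eq0; rewrite -nrm_ofE x0 of_real0.
Qed.
Lemma nrmZ (a : R) (x : E) : nrm (of_real c a *: x) = `|a| * nrm x.
Proof.
apply/eqP; rewrite -(inj_eq (can_inj (of_realK c))) of_realM !nrm_ofE.
by rewrite normrZ normr_of_real.
Qed.
End Nrm.

(* The space E with its scalars restricted to the reals: same topology, norm [nrm]. *)
Definition realify (E : normedModType K) : Type := E.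

Variable E : normedModType K.
HB.instance Definition _ := GRing.Zmodule.copy (realify E) E.
HB.instance Definition _ := PointedUniform.copy (realify E) E.

Let scale (a : R) (x : realify E) : realify E := of_real c a *: (x : E).
Let scaleA a b v : scale a (scale b v) = scale (a * b) v.
Proof. by rewrite /scale scalerA of_realM. Qed.
Let scale1 : left_id 1 scale.
Proof. by move=> x; rewrite /scale of_real1 scale1r. Qed.
Let scaleDr : right_distributive scale +%R.
Proof. by move=> a x y; rewrite /scale scalerDr. Qed.
Let scaleDl v : {morph scale^~ v : a b / a + b}.
Proof. by move=> a b; rewrite /scale of_realD scalerDl. Qed.
HB.instance Definition _ :=
  GRing.Zmodule_isLmodule.Build R (realify E) scaleA scale1 scaleDr scaleDl.

Let norm0 (x : realify E) : nrm (x : E) = 0 -> x = 0.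
Proof. exact: nrm0_eq0. Qed.
Let normN (x : realify E) : nrm (- x : E) = nrm (x : E).
Proof. by rewrite /nrm normrN. Qed.
Let normMn (x : realify E) n : nrm (x *+ n : E) = nrm (x : E) *+ n.
Proof.
apply: (can_inj (of_realK c)); rewrite nrm_ofE normrMn.
by elim: n => [|n IH]; rewrite ?mulr0n ?of_real0// !mulrS of_realD IH nrm_ofE.
Qed.
HB.instance Definition _ :=
  Num.Zmodule_isNormed.Build R (realify E) (@nrm_triangle E) norm0 normMn normN.

(** Radii are embedded real numbers. Every positive scalar is real, so these balls generate the same
    entourages as those of [E]. *)
Let rball (x : realify E) (r : R) (y : realify E) := ball (x : E) (of_real c r) y.
Let rball_center x (r : R) : 0 < r -> rball x r x.
Proof. by move=> r0; apply: ballxx; rewrite -(of_real0 R c) ltr_of_real. Qed.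
Let rball_sym x y (r : R) : rball x r y -> rball y r x.
Proof. exact: ball_sym. Qed.
Let rball_triangle x y z (r s : R) : rball x r y -> rball y s z -> rball x (r + s) z.
Proof. by rewrite /rball of_realD; exact: ball_triangle. Qed.
Let rball_entourage : @entourage (realify E) = entourage_ rball.
Proof.
apply/seteqP; split=> [A|A [r /= r0 rA]].
- rewrite -[entourage]/(@entourage E) -entourage_ballE => -[r /= r0 rA].
  exists (re_scalar r) => /=; first by rewrite -(ltr_of_real c) re_scalarK ?ltW// of_real0.
  by move=> p; rewrite /rball re_scalarK ?ltW//; exact: rA.
- rewrite -[entourage]/(@entourage E) -entourage_ballE; exists (of_real c r) => //=.
  by rewrite -(of_real0 R c) ltr_of_real.
Qed.
HB.instance Definition _ := Uniform_isPseudoMetric.Build R (realify E)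
  rball_center rball_sym rball_triangle rball_entourage.

Let rball_norm : @ball R (realify E) = ball_ (fun x => `|x|).
Proof.
apply/funext => x; apply/funext => r; apply/funext => y.
rewrite -[LHS]/(@ball K E x (of_real c r) y) -ball_normE /ball_ /=.
by rewrite -nrm_ofE ltr_of_real.
Qed.
HB.instance Definition _ :=
  NormedZmod_PseudoMetric_eq.Build R (realify E) rball_norm.
HB.instance Definition _ :=
  PseudoMetricNormedZmod_Lmodule_isNormedModule.Build R (realify E) (@nrmZ E).
End Realify.

HB.instance Definition _ (R : realType) (c : scalar_kind)
    (E : completeNormedModType (scalar_field R c)) :=
  Uniform_isComplete.Build (realify E) (@cauchy_cvg E).

(** * Derivatives and integration of curves *)

Section IntervalCalculus.
Variable R : realType.

(** Continuous induction: the supremum of the t with P a t is attained, because points on either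
    side of it are joined by the local hypothesis, and the same joining shows that it is b. This
    takes the place of compactness wherever a local estimate is summed over an interval. *)
Lemma cousin (P : R -> R -> Prop) (a b : R) : a <= b ->
  (forall s t u, a <= s -> s <= t -> t <= u -> u <= b -> P s t -> P t u -> P s u) ->
  (forall c, a <= c -> c <= b -> exists2 d, 0 < d & forall s t,
      a <= s -> s <= c -> c <= t -> t <= b -> c - d < s -> t < c + d -> P s t) ->
  P a b.
Proof.
move=> ab Ptrans Ploc.
pose S := [set t | a <= t /\ t <= b /\ P a t].
have Sa : S a.
  by have [d d0 H] := Ploc a (lexx _) ab; split => //; split => //; apply: H => //; lra.
have Sb : has_sup S by split; [exists a|exists b => t -[_ []]].
have ac : a <= sup S by apply: ub_le_sup => //; case: Sb.
have cb : sup S <= b by apply: ge_sup => [|t [_ []]//]; exists a.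
have [d d0 H] := Ploc _ ac cb.
have [t0 [at0 [t0b Pt0]] t0c] := sup_adherent d0 Sb.
have t0c' : t0 <= sup S by apply: ub_le_sup => //; case: Sb.
pose t := Num.min b (sup S + d / 2).
have tP : t <= b /\ t <= sup S + d / 2 by split; rewrite ge_min lexx ?orbT.
have ct : sup S <= t by rewrite le_min cb /=; lra.
have Pat : P a t.
  apply: (Ptrans _ t0) => //; first by lra.
    by case: tP.
  by apply: H => //; case: tP => //; lra.
have : t <= sup S.
  by apply: ub_le_sup; [case: Sb|split; [lra|split => //; case: tP]].
rewrite le_eqVlt => /orP[/eqP tc|]; last by lra.
suff <- : t = b by [].
case: tP => tb _; apply/eqP; rewrite eq_le tb /= leNgt; apply/negP => tb'.
have : t = sup S + d / 2.
  by rewrite /t /Num.min; case: ifPn => // bs; move: tb'; rewrite /t /Num.min bs ltxx.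
by lra.
Qed.

(** Implications P s -> P t compose, so they form an interval property to which Cousin's lemma
    applies. *)
Lemma cousinS (P : R -> Prop) (a b : R) : a <= b -> P a ->
  (forall c, a <= c -> c <= b -> exists2 d, 0 < d & forall s t,
      a <= s -> s <= c -> c <= t -> t <= b -> c - d < s -> t < c + d -> P s -> P t) ->
  P b.
Proof.
move=> ab Pa H.
by apply: (@cousin (fun s t => P s -> P t) a b) => // s t u _ _ _ _ st tu /st/tu.
Qed.

Section Deriv.
Variables E F : normedModType R.
Implicit Types (J : set R) (u v : R -> E) (t : R).

Definition cont_on J u t := forall e : R, 0 < e -> exists2 d : R, 0 < d &
  forall s, J s -> `|s - t| < d -> `|u s - u t| <= e.

(** Stated without a quotient, so s = t needs no exception; the restriction to [J] makes it
    one-sided at an endpoint. *)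
Definition deriv_on J u t (l : E) := forall e : R, 0 < e -> exists2 d : R, 0 < d &
  forall s, J s -> `|s - t| < d -> `|u s - u t - (s - t) *: l| <= e * `|s - t|.

Definition clusters J t := forall d : R, 0 < d ->
  exists s, [/\ J s, s != t & `|s - t| < d].

Lemma deriv_on_sub J J' u t l : J' `<=` J -> deriv_on J u t l -> deriv_on J' u t l.
Proof. by move=> JJ H e /H[d d0 {}H]; exists d => // s /JJ; exact: H. Qed.

Lemma cont_on_sub J J' u t : J' `<=` J -> cont_on J u t -> cont_on J' u t.
Proof. by move=> JJ H e /H[d d0 {}H]; exists d => // s /JJ; exact: H. Qed.

Lemma eq_deriv_on J u v t l : J t -> (forall s, J s -> u s = v s) ->
  deriv_on J u t l -> deriv_on J v t l.
Proof.
by move=> Jt uv H e /H[d d0 {}H]; exists d => // s Js ?; rewrite -!uv//; exact: H.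
Qed.

Lemma eq_cont_on J u v t : J t -> (forall s, J s -> u s = v s) ->
  cont_on J u t -> cont_on J v t.
Proof.
by move=> Jt uv H e /H[d d0 {}H]; exists d => // s Js ?; rewrite -!uv//; exact: H.
Qed.

Lemma deriv_on_cont J u t l : deriv_on J u t l -> cont_on J u t.
Proof.
move=> /(_ 1 ltr01)[d d0 H] e e0.
have k0 : 0 < 1 + `|l| by rewrite ltr_pwDl.
exists (Num.min d (e / (1 + `|l|))); first by rewrite lt_min d0 divr_gt0.
move=> s Js; rewrite lt_min => /andP[/(H _ Js){}H se].
rewrite -(subrK ((s - t) *: l) (u s - u t)) (le_trans (ler_normD _ _))//.
rewrite normrZ (le_trans (lerD H (lexx _)))// mulrC -mulrDr.
by rewrite -ler_pdivlMr// ltW.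
Qed.

Lemma deriv_on_unique J u t l l' : clusters J t ->
  deriv_on J u t l -> deriv_on J u t l' -> l = l'.
Proof.
move=> acc H H'; apply/eqP; rewrite -subr_eq0 -normr_eq0 eq_le normr_ge0 andbT.
apply/ler_addgt0Pr => e e0; rewrite add0r; have e20 : 0 < e / 2 by lra.
have [d d0 {}H] := H _ e20; have [d' d'0 {}H'] := H' _ e20.
have [|s [Js st]] := acc (Num.min d d'); first by rewrite lt_min d0.
rewrite lt_min => /andP[/(H _ Js){}H /(H' _ Js){}H'].
have st0 : 0 < `|s - t| by rewrite normr_gt0 subr_eq0.
rewrite -(ler_pM2l st0) -normrZ scalerBr.
rewrite (_ : _ - _ = (u s - u t - (s - t) *: l') - (u s - u t - (s - t) *: l)).
  rewrite (le_trans (ler_normB _ _))// (le_trans (lerD H' H))//.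
  by rewrite -mulrDl mulrC -splitr.
by lmod_over R E.
Qed.

Lemma deriv_on_cst J (k : E) t : deriv_on J (fun=> k) t 0.
Proof.
by move=> e /ltW e0; exists 1 => // s _ _; rewrite subrr scaler0 subr0 normr0 mulr_ge0.
Qed.

Lemma deriv_onD J u v t l m : deriv_on J u t l -> deriv_on J v t m ->
  deriv_on J (fun s => u s + v s) t (l + m).
Proof.
move=> H H' e e0; have e20 : 0 < e / 2 by lra.
have [d d0 {}H] := H _ e20; have [d' d'0 {}H'] := H' _ e20.
exists (Num.min d d') => [|s Js]; first by rewrite lt_min d0.
rewrite lt_min => /andP[/(H _ Js){}H /(H' _ Js){}H'].
rewrite /= scalerDr (opprD (u t)) addrACA (opprD (_ *: l)) (addrACA (u s - u t)) (le_trans (ler_normD _ _))//.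
by rewrite (le_trans (lerD H H'))// -mulrDl -splitr.
Qed.

Lemma contD_on J u v t : cont_on J u t -> cont_on J v t ->
  cont_on J (fun s => u s + v s) t.
Proof.
move=> H H' e e0; have e20 : 0 < e / 2 by lra.
have [d d0 {}H] := H _ e20; have [d' d'0 {}H'] := H' _ e20.
exists (Num.min d d') => [|s Js]; first by rewrite lt_min d0.
rewrite lt_min => /andP[/(H _ Js){}H /(H' _ Js){}H'].
by rewrite opprD addrACA (le_trans (ler_normD _ _))// (le_trans (lerD H H'))// -splitr.
Qed.

(* It suffices to bound the increments on short intervals, up to any e > 0. *)
Lemma mean_value u (g : R -> E) (a b M : R) : a <= b ->
  (forall t, a <= t <= b -> deriv_on `[a, b] u t (g t)) ->
  (forall t, a <= t <= b -> `|g t| <= M) ->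
  `|u b - u a| <= M * (b - a).
Proof.
move=> ab du gM; apply/ler_addgt0Pl => e e0.
have e'0 : 0 < e / (1 + (b - a)) by rewrite divr_gt0// ltr_pwDl// subr_ge0.
suff : `|u b - u a| <= (M + e / (1 + (b - a))) * (b - a).
  move=> /le_trans; apply; rewrite mulrDl addrC lerD2r -mulrA ger_pMr//.
  by rewrite mulrC ler_pdivrMr ?mul1r ?lerDr// ltr_pwDl// subr_ge0.
move: (e / _) e'0 => {e0}e e0.
apply: (@cousin (fun s t => `|u t - u s| <= (M + e) * (t - s))) => //.
  move=> s t v _ _ _ _ st tv; rewrite -(subrK (u t) (u v)) -addrA.
  rewrite (le_trans (ler_normD _ _))// (le_trans (lerD tv st))//.
  by rewrite -mulrDr addrA subrK.
move=> c ac cb; have cab : a <= c <= b by rewrite ac.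
have [d d0 H] := du c cab _ e0; exists d => // s t as_ sc ct tb cs tc.
have Js : `[a, b]%classic s by rewrite /= in_itv/= as_; lra.
have Jt : `[a, b]%classic t by rewrite /= in_itv/= tb; lra.
have Es : `|s - c| = c - s by rewrite distrC ger0_norm ?subr_ge0.
have Et : `|t - c| = t - c by rewrite ger0_norm ?subr_ge0.
have Hs : `|u s - u c - (s - c) *: g c| <= e * (c - s).
  by rewrite -Es; apply: H => //; rewrite Es; lra.
have Ht : `|u t - u c - (t - c) *: g c| <= e * (t - c).
  by rewrite -[X in e * X]Et; apply: H => //; rewrite Et; lra.
rewrite (_ : u t - u s = (u t - u c - (t - c) *: g c) - (u s - u c - (s - c) *: g c)
   + (t - s) *: g c); last first.
  by lmod_over R E.
rewrite (le_trans (ler_normD _ _))// (le_trans (lerD (ler_normB _ _) (lexx _)))//.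
rewrite normrZ ger0_norm; last lra.
rewrite (le_trans (lerD (lerD Ht Hs) (ler_wpM2l _ (gM c cab))))//; lra.
Qed.

End Deriv.
End IntervalCalculus.

Section BoundedLinear.
Variables (R : realType) (E F : normedModType R).

Definition blinear (L : E -> F) :=
  (forall (a : R) x y, L (a *: x + y) = a *: L x + L y) /\
  exists2 C : R, 0 <= C & forall x, `|L x| <= C * `|x|.

Variable L : E -> F.
Hypothesis bL : blinear L.

Lemma blinear0 : L 0 = 0.
Proof. by have := bL.1 (-1) 0 0; rewrite scaleN1r oppr0 addr0 scaleN1r addNr. Qed.
Lemma blinearD x y : L (x + y) = L x + L y.
Proof. by have := bL.1 1 x y; rewrite !scale1r. Qed.
Lemma blinearZ a x : L (a *: x) = a *: L x.
Proof. by have := bL.1 a x 0; rewrite blinear0 !addr0. Qed.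
Lemma blinearN x : L (- x) = - L x.
Proof. by rewrite -scaleN1r blinearZ scaleN1r. Qed.
Lemma blinearB x y : L (x - y) = L x - L y.
Proof. by rewrite blinearD blinearN. Qed.
Lemma blinear_sum (I : Type) (r : seq I) (P : pred I) (G : I -> E) :
  L (\sum_(i <- r | P i) G i) = \sum_(i <- r | P i) L (G i).
Proof. exact: (big_morph L blinearD blinear0). Qed.

Lemma blinear_bound : exists2 C : R, 0 < C & forall x, `|L x| <= C * `|x|.
Proof.
have [_ [C C0 H]] := bL; exists (C + 1) => [|x]; first by rewrite ltr_wpDl.
by rewrite (le_trans (H x))// ler_wpM2r// lerDl.
Qed.

Lemma deriv_on_blinear J u t l : deriv_on J u t l -> deriv_on J (L \o u) t (L l).
Proof.
have [C C0 H] := blinear_bound => du e e0.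
have [|d d0 {}du] := du (e / C); first by rewrite divr_gt0.
exists d => // s Js /(du _ Js){}du /=.
rewrite -blinearZ -!blinearB (le_trans (H _))//.
by rewrite -ler_pdivlMl// mulrA [C^-1 * e]mulrC.
Qed.

Lemma cont_on_blinear J u t : cont_on J u t -> cont_on J (L \o u) t.
Proof.
have [C C0 H] := blinear_bound => du e e0.
have [|d d0 {}du] := du (e / C); first by rewrite divr_gt0.
exists d => // s Js /(du _ Js){}du /=.
by rewrite -blinearB (le_trans (H _))// -ler_pdivlMl// [C^-1 * e]mulrC.
Qed.
End BoundedLinear.

Section Primitives.
Variables (R : realType).

(** The tail bound survives in the limit, so estimates on the limit inherit an explicit rate. *)
Lemma cauchy_bound (E : completeNormedModType R) (u : nat -> E) (r : nat -> R) :
  (forall n m, (n <= m)%N -> `|u m - u n| <= r n) ->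
  (forall e : R, 0 < e -> exists N, forall n, (N <= n)%N -> r n <= e) ->
  exists l, forall n, `|l - u n| <= r n.
Proof.
move=> ur r0.
have /cauchy_cvgP/cvg_ex[l ul] : cauchy (u @ \oo).
  apply: cauchy_exP => e e0; have e20 : 0 < e / 2 by lra.
  have [N HN] := r0 _ e20; exists (u N), N => // n /= Nn.
  rewrite -ball_normE /ball_ /= distrC (le_lt_trans (ur _ _ Nn))//.
  by have := HN _ (leqnn N); lra.
exists l => n; apply/ler_addgt0Pl => e e0.
move/cvgrPdist_le : ul => /(_ _ e0)[N _ HN].
rewrite -(subrK (u (maxn N n)) l) -addrA (le_trans (ler_normD _ _))//.
by rewrite lerD// ?ur ?leq_maxr//; apply: HN; rewrite /= leq_maxl.
Qed.

Lemma half_pow_small (C e : R) : 0 < e -> exists N, forall n, (N <= n)%N -> C * 2^-1 ^+ n <= e.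
Proof.
move=> e0; have := @cvg_geometric R C 2^-1.
rewrite ger0_norm ?invr_ge0// invf_lt1// ltr1n => /(_ isT).
move=> /cvgrPdist_le/(_ _ e0)[N _ H]; exists N => n /H /=.
by rewrite sub0r normrN; exact/le_trans/ler_norm.
Qed.

Variable E : completeNormedModType R.

(** Increments are tested only on intervals that contain r, the form in which Cousin's lemma glues.
    Because the tolerance is fixed, a locally affine function can qualify. *)
Definition approx_primitive (e : R) (g G : R -> E) (s t : R) :=
  forall r, s <= r -> r <= t -> exists2 d, 0 < d & forall p q,
    s <= p -> p <= r -> r <= q -> q <= t -> r - d < p -> q < r + d ->
    `|G q - G p - (q - p) *: g r| <= e * (q - p).

(** Near c the affine function of slope g c works, by continuity of g; two neighbours are joined by
    adding a constant to the second. *)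
Lemma approx_primitive_ex (g : R -> E) (a b e : R) : 0 < e -> a <= b ->
  (forall t, a <= t <= b -> cont_on `[a, b] g t) ->
  exists G, approx_primitive e g G a b.
Proof.
move=> e0 ab gc.
apply: (@cousin _ (fun s t => exists G, approx_primitive e g G s t)) => //.
  move=> s t u _ st tu _ [G GP] [H HP].
  exists (fun x => if x <= t then G x else H x - H t + G t) => r sr ru.
  have [rt|tr|rt] := ltgtP r t.
  - have [d d0 {}GP] := GP r sr (ltW rt).
    exists (Num.min d (t - r)); first by rewrite lt_min d0 subr_gt0.
    move=> p q sp pr rq qu dp qd.
    have [qd1 qd2] : q < r + d /\ q < t.
      by move: qd; rewrite -ltrBlDl lt_min => /andP[]; lra.
    have dp1 : r - d < p by move: dp; rewrite ltrBlDl -ltrBlDr lt_min => /andP[]; lra.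
    rewrite ifT; last by lra.
    rewrite ifT; last by lra.
    by apply: GP => //; lra.
  - have [d d0 {}HP] := HP r (ltW tr) ru.
    exists (Num.min d (r - t)); first by rewrite lt_min d0 subr_gt0.
    move=> p q sp pr rq qu dp qd.
    have qd1 : q < r + d.
      by move: qd; rewrite -ltrBlDl lt_min => /andP[]; lra.
    have [dp1 dp2] : r - d < p /\ t < p by move: dp; rewrite ltrBlDl -ltrBlDr lt_min => /andP[]; lra.
    rewrite ifF; last by apply/negbTE; rewrite -ltNge; lra.
    rewrite ifF; last by apply/negbTE; rewrite -ltNge; lra.
    rewrite (_ : _ - _ - _ = H q - H p - (q - p) *: g r); last by lmod_over R E.
    by apply: HP => //; lra.
  - rewrite rt in sr ru *; have [d d0 {}HP] := HP t (lexx _) tu.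
    have [d' d'0 {}GP] := GP t st (lexx _).
    exists (Num.min d d'); first by rewrite lt_min d0.
    move=> p q sp pr rq qu dp qd.
    have qd1 : q < t + d.
      by move: qd; rewrite -ltrBlDl lt_min => /andP[]; lra.
    have dp1 : t - d' < p by move: dp; rewrite ltrBlDl -ltrBlDr lt_min => /andP[]; lra.
    rewrite pr.
    have Gp : `|G t - G p - (t - p) *: g t| <= e * (t - p) by apply: GP => //; lra.
    have [qt|tq] := leP q t.
      by have -> : q = t by lra.
    have Hq : `|H q - H t - (q - t) *: g t| <= e * (q - t) by apply: HP => //; lra.
    rewrite (_ : _ - _ - _ = (H q - H t - (q - t) *: g t) + (G t - G p - (t - p) *: g t)).
      by rewrite (le_trans (ler_normD _ _))// (le_trans (lerD Hq Gp))//; lra.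
    by lmod_over R E.
move=> c ac cb; have [|d d0 H] := gc c _ _ e0; first by rewrite ac.
exists d => // s t as_ sc ct tb ds td; exists (fun x => x *: g c).
move=> r sr rt; exists 1 => // p q sp pr rq qt _ _.
rewrite -!scalerBl -scalerBr normrZ ger0_norm; last by lra.
rewrite mulrC ler_wpM2r//; first by lra.
rewrite distrC H//; first by rewrite /= in_itv/=; lra.
rewrite ltr_norml; lra.
Qed.

(** The terms (q - p) g r cancel. With tolerances 2^-n the bound makes a sequence of approximate
    primitives Cauchy. *)
Lemma approx_primitiveB (g G H : R -> E) (a b e e' s t : R) :
  approx_primitive e g G a b -> approx_primitive e' g H a b ->
  a <= s -> s <= t -> t <= b ->
  `|(G t - H t) - (G s - H s)| <= (e + e') * (t - s).
Proof.
move=> GP HP as_ st tb.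
apply: (@cousin _ (fun s t => `|(G t - H t) - (G s - H s)| <= (e + e') * (t - s))) => //.
  move=> p q r _ _ _ _ pq qr; rewrite -(subrK (G q - H q) (G r - H r)) -addrA.
  by rewrite (le_trans (ler_normD _ _))// (le_trans (lerD qr pq))//; lra.
move=> c sc ct.
have [||d d0 {}GP] := GP c; [lra|lra|]; have [||d' d'0 {}HP] := HP c; [lra|lra|].
exists (Num.min d d') => [|p q sp pc cq qt]; first by rewrite lt_min d0.
rewrite ltrBlDl -ltrBlDr lt_min => /andP[h1 h2]; rewrite -ltrBlDl lt_min => /andP[h3 h4].
rewrite (_ : _ - _ = (G q - G p - (q - p) *: g c) - (H q - H p - (q - p) *: g c)).
  rewrite (le_trans (ler_normB _ _))// mulrDl lerD//.
    by apply: GP => //; lra.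
  by apply: HP => //; lra.
by lmod_over R E.
Qed.

(** Limit of approximate primitives with tolerance 2^-n. [HG] keeps a Lipschitz bound on the error H
    - G n, not only a uniform one, and this lets the derivative pass to the limit. *)
Lemma primitive_ex (g : R -> E) (a b : R) : a <= b ->
  (forall t, a <= t <= b -> cont_on `[a, b] g t) ->
  exists G, G a = 0 /\ forall t, a <= t <= b -> deriv_on `[a, b] G t (g t).
Proof.
move=> ab gc.
have p0 n : 0 < 2^-1 ^+ n :> R by rewrite exprn_gt0// invr_gt0.
have /choice[G GP] : forall n : nat, exists G, approx_primitive (2^-1 ^+ n) g G a b.
  by move=> n; exact: approx_primitive_ex.
have ple n m : (n <= m)%N -> 2^-1 ^+ m <= 2^-1 ^+ n :> R.
  by move=> nm; rewrite ler_wiXn2l// ?invr_ge0// invf_le1// ler1n.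
have Gle n m s t : (n <= m)%N -> a <= s -> s <= t -> t <= b ->
    `|(G m t - G n t) - (G m s - G n s)| <= 2 * 2^-1 ^+ n * (t - s).
  move=> nm as_ st tb; rewrite (le_trans (approx_primitiveB (GP m) (GP n) _ _ _))//.
  by rewrite ler_wpM2r ?subr_ge0//; have := ple _ _ nm; lra.
have Gl t : exists l, a <= t <= b ->
    forall n, `|l - (G n t - G n a)| <= 2 * (b - a) * 2^-1 ^+ n.
  case: (boolP (a <= t <= b)) => [/andP[at_ tb]|_]; last by exists 0.
  have [n m nm|e e0|l Hl] := @cauchy_bound E (fun n => G n t - G n a) (fun n => 2 * (b - a) * 2^-1 ^+ n).
  - rewrite (_ : _ - _ = (G m t - G n t) - (G m a - G n a)); last by lmod_over R E.
    rewrite (le_trans (Gle _ _ _ _ nm _ _ _))// mulrAC ler_wpM2r ?(ltW (p0 _))//.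
    by rewrite ler_wpM2l//; lra.
  - exact: half_pow_small.
  - by exists l => _; exact: Hl.
have {Gl}[H HP] := choice Gl.
have HG n s t : a <= s -> s <= t -> t <= b ->
    `|(H t - G n t) - (H s - G n s)| <= 2 * 2^-1 ^+ n * (t - s).
  move=> as_ st tb; apply/ler_addgt0Pl => e e0.
  have e20 : 0 < e / 2 by lra.
  have [N HN] := half_pow_small (2 * (b - a)) e20.
  have HsN := HP s; have HtN := HP t.
  have /HsN{}HsN : a <= s <= b by lra.
  have /HtN{}HtN : a <= t <= b by lra.
  pose m := maxn n N.
  rewrite (_ : _ - _ = (H t - (G m t - G m a)) - (H s - (G m s - G m a)) +
     ((G m t - G n t) - (G m s - G n s))); last by lmod_over R E.
  rewrite (le_trans (ler_normD _ _))// lerD//.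
    rewrite (le_trans (ler_normB _ _))// (le_trans (lerD (HtN m) (HsN m)))//.
    by have := HN m (leq_maxr _ _); lra.
  by apply: Gle => //; exact: leq_maxl.
exists (fun t => H t - H a); split; first by rewrite subrr.
move=> t tab e e0; have e20 : 0 < e / 3 by lra.
have [n Hn] := half_pow_small 1 e20; have {Hn} := Hn _ (leqnn n); rewrite mul1r => Hn.
have /andP[atb tb] := tab.
have [d d0 {}GPn] := GP n t atb tb.
exists d => // s; rewrite /= in_itv/= => /andP[as_ sb]; rewrite ltr_norml => st.
have [ts|/ltW ts] := leP t s.
  rewrite ger0_norm ?subr_ge0//.
  rewrite (_ : _ - _ - _ = (H s - G n s) - (H t - G n t) + (G n s - G n t - (s - t) *: g t)); last by lmod_over R E.
  have K : `|G n s - G n t - (s - t) *: g t| <= 2^-1 ^+ n * (s - t) by apply: GPn => //; lra.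
  rewrite (le_trans (ler_normD _ _))// (le_trans (lerD (HG n t s _ _ _) K))//.
  by rewrite -mulrDl ler_wpM2r ?subr_ge0//; lra.
rewrite (distrC s) ger0_norm ?subr_ge0// -normrN.
rewrite [X in `|X|](_ : _ = (H t - G n t) - (H s - G n s) + (G n t - G n s - (t - s) *: g t)); last by lmod_over R E.
have K : `|G n t - G n s - (t - s) *: g t| <= 2^-1 ^+ n * (t - s) by apply: GPn => //; lra.
rewrite (le_trans (ler_normD _ _))// (le_trans (lerD (HG n s t _ _ _) K))//.
by rewrite -mulrDl ler_wpM2r ?subr_ge0//; lra.
Qed.

End Primitives.

(** * Ordinary differential equations in Banach spaces *)

Section Gronwall.
Variables (R : realType) (E : normedModType R).

Lemma itv_sub (a b s t : R) : a <= s -> t <= b -> [set` `[s, t]] `<=` [set` `[a, b]].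
Proof. by move=> as_ tb r; rewrite /= !in_itv/=; lra. Qed.

Lemma mean_value_itv (u g : R -> E) (a b s t M : R) :
  (forall r, a <= r <= b -> deriv_on `[a, b] u r (g r)) ->
  (forall r, a <= r <= b -> `|g r| <= M) ->
  a <= s <= b -> a <= t <= b -> `|u t - u s| <= M * `|t - s|.
Proof.
move=> du gM.
wlog st : s t / s <= t => [W|] sb tb.
  have [/W|/ltW/W] := leP s t; first exact.
  by move=> /(_ tb sb); rewrite distrC (distrC s).
rewrite [X in M * X]ger0_norm ?subr_ge0//; apply: (@mean_value R E u g) => // r rst.
  by apply: deriv_on_sub (du r _); [apply: itv_sub; lra|lra].
by apply: gM; lra.
Qed.

Lemma cont_on_bounded (u : R -> E) (a b : R) : a <= b ->
  (forall t, a <= t <= b -> cont_on `[a, b] u t) ->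
  exists B, forall t, a <= t <= b -> `|u t| <= B.
Proof.
move=> ab uc.
apply: (@cousin _ (fun s t => exists B, forall r, s <= r <= t -> `|u r| <= B)) => //.
  move=> s t v _ st tv _ [B HB] [B' HB']; exists (Num.max B B') => r srv.
  rewrite le_max; apply/orP; have [rt|/ltW tr] := leP r t.
    by left; apply: HB; lra.
  by right; apply: HB'; lra.
move=> c ac cb; have [|d d0 H] := uc c _ _ (@ltr01 R); first by rewrite ac.
exists d => // s t as_ sc ct tb ds td; exists (`|u c| + 1) => r srt.
rewrite -(subrK (u c) (u r)) addrC (le_trans (ler_normD _ _))// lerD2l H//.
  by rewrite /= in_itv/=; lra.
by rewrite ltr_norml; lra.
Qed.

(** With K (b - a) <= 1/2 the exponential is replaced by a bootstrap: each use of the mean value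
    estimate halves the excess of the bound over 2 A. The base point [s0] is arbitrary, so the
    estimate also runs backwards in time. *)
Lemma short_gronwall (u g : R -> E) (a b s0 K C : R) :
  0 <= K -> 0 <= C -> K * (b - a) <= 2^-1 -> a <= s0 <= b ->
  (forall t, a <= t <= b -> deriv_on `[a, b] u t (g t)) ->
  (forall t, a <= t <= b -> `|g t| <= K * `|u t| + C) ->
  forall t, a <= t <= b -> `|u t| <= 2 * (`|u s0| + C * (b - a)).
Proof.
move=> K0 C0 Kab s0ab du gu t tab.
have ab : a <= b by lra.
have [B HB] : exists B, forall t, a <= t <= b -> `|u t| <= B.
  by apply: cont_on_bounded => // r rab; exact: deriv_on_cont (du r rab).
set A := `|u s0| + _.
have HBn n : forall t, a <= t <= b -> `|u t| <= 2 * A + B * 2^-1 ^+ n.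
  elim: n => [|n IH] r rab.
    rewrite expr0 mulr1 (le_trans (HB r rab))// lerDr mulr_ge0// addr_ge0//.
    by rewrite mulr_ge0// subr_ge0.
  rewrite -(subrK (u s0) (u r)) (le_trans (ler_normD _ _))//.
  have gM q : a <= q <= b -> `|g q| <= K * (2 * A + B * 2^-1 ^+ n) + C.
    by move=> qab; rewrite (le_trans (gu q qab))// lerD2r ler_wpM2l// IH.
  have /le_trans : `|u r - u s0| <= (K * (2 * A + B * 2^-1 ^+ n) + C) * `|r - s0|.
    exact: mean_value_itv du gM _ _.
  have IH0 : 0 <= 2 * A + B * 2^-1 ^+ n by apply: le_trans (IH r rab).
  have rs : `|r - s0| <= b - a by rewrite ler_norml; lra.
  move=> /(_ ((2 * A + B * 2^-1 ^+ n) / 2 + C * (b - a))) H.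
  have {H} : `|u r - u s0| <= (2 * A + B * 2^-1 ^+ n) / 2 + C * (b - a).
    apply: H; rewrite mulrDl lerD//; last by rewrite ler_wpM2l.
    rewrite mulrAC mulrC ler_wpM2l// (le_trans _ Kab)// ler_wpM2l//.
  by rewrite exprS /A; lra.
apply/ler_addgt0Pr => e e0; have [N HN] := half_pow_small B e0.
by rewrite (le_trans (HBn N t tab))// lerD2l HN.
Qed.
End Gronwall.

Section ODE.
Variables (R : realType) (E : completeNormedModType R) (f : R -> E -> E).

Definition jointly_cont := forall t w (e : R), 0 < e -> exists2 d, 0 < d &
  forall s v, `|s - t| < d -> `|v - w| < d -> `|f s v - f t w| <= e.

Definition loc_lipschitz := forall (t : R) w, exists (d L : R), [/\ 0 < d, 0 <= L &
  forall s v v', `|s - t| < d -> `|v - w| < d -> `|v' - w| < d ->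
    `|f s v - f s v'| <= L * `|v - v'|].

Definition sol_on (J : set R) (w : R -> E) :=
  forall t, J t -> deriv_on J w t (f t (w t)).

Hypotheses (fc : jointly_cont) (fl : loc_lipschitz).

Lemma comp_cont_on (J : set R) (w : R -> E) t :
  cont_on J w t -> cont_on J (fun s => f s (w s)) t.
Proof.
move=> wc e /(fc t (w t))[d d0 H].
have d20 : 0 < d / 2 by lra.
have [d' d'0 {}wc] := wc _ d20.
exists (Num.min d d') => [|s Js]; first by rewrite lt_min d0.
rewrite lt_min => /andP[sd /(wc _ Js) sd']; apply: H => //; lra.
Qed.

Lemma sol_unique (a b : R) (w w' : R -> E) : w a = w' a ->
  sol_on `[a, b] w -> sol_on `[a, b] w' -> forall t, a <= t <= b -> w t = w' t.
Proof.
move=> aw sw sw' t /andP[at_ tb].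
apply: (@cousinS _ (fun t => w t = w' t) a t) => // c ac ct.
have Jc : `[a, b]%classic c by rewrite /= in_itv/=; lra.
have cw := deriv_on_cont (sw c Jc); have cw' := deriv_on_cont (sw' c Jc).
(* If the curves differ at c they differ nearby by continuity, and the implication from s to r is
   vacuous. *)
have [cc|/eqP ncc] := pselect (w c = w' c); last first.
  have h0 : 0 < `|w c - w' c| / 3 by rewrite divr_gt0// normr_gt0 subr_eq0.
  have [d d0 H] := cw _ h0; have [d' d'0 H'] := cw' _ h0.
  exists (Num.min d d'); first by rewrite lt_min d0.
  move=> s r as_ sc cr rt.
  rewrite ltrBlDl -ltrBlDr lt_min => /andP[sd sd'] _ ss; exfalso.
  have Js : `[a, b]%classic s by rewrite /= in_itv/=; lra.
  have /H{}H : `|s - c| < d by rewrite ltr_norml; lra.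
  have /H'{}H' : `|s - c| < d' by rewrite ltr_norml; lra.
  have {}H := H Js; have {}H' := H' Js.
  have : `|w c - w' c| <= `|w' s - w' c| + `|w s - w c|.
    rewrite (le_trans _ (ler_normB _ _))//.
    by rewrite ss (_ : _ - _ = w' s - w' c - (w' s - w c)) //; lmod_over R E.
  move: (`|w c - w' c|) h0 H H' => q; lra.
have [d [L [d0 L0 Lip]]] := fl c (w c).
have d20 : 0 < d / 2 by lra.
have [d1 d10 H1] := cw _ d20; have [d2 d20' H2] := cw' _ d20.
(* The interval [s, r] is shorter than 2 h, so the entry 4^-1 / (L + 1) gives L (r - s) <= 1/2, as
   the short Gronwall estimate requires. *)
pose h := Num.min (Num.min d1 d2) (Num.min d (4^-1 / (L + 1))).
have L1 : 0 < L + 1 by lra.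
have h0 : 0 < h by rewrite !lt_min d10 d20' d0 /= divr_gt0// invr_gt0.
exists h => // s r as_ sc cr rt hs hr ss; apply/eqP; rewrite -subr_eq0 -normr_eq0.
have hB q : q < h -> [/\ q < d1, q < d2, q < d & q < 4^-1 / (L + 1)].
  by rewrite /h !lt_min => /andP[/andP[-> ->] /andP[-> ->]].
have /hB[s1 s2 s3 s4] : c - s < h by lra.
have /hB[r1 r2 r3 r4] : r - c < h by lra.
have near q : s <= q <= r -> [/\ `|q - c| < d, `|w q - w c| < d & `|w' q - w c| < d].
  move=> sqr; have Jq : `[a, b]%classic q by rewrite /= in_itv/=; lra.
  split; first by rewrite ltr_norml; lra.
    have : `|w q - w c| <= d / 2 by apply: H1 => //; rewrite ltr_norml; lra.
    by lra.
  have : `|w' q - w' c| <= d / 2 by apply: H2 => //; rewrite ltr_norml; lra.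
  by rewrite cc; lra.
have Hr q : s <= q <= r -> deriv_on `[s, r] (fun p => w p + (-1) *: w' p) q
    (f q (w q) + (-1) *: f q (w' q)).
  move=> sqr; have Jq : `[a, b]%classic q by rewrite /= in_itv/=; lra.
  have JJ : `[s, r] `<=` `[a, b]%classic by apply: itv_sub; lra.
  apply: deriv_onD; first exact: deriv_on_sub (sw q Jq).
  apply: (@deriv_on_blinear _ _ _ (fun v => -1 *: v)).
    split => [k x y|]; first by lmod_over R E.
    by exists 1 => // x; rewrite normrZ normrN1.
  exact: deriv_on_sub (sw' q Jq).
have := @short_gronwall R E _ _ s r s L 0 L0 (lexx _) _ _ Hr _ r.
rewrite ss !scaleN1r subrr normr0 mul0r addr0 mulr0.
rewrite eq_le normr_ge0 andbT; apply.
- have : L * (r - s) <= (L + 1) * (r - s) by rewrite ler_wpM2r//; lra.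
  move=> /le_trans; apply; rewrite -ler_pdivlMl// mulrC; lra.
- lra.
- move=> q /near[qd wq w'q]; rewrite !scaleN1r addr0; exact: Lip.
- lra.
Qed.

Lemma sol_cat (a b c : R) (w w' : R -> E) : a <= b -> b <= c -> w b = w' b ->
  sol_on `[a, b] w -> sol_on `[b, c] w' ->
  sol_on `[a, c] (fun t => if t <= b then w t else w' t).
Proof.
move=> ab bc wb sw sw' t; rewrite /= in_itv/= => /andP[at_ tc].
have [tb|bt|tb] := ltgtP t b.
- have Jt : `[a, b]%classic t by rewrite /= in_itv/=; lra.
  move=> e /(sw t Jt)[d d0 H]; exists (Num.min d (b - t)); first by rewrite lt_min d0 subr_gt0.
  move=> s; rewrite /= in_itv/= => /andP[as_ sc]; rewrite lt_min => /andP[sd sb].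
  have sb' : s <= b by move: sb; rewrite ltr_norml; lra.
  by rewrite sb' (ltW tb); apply: H => //; rewrite /= in_itv/= as_.
- have Jt : `[b, c]%classic t by rewrite /= in_itv/=; lra.
  move=> e /(sw' t Jt)[d d0 H]; exists (Num.min d (t - b)); first by rewrite lt_min d0 subr_gt0.
  move=> s; rewrite /= in_itv/= => /andP[as_ sc]; rewrite lt_min => /andP[sd sb].
  have sb' : b < s by move: sb; rewrite ltr_norml; lra.
  by rewrite [s <= b]leNgt sb' [t <= b]leNgt bt /=; apply: H => //; rewrite /= in_itv/= ltW.
- subst t; have Jt : `[a, b]%classic b by rewrite /= in_itv/=; lra.
  have Jt' : `[b, c]%classic b by rewrite /= in_itv/=; lra.
  move=> e e0; have [d d0 H] := sw b Jt e e0; have [d' d'0 H'] := sw' b Jt' e e0.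
  exists (Num.min d d'); first by rewrite lt_min d0.
  move=> s; rewrite /= in_itv/= => /andP[as_ sc]; rewrite lt_min => /andP[sd sd'].
  rewrite lexx; have [sb|bs] := leP s b.
    by apply: H => //; rewrite /= in_itv/= as_.
  by rewrite wb; apply: H' => //; rewrite /= in_itv/= ltW.
Qed.

Lemma picard (a b M L r : R) (w0 : E) : a <= b -> 0 <= L -> 0 <= r ->
  M * (b - a) <= r -> L * (b - a) <= 2^-1 ->
  (forall t v, a <= t <= b -> `|v - w0| <= r -> `|f t v| <= M) ->
  (forall t v v', a <= t <= b -> `|v - w0| <= r -> `|v' - w0| <= r ->
     `|f t v - f t v'| <= L * `|v - v'|) ->
  exists w, w a = w0 /\ sol_on `[a, b] w.
Proof.
move=> ab L0 r0 Mr Lab fM fL.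
have p0 n : 0 < 2^-1 ^+ n :> R by rewrite exprn_gt0// invr_gt0.
pose inball (w : R -> E) := forall t, a <= t <= b -> `|w t - w0| <= r.
pose cont (w : R -> E) := forall t, a <= t <= b -> cont_on `[a, b] w t.
(* The integral operator of Picard's method, given an arbitrary value outside its domain so that
   [choice] yields a total map to iterate. *)
have step w : exists w', inball w -> cont w -> [/\ w' a = w0, inball w', cont w' &
    forall t, a <= t <= b -> deriv_on `[a, b] w' t (f t (w t))].
  have [iw|niw] := pselect (inball w); last by exists w.
  have [cw|ncw] := pselect (cont w); last by exists w.
  have [t tab|G [Ga HG]] := @primitive_ex _ E (fun s => f s (w s)) a b ab.
    exact: comp_cont_on (cw t tab).
  exists (fun t => w0 + G t) => _ _; split; first by rewrite Ga addr0.
  - move=> t tab; rewrite addrC addKr -[G t]subr0 -Ga.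
    rewrite (le_trans (mean_value_itv (M := M) HG _ _ _))//.
    - by move=> q qab; apply: fM => //; exact: iw.
    - lra.
    - rewrite (le_trans _ Mr)// ger0_norm; last lra.
      have M0 : 0 <= M.
        by have := fM t (w t) tab (iw t tab); apply: le_trans.
      by rewrite ler_wpM2l//; lra.
  - move=> t tab; apply: contD_on; first exact: deriv_on_cont (deriv_on_cst _ _ _).
    exact: deriv_on_cont (HG t tab).
  - move=> t tab; rewrite -[f _ _]add0r; apply: deriv_onD; first exact: deriv_on_cst.
    exact: HG.
have {step}[Phi PhiP] := choice step.
pose w n := iter n Phi (fun=> w0).
have wP n : [/\ w n a = w0, inball (w n) & cont (w n)].
  elim: n => [|n [_ IH1 IH2]]; last by have [] := PhiP _ IH1 IH2.
  split => // t tab; first by rewrite /= subrr normr0.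
  exact: deriv_on_cont (deriv_on_cst _ _ _).
have dw n t : a <= t <= b -> deriv_on `[a, b] (w n.+1) t (f t (w n t)).
  by have [_ h1 h2] := wP n; have [_ _ _] := PhiP _ h1 h2; exact.
have wstep n t : a <= t <= b -> `|w n.+1 t - w n t| <= r * 2^-1 ^+ n.
  elim: n t => [|n IH] t tab.
    by rewrite expr0 mulr1; have [_ + _] := wP 1%N; exact.
  have Hd q : a <= q <= b -> deriv_on `[a, b] (fun q => w n.+2 q + (-1) *: w n.+1 q) q
     (f q (w n.+1 q) + (-1) *: f q (w n q)).
    move=> qab; apply: deriv_onD; first exact: dw.
    apply: (@deriv_on_blinear _ _ _ (fun v => -1 *: v)); last exact: dw.
    split => [k x y|]; first by lmod_over R E.
    by exists 1 => // x; rewrite normrZ normrN1.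
  have := @mean_value_itv R E _ _ a b a t (L * (r * 2^-1 ^+ n)) Hd.
  have -> : w n.+1 a = w0 by have [] := wP n.+1.
  have -> : w n.+2 a = w0 by have [] := wP n.+2.
  rewrite !scaleN1r subrr subr0 => /(_ _ _ tab) H; apply: (le_trans (H _ _)).
  - move=> q qab; rewrite scaleN1r (le_trans (fL _ _ _ _ _ _))//.
      by have [_ + _] := wP n.+1; exact.
      by have [_ + _] := wP n; exact.
    by rewrite ler_wpM2l// IH.
  - lra.
  - rewrite ger0_norm; last lra.
    have Lta : L * (t - a) <= 2^-1 by rewrite (le_trans _ Lab)// ler_wpM2l//; lra.
    rewrite exprS [leLHS](_ : _ = r * 2^-1 ^+ n * (L * (t - a))); last by ring.
    rewrite [leRHS](_ : _ = r * 2^-1 ^+ n * 2^-1); last by ring.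
    by rewrite ler_wpM2l// mulr_ge0// (ltW (p0 _)).
have wcauchy n m t : (n <= m)%N -> a <= t <= b -> `|w m t - w n t| <= 2 * r * 2^-1 ^+ n.
  move=> nm tab; suff : `|w m t - w n t| <= 2 * r * (2^-1 ^+ n - 2^-1 ^+ m).
    move=> /le_trans; apply; rewrite ler_wpM2l ?mulr_ge0// gerBl (ltW (p0 _))//.
  elim: m nm => [|m IH]; first by rewrite leqn0 => /eqP ->; rewrite !subrr normr0 mulr0.
  rewrite leq_eqVlt => /orP[/eqP ->|]; first by rewrite !subrr normr0 mulr0.
  rewrite ltnS => /IH{}IH; rewrite -(subrK (w m t) (w m.+1 t)) -addrA.
  rewrite (le_trans (ler_normD _ _))// (le_trans (lerD (wstep m t tab) IH))//.
  rewrite exprS; lra.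
have wl t : exists l, a <= t <= b -> forall n, `|l - w n t| <= 2 * r * 2^-1 ^+ n.
  case: (boolP (a <= t <= b)) => [tab|_]; last by exists 0.
  have [n m nm|e e0|l Hl] := @cauchy_bound R E (w^~ t) (fun n => 2 * r * 2^-1 ^+ n).
  - exact: wcauchy.
  - exact: half_pow_small.
  - by exists l.
have {wl}[wi wiP] := choice wl.
have wiball : inball wi.
  move=> t tab; apply/ler_addgt0Pr => e e0; have [N HN] := half_pow_small (2 * r) e0.
  rewrite -(subrK (w N t) (wi t)) -addrA addrC (le_trans (ler_normD _ _))// lerD//.
    by have [_ + _] := wP N; exact.
  by rewrite (le_trans (wiP t tab N))// HN.
have wicont : cont wi.
  move=> t tab e e0; have e30 : 0 < e / 3 by lra.
  have [N HN] := half_pow_small (2 * r) e30.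
  have [_ _ cN] := wP N; have [d d0 {}cN] := cN t tab _ e30.
  exists d => // s Js sd; have := cN s Js sd.
  have sab : a <= s <= b by move: Js; rewrite /= in_itv.
  have := wiP s sab N; have := wiP t tab N; have := HN N (leqnn N) => h1 h2 h3 h4.
  rewrite (_ : _ - _ = (wi s - w N s) + (w N s - w N t) - (wi t - w N t)); last by lmod_over R E.
  rewrite (le_trans (ler_normB _ _))// (le_trans (lerD (ler_normD _ _) (lexx _)))//.
  lra.
(* A uniform limit need not inherit derivatives, so the limit is integrated once more: [Phi wi] is
   differentiable, and [WE] shows that it equals [wi]. *)
have [_ _ _ dW] := PhiP _ wiball wicont.
have [Wa _ _ _] := PhiP _ wiball wicont.
have WE t : a <= t <= b -> Phi wi t = wi t.
  move=> tab; apply/eqP; rewrite -subr_eq0 -normr_eq0 eq_le normr_ge0 andbT.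
  apply/ler_addgt0Pr => e e0; rewrite add0r; have e20 : 0 < e / 2 by lra.
  have [N HN] := half_pow_small (2 * r) e20.
  have Hd q : a <= q <= b -> deriv_on `[a, b] (fun q => Phi wi q + (-1) *: w N.+1 q) q
     (f q (wi q) + (-1) *: f q (w N q)).
    move=> qab; apply: deriv_onD; first exact: dW.
    apply: (@deriv_on_blinear _ _ _ (fun v => -1 *: v)); last exact: dw.
    split => [k x y|]; first by lmod_over R E.
    by exists 1 => // x; rewrite normrZ normrN1.
  have := @mean_value_itv R E _ _ a b a t (L * (e / 2)) Hd.
  have -> : w N.+1 a = w0 by have [] := wP N.+1.
  rewrite Wa !scaleN1r subrr subr0 => /(_ _ _ tab) H.
  rewrite -(subrK (w N.+1 t) (Phi wi t)) -addrA (le_trans (ler_normD _ _))//.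
  have -> : e = L * (e / 2) * `|t - a| + (e - L * (e / 2) * `|t - a|) by rewrite addrC subrK.
  rewrite lerD// ?H//.
  - move=> q qab; rewrite scaleN1r (le_trans (fL _ _ _ qab (wiball q qab) _))//.
      by have [_ + _] := wP N; exact.
    by rewrite ler_wpM2l// (le_trans (wiP q qab N))// HN.
  - lra.
  - rewrite distrC (le_trans (wiP t tab _))//.
    have : L * (e / 2) * `|t - a| <= e / 2 * 2^-1.
      rewrite mulrAC mulrC ler_wpM2l ?(ltW e20)// (le_trans _ Lab)// ler_wpM2l//.
      rewrite ger0_norm; lra.
    have := HN N.+1 (leqnSn N); lra.
exists (Phi wi); split => // t tab; rewrite WE//; exact: dW.
Qed.
End ODE.

Section DerivLimits.
Variables (R : realType) (E : normedModType R).

Lemma deriv_on_local (J J' : set R) (w : R -> E) t l (d : R) : 0 < d ->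
  (forall s, J s -> `|s - t| < d -> J' s) -> deriv_on J' w t l -> deriv_on J w t l.
Proof.
move=> d0 JJ H e /H[d' d'0 {}H]; exists (Num.min d d') => [|s Js]; first by rewrite lt_min d0.
by rewrite lt_min => /andP[/(JJ s Js) J's]; exact: H.
Qed.

(** Mean value estimate for w(q) - q l between s and a point p lying between c and s, followed by p
    -> c. It supplies the derivative at a time where the equation is so far known only at
    neighbouring times. *)
Lemma deriv_on_limit (J : set R) (w g : R -> E) (c : R) (l : E) :
  is_interval J -> J c -> cont_on J w c ->
  (forall t, J t -> t != c -> deriv_on (J `\ c) w t (g t)) ->
  (forall e : R, 0 < e -> exists2 d, 0 < d & forall t, J t -> t != c -> `|t - c| < d ->
     `|g t - l| <= e) ->
  deriv_on J w c l.
Proof.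
move=> iJ Jc wc dw gl e e0; have [d d0 Hg] := gl e e0.
exists d => // s Js sd; apply/ler_addgt0Pr => h h0.
have [->|sc] := eqVneq s c.
  by rewrite !subrr scale0r subr0 normr0 addr_ge0// ?mulr_ge0// ltW.
have h20 : 0 < h / 2 by lra.
have sc0 : 0 < `|s - c| by rewrite normr_gt0 subr_eq0.
have [d' d'0 Hc] := wc _ h20.
have l1 : 0 < `|l| + 1 by rewrite ltr_wpDl.
(* k is so small that w p is within h / 2 of w c and that |p - c| |l| <= h / 2. *)
pose k := Num.min 1 (Num.min (d' / (2 * `|s - c|)) ((h / 2) / ((`|l| + 1) * `|s - c|))).
have k0 : 0 < k by rewrite !lt_min ltr01 !divr_gt0// mulr_gt0.
have [k1 k2 k3] : [/\ k <= 1, k <= d' / (2 * `|s - c|) & k <= (h / 2) / ((`|l| + 1) * `|s - c|)].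
  by split; rewrite /k ?ge_min ?lexx ?orbT.
pose p := c + k * (s - c).
have pc : `|p - c| = k * `|s - c| by rewrite /p addrC addKr normrM gtr0_norm.
have pd' : `|p - c| < d'.
  rewrite pc; move: k2; rewrite ler_pdivlMr ?mulr_gt0//; have := mulr_gt0 k0 sc0; lra.
have ph : `|p - c| * `|l| <= h / 2.
  move: k3; rewrite ler_pdivlMr ?mulr_gt0// pc; apply: le_trans.
  by rewrite [leRHS](_ : _ = k * `|s - c| * `|l| + k * `|s - c|); [rewrite lerDl mulr_ge0// ltW|ring].
have btw q : Num.min s p <= q <= Num.max s p -> [/\ J q, q != c & `|q - c| < d].
  move=> H; have [cs|cs|cs] := ltgtP c s; last by rewrite cs eqxx in sc.
  - have [] : c < p /\ p <= s.
      have := mulr_gt0 k0 (_ : 0 < s - c); rewrite subr_gt0 => /(_ cs).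
      have := ler_wpM2r (_ : 0 <= s - c) k1; rewrite subr_ge0 ltW// => /(_ isT).
      by rewrite /p; lra.
    move=> cp ps; move: H sd; rewrite (min_idPr ps) (max_idPl ps) => /andP[pq qs].
    rewrite (gtr0_norm (_ : 0 < s - c)) ?subr_gt0// => sd; split; last by rewrite gtr0_norm; lra.
      by apply: (iJ c s) => //; lra.
    by rewrite gt_eqF//; lra.
  - have [] : p < c /\ s <= p.
      have := mulr_gt0 k0 (_ : 0 < c - s); rewrite subr_gt0 => /(_ cs).
      have := ler_wpM2r (_ : 0 <= c - s) k1; rewrite subr_ge0 ltW// => /(_ isT).
      by rewrite /p; lra.
    move=> cp ps; move: H sd; rewrite (min_idPl ps) (max_idPr ps) => /andP[pq qs].
    rewrite (ltr0_norm (_ : s - c < 0)) ?subr_lt0// => sd; split; last by rewrite ltr0_norm; lra.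
      by apply: (iJ s c) => //; lra.
    by rewrite lt_eqF//; lra.
have Hmv : `|(w s + s *: (- l)) - (w p + p *: (- l))| <= e * `|s - p|.
  apply: (@mean_value_itv R E (fun q => w q + q *: (- l)) (fun q => g q - l) (Num.min s p) (Num.max s p)).
  - move=> q /[dup] H /btw[Jq qc qd]; apply: deriv_onD.
      apply: deriv_on_sub (dw q Jq qc) => r; rewrite /= in_itv/= => /btw[Jr /eqP rc _].
      by split.
    by move=> z z0; exists 1 => // r _ _; rewrite -scalerBl subrr normr0 mulr_ge0// ltW.
  - by move=> q /btw[Jq qc qd]; exact: Hg.
  - by rewrite ge_min le_max !lexx !orbT.
  - by rewrite ge_min le_max !lexx.
have sp : `|s - p| <= `|s - c|.
  rewrite (_ : s - p = (1 - k) * (s - c)); last by rewrite /p; ring.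
  by rewrite normrM ger0_norm; [rewrite ler_piMl//; lra|lra].
have [Jp _ _] : [/\ J p, p != c & `|p - c| < d] by apply: btw; rewrite ge_min le_max !lexx !orbT.
have Hp := Hc p Jp pd'.
rewrite (_ : _ - _ = (w s + s *: (- l) - (w p + p *: (- l))) + ((w p - w c) - (p - c) *: l)); last by lmod_over R E.
rewrite (le_trans (ler_normD _ _))// lerD//.
  by rewrite (le_trans Hmv)// ler_wpM2l// ltW.
rewrite (le_trans (ler_normB _ _))// normrZ (le_trans (lerD Hp ph))//; lra.
Qed.
End DerivLimits.

Section MaximalSolutions.
Variables (R : realType) (E : completeNormedModType R) (f : R -> E -> E).
Hypotheses (fc : jointly_cont f) (fl : loc_lipschitz f).

Lemma local_sol (t0 : R) (w0 : E) :
  exists2 h, 0 < h & exists w, w t0 = w0 /\ sol_on f `[t0, t0 + h] w.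
Proof.
have [d d0 Hd] := fc t0 w0 (@ltr01 R); have [d' [L [d'0 L0 HL]]] := fl t0 w0.
pose M := `|f t0 w0| + 1; have M0 : 0 < M by rewrite ltr_wpDl.
pose r := Num.min d d' / 2.
have r0 : 0 < r by rewrite divr_gt0// lt_min d0.
have [rd rd'] : r < d /\ r < d'.
  have [] : Num.min d d' <= d /\ Num.min d d' <= d' by rewrite !ge_min !lexx orbT.
  by move: r0; rewrite /r; lra.
pose h := Num.min r (Num.min (r / M) (2^-1 / (L + 1))).
have L1 : 0 < L + 1 by lra.
have h0 : 0 < h by rewrite !lt_min r0 (divr_gt0 r0 M0) divr_gt0 ?invr_gt0.
have [h1 h2 h3] : [/\ h <= r, h <= r / M & h <= 2^-1 / (L + 1)].
  by split; rewrite /h ?ge_min ?lexx ?orbT.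
exists h => //; apply: (@picard R E f fc t0 (t0 + h) M L r w0) => //.
- lra.
- lra.
- by rewrite addrC addKr mulrC -ler_pdivlMr.
- rewrite addrC addKr; move: h3; rewrite ler_pdivlMr//; lra.
- move=> t v tt vr; rewrite -(subrK (f t0 w0) (f t v)) addrC (le_trans (ler_normD _ _))//.
  rewrite lerD2l Hd//; last lra.
  by rewrite ltr_norml; lra.
- move=> t v v' tt vr vr'; apply: HL; [rewrite ltr_norml|..]; lra.
Qed.

Definition extends_to (t0 : R) (w0 : E) (b : R) := t0 <= b /\
  exists w, w t0 = w0 /\ sol_on f `[t0, b] w.

Lemma extends_to_le t0 w0 b b' : t0 <= b' -> b' <= b ->
  extends_to t0 w0 b -> extends_to t0 w0 b'.
Proof.
move=> tb' bb [tb [w [w0E sw]]]; split => //; exists w; split => // t Jt.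
have Jt' : `[t0, b]%classic t by apply: itv_sub Jt.
by apply: deriv_on_sub (sw t Jt'); exact: itv_sub.
Qed.

Lemma extends_to_more t0 w0 b : extends_to t0 w0 b -> exists2 b', b < b' & extends_to t0 w0 b'.
Proof.
move=> [tb [w [w0E sw]]]; have [h h0 [w' [w'b sw']]] := local_sol b (w b).
exists (b + h); first lra.
split; first lra.
exists (fun t => if t <= b then w t else w' t); split; first by rewrite tb.
apply: sol_cat => //; lra.
Qed.

(** By uniqueness the value at t of a solution on [t0, t] does not depend on that solution, and the
    diagonal [W t t] glues them all. The condition on [J] asks that locally one solution interval
    suffices, which covers half-open and unbounded [J]. *)
Lemma glued_sol t0 w0 : exists w, w t0 = w0 /\
  forall J : set R, (forall t, J t -> t0 <= t) ->
    (forall t, J t -> exists2 b, extends_to t0 w0 b & exists2 d, 0 < d &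
        forall s, J s -> `|s - t| < d -> s <= b) -> sol_on f J w.
Proof.
have /choice[W HW] : forall b, exists w, extends_to t0 w0 b ->
    w t0 = w0 /\ sol_on f `[t0, b] w.
  by move=> b; have [[tb [w Hw]]|] := pselect (extends_to t0 w0 b); [exists w|exists (fun=> 0)].
have e0 : extends_to t0 w0 t0.
  by have [h h0 Hw] := local_sol t0 w0; apply: (@extends_to_le _ _ (t0 + h)); rewrite ?lerDl ?(ltW h0)//; split => //; rewrite lerDl ltW.
have We b s : extends_to t0 w0 b -> t0 <= s -> s <= b -> W s s = W b s.
  move=> eb ts sb; have es := extends_to_le ts sb eb.
  have [a1 b1] := HW _ eb; have [a2 b2] := HW _ es.
  apply: (@sol_unique R E f fl t0 s (W s) (W b)) => //; [by rewrite a1| |lra].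
  move=> t Jt; have Jt' : `[t0, b]%classic t by apply: itv_sub Jt.
  by apply: deriv_on_sub (b1 t Jt'); exact: itv_sub.
exists (fun t => W t t); split; first by have [] := HW _ e0.
move=> J Jt0 H t Jt; have [b eb [d d0 sb]] := H t Jt.
have tb : t <= b by apply: sb => //; rewrite subrr normr0.
have Jt' : `[t0, b]%classic t by rewrite /= in_itv/= Jt0.
apply: (@deriv_on_local _ _ _ ([set` `[t0, b]] `&` J) _ _ _ d d0).
  by move=> s Js sd; split => //; rewrite /= in_itv/= Jt0//= sb.
rewrite (We b)// ?Jt0//.
apply: (@eq_deriv_on _ _ _ (W b)) => //.
  by move=> s [+ Js]; rewrite /= in_itv/= => /andP[ts sb']; rewrite (We b).
have [_ /(_ t Jt')] := HW _ eb; apply: deriv_on_sub; exact: subIsetl.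
Qed.

(** The set of the b reached by a solution has no maximum, as every solution continues past b; hence
    it is unbounded, or its supremum T is not attained. *)
Theorem ode_maximal t0 w0 : exists w, w t0 = w0 /\
  ((sol_on f [set t | t0 <= t] w) \/
   exists T, [/\ t0 < T, sol_on f `[t0, T[ w & ~ extends_to t0 w0 T]).
Proof.
have [w [w0E Hw]] := glued_sol t0 w0; exists w; split => //.
have [h h0 eh] : exists2 h, 0 < h & extends_to t0 w0 (t0 + h).
  by have [h h0 Hh] := local_sol t0 w0; exists h => //; split => //; rewrite lerDl ltW.
have [[B HB]|unb] := pselect (exists B, forall b, extends_to t0 w0 b -> b <= B); last first.
  left; apply: Hw => // t /= tt0.
  have [b [eb tb]] : exists b, extends_to t0 w0 b /\ t + 1 < b.
    apply: contrapT => H; apply: unb; exists (t + 1) => b eb.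
    by rewrite leNgt; apply/negP => tb; apply: H; exists b.
  by exists b => //; exists 1 => // s _; rewrite ltr_norml; lra.
right; exists (sup (extends_to t0 w0)).
have hs : has_sup (extends_to t0 w0) by split; [exists (t0 + h)|exists B].
have lt b : extends_to t0 w0 b -> b < sup (extends_to t0 w0).
  move=> /extends_to_more[b' bb' eb']; apply: (lt_le_trans bb').
  by apply: ub_le_sup => //; case: hs.
split.
- by have := lt _ eh; lra.
- apply: Hw => t; rewrite /= in_itv/= => /andP[//].
  move=> tt0 tT; have d0 : 0 < sup (extends_to t0 w0) - t by rewrite subr_gt0.
  have [b eb tb] := sup_adherent d0 hs.
  exists b => //; exists (b - t); first lra.
  by move=> s _; rewrite ltr_norml; lra.
- by move=> /lt; rewrite ltxx.
Qed.

(** A bounded derivative makes w Lipschitz, hence convergent at T; the extended curve satisfies the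
    equation at T because its derivative has a limit there. *)
Lemma sol_lipschitz_extends (t0 T t1 M : R) (w0 : E) (w : R -> E) :
  w t0 = w0 -> t0 <= t1 -> t1 < T -> sol_on f `[t0, T[ w ->
  (forall t, t1 <= t < T -> `|f t (w t)| <= M) -> extends_to t0 w0 T.
Proof.
move=> w0E t01 t1T sw fM.
have dw a b t : t0 <= a -> b < T -> a <= t <= b -> deriv_on `[a, b] w t (f t (w t)).
  move=> ta bT tab; apply: deriv_on_sub (sw t _); last by rewrite /= in_itv/=; lra.
  by move=> s; rewrite /= !in_itv/=; lra.
have M0 : 0 <= M by rewrite (le_trans _ (fM t1 _)) ?lexx.
have wlip s t : t1 <= s -> s <= t -> t < T -> `|w t - w s| <= M * (t - s).
  move=> t1s st tT; apply: (@mean_value _ _ w (fun t => f t (w t))) => // r rst.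
    by apply: dw => //; lra.
  by apply: fM; lra.
pose a (n : nat) := T - (T - t1) * 2^-1 ^+ n.
have p0 n : 0 < (T - t1) * 2^-1 ^+ n by rewrite mulr_gt0 ?subr_gt0// exprn_gt0// invr_gt0.
have aP n : t1 <= a n < T.
  have : (T - t1) * 2^-1 ^+ n <= (T - t1) by rewrite ler_piMr ?subr_ge0 ?(ltW t1T)// exprn_ile1// ?invr_ge0// invf_le1// ler1n.
  by have := p0 n; rewrite /a; lra.
have an m n : (n <= m)%N -> a n <= a m.
  by move=> nm; rewrite /a lerD2l lerN2 ler_wpM2l ?subr_ge0 ?(ltW t1T)// ler_wiXn2l// ?invr_ge0// invf_le1// ler1n.
have [n m nm|e e0|l Hl] := @cauchy_bound R E (w \o a) (fun n => M * (T - t1) * 2^-1 ^+ n).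
- have [anP amP] := (aP n, aP m).
  have h1 : `|w (a m) - w (a n)| <= M * (a m - a n) by apply: wlip; [lra|exact: an|lra].
  by rewrite (le_trans h1)// -mulrA ler_wpM2l// /a; have := p0 m; lra.
- exact: half_pow_small.
have wl t : t1 <= t < T -> `|l - w t| <= M * (T - t).
  move=> tT; apply/ler_addgt0Pr => e e0; have [N HN] := half_pow_small (M * (T - t1)) e0.
  have Tt0 : 0 < T - t by lra.
  have [N' HN'] := half_pow_small (T - t1) Tt0.
  pose n := maxn N N'.
  have tn : t <= a n by have := HN' n (leq_maxr _ _); rewrite /a; lra.
  rewrite -(subrK (w (a n)) l) -addrA addrC (le_trans (ler_normD _ _))// lerD//.
    have anP := aP n.
    have h1 : `|w (a n) - w t| <= M * (a n - t) by apply: wlip => //; lra.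
    by rewrite (le_trans h1)// ler_wpM2l//; lra.
  by rewrite (le_trans (Hl n))// HN// leq_maxl.
pose w' t := if t < T then w t else l.
split; first lra.
have w't t : t < T -> w' t = w t by rewrite /w' => ->.
have w'T : w' T = l by rewrite /w' ltxx.
have dT : cont_on `[t0, T] w' T.
  move=> e e0; exists (Num.min (T - t1) (e / (M + 1))).
    by rewrite lt_min subr_gt0 t1T divr_gt0//; lra.
  move=> s; rewrite /= in_itv/= => /andP[ts]; rewrite le_eqVlt => /orP[/eqP ->|sT].
    by move=> _; rewrite subrr normr0 ltW.
  rewrite lt_min distrC gtr0_norm ?subr_gt0// ltr_pdivlMr; last lra.
  move=> /andP[s1 s2]; rewrite w't// w'T distrC (le_trans (wl s _))//; first lra.
  have := ler_wpM2l M0 (ltW s1); nra.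
exists w'; split; first by rewrite w't//; lra.
move=> t; rewrite /= in_itv/= => /andP[tt0]; rewrite le_eqVlt => /orP[/eqP ->|tT]; last first.
  rewrite w't//; apply: (@deriv_on_local _ _ _ `[t0, T[ _ _ _ (T - t)); first lra.
    by move=> s; rewrite /= !in_itv/= => /andP[-> sT]; rewrite ltr_norml; lra.
  have Jt : `[t0, T[%classic t by rewrite /= in_itv/= tt0.
  by apply: eq_deriv_on (sw t Jt) => // s; rewrite /= in_itv/= => /andP[_ ?]; rewrite w't.
rewrite w'T.
apply: (@deriv_on_limit _ _ _ _ (fun t => f t (w t))) => //.
- exact: interval_is_interval.
- by rewrite /= in_itv/=; lra.
- move=> s; rewrite /= in_itv/= => /andP[s1 s2] sT.
  have Js : `[t0, T[%classic s by rewrite /= in_itv/= s1 lt_neqAle sT.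
  apply: eq_deriv_on (deriv_on_sub _ (sw s Js)).
  + by split => //=; [rewrite in_itv/= s1|exact/eqP].
  + by move=> r [/=]; rewrite in_itv/= => /andP[_ r1] /eqP r2; rewrite w't// lt_neqAle r2.
  + by move=> r [/=]; rewrite !in_itv/= => /andP[-> r1] /eqP r2; rewrite lt_neqAle r2.
- have := @comp_cont_on _ _ f fc _ w' T dT.
  move=> H e e0; have [d d0 {}H] := H e e0; exists d => // s Js sT sd.
  have := H s Js sd; rewrite w'T w't//.
  by move: Js; rewrite /= in_itv/= => /andP[_]; rewrite lt_neqAle sT.
Qed.

(** The bound holds at all times near T, not just along a sequence: if |w t1| <= r at some t1 with M
    (T - t1) <= 1/2, the curve cannot leave the ball of radius r + 1 before T, so its derivative
    stays bounded and it extends to T. *)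
Lemma sol_blowup (t0 T : R) (w0 : E) (w : R -> E) :
  w t0 = w0 -> t0 < T -> sol_on f `[t0, T[ w -> ~ extends_to t0 w0 T ->
  (forall r, exists M, forall t, t0 <= t < T -> `|w t| <= r -> `|f t (w t)| <= M) ->
  forall r, exists2 s, t0 <= s < T & forall t, s < t < T -> r < `|w t|.
Proof.
move=> w0E tT sw ne fM r; apply: contrapT => H; apply: ne.
have [M0 HM0] := fM (r + 1).
pose M := Num.max M0 0; have M_ge0 : 0 <= M by rewrite le_max lexx orbT.
have HM t : t0 <= t < T -> `|w t| <= r + 1 -> `|f t (w t)| <= M.
  by move=> /HM0/[apply] /le_trans; apply; rewrite le_max lexx.
have M1 : 0 < M + 1 by lra.
pose s0 := Num.max t0 (T - (2 * (M + 1))^-1).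
have s0P : t0 <= s0 < T.
  rewrite /s0 le_max lexx /= gt_max tT /= ltrBlDr ltrDl invr_gt0; lra.
have [t1 [t1s t1T wt1]] : exists t1, [/\ s0 < t1, t1 < T & `|w t1| <= r].
  apply: contrapT => H'; apply: H; exists s0 => // t tsT.
  by rewrite ltNge; apply/negP => wr; apply: H'; exists t; case/andP: tsT.
have t01 : t0 <= t1 by lra.
have mono (x y : R) : x <= y -> M * x <= M * y by move=> ?; exact: ler_wpM2l.
have small : M * (T - t1) <= 2^-1.
  have : T - (2 * (M + 1))^-1 <= s0 by rewrite le_max lexx orbT.
  have : (M + 1) * (2 * (M + 1))^-1 = 2^-1 by rewrite invfM mulrCA mulfV ?mulr1 ?gt_eqF.
  have h1 : 0 < (2 * (M + 1))^-1 by rewrite invr_gt0; lra.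
  move=> h3 h4; have h5 : T - t1 <= (2 * (M + 1))^-1 by lra.
  have := mono _ _ h5; lra.
have dw a b t : t0 <= a -> b < T -> a <= t <= b -> deriv_on `[a, b] w t (f t (w t)).
  move=> ta bT tab; apply: deriv_on_sub (sw t _); last by rewrite /= in_itv/=; lra.
  by move=> s; rewrite /= !in_itv/=; lra.
apply: (sol_lipschitz_extends w0E t01 t1T sw (M := M)) => t tT1.
suff K q : t1 <= q < T -> `|w q - w t1| <= M * (q - t1).
  apply: HM; first lra.
  rewrite -(subrK (w t1) (w t)) (le_trans (ler_normD _ _))//.
  have h0 : t - t1 <= T - t1 by lra.
  by have := K t tT1; have := mono _ _ h0; lra.
move=> /andP[t1q qT].
apply: (@cousinS _ (fun q => `|w q - w t1| <= M * (q - t1)) t1 q) => //.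
  by rewrite !subrr mulr0 normr0.
move=> c t1c cq.
have Jc : `[t0, T[%classic c by rewrite /= in_itv/=; lra.
(* Two oscillations of at most 1/4 and the increment M (s - t1) <= 1/2 keep |w z| <= r + 1 on the
   next short interval. *)
have h0 : 0 < 4^-1 :> R by rewrite invr_gt0.
have [d d0 Hd] := deriv_on_cont (sw c Jc) h0.
exists d => // s p t1s' sc cp pq ds pd Hs.
have J z : s <= z <= p -> `|w z - w c| <= 4^-1.
  by move=> zsp; apply: Hd; [rewrite /= in_itv/=; lra|rewrite ltr_norml; lra].
have : `|w p - w s| <= M * (p - s).
  apply: (@mean_value _ _ w (fun t => f t (w t))) => [|z zsp|z zsp]; first lra.
    by apply: dw => //; lra.
  apply: HM; first lra.
  rewrite (_ : w z = (w z - w c) - (w s - w c) + (w s - w t1) + w t1); last by lmod_over R E.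
  rewrite (le_trans (ler_normD _ _))// (le_trans (lerD (ler_normD _ _) (lexx _)))//.
  rewrite (le_trans (lerD (lerD (ler_normB _ _) (lexx _)) (lexx _)))//.
  have ssp : s <= s <= p by lra.
  have h1 : s - t1 <= T - t1 by lra.
  have := J z zsp; have := J s ssp; have := mono _ _ h1; lra.
move=> h; rewrite (_ : w p - w t1 = (w p - w s) + (w s - w t1)); last by lmod_over R E.
by rewrite (le_trans (ler_normD _ _))// (le_trans (lerD h Hs))//; lra.
Qed.
End MaximalSolutions.

(** * Closed graph theorem and Newton iteration *)

Section ClosedGraph.
Variables (R : realType) (E F : completeNormedModType R).
Variables (Z : set E) (T : E -> F).
Hypotheses (Z0 : Z 0) (ZP : forall (a : R) x y, Z x -> Z y -> Z (a *: x + y)).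
Hypothesis Zcl : forall z, (forall e : R, 0 < e -> exists2 v, Z v & `|v - z| <= e) -> Z z.
Hypothesis Tlin : forall (a : R) x y, Z x -> Z y -> T (a *: x + y) = a *: T x + T y.
Hypothesis Tcl : forall z y,
  (forall e : R, 0 < e -> exists v, [/\ Z v, `|v - z| <= e & `|T v - y| <= e]) -> T z = y.

Let ZB x y : Z x -> Z y -> Z (x - y).
Proof. by move=> Zx Zy; have := ZP (-1) Zy Zx; rewrite scaleN1r addrC. Qed.
Let TB x y : Z x -> Z y -> T (x - y) = T x - T y.
Proof. by move=> Zx Zy; have := Tlin (-1) Zy Zx; rewrite !scaleN1r addrC [RHS]addrC. Qed.
Let T0 : T 0 = 0.
Proof. by have := TB Z0 Z0; rewrite !subrr. Qed.
Let TZ a x : Z x -> T (a *: x) = a *: T x.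
Proof. by move=> Zx; have := Tlin a Zx Z0; rewrite T0 !addr0. Qed.
Let ZZ a x : Z x -> Z (a *: x).
Proof. by move=> Zx; have := ZP a Zx Z0; rewrite addr0. Qed.

(* Baire's argument, run inside the closed subspace [Z]. *)
Lemma somewhere_dense_sublevel : exists (n : nat) z0 (r : R), [/\ Z z0, 0 < r &
  forall z, Z z -> `|z - z0| <= r -> forall e : R, 0 < e ->
    exists v, [/\ Z v, `|v - z| <= e & `|T v| <= n%:R]].
Proof.
apply: contrapT => H.
have step (x : nat * (E * R)) : exists y : E * R, Z x.2.1 -> 0 < x.2.2 ->
   [/\ Z y.1, 0 < y.2, `|y.1 - x.2.1| + y.2 <= x.2.2, y.2 <= x.2.2 / 2 &
     forall v, Z v -> `|v - y.1| <= y.2 -> x.1%:R < `|T v|].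
  case: x => n [z0 r] /=.
  have [Zz0|] := pselect (Z z0); last by exists (z0, r).
  have [r0|] := pselect (0 < r); last by exists (z0, r).
  apply: contrapT => H1; apply: H; exists n, z0, (r / 2); split => //; first lra.
  move=> z Zz zz0 e e0; apply: contrapT => H2; apply: H1.
  exists (z, Num.min e (r / 2)) => _ _ /=; split => //.
  - by rewrite lt_min e0; lra.
  - have : Num.min e (r / 2) <= r / 2 by rewrite ge_min lexx orbT.
    by lra.
  - by rewrite ge_min lexx orbT.
  - move=> v Zv; rewrite le_min => /andP[ve _]; rewrite ltNge; apply/negP => Tv.
    by apply: H2; exists v.
have {step}[Phi PhiP] := choice step.
pose s := fix s n := if n is n'.+1 then Phi (n', s n') else (0, 1).
have sP n : Z (s n).1 /\ 0 < (s n).2.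
  by elim: n => [|n [h1 h2]] //=; have [] := PhiP (n, s n) h1 h2.
have sS n : [/\ `|(s n.+1).1 - (s n).1| + (s n.+1).2 <= (s n).2, (s n.+1).2 <= (s n).2 / 2 &
     forall v, Z v -> `|v - (s n.+1).1| <= (s n.+1).2 -> n%:R < `|T v|].
  by have [h1 h2] := sP n; have [] := PhiP (n, s n) h1 h2.
have s2 n : (s n).2 <= 1 * 2^-1 ^+ n.
  elim: n => [|n IH]; first by rewrite expr0 mulr1.
  by have [_ h _] := sS n; rewrite exprS; lra.
have sd n m : (n <= m)%N -> `|(s m).1 - (s n).1| + (s m).2 <= (s n).2.
  elim: m => [|m IH]; first by rewrite leqn0 => /eqP ->; rewrite subrr normr0 add0r.
  rewrite leq_eqVlt => /orP[/eqP <-|]; first by rewrite subrr normr0 add0r.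
  rewrite ltnS => /IH{}IH; have [h _ _] := sS m.
  have := ler_distD (s m).1 (s m.+1).1 (s n).1; lra.
have [n m nm|e e0|l Hl] := @cauchy_bound R E (fun n => (s n).1) (fun n => (s n).2).
- by have := sd _ _ nm; have [_] := sP m; lra.
- by have [N HN] := half_pow_small 1 e0; exists N => n Nn; apply: le_trans (s2 n) (HN n Nn).
have Zl : Z l.
  apply: Zcl => e e0; have [N HN] := half_pow_small 1 e0.
  exists (s N).1; first by have [] := sP N.
  by rewrite distrC (le_trans (Hl N))// (le_trans (s2 N))// HN.
have Tl n : n%:R < `|T l| by have [_ _] := sS n; apply => //; exact: Hl.
have := Tl (Num.truncn `|T l|).+1; rewrite ltNge => /negP; apply.
by rewrite ltW// truncnS_gt.
Qed.

(** Rescaled differences of points of the ball where a sublevel is dense give [dens]. Correcting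
    repeatedly, with remainders [rho k] of size 2^-k |z|, produces a convergent series of values
    whose sum is T z because the graph is closed. *)
Theorem closed_graph : exists2 C : R, 0 <= C & forall z, Z z -> `|T z| <= C * `|z|.
Proof.
have [n [z0 [r [Zz0 r0 H]]]] := somewhere_dense_sublevel.
(* A vector z is scaled to norm r, and two values of norm at most n are subtracted. *)
pose K := 2 * n%:R / r.
have K0 : 0 <= K by rewrite divr_ge0 ?mulr_ge0// ltW.
have dens z e : Z z -> 0 < e -> exists v, [/\ Z v, `|v - z| <= e & `|T v| <= K * `|z|].
  move=> Zz e0; have [->|zn] := eqVneq z 0.
    by exists 0; rewrite T0 !normr0 subrr normr0 mulr0 ltW.
  have z_gt0 : 0 < `|z| by rewrite normr_gt0.
  pose k := r / `|z|; have k0 : 0 < k by rewrite divr_gt0.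
  have ke0 : 0 < k * e / 2 by rewrite divr_gt0// mulr_gt0.
  have [||v [Zv vz Tv]] := H (k *: z + z0) _ _ _ ke0; first exact: ZP.
    by rewrite addrK normrZ gtr0_norm// /k divfK// gt_eqF.
  have [||v' [Zv' vz' Tv']] := H z0 _ _ _ ke0; [by []|by rewrite subrr normr0 ltW|].
  exists (k^-1 *: (v - v')); split.
  - by apply: ZZ; exact: ZB.
  - rewrite (_ : _ - z = k^-1 *: ((v - (k *: z + z0)) - (v' - z0))); last first.
      by rewrite !scalerBr scalerDr scalerA mulVf ?gt_eqF// scale1r; lmod_over R E.
    rewrite normrZ gtr0_norm ?invr_gt0// ler_pdivrMl//.
    by rewrite (le_trans (ler_normB _ _))// (le_trans (lerD vz vz'))// -splitr.
  - rewrite TZ; last exact: ZB.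
    rewrite TB// normrZ gtr0_norm ?invr_gt0// ler_pdivrMl//.
    rewrite (le_trans (ler_normB _ _))// (le_trans (lerD Tv Tv'))//.
    rewrite /k /K [leRHS](_ : _ = 2 * n%:R * ((r / r) * (`|z| / `|z|))); last by ring.
    by rewrite !divff ?gt_eqF// !mulr1; lra.
exists (2 * K) => [|z Zz]; first by rewrite mulr_ge0.
have [->|zn] := eqVneq z 0; first by rewrite T0 !normr0 mulr0.
have z_gt0 : 0 < `|z| by rewrite normr_gt0.
have p0 k : 0 < 2^-1 ^+ k :> R by rewrite exprn_gt0// invr_gt0.
have step (x : nat * E) : exists v, Z x.2 ->
    [/\ Z v, `|v - x.2| <= 2^-1 ^+ x.1.+1 * `|z| & `|T v| <= K * `|x.2|].
  have [Zx|] := pselect (Z x.2); last by exists 0.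
  by have [|v Hv] := dens x.2 (2^-1 ^+ x.1.+1 * `|z|) Zx; [rewrite mulr_gt0|exists v].
have {step}[Phi PhiP] := choice step.
pose rho := fix rho k := if k is k'.+1 then rho k' - Phi (k', rho k') else z.
have rP k : Z (rho k) /\ `|rho k| <= 2^-1 ^+ k * `|z|.
  elim: k => [|k [h1 h2]] /=; first by rewrite expr0 mul1r.
  by have [h3 h4 _] := PhiP (k, rho k) h1; rewrite distrC; split => //; exact: ZB.
have Tr k : `|T (rho k) - T (rho k.+1)| <= K * (2^-1 ^+ k * `|z|).
  have [h1 h2] := rP k; have [h3 _ h5] := PhiP (k, rho k) h1.
  rewrite -TB//; last by have [] := rP k.+1.
  by rewrite /= subKr (le_trans h5)// ler_wpM2l.
have Tc k m : (k <= m)%N -> `|(T z - T (rho m)) - (T z - T (rho k))| <= 2 * K * `|z| * 2^-1 ^+ k.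
  move=> km; suff : `|T (rho k) - T (rho m)| <= 2 * K * `|z| * (2^-1 ^+ k - 2^-1 ^+ m).
    rewrite (_ : _ - _ - _ = T (rho k) - T (rho m)); last by lmod_over R F.
    by move=> /le_trans; apply; apply: ler_wpM2l; [exact: mulr_ge0 (mulr_ge0 (ler0n _ 2) K0) (normr_ge0 _)|have := p0 m; lra].
  elim: m km => [|m IH]; first by rewrite leqn0 => /eqP ->; rewrite !subrr normr0 mulr0.
  rewrite leq_eqVlt => /orP[/eqP <-|]; first by rewrite !subrr normr0 mulr0.
  rewrite ltnS => /IH{}IH; have := Tr m; rewrite exprS.
  have := ler_distD (T (rho m)) (T (rho k)) (T (rho m.+1)); lra.
have [//|e e0|y Hy] := @cauchy_bound R F (fun k => T z - T (rho k)) (fun k => 2 * K * `|z| * 2^-1 ^+ k).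
- exact: half_pow_small.
have -> : T z = y.
  apply: Tcl => e e0; have [N HN] := half_pow_small `|z| e0.
  have [N' HN'] := half_pow_small (2 * K * `|z|) e0.
  pose k := maxn N N'; have [h1 h2] := rP k; exists (z - rho k); split; first exact: ZB.
    by rewrite addrAC subrr add0r normrN (le_trans h2)// mulrC HN// leq_maxl.
  by rewrite TB// distrC (le_trans (Hy k))// HN'// leq_maxr.
by have := Hy 0%N; rewrite /= subrr subr0 expr0 mulr1.
Qed.
End ClosedGraph.

Section Contraction.
Variables (R : realType) (E F : completeNormedModType R).

(* Simplified Newton iteration [v - Zi (Phi v)] inside a closed subspace [W]. *)
Lemma newton_zero (W : set E) (Phi : E -> F) (Zi : F -> E) (v0 : E) (e k C : R) :
  W 0 -> (forall (a : R) x y, W x -> W y -> W (a *: x + y)) ->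
  (forall z, (forall e : R, 0 < e -> exists2 v, W v & `|v - z| <= e) -> W z) ->
  (forall v, W v -> `|v - v0| <= e -> W (Zi (Phi v))) ->
  (forall v v', W v -> W v' -> `|v - v0| <= e -> `|v' - v0| <= e ->
     `|Zi (Phi v) - Zi (Phi v') - (v - v')| <= k * `|v - v'|) ->
  (forall v, W v -> `|v - v0| <= e -> Zi (Phi v) = 0 -> Phi v = 0) ->
  0 <= k < 1 -> W v0 -> `|Zi (Phi v0)| <= C -> C <= (1 - k) * e ->
  exists v, [/\ W v, Phi v = 0 & `|v - v0| <= C / (1 - k)].
Proof.
move=> W0 WP Wcl WZ Zk Zi0 /andP[k0 k1] Wv0 C0 Ce.
have C_ge0 : 0 <= C by apply: le_trans C0.
have k1' : 0 < 1 - k by lra.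
have Cke : C / (1 - k) <= e by rewrite ler_pdivrMr// mulrC.
have e_ge0 : 0 <= e by apply: le_trans Cke; rewrite divr_ge0// ltW.
pose w := fix w n := if n is n'.+1 then w n' - Zi (Phi (w n')) else v0.
have kn n : 0 <= k ^+ n by rewrite exprn_ge0.
have wS m : w m.+1 - w m = - Zi (Phi (w m)) by rewrite /= addrC addKr.
have wP n : [/\ W (w n), `|w n - v0| <= C / (1 - k) * (1 - k ^+ n) &
    `|w n.+1 - w n| <= C * k ^+ n].
  elim: n => [|n [h1 h2 h3]].
    by rewrite /= subrr normr0 expr0 subrr mulr0 mulr1 addrC addKr normrN; split.
  have le1 m : C / (1 - k) * (1 - k ^+ m) <= e.
    rewrite (le_trans _ Cke)// ler_piMr ?divr_ge0 ?(ltW k1')//.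
    by have := kn m; lra.
  have we : `|w n - v0| <= e by apply: le_trans h2 (le1 n).
  have h1' : W (w n.+1).
    by have := WP (-1) _ _ (WZ _ h1 we) h1; rewrite scaleN1r addrC.
  have h2' : `|w n.+1 - v0| <= C / (1 - k) * (1 - k ^+ n.+1).
    rewrite (le_trans (ler_distD (w n) _ _))// (le_trans (lerD h3 h2))//.
    rewrite exprS le_eqVlt; apply/orP; left; apply/eqP; field.
    by rewrite gt_eqF.
  split => //.
  have we' : `|w n.+1 - v0| <= e by apply: le_trans h2' (le1 _).
  rewrite wS (_ : - _ = - (Zi (Phi (w n.+1)) - Zi (Phi (w n)) - (w n.+1 - w n))).
    by rewrite normrN (le_trans (Zk _ _ _ _ _ _))// exprS mulrCA ler_wpM2l.
  by rewrite (wS n) opprK subrK.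
have wc n m : (n <= m)%N -> `|w m - w n| <= C / (1 - k) * k ^+ n.
  move=> nm; suff : `|w m - w n| <= C / (1 - k) * (k ^+ n - k ^+ m).
    by move=> /le_trans; apply; apply: ler_wpM2l; [rewrite divr_ge0 ?(ltW k1')|have := kn m; lra].
  elim: m nm => [|m IH]; first by rewrite leqn0 => /eqP ->; rewrite !subrr normr0 mulr0.
  rewrite leq_eqVlt => /orP[/eqP <-|]; first by rewrite !subrr normr0 mulr0.
  rewrite ltnS => /IH{}IH; have [_ _ h] := wP m.
  rewrite (le_trans (ler_distD (w m) _ _))// (le_trans (lerD h IH))//.
  rewrite exprS le_eqVlt; apply/orP; left; apply/eqP; field.
  by rewrite gt_eqF.
have geo x : 0 < x -> exists N, forall n, (N <= n)%N -> C / (1 - k) * k ^+ n <= x.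
  move=> x0; have := @cvg_geometric R (C / (1 - k)) k.
  rewrite ger0_norm// => /(_ k1) /cvgrPdist_le/(_ _ x0)[N _ H]; exists N => n /H /=.
  by rewrite sub0r normrN; exact/le_trans/ler_norm.
have [//|//|l Hl] := @cauchy_bound R E w (fun n => C / (1 - k) * k ^+ n).
have Wl : W l.
  apply: Wcl => x x0; have [N HN] := geo x x0; exists (w N); first by have [] := wP N.
  by rewrite distrC (le_trans (Hl N))// HN.
have lv0 : `|l - v0| <= C / (1 - k) by have := Hl 0%N; rewrite expr0 mulr1.
have le : `|l - v0| <= e by apply: le_trans lv0 Cke.
exists l; split => //; apply: Zi0 => //; apply/eqP; rewrite -normr_eq0 eq_le normr_ge0 andbT.
apply/ler_addgt0Pr => x x0; rewrite add0r; have x30 : 0 < x / 3 by lra.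
have [N HN] := geo _ x30; have [h1 h2 h3] := wP N.
have we : `|w N - v0| <= e.
  by rewrite (le_trans h2)// (le_trans _ Cke)// ler_piMr ?divr_ge0 ?(ltW k1')//; have := kn N; lra.
rewrite (_ : Zi _ = (Zi (Phi l) - Zi (Phi (w N)) - (l - w N)) + (l - w N) - (w N.+1 - w N)); last first.
  by rewrite wS; lmod_over R E.
have := Zk _ _ Wl h1 le we; have := Hl N; have := HN N (leqnn N) => n1 n2 n3.
rewrite (le_trans (ler_normB _ _))// (le_trans (lerD (ler_normD _ _) (lexx _)))//.
have n4 : `|w N.+1 - w N| <= C / (1 - k) * k ^+ N by apply: wc.
have n5 : k * `|l - w N| <= `|l - w N| by rewrite ler_piMl// ltW.
lra.
Qed.
End Contraction.

(** * Smooth curves and implicit functions *)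

Section SmoothCurves.
Variable R : realType.
Definition half_line : set R := [set t | 0 <= t].

Lemma half_line_acc t : 0 <= t -> clusters half_line t.
Proof.
move=> t0 d d0; exists (t + d / 2); split; first by rewrite /half_line /=; lra.
  by rewrite gt_eqF//; lra.
by rewrite addrC addKr gtr0_norm//; lra.
Qed.

Section Cl.
Variable E : normedModType R.

Fixpoint smooth (k : nat) (u : R -> E) : Prop :=
  if k is k'.+1 then
    exists2 u', (forall t, 0 <= t -> deriv_on half_line u t (u' t)) & smooth k' u'
  else forall t, 0 <= t -> cont_on half_line u t.

Lemma smooth0 k (u : R -> E) : smooth k u -> forall t, 0 <= t -> cont_on half_line u t.
Proof. by case: k => // k [u' du _] t t0; exact: deriv_on_cont (du t t0). Qed.

Lemma smoothS k (u : R -> E) : smooth k.+1 u -> smooth k u.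
Proof.
elim: k u => [|k IH] u; last by move=> [u' du su']; exists u' => //; exact: IH.
exact: smooth0.
Qed.

Lemma smooth_le k l (u : R -> E) : (k <= l)%N -> smooth l u -> smooth k u.
Proof.
move=> /subnK <-; elim: (l - k)%N => // n IH; rewrite addSn => /smoothS; exact: IH.
Qed.

Lemma eq_smooth k (u v : R -> E) : (forall t, 0 <= t -> u t = v t) ->
  smooth k u -> smooth k v.
Proof.
move=> uv; case: k => [|k]; first by move=> uc t t0; apply: eq_cont_on (uc t t0).
by move=> [u' du su']; exists u' => // t t0; apply: eq_deriv_on (du t t0).
Qed.

Lemma smooth_cst k (x : E) : smooth k (fun=> x).
Proof.
elim: k x => [|k IH] x; first by move=> t _; exact: deriv_on_cont (deriv_on_cst _ _ _).
by exists (fun=> 0) => // t _; exact: deriv_on_cst.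
Qed.

Lemma smoothD k (u v : R -> E) : smooth k u -> smooth k v -> smooth k (fun t => u t + v t).
Proof.
elim: k u v => [|k IH] u v; first by move=> cu cv t t0; apply: contD_on; [exact: cu|exact: cv].
move=> [u' du su'] [v' dv sv']; exists (fun t => u' t + v' t); last exact: IH.
by move=> t t0; apply: deriv_onD; [exact: du|exact: dv].
Qed.

Lemma smooth_sum k (I : Type) (r : seq I) (P : pred I) (u : I -> R -> E) :
  (forall i, P i -> smooth k (u i)) -> smooth k (fun t => \sum_(i <- r | P i) u i t).
Proof.
move=> su; elim: r => [|i r IH].
  by apply: eq_smooth (smooth_cst k 0) => t _; rewrite big_nil.
have [Pi|Pi] := boolP (P i); last by apply: eq_smooth IH => t _; rewrite big_cons (negbTE Pi).
by apply: eq_smooth (smoothD (su i Pi) IH) => t _; rewrite big_cons Pi.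
Qed.
End Cl.

Lemma smooth_blinear (E F : normedModType R) k (L : E -> F) (u : R -> E) :
  blinear L -> smooth k u -> smooth k (L \o u).
Proof.
move=> bL; elim: k u => [|k IH] u; first by move=> cu t t0; apply: cont_on_blinear => //; exact: cu.
move=> [u' du su']; exists (L \o u'); last exact: IH.
by move=> t t0; apply: deriv_on_blinear => //; exact: du.
Qed.

Lemma blinear_scale (E : normedModType R) (a : R) : blinear (fun x : E => a *: x).
Proof.
split => [k x y|]; first by lmod_over R E.
by exists `|a| => // x; rewrite normrZ.
Qed.

Lemma smoothZ (E : normedModType R) k (a : R) (u : R -> E) :
  smooth k u -> smooth k (fun t => a *: u t).
Proof. exact: smooth_blinear (blinear_scale E a). Qed.

Section Scaling.
Variable E : normedModType R.
Implicit Types (a : R -> R^o) (u : R -> E).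

Lemma cont_on_scale J a u t : cont_on J a t -> cont_on J u t ->
  cont_on J (fun s => a s *: u s) t.
Proof.
move=> ca cu e e0.
pose K := `|a t| + `|u t| + 1; have K0 : 0 < K by rewrite ltr_wpDl// addr_ge0.
pose h := Num.min 1 (e / (2 * K)).
have h0 : 0 < h by rewrite lt_min ltr01 divr_gt0// mulr_gt0.
have [h1 h2] : h <= 1 /\ h <= e / (2 * K) by rewrite !ge_min !lexx orbT.
have [d d0 {}ca] := ca _ h0; have [d' d'0 {}cu] := cu _ h0.
exists (Num.min d d') => [|s Js]; first by rewrite lt_min d0.
rewrite lt_min => /andP[/(ca _ Js) Ha /(cu _ Js) Hu].
rewrite (_ : _ - _ = a s *: (u s - u t) + (a s - a t) *: u t); last by lmod_over R E.
rewrite (le_trans (ler_normD _ _))// !normrZ.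
have as1 : `|a s| <= `|a t| + 1.
  by have := ler_distD (a t) (a s) 0; rewrite !subr0; move: Ha; set x := `|_ - _|; lra.
have p1 : `|a s| * `|u s - u t| <= K * h.
  by apply: ler_pM => //; rewrite (le_trans as1)// /K; have := normr_ge0 (u t); lra.
have p2 : `|a s - a t| * `|u t| <= h * K.
  by apply: ler_pM => //; rewrite /K; have := normr_ge0 (a t); lra.
move: h2; rewrite ler_pdivlMr ?mulr_gt0// => h2.
rewrite (le_trans (lerD p1 p2))//; lra.
Qed.

Lemma deriv_on_scale J a u t (a' : R^o) (u' : E) : deriv_on J a t a' -> deriv_on J u t u' ->
  deriv_on J (fun s => a s *: u s) t (a' *: u t + a t *: u').
Proof.
move=> da du e e0.
pose K := `|a t| + `|u t| + `|a'| + 1; have K0 : 0 < K by rewrite ltr_wpDl// !addr_ge0.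
pose h := Num.min 1 (e / (3 * K)).
have h0 : 0 < h by rewrite lt_min ltr01 divr_gt0// mulr_gt0.
have [h1 h2] : h <= 1 /\ h <= e / (3 * K) by rewrite !ge_min !lexx orbT.
have [d1 d10 cu] := deriv_on_cont du h0.
have [d d0 {}da] := da _ h0; have [d' d'0 {}du] := du _ h0.
exists (Num.min d1 (Num.min d d')) => [|s Js]; first by rewrite !lt_min d0 d10.
rewrite !lt_min => /andP[/(cu _ Js) Hc /andP[/(da _ Js) Ha /(du _ Js) Hu]].
rewrite (_ : _ - _ = a t *: (u s - u t - (s - t) *: u') + (a s - a t - (s - t) *: a') *: u s
   + ((s - t) * a') *: (u s - u t)); last first.
  by rewrite scalerBl -[(s - t) *: a']/((s - t) * a'); lmod_over R E.
have us1 : `|u s| <= `|u t| + 1.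
  by have := ler_distD (u t) (u s) 0; rewrite !subr0; move: Hc; set x := `|_ - _|; lra.
have n0 : 0 <= `|s - t| by [].
have p1 : `|a t *: (u s - u t - (s - t) *: u')| <= K * (h * `|s - t|).
  rewrite normrZ; apply: ler_pM => //; rewrite /K; have := normr_ge0 (u t); have := normr_ge0 a'; lra.
have p2 : `|(a s - a t - (s - t) *: a') *: u s| <= h * `|s - t| * K.
  rewrite normrZ; apply: ler_pM => //; rewrite (le_trans us1)// /K; have := normr_ge0 (a t); have := normr_ge0 a'; lra.
have p3 : `|((s - t) * a') *: (u s - u t)| <= `|s - t| * K * h.
  rewrite normrZ normrM; apply: ler_pM => //; apply: ler_pM => //.
  by rewrite /K; have := normr_ge0 (u t); have := normr_ge0 (a t); lra.
rewrite (le_trans (ler_normD _ _))// (le_trans (lerD (ler_normD _ _) (lexx _)))//.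
rewrite (le_trans (lerD (lerD p1 p2) p3))//.
move: h2; rewrite ler_pdivlMr ?mulr_gt0// => h2.
rewrite [leLHS](_ : _ = h * (3 * K) * `|s - t|); last by ring.
by rewrite ler_wpM2r.
Qed.

Lemma smooth_scale k a u : smooth k a -> smooth k u -> smooth k (fun t => a t *: u t).
Proof.
elim: k a u => [|k IH] a u.
  by move=> ca cu t t0; apply: cont_on_scale; [exact: ca|exact: cu].
move=> sa su; have [a' da sa'] := sa; have [u' du su'] := su.
exists (fun t => a' t *: u t + a t *: u' t).
  by move=> t t0; apply: deriv_on_scale; [exact: da|exact: du].
by apply: smoothD; apply: IH => //; exact: smoothS.
Qed.
End Scaling.

Lemma smooth_prod k (I : Type) (r : seq I) (P : pred I) (a : I -> R -> R^o) :
  (forall i, P i -> smooth k (a i)) -> smooth k (fun t => \prod_(i <- r | P i) a i t : R^o).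
Proof.
move=> sa; elim: r => [|i r IH].
  by apply: eq_smooth (smooth_cst k (1 : R^o)) => t _; rewrite big_nil.
have [Pi|Pi] := boolP (P i); last by apply: eq_smooth IH => t _; rewrite big_cons (negbTE Pi).
by apply: eq_smooth (smooth_scale (sa i Pi) IH) => t _; rewrite big_cons Pi.
Qed.

Lemma cont_on_inv J (a : R -> R^o) t : a t != 0 -> cont_on J a t ->
  cont_on J (fun s => (a s)^-1 : R^o) t.
Proof.
move=> at0 ca e e0; have n0 : 0 < `|a t| by rewrite normr_gt0.
pose h := Num.min (`|a t| / 2) (e * `|a t| ^+ 2 / 2).
have h0 : 0 < h by rewrite lt_min !divr_gt0// mulr_gt0// exprn_gt0.
have [h1 h2] : h <= `|a t| / 2 /\ h <= e * `|a t| ^+ 2 / 2 by rewrite !ge_min !lexx orbT.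
have [d d0 {}ca] := ca _ h0; exists d => // s Js /(ca _ Js) H.
have as1 : `|a t| / 2 <= `|a s|.
  by have := ler_distD (a s) (a t) 0; rewrite !subr0 (distrC (a t)); move: H; set x := `|_ - _|; lra.
have as0 : a s != 0 by rewrite -normr_gt0; lra.
rewrite (_ : _ - _ = - (a s - a t) / (a s * a t)); last by field; rewrite as0 at0.
rewrite normrM normrN normfV normrM ler_pdivrMr ?mulr_gt0//; last lra.
rewrite (le_trans H)// (le_trans h2)// [leLHS](_ : _ = e * (`|a t| / 2 * `|a t|)); last by ring.
by rewrite ler_wpM2l ?(ltW e0)// ler_wpM2r.
Qed.

Lemma deriv_on_inv J (a : R -> R^o) t (a' : R) : a t != 0 -> deriv_on J a t a' ->
  deriv_on J (fun s => (a s)^-1 : R^o) t (- a' * (a t)^-1 * (a t)^-1).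
Proof.
move=> at0 da e e0; have ca := cont_on_inv at0 (deriv_on_cont da).
pose b := (a t)^-1; pose K := `|b| * (`|b| + 1 + `|a'|) + 1.
have K0 : 0 < K by rewrite ltr_wpDl// mulr_ge0// !addr_ge0.
pose h := Num.min 1 (e / K).
have h0 : 0 < h by rewrite lt_min ltr01 divr_gt0.
have [h1 h2] : h <= 1 /\ h <= e / K by rewrite !ge_min !lexx orbT.
have [d d0 H1] := da _ h0; have [d' d'0 H2] := ca _ h0.
have n0 : 0 < `|a t| / 2 by rewrite divr_gt0// normr_gt0.
have [d1 d10 nz] := deriv_on_cont (da : deriv_on J a t a') n0.
exists (Num.min d1 (Num.min d d')) => [|s Js]; first by rewrite !lt_min d0 d10.
rewrite !lt_min => /andP[/(nz _ Js) Hz /andP[/(H1 _ Js) Ha /(H2 _ Js) Hb]].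
have as0 : a s != 0.
  by rewrite -normr_gt0; have := ler_distD (a s) (a t) 0; rewrite !subr0 (distrC (a t)); move: Hz n0; set x := `|_ - _|; lra.
rewrite (_ : _ - _ = - ((a s - a t - (s - t) *: (a' : R^o)) * (a s)^-1 * b) - (s - t) * a' * b * ((a s)^-1 - b)); last first.
  by rewrite /b -![(s - t) *: _]/((s - t) * _); field; rewrite as0 at0.
have bs : `|(a s)^-1| <= `|b| + 1.
  by have := ler_distD b (a s)^-1 0; rewrite !subr0; move: Hb; rewrite -/b; set x := `|_ - _|; lra.
have p1 : `|(a s - a t - (s - t) *: (a' : R^o)) * (a s)^-1 * b| <= h * `|s - t| * (`|b| + 1) * `|b|.
  by rewrite !normrM; apply: ler_pM => //; rewrite ?mulr_ge0//; apply: ler_pM.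
have p2 : `|(s - t) * a' * b * ((a s)^-1 - b)| <= `|s - t| * `|a'| * `|b| * h.
  by rewrite !normrM ler_wpM2l// !mulr_ge0.
rewrite (le_trans (ler_normB _ _))// normrN (le_trans (lerD p1 p2))//.
move: h2; rewrite ler_pdivlMr// => h2.
rewrite (le_trans (_ : _ <= h * K * `|s - t|))//; last by rewrite ler_wpM2r.
rewrite [leLHS](_ : _ = h * (`|b| * (`|b| + 1 + `|a'|)) * `|s - t|); last by ring.
by rewrite ler_wpM2r// ler_wpM2l ?(ltW h0)// lerDl.
Qed.

Lemma smooth_inv k (a : R -> R^o) : (forall t, 0 <= t -> a t != 0) ->
  smooth k a -> smooth k (fun t => (a t)^-1 : R^o).
Proof.
move=> a0; elim: k a a0 => [|k IH] a a0.
  by move=> ca t t0; apply: cont_on_inv; [exact: a0|exact: ca].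
move=> sa; have [a' da sa'] := sa.
exists (fun t => - a' t * (a t)^-1 * (a t)^-1).
  by move=> t t0; apply: deriv_on_inv; [exact: a0|exact: da].
have si := IH _ a0 (smoothS sa).
apply: (@smooth_scale R^o k (fun t => - a' t * (a t)^-1)) => //.
apply: (@smooth_scale R^o k (fun t => - a' t)) => //.
by apply: eq_smooth (smoothZ (-1) sa') => t _; rewrite scaleN1r.
Qed.

Lemma smooth_det k n (M : R -> 'M[R]_n) :
  (forall i j, smooth k (fun t => M t i j : R^o)) -> smooth k (fun t => \det (M t) : R^o).
Proof.
move=> sM; apply: (@eq_smooth _ k (fun t => \sum_(s : 'S_n)
    ((-1) ^+ s : R) *: (\prod_i M t i (s i) : R^o))) => //.
apply: smooth_sum => s _; apply: smooth_scale; first exact: smooth_cst.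
by apply: smooth_prod => i _; exact: sM.
Qed.

Lemma smooth_invmx k n (M : R -> 'M[R]_n) : (forall t, 0 <= t -> M t \in unitmx) ->
  (forall i j, smooth k (fun t => M t i j : R^o)) ->
  forall i j, smooth k (fun t => invmx (M t) i j : R^o).
Proof.
move=> uM sM i j.
apply: (@eq_smooth _ _ (fun t => (\det (M t))^-1 *: (cofactor (M t) j i : R^o))).
  by move=> t t0; rewrite /invmx uM// !mxE.
apply: smooth_scale.
  apply: smooth_inv; last exact: smooth_det.
  by move=> t t0; have := uM t t0; rewrite unitmxE unitfE.
apply: (@eq_smooth _ k (fun t => ((-1) ^+ (j + i) : R) *: (\det (row' j (col' i (M t))) : R^o))) => //.
apply: smooth_scale; first exact: smooth_cst.
apply: smooth_det => p q; apply: eq_smooth (sM (lift j p) (lift i q)) => t _.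
by rewrite !mxE.
Qed.

End SmoothCurves.
Arguments half_line {R}.

Section FiniteSmoothness.
Variables (R : realType) (X Y : normedModType R).
Implicit Types (S W : set X) (G : nat -> R -> X -> seq (R * X) -> Y).

Definition dnorm (h : R * X) : R := `|h.1| + `|h.2|.
Definition dirs W (j : nat) (hs : seq (R * X)) :=
  size hs = j /\ forall h, h \in hs -> W h.2.
Definition dirs_size (hs : seq (R * X)) : R := \prod_(h <- hs) dnorm h.

(* Defs.Ck over the reals, for a given family [G] of derivatives *)
Definition derivatives (k : nat) S W (g : R -> X -> Y) G :=
  [/\ forall (t : R) x, 0 <= t -> S x -> G 0%N t x [::] = g t x,
      forall j (t : R) x hs, (j < k)%N -> 0 <= t -> S x -> dirs W j hs ->
        forall (a : R) h h', W h.2 -> W h'.2 ->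
          G j.+1 t x ((a * h.1 + h'.1, a *: h.2 + h'.2) :: hs)
          = a *: G j.+1 t x (h :: hs) + G j.+1 t x (h' :: hs),
      forall j (t : R) x, (j <= k)%N -> 0 <= t -> S x ->
        exists C : R, forall hs, dirs W j hs -> `|G j t x hs| <= C * dirs_size hs,
      forall j (t : R) x, (j < k)%N -> 0 <= t -> S x ->
        forall e : R, 0 < e -> exists2 d : R, 0 < d &
        forall (t' : R) y, 0 <= t' -> S y -> dnorm (t' - t, y - x) < d ->
        forall hs, dirs W j hs ->
          `|G j t' y hs - G j t x hs - G j.+1 t x ((t' - t, y - x) :: hs)|
          <= e * dnorm (t' - t, y - x) * dirs_size hs
    & forall (t : R) x, 0 <= t -> S x ->
        forall e : R, 0 < e -> exists2 d : R, 0 < d &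
        forall (t' : R) y, 0 <= t' -> S y -> dnorm (t' - t, y - x) < d ->
        forall hs, dirs W k hs ->
          `|G k t' y hs - G k t x hs| <= e * dirs_size hs].

Lemma dnorm_ge0 h : 0 <= dnorm h. Proof. by rewrite addr_ge0. Qed.
Lemma dirs_size_ge0 hs : 0 <= dirs_size hs.
Proof. by apply: prodr_ge0 => h _; exact: dnorm_ge0. Qed.
Lemma dirs_size_cons h hs : dirs_size (h :: hs) = dnorm h * dirs_size hs.
Proof. by rewrite /dirs_size big_cons. Qed.
Lemma dirs_cons W j h hs : W h.2 -> dirs W j hs -> dirs W j.+1 (h :: hs).
Proof.
by move=> Wh [<- H]; split => // h'; rewrite inE => /orP[/eqP ->//|]; exact: H.
Qed.

Variables (k : nat) (S W : set X) (g : R -> X -> Y) (G : nat -> R -> X -> seq (R * X) -> Y).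
Hypotheses (W0 : W 0) (WP : forall (a : R) x y, W x -> W y -> W (a *: x + y)).
Hypothesis SW : S `<=` W.
Hypothesis GP : derivatives k S W g G.

Let WB x y : W x -> W y -> W (x - y).
Proof. by move=> Wx Wy; have := WP (-1) Wy Wx; rewrite scaleN1r addrC. Qed.

Lemma deriv_family_bound j (t : R) x : (j <= k)%N -> 0 <= t -> S x ->
  exists2 C : R, 0 < C & forall hs, dirs W j hs -> `|G j t x hs| <= C * dirs_size hs.
Proof.
move=> jk t0 Sx; have [_ _ /(_ j t x jk t0 Sx)[C HC] _ _] := GP.
exists (`|C| + 1) => [|hs Hhs]; first by rewrite ltr_wpDl.
rewrite (le_trans (HC hs Hhs))// ler_wpM2r ?dirs_size_ge0//.
by rewrite (le_trans (ler_norm _))// lerDl.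
Qed.

Lemma deriv_family_cont j (t : R) x : (j <= k)%N -> 0 <= t -> S x ->
  forall e : R, 0 < e -> exists2 d : R, 0 < d &
    forall (t' : R) y, 0 <= t' -> S y -> dnorm (t' - t, y - x) < d ->
    forall hs, dirs W j hs -> `|G j t' y hs - G j t x hs| <= e * dirs_size hs.
Proof.
move=> jk t0 Sx e e0; have [_ _ _ Gd Gc] := GP.
move: jk; rewrite leq_eqVlt => /orP[/eqP ->|jk]; first exact: Gc.
have [C C0 HC] := deriv_family_bound jk t0 Sx.
have e20 : 0 < e / 2 by lra.
have [d d0 Hd] := Gd j t x jk t0 Sx _ (@ltr01 R).
exists (Num.min d (e / (1 + C))); first by rewrite lt_min d0 divr_gt0// addr_gt0.
move=> t' y t'0 Sy; rewrite lt_min ltr_pdivlMr ?addr_gt0// => /andP[h1 h2] hs Hhs.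
have := Hd t' y t'0 Sy h1 hs Hhs.
have Hc : dirs W j.+1 ((t' - t, y - x) :: hs) by apply: dirs_cons => //=; apply: WB; exact: SW.
have := HC _ Hc; rewrite dirs_size_cons.
move: (dnorm _) h2 (dnorm_ge0 (t' - t, y - x)) => q h2 q0 p1 p2.
rewrite -(subrK (G j.+1 t x ((t' - t, y - x) :: hs)) (_ - _)).
rewrite (le_trans (ler_normD _ _))// (le_trans (lerD p2 p1))//.
rewrite [leLHS](_ : _ = q * (1 + C) * dirs_size hs); last by ring.
by rewrite ler_wpM2r ?dirs_size_ge0// ltW.
Qed.

Lemma deriv_family_lin j (t : R) x hs (a : R) h h' : (j < k)%N -> 0 <= t -> S x ->
  dirs W j hs -> W h.2 -> W h'.2 ->
  G j.+1 t x ((a * h.1 + h'.1, a *: h.2 + h'.2) :: hs)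
    = a *: G j.+1 t x (h :: hs) + G j.+1 t x (h' :: hs).
Proof. by have [_ H _ _ _] := GP => *; exact: H. Qed.

(** The increment is split into (s - t) (1, u') and (0, r) with r = o(s - t); the second part is
    controlled by the operator norm of the next derivative. *)
Lemma deriv_family_chain j (u : R -> X) (t : R) (u' : X) hs : (j < k)%N -> 0 <= t ->
  (forall s, 0 <= s -> S (u s)) -> W u' -> dirs W j hs ->
  deriv_on half_line u t u' ->
  deriv_on half_line (fun s => G j s (u s) hs) t (G j.+1 t (u t) ((1, u') :: hs)).
Proof.
move=> jk t0 Su Wu' Hhs du e e0; have [_ _ _ Gd _] := GP.
have St := Su t t0.
have [C C0 HC] := deriv_family_bound jk t0 St.
(* The summand 1 keeps the constant invertible when some direction in [hs] is zero. *)
pose s1 := dirs_size hs + 1; have s10 : 0 < s1 by rewrite ltr_wpDl// dirs_size_ge0.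
have u1 : 0 < 2 + `|u'| by rewrite ltr_pwDl.
have q_gt0 : 0 < e / (2 * (2 + `|u'|) * s1) by rewrite divr_gt0// mulr_gt0// mulr_gt0.
have [d1 d10 H1] := Gd j t (u t) jk t0 St _ q_gt0.
have [d2 d20 H2] := du 1 ltr01.
have [|d3 d30 H3] := du (e / (2 * C * s1)); first by rewrite divr_gt0// mulr_gt0// mulr_gt0.
exists (Num.min d2 (Num.min d3 (d1 / (2 + `|u'|)))); first by rewrite !lt_min d20 d30 divr_gt0.
move=> s Js; rewrite !lt_min ltr_pdivlMr// => /andP[/(H2 _ Js) K2 /andP[/(H3 _ Js) K3 st]].
have us : `|u s - u t| <= (1 + `|u'|) * `|s - t|.
  rewrite -(subrK ((s - t) *: u') (u s - u t)) (le_trans (ler_normD _ _))// normrZ.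
  by rewrite (le_trans (lerD K2 (lexx _)))//; lra.
have dn : dnorm (s - t, u s - u t) <= (2 + `|u'|) * `|s - t| by rewrite /dnorm /=; lra.
have dn1 : dnorm (s - t, u s - u t) < d1 by rewrite (le_lt_trans dn)// mulrC.
have {H1} K1 := H1 s (u s) Js (Su s Js) dn1 hs Hhs.
set r := u s - u t - (s - t) *: u' in K3.
have Wd : W (u s - u t) by apply: WB; apply: SW; exact: Su.
have Wr : W r by apply: WB => //; have := WP (s - t) Wu' W0; rewrite addr0.
have E1 : G j.+1 t (u t) ((s - t, u s - u t) :: hs) =
    (s - t) *: G j.+1 t (u t) ((1, u') :: hs) + G j.+1 t (u t) ((0, r) :: hs).
  rewrite -(@deriv_family_lin j t (u t) hs (s - t) (1, u') (0, r))//=.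
  by rewrite mulr1 addr0 /r [_ *: u' + _]addrC subrK.
rewrite (_ : _ - _ - _ = (G j s (u s) hs - G j t (u t) hs - G j.+1 t (u t) ((s - t, u s - u t) :: hs))
  + G j.+1 t (u t) ((0, r) :: hs)); last by rewrite E1; lmod_over R Y.
have K4 : `|G j.+1 t (u t) ((0, r) :: hs)| <= e / 2 * `|s - t|.
  rewrite (le_trans (HC _ _))//; first exact: dirs_cons.
  rewrite dirs_size_cons /dnorm /= normr0 add0r.
  have : C * (`|r| * dirs_size hs) <= C * ((e / (2 * C * s1) * `|s - t|) * s1).
    rewrite ler_wpM2l ?(ltW C0)//; apply: ler_pM => //; first exact: dirs_size_ge0.
    by rewrite /s1 lerDl.
  move=> /le_trans; apply; rewrite le_eqVlt; apply/orP; left; apply/eqP; field.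
  by rewrite !gt_eqF.
rewrite (le_trans (ler_normD _ _))// [leRHS](_ : _ = e / 2 * `|s - t| + e / 2 * `|s - t|); last by field.
rewrite lerD// (le_trans K1)//.
set q := e / (2 * (2 + `|u'|) * s1).
have q0 : 0 <= q by rewrite ltW.
rewrite (@le_trans _ _ (q * ((2 + `|u'|) * `|s - t|) * s1))//.
  apply: ler_pM => //; [by rewrite mulr_ge0// dnorm_ge0|exact: dirs_size_ge0|by rewrite ler_wpM2l|].
  by rewrite /s1 lerDl.
rewrite le_eqVlt; apply/orP; left; apply/eqP; rewrite /q.
by move: (2 + `|u'|) u1 => K K0; field; rewrite !gt_eqF.
Qed.

Variables (N : nat) (e_ : 'I_N -> X) (c_ : 'I_N -> X -> R^o).
Hypotheses (We : forall i, W (e_ i)) (cl : forall i, blinear (c_ i)).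
Hypothesis ec : forall x, W x -> x = \sum_i c_ i x *: e_ i.

Lemma deriv_family_sum j (t : R) x hs (a : R) (y : X) : (j < k)%N -> 0 <= t -> S x ->
  dirs W j hs -> W y ->
  G j.+1 t x ((a, y) :: hs) =
    a *: G j.+1 t x ((1, 0) :: hs) + \sum_i c_ i y *: G j.+1 t x ((0, e_ i) :: hs).
Proof.
move=> jk t0 Sx Hhs Wy; have lin := @deriv_family_lin j t x hs.
have := lin a (1, 0) (0, y) jk t0 Sx Hhs W0 Wy; rewrite /= mulr1 addr0 scaler0 add0r => ->.
congr (_ + _); rewrite {1}(ec Wy).
have G00 : G j.+1 t x ((0, 0) :: hs) = 0.
  have := lin 1 (0, 0) (0, 0) jk t0 Sx Hhs W0 W0; rewrite /= mulr0 addr0 scaler0 addr0 scale1r.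
  by move=> /eqP; rewrite -subr_eq0 opprD addrA subrr add0r oppr_eq0 => /eqP.
have Wsum (r : seq 'I_N) : W (\sum_(i <- r) c_ i y *: e_ i).
  elim: r => [|i r IH]; first by rewrite big_nil.
  by rewrite big_cons; exact: WP.
elim: (index_enum _) => [|i r IH]; first by rewrite !big_nil.
rewrite !big_cons -IH; have := lin (c_ i y) (0, e_ i) (0, \sum_(i <- r) c_ i y *: e_ i) jk t0 Sx Hhs (We i) (Wsum r).
by rewrite /= mulr0 addr0.
Qed.

(** The derivative is pushed through the reconstruction map x -> sum of the c_i(x) e_i, which is the
    identity on W: it then lies in W at every t, including the negative times where [smooth] leaves
    it free. *)
Lemma smooth_in_W l (u : R -> X) : (forall s, 0 <= s -> W (u s)) -> smooth l.+1 u ->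
  exists u', [/\ forall t, 0 <= t -> deriv_on half_line u t (u' t), smooth l u' &
    forall t, W (u' t)].
Proof.
move=> Wu [u' du su']; exists (fun t => \sum_i c_ i (u' t) *: e_ i); split.
- move=> t t0; apply: (@eq_deriv_on _ _ _ (fun s => \sum_i c_ i (u s) *: e_ i)) => //.
    by move=> s s0; rewrite -ec//; exact: Wu.
  rewrite (_ : (fun s => _) = (fun x => \sum_i c_ i x *: e_ i) \o u)//.
  apply: (@deriv_on_blinear _ _ _ (fun x => \sum_i c_ i x *: e_ i)); last exact: du.
  split.
    move=> a x y; rewrite scaler_sumr -big_split /=; apply: eq_bigr => i _.
    by rewrite (cl i).1 scalerDl scalerA.
  exists (\sum_i xget 0 [set C : R | 0 <= C /\ forall x, `|c_ i x| <= C * `|x| ] * `|e_ i|).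
    apply: sumr_ge0 => i _; apply: mulr_ge0 => //; have [_ [C C0 HC]] := cl i.
    by case: xgetP => [D _ []//|/(_ C)[]]; split.
  move=> x; rewrite (le_trans (ler_norm_sum _ _ _))// mulr_suml; apply: ler_sum => i _.
  rewrite normrZ mulrAC ler_wpM2r//; have [_ [C C0 HC]] := cl i.
  by case: xgetP => [D _ []//|/(_ C)[]]; split.
- apply: smooth_sum => i _; apply: (@smooth_scale R X l (fun t => c_ i (u' t)) (fun=> e_ i)).
    exact: smooth_blinear.
  exact: smooth_cst.
- move=> t; elim: (index_enum _) => [|i r IH]; first by rewrite big_nil.
  by rewrite big_cons; exact: WP.
Qed.

(** Differentiating adds the moving direction (1, u'). Expanding u' in the finite family [e_] turns
    the result into scalar curves times terms with fixed directions, to which the induction on l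
    applies; this is where finite dimension enters. *)
Theorem smooth_comp l j (u : R -> X) hs : (j + l <= k)%N -> dirs W j hs ->
  (forall s, 0 <= s -> S (u s)) -> smooth l u -> smooth l (fun t => G j t (u t) hs).
Proof.
elim: l j hs => [|l IH] j hs jlk Hhs Su su.
  move=> t t0 e e0; rewrite addn0 in jlk.
  pose q := dirs_size hs + 1; have q0 : 0 < q by rewrite ltr_wpDl// dirs_size_ge0.
  have [d d0 H] := deriv_family_cont jlk t0 (Su t t0) (divr_gt0 e0 q0).
  have d20 : 0 < d / 2 by lra.
  have [d' d'0 H'] := su t t0 _ d20.
  exists (Num.min (d / 2) d') => [|s Js]; first by rewrite lt_min d20.
  rewrite lt_min => /andP[s1 /(H' _ Js) s2].
  rewrite (le_trans (H s (u s) Js (Su s Js) _ hs Hhs))//.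
    by rewrite /dnorm /=; lra.
  by rewrite mulrAC ler_pdivrMr// ler_wpM2l ?(ltW e0)// /q lerDl.
have Wu s : 0 <= s -> W (u s) by move=> s0; apply: SW; exact: Su.
have [u' [du su' Wu']] := smooth_in_W Wu su.
have jk : (j < k)%N by rewrite (leq_trans _ jlk)// addnS ltnS leq_addr.
have jlk' : (j.+1 + l <= k)%N by rewrite addSnnS.
exists (fun t => G j.+1 t (u t) ((1, u' t) :: hs)).
  by move=> t t0; apply: deriv_family_chain => //; exact: du.
apply: (@eq_smooth _ _ _ (fun t => G j.+1 t (u t) ((1, 0) :: hs) +
    \sum_i c_ i (u' t) *: G j.+1 t (u t) ((0, e_ i) :: hs))).
  by move=> t t0; rewrite (@deriv_family_sum j t (u t) hs 1 (u' t))// ?scale1r//; exact: Su.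
have sul := smoothS su.
apply: smoothD; first by apply: IH => //; exact: dirs_cons.
apply: smooth_sum => i _; apply: (@smooth_scale R Y l (fun t => c_ i (u' t))).
  exact: smooth_blinear.
by apply: IH => //; apply: dirs_cons => /=.
Qed.

End FiniteSmoothness.

Section ImplicitCurve.
Variable R : realType.

Lemma mean_value01 (Y : normedModType R) (c D : R -> Y) (l : Y) (M : R) :
  (forall r, 0 <= r <= 1 -> deriv_on `[0, 1] c r (D r)) ->
  (forall r, 0 <= r <= 1 -> `|D r - l| <= M) -> `|c 1 - c 0 - l| <= M.
Proof.
move=> dc DM.
have /(_ 0 1) := @mean_value_itv R Y (fun r => c r + r *: (- l)) (fun r => D r - l) 0 1 _ _ M.
rewrite scale1r scale0r addr0 subr0 normr1 mulr1 addrAC; apply => //.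
- move=> r r01; apply: deriv_onD; first exact: dc.
  by move=> e e0; exists 1 => // s _ _; rewrite -scalerBl subrr normr0 mulr_ge0// ltW.
- by rewrite lexx ler01.
- by rewrite lexx ler01.
Qed.

Section Coordinates.
Variable X : normedModType R.

(** A frame rather than a basis: the family may be redundant (over the reals it will contain zero
    vectors), and the functionals are bounded on the whole space. *)
Definition coordinates (W : set X) (N : nat) (e_ : 'I_N -> X) (c_ : 'I_N -> X -> R^o) :=
  [/\ W 0, forall (a : R) x y, W x -> W y -> W (a *: x + y), forall i, W (e_ i),
      forall i, blinear (c_ i) & forall x, W x -> x = \sum_i c_ i x *: e_ i].

Lemma coordinates_sum W N e_ c_ (a : 'I_N -> R) : @coordinates W N e_ c_ ->
  W (\sum_i a i *: e_ i).
Proof.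
move=> [W0 WP We _ _]; elim: (index_enum _) => [|i r IH]; first by rewrite big_nil.
by rewrite big_cons; exact: WP.
Qed.

Lemma coordinates_blinear W N e_ c_ : @coordinates W N e_ c_ ->
  blinear (fun x => \sum_i c_ i x *: e_ i).
Proof.
move=> [_ _ _ cl _]; split.
  move=> a x y; rewrite scaler_sumr -big_split /=; apply: eq_bigr => i _.
  by rewrite (cl i).1 scalerDl scalerA.
have /choice[C HC] : forall i, exists C : R, 0 <= C /\ forall x, `|c_ i x| <= C * `|x|.
  by move=> i; have [_ [C C0 HC]] := cl i; exists C.
exists (\sum_i C i * `|e_ i|).
  by apply: sumr_ge0 => i _; apply: mulr_ge0 => //; have [] := HC i.
move=> x; rewrite (le_trans (ler_norm_sum _ _ _))// mulr_suml; apply: ler_sum => i _.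
by rewrite normrZ mulrAC ler_wpM2r//; have [_] := HC i.
Qed.

Lemma coordinates_closed W N e_ c_ : @coordinates W N e_ c_ ->
  forall z, (forall e : R, 0 < e -> exists2 v, W v & `|v - z| <= e) -> W z.
Proof.
move=> H z Wz; have [W0 WP We cl ec] := H; have bE := coordinates_blinear H.
set E := (fun x => _) in bE; suff -> : z = E z by exact: coordinates_sum H.
have [C C0 HC] := blinear_bound bE.
apply/eqP; rewrite -subr_eq0 -normr_eq0 eq_le normr_ge0 andbT.
apply/ler_addgt0Pr => e e0; rewrite add0r.
have [|v Wv vz] := Wz (e / (1 + C)); first by rewrite divr_gt0// addr_gt0.
rewrite (_ : z - E z = E (v - z) - (v - z)); last first.
  by rewrite blinearB// -[E v]ec//; lmod_over R X.
rewrite (le_trans (ler_normB _ _))// (le_trans (lerD (HC _) (lexx _)))//.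
move: vz; rewrite ler_pdivlMr ?addr_gt0//; move: `|_ - _| => q; lra.
Qed.

Lemma coordinatesB W N e_ c_ x y : @coordinates W N e_ c_ -> W x -> W y -> W (x - y).
Proof. by move=> [_ WP _ _ _] Wx Wy; have := WP (-1) _ _ Wy Wx; rewrite scaleN1r addrC. Qed.

End Coordinates.

Section Solve.
Variables (X Y : normedModType R) (W : set X) (N : nat) (e_ : 'I_N -> X) (c_ : 'I_N -> X -> R^o).
Hypothesis HW : coordinates W e_ c_.
Variables (La : R -> X -> Y) (T : Y -> X) (b : R -> Y) (z : R -> X).
Hypotheses (bT : blinear T) (TW : forall y, W (T y)) (Wz : forall t, 0 <= t -> W (z t)).
Hypothesis Lalin : forall t (a : 'I_N -> R), 0 <= t ->
  La t (\sum_i a i *: e_ i) = \sum_i a i *: La t (e_ i).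
Hypothesis Tinj : forall t h, 0 <= t -> W h -> T (La t h) = 0 -> h = 0.
Hypothesis Tz : forall t, 0 <= t -> T (La t (z t)) = T (b t).

(* In coordinates (E, C) of [W], the map C T La E + (1 - C E) is invertible on the
   whole coordinate space although C E need not be the identity. *)
Lemma smooth_solve l : (forall i, smooth l (fun t => La t (e_ i))) -> smooth l b -> smooth l z.
Proof.
move=> sL sb; have [W0 WP We cl ec] := HW.
pose M t := \matrix_(i, j) (c_ i (T (La t (e_ j))) + (i == j)%:R - c_ i (e_ j)) : 'M[R]_N.
have ME t (zeta : 'cV[R]_N) i : 0 <= t -> (M t *m zeta) i 0 =
    c_ i (T (La t (\sum_j zeta j 0 *: e_ j))) + zeta i 0 - c_ i (\sum_j zeta j 0 *: e_ j).
  move=> t0; rewrite mxE Lalin// (blinear_sum bT) !(blinear_sum (cl i)).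
  rewrite [X in _ = _ + X - _](_ : _ = \sum_j (i == j)%:R * zeta j 0); last first.
    rewrite (bigD1 i)//= eqxx mul1r big1 ?addr0// => j; rewrite eq_sym => /negbTE ->.
    by rewrite mul0r.
  rewrite -big_split -sumrB /=; apply: eq_bigr => j _.
  rewrite (blinearZ bT) !(blinearZ (cl i)) mxE mulrBl mulrDl.
  by rewrite -![_ *: c_ i _]/(_ * c_ i _) ![zeta j 0 * c_ i _]mulrC.
have Munit t : 0 <= t -> M t \in unitmx.
  move=> t0; rewrite -unitmx_tr -row_free_unit; apply: inj_row_free => zeta.
  move=> /(congr1 trmx); rewrite trmx_mul trmxK trmx0 => Mz.
  pose h := \sum_j zeta 0 j *: e_ j; have Wh : W h by exact: coordinates_sum HW.
  have hE : h = \sum_j zeta^T j 0 *: e_ j by apply: eq_bigr => j _; rewrite mxE.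
  have Mi i : c_ i (T (La t h)) + zeta 0 i - c_ i h = 0.
    by have := ME t zeta^T i t0; rewrite Mz -hE !mxE => <-.
  (* Reconstructing the identities [Mi] against the [e_] gives T (La t h) + h - h = 0; only then are
     the entries of zeta recovered from [Mi]. *)
  have T0 : T (La t h) = 0.
    move: (TW (La t h)) Mi; set y := T _ => Wy Mi.
    have -> : y = \sum_i c_ i y *: e_ i + \sum_i zeta 0 i *: e_ i - \sum_i c_ i h *: e_ i.
      by rewrite -!ec// -/h addrK.
    by rewrite -big_split -sumrB; apply: big1 => i _ /=; rewrite -scalerDl -scalerBl Mi scale0r.
  have h0 := Tinj t0 Wh T0; apply/rowP => i; have := Mi i.
  by rewrite T0 h0 (blinear0 (cl i)) add0r subr0 mxE.
pose beta t := \col_i c_ i (T (b t)) : 'cV[R]_N.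
have zE t : 0 <= t -> z t = \sum_i (invmx (M t) *m beta t) i 0 *: e_ i.
  move=> t0; rewrite {1}(ec _ (Wz t0)); apply: eq_bigr => i _; congr (_ *: _).
  pose zeta := \col_i c_ i (z t) : 'cV[R]_N.
  suff -> : beta t = M t *m zeta by rewrite mulKmx ?Munit// mxE.
  apply/colP => j; rewrite ME//.
  have -> : \sum_j0 zeta j0 0 *: e_ j0 = z t.
    by rewrite [RHS](ec _ (Wz t0)); apply: eq_bigr => k _; rewrite mxE.
  by rewrite Tz// !mxE addrK.
apply: (@eq_smooth _ _ _ (fun t => \sum_i (\sum_j (invmx (M t) i j : R^o) *: c_ j (T (b t)) : R^o) *: e_ i)).
  move=> t t0; rewrite zE//; apply: eq_bigr => i _; rewrite mxE; congr (_ *: _).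
  by apply: eq_bigr => j _; rewrite mxE.
apply: smooth_sum => i _; apply: smooth_scale; last exact: smooth_cst.
apply: smooth_sum => j _; apply: (@smooth_scale R R^o).
  apply: smooth_invmx => // p q.
  apply: (@eq_smooth _ _ _ (fun t => (c_ p (T (La t (e_ q))) + ((p == q)%:R - c_ p (e_ q))) : R^o)).
    by move=> t _; rewrite mxE addrA.
  apply: smoothD; last exact: smooth_cst.
  exact: (smooth_blinear (cl p) (smooth_blinear bT (sL q))).
exact: (smooth_blinear (cl j) (smooth_blinear bT sb)).
Qed.
End Solve.

Section Implicit.
Variables X Y : completeNormedModType R.
Variables (k : nat) (S W W1 : set X) (g : R -> X -> Y) (G : nat -> R -> X -> seq (R * X) -> Y).
Variables (N N1 : nat) (e_ : 'I_N -> X) (c_ : 'I_N -> X -> R^o).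
Variables (e1 : 'I_N1 -> X) (c1 : 'I_N1 -> X -> R^o).
Hypotheses (HW : coordinates W e_ c_) (HW1 : coordinates W1 e1 c1) (W1W : W1 `<=` W).
Hypotheses (SW : S `<=` W) (GP : derivatives k S W g G) (k1 : (0 < k)%N).
Hypothesis Sopen : forall x, S x -> exists2 d : R, 0 < d & forall y, W y -> `|y - x| < d -> S y.

Let W0 : W 0. Proof. by have [] := HW. Qed.
Let WP (a : R) x y : W x -> W y -> W (a *: x + y). Proof. by have [_ + _ _ _] := HW; exact. Qed.

Lemma deriv_segment (s : R) (y h : X) (r : R) (J : set R) : 0 <= s -> W h -> J r ->
  (forall p, J p -> S (y + p *: h)) ->
  deriv_on J (fun p => g s (y + p *: h)) r (G 1 s (y + r *: h) [:: (0, h)]).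
Proof.
move=> s0 Wh Jr Sy e e0; have [G0 _ _ Gd _] := GP.
have h1 : 0 < `|h| + 1 by rewrite ltr_wpDl.
have [d d0 Hd] := Gd 0%N s _ k1 s0 (Sy r Jr) _ (divr_gt0 e0 h1).
exists (d / (`|h| + 1)); first by rewrite divr_gt0.
move=> p Jp; rewrite ltr_pdivlMr// => pr.
have dE : dnorm (s - s, y + p *: h - (y + r *: h)) = `|p - r| * `|h|.
  by rewrite /dnorm /= subrr normr0 add0r -normrZ; congr `|_|; lmod_over R X.
have dd : dnorm (s - s, y + p *: h - (y + r *: h)) < d.
  by rewrite dE (le_lt_trans _ pr)// ler_wpM2l// lerDl.
have Hnil : dirs W 0 (@nil (R * X)) by split.
have := Hd s _ s0 (Sy p Jp) dd [::] Hnil.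
rewrite G0 ?G0//; [|exact: Sy|exact: Sy].
have -> : (s - s, y + p *: h - (y + r *: h)) = ((p - r) * (0 : R, h).1 + (0 : R, 0 : X).1, (p - r) *: (0 : R, h).2 + (0 : R, 0 : X).2).
  by rewrite /= subrr mulr0 !addr0; congr pair; lmod_over R X.
rewrite (deriv_family_lin GP)//=; last exact: Sy.
have := @deriv_family_lin R X Y k S W g G GP 0%N s (y + r *: h) [::] (-1) (0, 0) (0, 0) k1 s0 (Sy r Jr) Hnil W0 W0.
rewrite /= mulr0 addr0 scaler0 addr0 scaleN1r addNr => ->; rewrite addr0.
move=> /le_trans; apply; rewrite mulr0 !addr0.
rewrite /dirs_size big_nil mulr1 /dnorm /= normr0 add0r normrZ.
rewrite mulrAC ler_pdivrMr// -mulrA ler_wpM2l ?(ltW e0)// ler_wpM2l// lerDl//.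
Qed.

(** Mean value along the segment from y' to y, which stays in the open set S. The estimate is
    uniform in the time s near t, as needed when the base point of a Newton iteration is kept while
    time moves. *)
Lemma strictly_differentiable (t : R) x (e : R) : 0 <= t -> S x -> 0 < e ->
  exists2 d, 0 < d & forall s y y', 0 <= s -> `|s - t| < d -> W y -> W y' ->
    `|y - x| < d -> `|y' - x| < d ->
    `|g s y - g s y' - G 1 t x [:: (0, y - y')]| <= e * `|y - y'|.
Proof.
move=> t0 Sx e0.
have [d d0 Hd] := deriv_family_cont WP SW GP k1 t0 Sx e0.
have [d' d'0 Hd'] := Sopen Sx.
exists (Num.min (d / 2) d'); first by rewrite lt_min d'0 divr_gt0.
move=> s y y' s0; rewrite !lt_min => /andP[st _] Wy Wy' /andP[yx yx'] /andP[yx1 yx1'].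
pose h := y - y'; have Wh : W h by exact: coordinatesB HW _ _.
have Wp p : W (y' + p *: h) by rewrite addrC; exact: WP.
have pd p (D : R) : 0 <= p <= 1 -> `|y - x| < D -> `|y' - x| < D -> `|y' + p *: h - x| < D.
  move=> /andP[p0 p1] h1 h2.
  rewrite (_ : _ - _ = p *: (y - x) + (1 - p) *: (y' - x)); last by rewrite /h; lmod_over R X.
  rewrite (le_lt_trans (ler_normD _ _))// !normrZ ger0_norm// ger0_norm ?subr_ge0//.
  have [->|pn] := eqVneq p 0; first by rewrite mul0r subr0 mul1r add0r.
  have p_gt0 : 0 < p by rewrite lt_neqAle eq_sym pn.
  have : p * `|y - x| < p * D by rewrite ltr_pM2l.
  have : (1 - p) * `|y' - x| <= (1 - p) * D by rewrite ler_wpM2l ?subr_ge0// ltW.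
  lra.
have Sp p : 0 <= p <= 1 -> S (y' + p *: h) by move=> p01; apply: Hd' => //; exact: pd.
have := @mean_value01 Y (fun p => g s (y' + p *: h))
  (fun p => G 1 s (y' + p *: h) [:: (0, h)]) (G 1 t x [:: (0, h)]) (e * `|h|).
rewrite scale1r scale0r addr0 /h [y' + (_ - _)]addrC subrK; apply.
- by move=> r r01; apply: deriv_segment => // p; rewrite /= in_itv/=; exact: Sp.
- move=> r r01; have := Hd s (y' + r *: h) s0 (Sp r r01).
  have h1 : dnorm (s - t, y' + r *: h - x) < d.
    by rewrite /dnorm /=; have := pd r _ r01 yx yx1; lra.
  move=> /(_ h1 [:: (0, h)]); rewrite dirs_size_cons /dirs_size big_nil mulr1 /dnorm /= normr0 add0r.
  by apply; split => // p; rewrite inE => /eqP ->.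
Qed.

Lemma deriv_family1_lin (t : R) x (a : R) y z : 0 <= t -> S x -> W y -> W z ->
  G 1 t x [:: (0, a *: y + z)] = a *: G 1 t x [:: (0, y)] + G 1 t x [:: (0, z)].
Proof.
move=> t0 Sx Wy Wz; have Hnil : dirs W 0 (@nil (R * X)) by split.
have := @deriv_family_lin R X Y k S W g G GP 0%N t x [::] a (0, y) (0, z) k1 t0 Sx Hnil Wy Wz.
by rewrite /= mulr0 addr0.
Qed.

Lemma jointly_continuous (t : R) x (e : R) : 0 <= t -> S x -> 0 < e ->
  exists2 d, 0 < d & forall s y, 0 <= s -> S y -> `|s - t| < d -> `|y - x| < d ->
    `|g s y - g t x| <= e.
Proof.
move=> t0 Sx e0; have [G0 _ _ _ _] := GP.
have [d d0 Hd] := deriv_family_cont WP SW GP (leq0n k) t0 Sx e0.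
exists (d / 2) => [|s y s0 Sy st yx]; first by rewrite divr_gt0.
have Hnil : dirs W 0 (@nil (R * X)) by split.
have := Hd s y s0 Sy _ [::] Hnil; rewrite !G0// /dirs_size big_nil mulr1; apply.
by rewrite /dnorm /=; lra.
Qed.

Variables (M : set X) (B : X -> Y) (QV : Y -> Y) (u v : R -> X) (a : R -> Y) (T : R -> Y -> X).
Hypotheses (bB : blinear B) (bQ : blinear QV).
Hypotheses (Wu : forall t, 0 <= t -> W (u t)) (su : smooth k u) (sa : smooth k a).
Hypotheses (MW1 : M `<=` W1) (MS : forall t z, 0 <= t -> M z -> S (u t + z)).
Hypothesis Mopen : forall x, M x -> exists2 d : R, 0 < d & forall y, W1 y -> `|y - x| < d -> M y.
Hypotheses (Mv : forall t, 0 <= t -> M (v t))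
  (v0 : forall t, 0 <= t -> g t (u t + v t) - B (v t) - a t = 0)
  (vuniq : forall t z, 0 <= t -> M z -> g t (u t + z) - B z - a t = 0 -> z = v t).
Hypotheses (Qg : forall t x, 0 <= t -> S x -> QV (g t x) = g t x)
  (QB : forall z, W1 z -> QV (B z) = B z) (Qa : forall t, 0 <= t -> QV (a t) = a t).
Hypotheses (bT : forall t, 0 <= t -> blinear (T t)) (TW : forall t y, 0 <= t -> W1 (T t y))
  (TL : forall t h, 0 <= t -> W1 h -> T t (G 1 t (u t + v t) [:: (0, h)] - B h) = h)
  (LT : forall t y, 0 <= t -> QV y = y -> G 1 t (u t + v t) [:: (0, T t y)] - B (T t y) = y).

Let W10 : W1 0. Proof. by have [] := HW1. Qed.
Let W1P (b : R) x y : W1 x -> W1 y -> W1 (b *: x + y). Proof. by have [_ + _ _ _] := HW1; exact. Qed.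
Let Suv t : 0 <= t -> S (u t + v t). Proof. by move=> t0; apply: MS => //; exact: Mv. Qed.

(** The inverse is frozen at time t and Newton's iteration is run at a nearby time s, starting from
    v t. The zero that it finds near v t is v s by uniqueness, so continuity costs no uniformity of
    the inverses in t. *)
Lemma implicit_cont : smooth 0 v.
Proof.
move=> t t0; set x := u t + v t; have Sx : S x by exact: Suv.
have [C C0 HC] := blinear_bound (bT t0).
pose Phi s z := g s (u s + z) - B z - a s.
(* With C a bound of the inverse, this precision makes the iteration a contraction by 1/2. *)
have e0 : 0 < (2 * C)^-1 by rewrite invr_gt0 mulr_gt0.
have [d d0 Hd] := strictly_differentiable t0 Sx e0.
have [dM dM0 HM] := Mopen (Mv t0).
move=> eps eps0.
pose r := Num.min (Num.min eps dM / 2) (d / 4).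
have r0 : 0 < r by rewrite !lt_min !divr_gt0 ?lt_min ?eps0.
have [r1 r2 r3] : [/\ r <= eps, r < dM & r < d].
  have : r <= Num.min eps dM / 2 by rewrite ge_min lexx.
  have : r <= d / 4 by rewrite ge_min lexx orbT.
  have : Num.min eps dM <= eps by rewrite ge_min lexx.
  have : Num.min eps dM <= dM by rewrite ge_min lexx orbT.
  split; lra.
have rd : r <= d / 4 by rewrite ge_min lexx orbT.
pose eta := r / (8 * C); have eta0 : 0 < eta by rewrite divr_gt0// mulr_gt0.
have [d1 d10 H1] := jointly_continuous t0 Sx eta0.
have d120 : 0 < Num.min d1 d / 2 by rewrite divr_gt0// lt_min d10.
have [d2 d20 H2] := smooth0 su t0 d120.
have [d3 d30 H3] := smooth0 sa t0 eta0.
exists (Num.min (Num.min d1 d) (Num.min d2 d3)); first by rewrite !lt_min d10 d0 d20.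
move=> s s0; rewrite !lt_min => /andP[/andP[st1 std] /andP[/(H2 _ s0) us /(H3 _ s0) as_]].
have [m1 m2] : Num.min d1 d <= d1 /\ Num.min d1 d <= d by rewrite !ge_min !lexx orbT.
have Ws z : W1 z -> W (u s + z).
  by move=> W1z; have := WP 1 (Wu s0) (W1W W1z); rewrite scale1r.
have near z : `|z - v t| <= r -> `|u s + z - x| < d.
  move=> zr; rewrite /x (_ : _ - _ = (u s - u t) + (z - v t)); last by lmod_over R X.
  by rewrite (le_lt_trans (ler_normD _ _))//; lra.
have QPhi z : W1 z -> `|z - v t| <= r -> QV (Phi s z) = Phi s z.
  move=> W1z zr; have Mz : M z by apply: HM => //; lra.
  by rewrite !(blinearB bQ) Qg ?QB ?Qa//; exact: MS.
have TPhi z z' : W1 z -> W1 z' -> `|z - v t| <= r -> `|z' - v t| <= r ->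
    `|T t (Phi s z) - T t (Phi s z') - (z - z')| <= 2^-1 * `|z - z'|.
  move=> W1z W1z' zr z'r.
  have W1d : W1 (z - z') by exact: coordinatesB HW1 _ _.
  have TLx := TL t0 W1d; rewrite -/x in TLx.
  have := Hd s (u s + z) (u s + z') s0 std (Ws _ W1z) (Ws _ W1z') (near _ zr) (near _ z'r).
  rewrite (_ : u s + z - (u s + z') = z - z'); last by lmod_over R X.
  move: TLx; set L := G 1 t x _ => TLx.
  rewrite -[z - z' in X in _ -> X <= _]TLx -!(blinearB (bT t0)) => HL; rewrite (le_trans (HC _))//; move: HL.
  rewrite (_ : Phi s z - Phi s z' - _ = g s (u s + z) - g s (u s + z') - L).
    by rewrite -ler_pdivlMl// mulrA invfM [C^-1 * _]mulrC.
  by rewrite /Phi (blinearB bB); lmod_over R Y.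
have C4 : `|T t (Phi s (v t))| <= r / 4.
  rewrite (le_trans (HC _))// -ler_pdivlMl//.
  have Suvs : S (u s + v t) by apply: MS => //; exact: Mv.
  have h1 : `|u s + v t - x| < d1 by rewrite /x (_ : _ - _ = u s - u t); [lra|lmod_over R X].
  have K := H1 s _ s0 Suvs st1 h1.
  rewrite /Phi (_ : _ - _ = (g s (u s + v t) - g t x) - (a s - a t)).
    rewrite (le_trans (ler_normB _ _))// (le_trans (lerD K as_))// /eta.
    by rewrite le_eqVlt; apply/orP; left; apply/eqP; field; rewrite gt_eqF.
  have /eqP := v0 t0; rewrite !subr_eq add0r => /eqP; rewrite -/x => ->.
  by lmod_over R Y.
have half01 : 0 <= (2^-1 : R) < 1 by lra.
have [|||||||z [W1z Phiz zv]] := @newton_zero R X Y W1 (Phi s) (T t) (v t) r 2^-1 (r / 4) W10 W1P (coordinates_closed HW1).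
- by move=> z W1z zr; exact: TW.
- exact: TPhi.
- move=> z W1z zr Tz0; have := LT t0 (QPhi z W1z zr); rewrite Tz0 (blinear0 bB) subr0.
  have := deriv_family1_lin (-1) t0 Sx W0 W0.
  by rewrite scaler0 addr0 scaleN1r addNr => -> <-.
- exact: half01.
- by apply: MW1; exact: Mv.
- exact: C4.
- lra.
have zr : `|z - v t| <= r.
  by rewrite (le_trans zv)// (_ : r / 4 / (1 - 2^-1) = r / 2); [lra|field].
have Mz : M z by apply: HM => //; lra.
by rewrite -(vuniq s0 Mz Phiz); lra.
Qed.

(** Applying the inverse to the difference of the equations at s and t expresses v s - v t - (s - t)
    v' by small terms and a remainder of the size of the increments of u and v. With a factor below
    1/2 the unknown part of this remainder is absorbed in the left-hand side, so v need not be known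
    to be Lipschitz beforehand. *)
Lemma implicit_deriv t (u' : X) (a' : Y) : 0 <= t -> W u' ->
  deriv_on half_line u t u' -> deriv_on half_line a t a' ->
  deriv_on half_line v t (- T t (G 1 t (u t + v t) [:: (1, u')] - a')).
Proof.
move=> t0 Wu' du da; set x := u t + v t; have Sx : S x by exact: Suv.
set G1 := G 1 t x [:: (1, u')]; set v' := - T t _.
have [C C0 HC] := blinear_bound (bT t0).
have [K K0 HK] := deriv_family_bound GP k1 t0 Sx.
pose D := 2 + `|u'| + `|v'|; have D0 : 0 < D by rewrite /D -addrA ltr_pwDl// addr_ge0.
have Hnil : dirs W 0 (@nil (R * X)) by split.
have [G0 _ _ Gd _] := GP.
move=> e e0.
have ea0 : 0 < e / (8 * C) by rewrite divr_gt0// mulr_gt0.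
have eu0 : 0 < e / (8 * (C * K)) by rewrite divr_gt0// mulr_gt0// mulr_gt0.
(* The first bound absorbs q; the second makes the part proportional to |s - t| at most e / 8 times
   |s - t|. *)
pose ee := Num.min (2 * C)^-1 (e / (8 * (C * D))).
have ee0 : 0 < ee by rewrite lt_min invr_gt0 mulr_gt0// divr_gt0// mulr_gt0// mulr_gt0.
have [eea eeb] : ee <= (2 * C)^-1 /\ ee <= e / (8 * (C * D)) by rewrite !ge_min !lexx orbT.
have [d d0 Hd] := Gd 0%N t x k1 t0 Sx ee ee0.
have d40 : 0 < d / 4 by rewrite divr_gt0.
have [d1 d10 H1] := implicit_cont t0 d40.
have [d2 d20 H2] := deriv_on_cont du d40.
have [d3 d30 H3] := da _ ea0; have [d4 d40' H4] := du _ eu0; have [d5 d50 H5] := du 1 ltr01.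
exists (Num.min (Num.min (d / 4) d1) (Num.min (Num.min d2 d3) (Num.min d4 d5))).
  by rewrite !lt_min d40 d10 d20 d30 d40' d50.
move=> s s0; rewrite !lt_min => /andP[/andP[st /(H1 _ s0) dv]].
move=> /andP[/andP[/(H2 _ s0) du1 /(H3 _ s0) da1] /andP[/(H4 _ s0) du2 /(H5 _ s0) du3]].
set tau := s - t in st da1 du2 du3 *; set xs := u s + v s.
pose rho := u s - u t - tau *: u'; pose dvs := v s - v t.
have Sxs : S xs by exact: Suv.
have xsx : xs - x = (tau *: u' + rho) + dvs by rewrite /xs /x /rho /dvs; lmod_over R X.
have ndx : dnorm (tau, xs - x) <= `|tau| + (`|u s - u t| + `|dvs|).
  rewrite /dnorm /= lerD2l (_ : xs - x = (u s - u t) + dvs) ?ler_normD//.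
  by rewrite /xs /x /dvs; lmod_over R X.
have ndx_lt : dnorm (tau, xs - x) < d by rewrite (le_lt_trans ndx)//; move: dv; rewrite -/dvs; lra.
have := Hd s xs s0 Sxs ndx_lt [::] Hnil.
rewrite !G0// /dirs_size big_nil mulr1; set rem := (X in `|X| <= _) => Hrem.
have Wrho : W rho.
  apply: (coordinatesB HW); first by apply: (coordinatesB HW); exact: Wu.
  by have := WP tau Wu' W0; rewrite addr0.
have W1dvs : W1 dvs by apply: (coordinatesB HW1); apply: MW1; exact: Mv.
have Grho : `|G 1 t x [:: (0, rho)]| <= K * `|rho|.
  have := HK [:: (0, rho)]; rewrite dirs_size_cons /dirs_size big_nil mulr1 /dnorm /= normr0 add0r.
  by apply; split => // p; rewrite inE => /eqP ->.
have lin2 := @deriv_family_lin R X Y k S W g G GP 0%N t x [::].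
have EG : G 1 t x [:: (tau, xs - x)] =
    tau *: G1 + (G 1 t x [:: (0, rho)] + G 1 t x [:: (0, dvs)]).
  have -> : G 1 t x [:: (tau, xs - x)] = tau *: G1 + G 1 t x [:: (0, rho + dvs)].
    rewrite -(lin2 tau (1, u') (0, rho + dvs))//=; last first.
      by have := WP 1 Wrho (W1W W1dvs); rewrite scale1r.
    by rewrite mulr1 addr0 xsx -addrA.
  have := lin2 1 (0, rho) (0, dvs) k1 t0 Sx Hnil Wrho (W1W W1dvs).
  by rewrite /= mulr0 addr0 !scale1r => ->.
have Eg : g s xs - g t x = B dvs + (a s - a t).
  have /eqP := v0 s0; have /eqP := v0 t0; rewrite -/x -/xs /dvs (blinearB bB) !subr_eq !add0r.
  by move=> /eqP -> /eqP ->; lmod_over R Y.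
have TLd := TL t0 W1dvs; rewrite -/x in TLd.
have main : dvs - tau *: v' = T t (a s - a t - tau *: a') - T t (G 1 t x [:: (0, rho)]) - T t rem.
  rewrite -TLd /v' /rem Eg EG scalerN -(blinearZ (bT t0)) -!(blinearB (bT t0)) opprK -(blinearD (bT t0)).
  congr (T t _); move: (G 1 t x [:: (0, dvs)]) (G 1 t x [:: (0, rho)]) (B dvs) => p q r.
  by lmod_over R Y.
rewrite -/dvs main; set q := `|T t _ - _ - _|.
have qE : q = `|dvs - tau *: v'| by rewrite main.
have n0 : 0 <= `|tau| by [].
have q1 : `|T t (a s - a t - tau *: a')| <= e / 8 * `|tau|.
  rewrite (le_trans (HC _))// -ler_pdivlMl// (le_trans da1)// le_eqVlt.
  by apply/orP; left; apply/eqP; field; rewrite gt_eqF.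
have q2 : `|T t (G 1 t x [:: (0, rho)])| <= e / 8 * `|tau|.
  rewrite (le_trans (HC _))// -ler_pdivlMl// (le_trans Grho)// -ler_pdivlMl// (le_trans du2)//.
  by rewrite le_eqVlt; apply/orP; left; apply/eqP; field; rewrite !gt_eqF.
have dvq : `|dvs| <= q + `|v'| * `|tau|.
  by rewrite qE -{1}(subrK (tau *: v') dvs) (le_trans (ler_normD _ _))// normrZ mulrC.
have usu : `|u s - u t| <= (1 + `|u'|) * `|tau|.
  rewrite -(subrK (tau *: u') (u s - u t)) (le_trans (ler_normD _ _))// normrZ.
  by rewrite (le_trans (lerD du3 (lexx _)))//; lra.
have q3 : `|T t rem| <= C * ee * (D * `|tau| + q).
  rewrite (le_trans (HC _))// -mulrA ler_wpM2l ?(ltW C0)// (le_trans Hrem)// ler_wpM2l ?(ltW ee0)//.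
  by rewrite (le_trans ndx)// /D; lra.
have q0 : 0 <= q by rewrite qE.
have qle : q <= e / 8 * `|tau| + e / 8 * `|tau| + C * ee * (D * `|tau| + q).
  rewrite /q (le_trans (ler_normB _ _))// lerD// (le_trans (ler_normB _ _))// lerD//.
have k_half : C * ee <= 2^-1.
  have : C * ee <= C * (2 * C)^-1 by rewrite ler_wpM2l ?(ltW C0).
  by rewrite (_ : C * (2 * C)^-1 = 2^-1)//; field; rewrite gt_eqF.
have c2 : C * ee * (D * `|tau|) <= e / 8 * `|tau|.
  have : C * ee * (D * `|tau|) <= C * (e / (8 * (C * D))) * (D * `|tau|).
    by rewrite ler_wpM2r ?mulr_ge0 ?(ltW D0)// ler_wpM2l ?(ltW C0).
  rewrite (_ : C * (e / (8 * (C * D))) * (D * `|tau|) = e / 8 * `|tau|)//.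
  by field; rewrite !gt_eqF.
have c3 : C * ee * q <= 2^-1 * q by rewrite ler_wpM2r.
have : 0 <= e * `|tau| by rewrite mulr_ge0// ltW.
lra.
Qed.

(** A derivative of a curve fixed by [QV] is fixed by [QV], by uniqueness of derivatives; the curve
    is g along a short segment of S starting at u t + v t. The inverse [T] is controlled on such
    values only. *)
Let Gdir_fixed t h : 0 <= t -> W h ->
  QV (G 1 t (u t + v t) [:: (0, h)]) = G 1 t (u t + v t) [:: (0, h)].
Proof.
move=> t0 Wh; set x := u t + v t; have Sx : S x by exact: Suv.
have [d d0 Hd] := Sopen Sx.
have h1 : 0 < `|h| + 1 by rewrite ltr_wpDl.
pose J := [set r : R | 0 <= r < d / (`|h| + 1)].
have d1 : 0 < d / (`|h| + 1) by rewrite divr_gt0.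
have J0 : J 0 by rewrite /J /= lexx.
have SJ p : J p -> S (x + p *: h).
  move=> /andP[p0 pd]; apply: Hd; first by rewrite addrC; apply: WP => //; exact: SW.
  rewrite addrC addKr normrZ ger0_norm//.
  by rewrite (@le_lt_trans _ _ (p * (`|h| + 1)))// ?ler_wpM2l ?lerDl// -ltr_pdivlMr.
have := @deriv_segment t x h 0 J t0 Wh J0 SJ; rewrite scale0r addr0 => dG.
apply: (@deriv_on_unique R Y J (fun p => g t (x + p *: h)) 0) => //.
- move=> r r0; exists (Num.min r (d / (`|h| + 1)) / 2).
  have m0 : 0 < Num.min r (d / (`|h| + 1)) by rewrite lt_min r0.
  have [m1 m2] : Num.min r (d / (`|h| + 1)) <= r /\ Num.min r (d / (`|h| + 1)) <= d / (`|h| + 1).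
    by rewrite !ge_min !lexx orbT.
  split; [rewrite /J /=; lra|by rewrite gt_eqF// divr_gt0|].
  by rewrite subr0 gtr0_norm ?divr_gt0//; lra.
- apply: (@eq_deriv_on _ _ _ (QV \o (fun p => g t (x + p *: h)))) => //.
    by move=> p Jp /=; rewrite Qg//; exact: SJ.
  exact: deriv_on_blinear.
Qed.

(** The direction (1, u') alone is not that of a curve known to stay in S, so the curve u + v is
    differentiated instead and the part in direction v' is subtracted. *)
Let Gone_fixed t (u' : X) (a' : Y) : 0 <= t -> W u' ->
  deriv_on half_line u t u' -> deriv_on half_line a t a' ->
  QV (G 1 t (u t + v t) [:: (1, u')]) = G 1 t (u t + v t) [:: (1, u')].
Proof.
move=> t0 Wu' du da; have dv := implicit_deriv t0 Wu' du da.
set v' := - T t _ in dv; have W1v' : W1 v'.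
  by have := W1P (-1) (TW (G 1 t (u t + v t) [:: (1, u')] - a') t0) W10; rewrite scaleN1r addr0.
have Wuv' : W (u' + v') by have := WP 1 Wu' (W1W W1v'); rewrite scale1r.
have Hnil : dirs W 0 (@nil (R * X)) by split.
have := deriv_family_chain W0 WP SW GP k1 t0 Suv Wuv' Hnil (deriv_onD du dv) => dG.
have EG : G 1 t (u t + v t) [:: (1, u' + v')] =
    G 1 t (u t + v t) [:: (1, u')] + G 1 t (u t + v t) [:: (0, v')].
  have := @deriv_family_lin R X Y k S W g G GP 0%N t (u t + v t) [::] 1 (1, u') (0, v') k1 t0 (Suv t0) Hnil Wu' (W1W W1v').
  by rewrite /= mulr1 addr0 !scale1r => ->.
have [G0 _ _ _ _] := GP.
have : QV (G 1 t (u t + v t) [:: (1, u' + v')]) = G 1 t (u t + v t) [:: (1, u' + v')].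
  apply: (deriv_on_unique (half_line_acc t0)) (dG).
  apply: (@eq_deriv_on _ _ _ (QV \o (fun s => G 0%N s (u s + v s) [::]))) => //.
    by move=> s s0 /=; rewrite G0 ?Qg//; exact: Suv.
  exact: (deriv_on_blinear bQ dG).
rewrite EG (blinearD bQ) Gdir_fixed//; last exact: W1W.
by move/addIr.
Qed.

(** If v is C^l, its derivative solves a linear equation with C^l coefficients. Since the pointwise
    inverse T t carries no regularity in t, the equation is multiplied by the constant operator T 0,
    which brings it into the coordinates of W1, where Cramer's rule solves it smoothly. *)
Theorem implicit_smooth : smooth k v.
Proof.
suff H l : (l <= k)%N -> smooth l v by exact: H.
elim: l => [_|l IH lk]; first exact: implicit_cont.
have svl := IH (ltnW lk).
have sul := smooth_le lk su; have sal := smooth_le lk sa.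
have [W0' WP' We cl ec] := HW.
have [u' [du su' Wu']] := smooth_in_W W0' WP' We cl ec Wu sul.
have [a' da sa'] := sal.
pose x t := u t + v t.
have sx : smooth l x by apply: smoothD => //; exact: smoothS.
have Sx s : 0 <= s -> S (x s) by exact: Suv.
pose b t := - (G 1 t (x t) [:: (1, u' t)] - a' t).
have dirs1 h : W h -> dirs W 1 [:: (0 : R, h)] by split => // p; rewrite inE => /eqP ->.
have Hnil : dirs W 0 (@nil (R * X)) by split.
exists (fun t => - T t (G 1 t (x t) [:: (1, u' t)] - a' t)).
  by move=> t t0; apply: implicit_deriv => //; [exact: du|exact: da].
have Qb t : 0 <= t -> QV (G 1 t (x t) [:: (1, u' t)] - a' t) = G 1 t (x t) [:: (1, u' t)] - a' t.
  move=> t0; rewrite (blinearB bQ); rewrite /x (Gone_fixed t0 (Wu' t) (du t t0) (da t t0)).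
  congr (_ - _); apply: (deriv_on_unique (half_line_acc t0)) (da t t0).
  apply: (@eq_deriv_on _ _ _ (QV \o a)) => //.
  exact: (deriv_on_blinear bQ) (da t t0).
have W1N y : W1 y -> W1 (- y) by move=> W1y; have := W1P (-1) W1y W10; rewrite scaleN1r addr0.
have G10 t : 0 <= t -> G 1 t (x t) [:: (0, 0)] = 0.
  move=> t0; have := deriv_family1_lin (-1) t0 (Sx t t0) W0 W0.
  by rewrite scaler0 addr0 scaleN1r addNr.
have [W10' W1P' We1 cl1 ec1] := HW1.
apply: (@smooth_solve X Y W1 N1 e1 c1 HW1 (fun t h => G 1 t (x t) [:: (0, h)] - B h) (T 0) b).
- exact: bT.
- by move=> y; exact: TW.
- by move=> t t0; apply: W1N; exact: TW.
- move=> t al t0; elim: (index_enum _) => [|i r IHr].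
    by rewrite !big_nil G10// (blinear0 bB) subr0.
  rewrite !big_cons -IHr.
  have W1s : W1 (\sum_(j <- r) al j *: e1 j).
    by elim: r {IHr} => [|j r IHr]; rewrite ?big_nil// big_cons; exact: W1P.
  rewrite (deriv_family1_lin (al i) t0 (Sx t t0) (W1W (We1 i)) (W1W W1s)) bB.1.
  by rewrite scalerBr opprD addrACA.
- move=> t h t0 W1h; set y := _ - _ => Ty.
  have Qy : QV y = y by rewrite /y (blinearB bQ) /x Gdir_fixed ?QB//; exact: W1W.
  have y0 : y = 0.
    by have := LT (lexx 0) Qy; rewrite Ty G10// (blinear0 bB) subr0.
  by rewrite -(TL t0 W1h) -/(x t) -/y y0 (blinear0 (bT t0)).
- move=> t t0; congr (T 0 _); rewrite /b.
  have := LT t0 (Qb t t0); set y := G 1 t (x t) _ - a' t => Ly.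
  have := deriv_family1_lin (-1) t0 (Sx t t0) (W1W (TW y t0)) W0.
  rewrite addr0 scaleN1r G10// addr0 scaleN1r => ->.
  by rewrite (blinearN bB) -opprD Ly.
- move=> i; apply: smoothD; last exact: smooth_cst.
  apply: (smooth_comp W0' WP' SW GP We cl ec) => //; apply: dirs1; exact: W1W.
- apply: (@eq_smooth _ _ _ (fun t => (-1) *: (G 1 t (x t) [:: (1, u' t)] + (-1) *: a' t))).
    by move=> t _; rewrite !scaleN1r.
  apply: smoothZ; apply: smoothD; last exact: smoothZ.
  apply: (@eq_smooth _ _ _ (fun t => G 1 t (x t) [:: (1, 0)] +
      \sum_i c_ i (u' t) *: G 1 t (x t) [:: (0, e_ i)])).
    move=> t t0; rewrite (deriv_family_sum W0' WP' GP We ec 1 k1 t0 (Sx t t0) Hnil (Wu' t)).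
    by rewrite scale1r.
  apply: smoothD.
    apply: (smooth_comp W0' WP' SW GP We cl ec) => //; split => // p.
    by rewrite inE => /eqP ->.
  apply: smooth_sum => i _; apply: (@smooth_scale R Y l (fun t => c_ i (u' t))).
    exact: smooth_blinear.
  by apply: (smooth_comp W0' WP' SW GP We cl ec) => //; apply: dirs1.
Qed.
End Implicit.
End ImplicitCurve.

(** * The projectors *)

Section BlinearSums.
Variables (R : realType) (E F : normedModType R).

Lemma blinear0_fun : blinear (fun _ : E => 0 : F).
Proof. by split => [a x y|]; [rewrite scaler0 addr0|exists 0 => // x; rewrite normr0 mul0r]. Qed.

Lemma blinearD_fun (L L' : E -> F) : blinear L -> blinear L' -> blinear (fun x => L x + L' x).
Proof.
move=> [L1 [C C0 HC]] [L1' [C' C0' HC']]; split.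
  by move=> a x y; rewrite L1 L1' scalerDr addrACA.
exists (C + C') => [|x]; first exact: addr_ge0.
by rewrite (le_trans (ler_normD _ _))// mulrDl lerD.
Qed.

Lemma blinear_sum_fun (I : Type) (r : seq I) (P : pred I) (L : I -> E -> F) :
  (forall i, P i -> blinear (L i)) -> blinear (fun x => \sum_(i <- r | P i) L i x).
Proof.
move=> bL; elim: r => [|i r IH].
  rewrite (_ : (fun x => _) = fun=> 0); first exact: blinear0_fun.
  by apply/funext => x; rewrite big_nil.
rewrite (_ : (fun x => _) = fun x => (if P i then L i x else 0) + \sum_(j <- r | P j) L j x).
  apply: blinearD_fun => //; case: (boolP (P i)) => [/bL//|_]; exact: blinear0_fun.
by apply/funext => x; rewrite big_cons; case: ifP; rewrite ?add0r.
Qed.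

Lemma blinear_id : blinear (fun x : E => x).
Proof. by split => //; exists 1 => // x; rewrite mul1r. Qed.
End BlinearSums.

Lemma blinear_comp (R : realType) (E F G : normedModType R) (L : E -> F) (L' : F -> G) :
  blinear L -> blinear L' -> blinear (L' \o L).
Proof.
move=> [L1 [C C0 HC]] [L1' [C' C0' HC']]; split.
  by move=> a x y /=; rewrite L1 L1'.
exists (C' * C) => [|x /=]; first exact: mulr_ge0.
by rewrite (le_trans (HC' _))// -mulrA ler_wpM2l.
Qed.

Section ScalarCoordinates.
Variables (R : realType) (c : scalar_kind).
Local Notation K := (scalar_field R c).

Definition knorm (a : K) : R := re_scalar `|a|.

(** The real basis 1, i of the complex numbers. Over the reals the second vector is 0, so that both
    cases share the index type [bool]. *)
Definition scalar_basis (b : bool) : K :=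
  match c return scalar_field R c with
  | RealScalars => (~~ b)%:R
  | ComplexScalars => if b then 'i%C else 1
  end.

Definition scalar_coord (b : bool) : K -> R :=
  match c return scalar_field R c -> R with
  | RealScalars => fun a => if b then 0 else a
  | ComplexScalars => fun a => if b then complex.Im a else complex.Re a
  end.

Lemma scalar_coordE (a : K) :
  a = of_real c (scalar_coord false a) * scalar_basis false
    + of_real c (scalar_coord true a) * scalar_basis true.
Proof.
rewrite /scalar_coord /scalar_basis; case: c a => /= a; first by rewrite mulr1 mulr0 addr0.
by case: a => x y; rewrite mulr1; apply/eqP; rewrite eq_complex /=; apply/andP; split; apply/eqP; ring.
Qed.

Lemma scalar_coordD b (r : R) (x y : K) :
  scalar_coord b (of_real c r * x + y) = r * scalar_coord b x + scalar_coord b y.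
Proof.
rewrite /scalar_coord; case: c x y => /= x y; first by case: b => //; rewrite mulr0 addr0.
by case: x => x1 x2; case: y => y1 y2; case: b => /=; ring.
Qed.

Lemma scalar_coord_norm b (x : K) : `|scalar_coord b x| <= knorm x.
Proof.
rewrite /scalar_coord /knorm; case: c x => [x|[x1 x2]]; first by case: b; rewrite ?normr0 /=.
rewrite normc_def; case: b; rewrite /= -sqrtr_sqr ler_wsqrtr// ?lerDl ?lerDr sqr_ge0//.
Qed.

Lemma nrmZK (E : normedModType K) (a : K) (x : E) : nrm (a *: x) = knorm a * nrm x.
Proof.
rewrite /knorm /nrm; apply: (can_inj (of_realK c)).
by rewrite of_realM !re_scalarK// normrZ.
Qed.

Lemma dual_blinear (E F : normedModType K) (p : E -> K^o) (v : F) : dual_element p ->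
  @blinear R (realify E) (realify F) (fun x => p x *: v).
Proof.
move=> [pl [C HC]]; split.
  move=> a x y; rewrite -[a *: x + y]/(of_real c a *: (x : E) + (y : E)) pl scalerDl.
  by rewrite -scalerA.
exists (`|C| * nrm v) => [|x]; first by rewrite mulr_ge0// -(ler_of_real c) of_real0 nrm_ofE.
rewrite -[`|_|]/(nrm (p x *: v)) nrmZK mulrAC ler_wpM2r//.
  by rewrite -(ler_of_real c) of_real0 nrm_ofE.
apply: (le_trans (HC x I)); rewrite -[`|x|]/(nrm (x : E)) ler_wpM2r ?ler_norm//.
by rewrite -(ler_of_real c) of_real0 nrm_ofE.
Qed.

Lemma dual_coord_blinear (E : normedModType K) (p : E -> K^o) b : dual_element p ->
  @blinear R (realify E) R^o (fun x => scalar_coord b (p x)).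
Proof.
move=> [pl [C HC]]; split.
  move=> a x y; rewrite -[a *: x + y]/(of_real c a *: (x : E) + (y : E)) pl.
  exact: scalar_coordD.
exists `|C| => // x; rewrite (le_trans (scalar_coord_norm _ _))//.
apply: (le_trans (HC x I)); rewrite -[`|x|]/(nrm (x : E)) ler_wpM2r ?ler_norm//.
by rewrite -(ler_of_real c) of_real0 nrm_ofE.
Qed.
End ScalarCoordinates.

Section ChainProjectors.
Variables (R : realType) (c : scalar_kind).
Local Notation K := (scalar_field R c).

Lemma dualD (E : normedModType K) (p : E -> K^o) (I : Type) (r : seq I) (P : pred I) (f : I -> E) :
  dual_element p -> p (\sum_(i <- r | P i) f i) = \sum_(i <- r | P i) p (f i).
Proof.
move=> [pl _]; have p0 : p 0 = 0.
  by have := pl (-1) 0 0; rewrite scaler0 addr0 scaleN1r addNr.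
have pD x y : p (x + y) = p x + p y by have := pl 1 x y; rewrite !scale1r.
exact: (big_morph p pD p0).
Qed.
Lemma dualZ (E : normedModType K) (p : E -> K^o) (a : K) x : dual_element p ->
  p (a *: x) = a *: p x.
Proof.
move=> [pl _]; have p0 : p 0 = 0.
  by have := pl (-1) 0 0; rewrite scaler0 addr0 scaleN1r addNr.
by have := pl a x 0; rewrite p0 !addr0.
Qed.

Variables (E : normedModType K) (n : nat) (m : 'I_n -> nat).
Variables (p : 'I_n -> nat -> E -> K^o) (v : 'I_n -> nat -> E).

(* The projector of a biorthogonal system attached to a set [T] of pairs
   (chain i, level s), s < m i; each projector of the theorem is of this form. *)
Definition chain_proj (T : 'I_n -> nat -> bool) (x : E) : E :=
  \sum_(i < n) \sum_(s < m i | T i s) p i s.+1 x *: v i s.+1.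

Lemma eq_chain_proj T T' x : (forall i s, (s < m i)%N -> T i s = T' i s) ->
  chain_proj T x = chain_proj T' x.
Proof. by move=> TT; apply: eq_bigr => i _; apply: eq_bigl => s; rewrite TT. Qed.

Lemma chain_proj_eq0 T x : (forall i s, (s < m i)%N -> T i s = false) -> chain_proj T x = 0.
Proof. by move=> T0; apply: big1 => i _; apply: big1 => s; rewrite T0. Qed.

Lemma chain_projD T T' x : (forall i s, (s < m i)%N -> ~~ (T i s && T' i s)) ->
  chain_proj T x + chain_proj T' x = chain_proj (fun i s => T i s || T' i s) x.
Proof.
move=> TT; rewrite /chain_proj -big_split; apply: eq_bigr => i _ /=.
rewrite [X in X + _]big_mkcond [X in _ + X]big_mkcond [RHS]big_mkcond -big_split.
apply: eq_bigr => s _ /=.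
by have := TT i s (ltn_ord s); case: (T i s); case: (T' i s); rewrite ?addr0 ?add0r.
Qed.

Lemma chain_proj_sum (key : 'I_n -> nat -> nat) (b : 'I_n -> nat -> bool) lo hi x :
  \sum_(lo <= j < hi) chain_proj (fun i s => (key i s == j) && b i s) x =
  chain_proj (fun i s => (lo <= key i s < hi)%N && b i s) x.
Proof.
have [hl|lh] := leqP hi lo.
  rewrite big_geq// chain_proj_eq0// => i s _.
  by case: (leqP lo (key i s)) => //= ls; rewrite ltnNge (leq_trans hl ls).
elim: hi lh => // hi IH; rewrite ltnS leq_eqVlt => /orP[/eqP ->|lh].
  rewrite big_nat1; apply: eq_chain_proj => i s _; congr andb.
  by rewrite ltnS eqn_leq andbC.
rewrite big_nat_recr ?IH//; last exact: ltnW.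
rewrite /= chain_projD => [|i s _].
  apply: eq_chain_proj => i s _; rewrite -andb_orl; congr andb.
  rewrite ltnS (leq_eqVlt (key i s)) andb_orr orbC; congr orb.
  by case: eqP => [->|]; rewrite ?andbF// andbT ltnW.
by apply/negP => /andP[/andP[/andP[_ h1] _] /andP[/eqP h2 _]]; rewrite h2 ltnn in h1.
Qed.

Lemma chain_proj_level s (b : 'I_n -> bool) x : (forall i, b i -> (s < m i)%N) ->
  chain_proj (fun i s' => (s' == s) && b i) x = \sum_(i < n | b i) p i s.+1 x *: v i s.+1.
Proof.
move=> bm; rewrite [RHS]big_mkcond; apply: eq_bigr => i _.
case: (boolP (b i)) => [/bm sm|_]; last by rewrite big1// => s'; rewrite andbF.
rewrite (bigD1 (Ordinal sm)) /= ?eqxx//= big1 ?addr0// => s' /andP[/andP[/eqP s's _]].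
by rewrite -val_eqE /= s's eqxx.
Qed.

Hypothesis p_dual : forall i j, (1 <= j <= m i)%N -> dual_element (p i j).
Hypothesis pv : forall i j k l, (1 <= j <= m i)%N -> (1 <= l <= m k)%N ->
  p k l (v i j) = ((i == k) && (j == l))%:R.

Lemma lev i (s : 'I_(m i)) : (1 <= s.+1 <= m i)%N. Proof. exact: ltn_ord. Qed.

Lemma chain_proj_blinear T : @blinear R (realify E) (realify E) (chain_proj T).
Proof.
apply: (@blinear_sum_fun R (realify E) (realify E)) => i _.
apply: (@blinear_sum_fun R (realify E) (realify E)) => s _.
by apply: dual_blinear; apply: p_dual; exact: lev.
Qed.

Lemma coef_chain_proj T k l x : (l < m k)%N ->
  p k l.+1 (chain_proj T x) = if T k l then p k l.+1 x else 0.
Proof.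
move=> lm; have kl : (1 <= l.+1 <= m k)%N by [].
have dB := p_dual kl; rewrite (dualD _ _ _ dB) (bigD1 k)//= (dualD _ _ _ dB).
rewrite [X in _ + X]big1 ?addr0; last first.
  move=> i ik; rewrite (dualD _ _ _ dB) big1// => s _; rewrite (dualZ _ _ dB) pv ?lev//.
  by rewrite (negbTE ik) /= scaler0.
have term (s : 'I_(m k)) : p k l.+1 (p k s.+1 x *: v k s.+1) = if s == Ordinal lm then p k l.+1 x else 0.
  rewrite (dualZ _ _ dB) pv ?lev// eqxx /= eqSS -val_eqE /=.
  by case: eqP => [->|_]; rewrite ?scaler0// /GRing.scale /= mulr1.
under eq_bigr do rewrite term.
case: ifP => Tkl; first by rewrite (bigD1 (Ordinal lm))//= eqxx big1 ?addr0// => s /andP[_ /negbTE ->].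
by rewrite big1// => s Ts; case: eqP => // sl; rewrite sl /= Tkl in Ts.
Qed.

(** Biorthogonality turns composition into intersection of index sets, just as sums over disjoint
    sets become unions; identities between projectors thereby reduce to Boolean identities on pairs
    (chain, level). *)
Lemma chain_proj_comp T T' x :
  chain_proj T (chain_proj T' x) = chain_proj (fun i s => T i s && T' i s) x.
Proof.
apply: eq_bigr => i _; rewrite [RHS]big_mkcond [LHS]big_mkcond; apply: eq_bigr => s _ /=.
by rewrite coef_chain_proj//; case: (T i s); case: (T' i s) => //=; rewrite scale0r.
Qed.

Lemma chain_proj_idem T x : chain_proj T (chain_proj T x) = chain_proj T x.
Proof. by rewrite chain_proj_comp; apply: eq_chain_proj => i s _; rewrite andbb. Qed.
End ChainProjectors.

(** A class, so that the standing hypotheses are supplied by instance resolution in later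
    statements. *)
Class root_adae (R : realType) (c : scalar_kind)
    (X Y : completeNormedModType (scalar_field R c)) (S : adae X Y) : Prop := {
  ra_standing : standing_assumptions S;
  ra_dom : domA S `<=` domB S;
  ra_roots : root_system S }.

Section Projectors.
Variables (R : realType) (c : scalar_kind).
Local Notation K := (scalar_field R c).
Variables (X Y : completeNormedModType K) (S : adae X Y).
Local Notation A := (opA S).
Local Notation B := (opB S).
Local Notation ν := (nu S).
Local Notation n := (nchains S).
Local Notation m := (@chain_len _ _ _ _ S).
Local Notation φ := (@root_vec _ _ _ _ S).
Local Notation q := (@root_fun _ _ _ _ S).
Local Notation rX := (realify X).
Local Notation rY := (realify Y).

Context {HS : root_adae S}.

Let Hst : standing_assumptions S. Proof. by case: HS. Qed.
Let HAB : domA S `<=` domB S. Proof. by case: HS. Qed.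
Let Hrs : root_system S. Proof. by case: HS. Qed.

Lemma domE : dom S = domA S.
Proof. by apply/seteqP; split => x; [case|move=> Ax; split => //; exact: HAB]. Qed.

Lemma dom_lin (a : K) x y : dom S x -> dom S y -> dom S (a *: x + y).
Proof. by rewrite domE; have [[[_ H] _ _ _] _ _ _] := Hst; exact: H. Qed.
Lemma dom0 : dom S 0.
Proof. by rewrite domE; have [[[H _] _ _ _] _ _ _] := Hst. Qed.
Lemma domD x y : dom S x -> dom S y -> dom S (x + y).
Proof. by move=> Dx Dy; have := dom_lin 1 Dx Dy; rewrite scale1r. Qed.
Lemma domZ (a : K) x : dom S x -> dom S (a *: x).
Proof. by move=> Dx; have := dom_lin a Dx dom0; rewrite addr0. Qed.
Lemma domB_ x y : dom S x -> dom S y -> dom S (x - y).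
Proof. by move=> Dx Dy; have := dom_lin (-1) Dy Dx; rewrite scaleN1r addrC. Qed.
Lemma dom_sum (I : Type) (r : seq I) (P : pred I) (f : I -> X) :
  (forall i, P i -> dom S (f i)) -> dom S (\sum_(i <- r | P i) f i).
Proof. by move=> H; apply: big_ind => //; [exact: dom0|exact: domD]. Qed.

Lemma A_lin (a : K) x y : dom S x -> dom S y -> A (a *: x + y) = a *: A x + A y.
Proof. by rewrite domE; have [[_ H _ _] _ _ _] := Hst; exact: H. Qed.
Lemma B_lin (a : K) x y : dom S x -> dom S y -> B (a *: x + y) = a *: B x + B y.
Proof. by rewrite domE => /HAB h /HAB h'; have [_ [_ H _ _] _ _] := Hst; exact: H. Qed.

Section LinearOnDom.
Variable T : X -> Y.
Hypothesis Tl : forall (a : K) x y, dom S x -> dom S y -> T (a *: x + y) = a *: T x + T y.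
Lemma lin_dom0 : T 0 = 0.
Proof. by have := Tl (-1) dom0 dom0; rewrite scaler0 addr0 scaleN1r addNr. Qed.
Lemma lin_domD x y : dom S x -> dom S y -> T (x + y) = T x + T y.
Proof. by move=> Dx Dy; have := Tl 1 Dx Dy; rewrite !scale1r. Qed.
Lemma lin_domZ (a : K) x : dom S x -> T (a *: x) = a *: T x.
Proof. by move=> Dx; have := Tl a Dx dom0; rewrite !addr0 lin_dom0 addr0. Qed.
Lemma lin_domB x y : dom S x -> dom S y -> T (x - y) = T x - T y.
Proof. by move=> Dx Dy; have := Tl (-1) Dy Dx; rewrite !scaleN1r addrC [RHS]addrC. Qed.
Lemma lin_dom_sum (I : Type) (r : seq I) (P : pred I) (f : I -> X) :
  (forall i, P i -> dom S (f i)) ->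
  T (\sum_(i <- r | P i) f i) = \sum_(i <- r | P i) T (f i).
Proof.
move=> H; elim: r => [|i r IH]; first by rewrite !big_nil lin_dom0.
by rewrite !big_cons; case: ifP => // /H Di; rewrite lin_domD ?IH//; exact: dom_sum.
Qed.
End LinearOnDom.

Lemma chain_bounds i : (1 <= m i <= ν)%N.
Proof. by have [[H _] _ _ _] := Hrs. Qed.
Lemma phi_dom i j : (1 <= j <= m i)%N -> dom S (φ i j).
Proof. by have [_ [H _ _ _] _ _] := Hrs; exact: H. Qed.
Lemma Aphi1 i : A (φ i 1%N) = 0.
Proof. by have [_ [_ H _ _] _ _] := Hrs; exact: H. Qed.
Lemma AphiS i j : (1 <= j < m i)%N -> A (φ i j.+1) = - B (φ i j).
Proof. by move=> /andP[j1 jm]; have [_ [_ _ H _] _ _] := Hrs; rewrite H// !ltnS j1. Qed.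
Lemma q_dual i j : (1 <= j <= m i)%N -> dual_element (q i j).
Proof. by move=> ij; have [_ _ [H _ _] _] := Hrs; have [[]] := H i j ij. Qed.

Lemma adjointP (D : set X) (T : X -> Y) p : dom_adjoint D T p -> is_adjoint D T p (adjoint D T p).
Proof. by move=> [_ [p' Hp']]; rewrite /adjoint; case: xgetP => // /(_ p')[]. Qed.

Lemma Bq_dual i j : (1 <= j <= m i)%N -> dual_element (Bq i j : X -> K^o).
Proof. by move=> ij; have [_ _ [H _ _] _] := Hrs; have [_ /adjointP[]] := H i j ij. Qed.
Lemma BqE i j x : (1 <= j <= m i)%N -> dom S x -> Bq i j x = q i j (B x).
Proof.
move=> ij [_ Dx]; have [_ _ [H _ _] _] := Hrs; have [_ /adjointP[_]] := H i j ij.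
exact.
Qed.
Lemma qA_last i x : dom S x -> q i (m i) (A x) = 0.
Proof.
move=> [Dx _]; have [_ _ [H H' _] _] := Hrs.
have im : (1 <= m i <= m i)%N by rewrite leqnn; have /andP[-> _] := chain_bounds i.
by have [/adjointP[_ /(_ x Dx) <-] _] := H i (m i) im; exact: H'.
Qed.
Lemma qA i j x : (1 <= j < m i)%N -> dom S x -> q i j (A x) = - Bq i j.+1 x.
Proof.
move=> /andP[j1 jm] [Dx _]; have [_ _ [H _ H'] _] := Hrs.
have ij : (1 <= j <= m i)%N by rewrite j1 ltnW.
by have [/adjointP[_ /(_ x Dx) <-] _] := H i j ij; rewrite H'// j1.
Qed.
Lemma q_Bphi i j k l : (1 <= j <= m i)%N -> (1 <= l <= m k)%N ->
  q k l (B (φ i j)) = ((i == k) && (j == l))%:R.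
Proof. by have [_ _ _ H] := Hrs; exact: H. Qed.
Lemma Bq_phi i j k l : (1 <= j <= m i)%N -> (1 <= l <= m k)%N ->
  Bq k l (φ i j) = ((i == k) && (j == l))%:R.
Proof. by move=> ij kl; rewrite BqE ?q_Bphi//; exact: phi_dom. Qed.

Definition PT : ('I_n -> nat -> bool) -> X -> X := chain_proj m (@Bq _ _ _ _ S) φ.
Definition QT : ('I_n -> nat -> bool) -> Y -> Y := chain_proj m q (fun i j => B (φ i j)).

Lemma PT_blinear T : @blinear R rX rX (PT T).
Proof. exact: chain_proj_blinear Bq_dual T. Qed.
Lemma QT_blinear T : @blinear R rY rY (QT T).
Proof. exact: chain_proj_blinear q_dual T. Qed.
Lemma PT_PT T T' x : PT T (PT T' x) = PT (fun i s => T i s && T' i s) x.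
Proof. exact: chain_proj_comp Bq_dual Bq_phi T T' x. Qed.
Lemma QT_QT T T' y : QT T (QT T' y) = QT (fun i s => T i s && T' i s) y.
Proof. exact: chain_proj_comp q_dual q_Bphi T T' y. Qed.
Lemma PT_idem T x : PT T (PT T x) = PT T x.
Proof. exact: chain_proj_idem Bq_dual Bq_phi T x. Qed.
Lemma QT_idem T y : QT T (QT T y) = QT T y.
Proof. exact: chain_proj_idem q_dual q_Bphi T y. Qed.
Lemma Bq_PT T k l x : (l < m k)%N -> Bq k l.+1 (PT T x) = if T k l then Bq k l.+1 x else 0.
Proof. exact: coef_chain_proj Bq_dual Bq_phi T k l x. Qed.
Lemma q_QT T k l y : (l < m k)%N -> q k l.+1 (QT T y) = if T k l then q k l.+1 y else 0.
Proof. exact: coef_chain_proj q_dual q_Bphi T k l y. Qed.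

Lemma PT_dom T x : dom S (PT T x).
Proof.
apply: dom_sum => i _; apply: dom_sum => s _; apply: domZ; apply: phi_dom; exact: lev.
Qed.

Lemma QT_B T x : dom S x -> QT T (B x) = B (PT T x).
Proof.
move=> Dx; have Dphi i (s : 'I_(m i)) : dom S (Bq i s.+1 x *: φ i s.+1).
  by apply: domZ; apply: phi_dom; exact: lev.
rewrite (lin_dom_sum B_lin); last by move=> i _; apply: dom_sum => s _.
apply: eq_bigr => i _; rewrite (lin_dom_sum B_lin); last by move=> s _; exact: Dphi.
apply: eq_bigr => s _; rewrite (lin_domZ B_lin); last by apply: phi_dom; exact: lev.
by rewrite BqE ?lev.
Qed.

(* The pencil moves level s + 1 to level s. *)
Lemma QT_A T x : dom S x -> QT T (A x) = A (PT (fun i s => (0 < s)%N && T i s.-1) x).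
Proof.
move=> Dx; have Dphi i (s : 'I_(m i)) : dom S (Bq i s.+1 x *: φ i s.+1).
  by apply: domZ; apply: phi_dom; exact: lev.
rewrite (lin_dom_sum A_lin); last by move=> i _; apply: dom_sum => s _.
apply: eq_bigr => i _; rewrite (lin_dom_sum A_lin); last by move=> s _; exact: Dphi.
have mi0 : (0 < m i)%N by have /andP[] := chain_bounds i.
rewrite -(big_mkord (fun s => T i s) (fun s => q i s.+1 (A x) *: B (φ i s.+1))).
rewrite -(big_mkord (fun s => (0 < s)%N && T i s.-1) (fun s => A (Bq i s.+1 x *: φ i s.+1))).
have [k mk] : exists k, m i = k.+1 by case: (m i) mi0 => // k; exists k.
have qlast : q i k.+1 (A x) = 0 by rewrite -mk qA_last.
rewrite mk [LHS]big_mkcond big_nat_recr//= qlast scale0r if_same addr0.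
rewrite [RHS]big_mkcond [RHS]big_ltn//= add0r big_add1 /= [LHS]big_nat [RHS]big_nat.
apply: eq_bigr => s /andP[_ sk]; case: ifP => // _.
have sm : (1 <= s.+1 < m i)%N by rewrite mk.
rewrite qA// (lin_domZ A_lin); last by apply: phi_dom; rewrite mk.
by rewrite AphiS// scalerN scaleNr.
Qed.

Lemma P2dE s x : P2d S s x = PT (fun i s' => (s' == s) && (m i == s.+1)) x.
Proof. by rewrite [RHS]chain_proj_level// => i /eqP ->. Qed.
Lemma Q2dE s y : Q2d S s y = QT (fun i s' => (s' == s) && (m i == s.+1)) y.
Proof. by rewrite [RHS]chain_proj_level// => i /eqP ->. Qed.

Let P2sjE s j x : (s < j)%N -> P2sj S s j x = PT (fun i s' => (m i == j) && (s' == s)) x.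
Proof.
move=> sj; rewrite [RHS](@eq_chain_proj _ _ _ _ _ _ _ _ (fun i s' => (s' == s) && (m i == j))).
  by rewrite [RHS]chain_proj_level// => i /eqP ->.
by move=> i s' _; rewrite andbC.
Qed.
Let Q2sjE s j y : (s < j)%N -> Q2sj S s j y = QT (fun i s' => (m i == j) && (s' == s)) y.
Proof.
move=> sj; rewrite [RHS](@eq_chain_proj _ _ _ _ _ _ _ _ (fun i s' => (s' == s) && (m i == j))).
  by rewrite [RHS]chain_proj_level// => i /eqP ->.
by move=> i s' _; rewrite andbC.
Qed.

Let mν i : (m i <= ν)%N. Proof. by have /andP[] := chain_bounds i. Qed.

Lemma P2sE s x : P2s S s x = PT (fun _ s' => s' == s) x.
Proof.
rewrite /P2s big_nat (eq_bigr (fun j => PT (fun i s' => (m i == j) && (s' == s)) x)).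
  rewrite -big_nat [LHS]chain_proj_sum; apply: eq_chain_proj => i s' sm.
  by rewrite ltnS mν andbT; case: eqP => [<-|]; rewrite ?andbF// sm.
by move=> j /andP[sj _]; rewrite P2sjE.
Qed.
Lemma Q2sE s y : Q2s S s y = QT (fun _ s' => s' == s) y.
Proof.
rewrite /Q2s big_nat (eq_bigr (fun j => QT (fun i s' => (m i == j) && (s' == s)) y)).
  rewrite -big_nat [LHS]chain_proj_sum; apply: eq_chain_proj => i s' sm.
  by rewrite ltnS mν andbT; case: eqP => [<-|]; rewrite ?andbF// sm.
by move=> j /andP[sj _]; rewrite Q2sjE.
Qed.

Lemma P2E x : P2 S x = PT (fun _ _ => true) x.
Proof.
rewrite /P2 (eq_bigr (fun s => PT (fun i s' => (s' == s) && true) x)).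
  rewrite [LHS]chain_proj_sum; apply: eq_chain_proj => i s sm.
  by rewrite andbT /= (leq_trans sm (mν i)).
by move=> s _; rewrite P2sE; apply: eq_chain_proj => i s' _; rewrite andbT.
Qed.
Lemma Q2E y : Q2 S y = QT (fun _ _ => true) y.
Proof.
rewrite /Q2 (eq_bigr (fun s => QT (fun i s' => (s' == s) && true) y)).
  rewrite [LHS]chain_proj_sum; apply: eq_chain_proj => i s sm.
  by rewrite andbT /= (leq_trans sm (mν i)).
by move=> s _; rewrite Q2sE; apply: eq_chain_proj => i s' _; rewrite andbT.
Qed.
Lemma P2SE x : P2S S x = PT (fun _ s => (0 < s)%N) x.
Proof.
rewrite /P2S (eq_bigr (fun s => PT (fun i s' => (s' == s) && true) x)).
  rewrite [LHS]chain_proj_sum; apply: eq_chain_proj => i s sm.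
  by rewrite andbT (leq_trans sm (mν i)) andbT.
by move=> s _; rewrite P2sE; apply: eq_chain_proj => i s' _; rewrite andbT.
Qed.

Lemma P2wE s x : P2w S s x = PT (fun i s' => (s' == s) && (s.+1 < m i)%N) x.
Proof.
apply/eqP; rewrite subr_eq P2sE -[P2sj _ _ _ _]/(P2d S s x) P2dE; apply/eqP.
rewrite [RHS]chain_projD => [|i s' _].
  apply: eq_chain_proj => i s' sm; rewrite -andb_orr; case: eqP => // s's.
  by rewrite -s's eq_sym orbC -leq_eqVlt sm.
by case: (s' == s) => //=; rewrite eq_sym; case: ltngtP.
Qed.
Lemma Q2SE s y : Q2S S s y = QT (fun i s' => (s' == s) && (s.+1 < m i)%N) y.
Proof.
apply/eqP; rewrite subr_eq Q2sE -[Q2sj S _ _ _]/(Q2d S s y) Q2dE; apply/eqP.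
rewrite [RHS]chain_projD => [|i s' _].
  apply: eq_chain_proj => i s' sm; rewrite -andb_orr; case: eqP => // s's.
  by rewrite -s's eq_sym orbC -leq_eqVlt sm.
by case: (s' == s) => //=; rewrite eq_sym; case: ltngtP.
Qed.

Lemma sum_P2dE lo hi x : \sum_(lo <= j < hi) P2d S j x =
  PT (fun i s => (lo <= s < hi)%N && (m i == s.+1)) x.
Proof.
rewrite -[RHS]chain_proj_sum; apply: eq_bigr => j _; rewrite P2dE.
by apply: eq_chain_proj => i s _; case: eqP => // ->.
Qed.
Lemma sum_P2wE lo hi x : \sum_(lo <= j < hi) P2w S j x =
  PT (fun i s => (lo <= s < hi)%N && (s.+1 < m i)%N) x.
Proof.
rewrite -[RHS]chain_proj_sum; apply: eq_bigr => j _; rewrite P2wE.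
by apply: eq_chain_proj => i s _; case: eqP => // ->.
Qed.
End Projectors.

(** * The inverse of A on Y_1 *)

Section ClosedSets.
Variables (R : realType) (c : scalar_kind).
Local Notation K := (scalar_field R c).

Lemma closed_approx (E : normedModType K) (Z : set E) : closed Z ->
  forall z, (forall e : R, 0 < e -> exists2 v, Z v & nrm (v - z) <= e) -> Z z.
Proof.
move=> Zcl z Hz; apply: Zcl => U.
rewrite -[nbhs z U]/(nbhs (z : realify E) U) => /nbhs_ballP[r /= r0 rU].
have [|v Zv vz] := Hz (r / 2); first by rewrite divr_gt0.
exists v; split => //; apply: rU; rewrite -ball_normE /ball_ /= distrC.
by rewrite -[`|_|]/(nrm (v - z)) (le_lt_trans vz)// ltr_pdivrMr// ltr_pMr// ltr1n.
Qed.

Lemma closed_prod_approx (E F : normedModType K) (Z : set (E * F)) : closed Z ->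
  forall z y, (forall e : R, 0 < e -> exists v, [/\ Z v, nrm (v.1 - z) <= e & nrm (v.2 - y) <= e]) ->
  Z (z, y).
Proof.
move=> Zcl z y Hz; apply: Zcl => U [[U1 U2] /= [h1 h2] UU].
move: h1 h2; rewrite -[nbhs z U1]/(nbhs (z : realify E) U1) -[nbhs y U2]/(nbhs (y : realify F) U2).
move=> /nbhs_ballP[r /= r0 rU] /nbhs_ballP[s /= s0 sU].
have [|v [Zv vz vy]] := Hz (Num.min r s / 2); first by rewrite divr_gt0// lt_min r0.
have [m1 m2] : Num.min r s <= r /\ Num.min r s <= s by rewrite !ge_min !lexx orbT.
exists v; split => //; apply: UU; split => /=.
  apply: rU; rewrite -ball_normE /ball_ /= distrC -[`|_|]/(nrm (v.1 - z)) (le_lt_trans vz)//; lra.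
apply: sU; rewrite -ball_normE /ball_ /= distrC -[`|_|]/(nrm (v.2 - y)) (le_lt_trans vy)//; lra.
Qed.
End ClosedSets.

(** The pencil is taken at lambda = 1 / mu. For real spaces the complexified equation is solved for
    the right-hand side (y / mu, 0) and the first component is kept, since mu is real. *)
Lemma pencil_onto (R : realType) (c : scalar_kind)
    (X Y : normedModType (scalar_field R c)) (D : set X) (A B : X -> Y) (nu : nat) :
  regular_pencil D A B nu ->
  exists2 r : R, 0 < r & forall mu : R, 0 < mu -> mu < r ->
    forall y, exists2 x, D x & A x + of_real c mu *: B x = y.
Proof.
case: c X Y D A B => X Y D A B /= [_ [r r0 Hr] _].
  exists r^-1 => [|mu mu0 mur y]; first by rewrite invr_gt0.
  have [|T [_ DT _ TK]] := Hr (mu^-1)%:C%C.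
    rewrite normc_def /= expr0n addr0 sqrtr_sqr ltcR gtr0_norm ?invr_gt0//.
    by rewrite -[r]invrK ltf_pV2// posrE// invr_gt0.
  have := TK (mu^-1 *: y, 0); set p := T _ => /(congr1 fst) /=.
  have [Dp _] := DT (mu^-1 *: y, 0); rewrite scale0r subr0 => H.
  exists p.1 => //; have := congr1 (fun z => mu *: z) H; rewrite /= scalerDr !scalerA mulfV ?gt_eqF//.
  by rewrite !scale1r.
exists r^-1 => [|mu mu0 mur y]; first by rewrite invr_gt0.
have [|T [_ DT _ TK]] := Hr (mu^-1)%:C%C.
  rewrite normc_def /= expr0n addr0 sqrtr_sqr ltcR gtr0_norm ?invr_gt0//.
  by rewrite -[r]invrK ltf_pV2// posrE// invr_gt0.
have H := TK ((mu^-1)%:C%C *: y); exists (T ((mu^-1)%:C%C *: y)); first exact: DT.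
have := congr1 (fun z => mu%:C%C *: z) H; rewrite /= scalerDr !scalerA -rmorphM mulfV ?gt_eqF//.
by rewrite !scale1r.
Qed.

Section ReducedOperator.
Variables (R : realType) (c : scalar_kind).
Local Notation K := (scalar_field R c).
Variables (X Y : completeNormedModType K) (S : adae X Y).
Local Notation A := (opA S).
Local Notation B := (opB S).
Local Notation n := (nchains S).
Local Notation m := (@chain_len _ _ _ _ S).
Local Notation φ := (@root_vec _ _ _ _ S).
Local Notation q := (@root_fun _ _ _ _ S).
Local Notation rX := (realify X).
Local Notation rY := (realify Y).
Local Notation PT := (@PT _ _ _ _ S).
Local Notation QT := (@QT _ _ _ _ S).
Context {HS : root_adae S}.
Local Notation PT_blinear := (@PT_blinear _ _ _ _ S HS).
Local Notation QT_blinear := (@QT_blinear _ _ _ _ S HS).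
Local Notation chain_bounds := (@chain_bounds _ _ _ _ S HS).
Local Notation Bq_dual := (@Bq_dual _ _ _ _ S HS).
Local Notation q_dual := (@q_dual _ _ _ _ S HS).
Local Notation A_lin := (@A_lin _ _ _ _ S HS).
Local Notation B_lin := (@B_lin _ _ _ _ S HS).
Local Notation q_Bphi := (@q_Bphi _ _ _ _ S HS).
Local Notation Bq_phi := (@Bq_phi _ _ _ _ S HS).
Hypothesis Hpencil : regular_pencil (dom S) (opA S) (opB S) (nu S).

Let all2 : 'I_n -> nat -> bool := fun _ _ => true.

Lemma realZ (E : normedModType K) (a : R) (x : realify E) : a *: x = of_real c a *: (x : E).
Proof. by []. Qed.

Lemma A_closed (x : X) (y : Y) :
  (forall e : R, 0 < e -> exists v, [/\ dom S v, nrm (v - x) <= e & nrm (A v - y) <= e]) ->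
  dom S x /\ A x = y.
Proof.
have [[[_ _ _ Gcl] _ _ _] _ _] := HS => H.
have [] := closed_prod_approx Gcl (z := x) (y := y).
  move=> e /H[v [Dv h1 h2]]; exists (v, A v); split => //; split => //=.
  by have [] := Dv.
by move=> /= Dx ->; split => //; rewrite domE.
Qed.

Lemma B_closed (x : X) (y : Y) : dom S x ->
  (forall e : R, 0 < e -> exists v, [/\ dom S v, nrm (v - x) <= e & nrm (B v - y) <= e]) ->
  B x = y.
Proof.
have [[_ [_ _ _ Gcl] _ _] _ _] := HS => Dx H.
have [] := closed_prod_approx Gcl (z := x) (y := y).
  move=> e /H[v [Dv h1 h2]]; exists (v, B v); split => //; split => //=.
  by have [] := Dv.
by move=> /= _ ->.
Qed.

(** Level 0 is spanned by the phi_i^1, which lie in ker A. *)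
Lemma A_PT T x : A (PT T x) = A (PT (fun i s => (0 < s)%N && T i s) x).
Proof.
have -> : PT T x = PT (fun i s => (s == 0%N) && T i s) x + PT (fun i s => (0 < s)%N && T i s) x.
  rewrite [RHS]chain_projD => [|i s _].
    by apply: eq_chain_proj => i s _; rewrite lt0n; case: (s == 0%N); rewrite /= ?orbF.
  by rewrite lt0n; case: (s == 0%N); rewrite /= ?andbF.
rewrite (lin_domD A_lin); try exact: PT_dom.
rewrite [X in X + _](_ : _ = 0) ?add0r//.
rewrite (lin_dom_sum A_lin) ?big1// => i _; last first.
  by apply: dom_sum => s _; apply: domZ; apply: phi_dom; exact: lev.
rewrite (lin_dom_sum A_lin); last first.
  by move=> s _; apply: domZ; apply: phi_dom; exact: lev.
apply: big1 => s /andP[/eqP s0 _].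
rewrite (lin_domZ A_lin); last by apply: phi_dom; exact: lev.
by rewrite s0 Aphi1 scaler0.
Qed.

Lemma P1E x : P1 S x = x - PT all2 x. Proof. by rewrite /P1 P2E. Qed.
Lemma Q1E y : Q1 S y = y - QT all2 y. Proof. by rewrite /Q1 Q2E. Qed.

Lemma P1_blinear : @blinear R rX rX (P1 S).
Proof.
rewrite (_ : P1 S = (fun x : rX => x + (-1) *: (PT all2 x : rX))); last first.
  by apply/funext => x; rewrite P1E scaleN1r.
apply: (@blinearD_fun R rX rX (fun x => x) (fun x => (-1) *: (PT all2 x : rX))).
  exact: blinear_id.
exact: (@blinear_comp R rX rX rX (PT all2) _ (PT_blinear all2) (@blinear_scale R rX (-1))).
Qed.
Lemma Q1_blinear : @blinear R rY rY (Q1 S).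
Proof.
rewrite (_ : Q1 S = (fun x : rY => x + (-1) *: (QT all2 x : rY))); last first.
  by apply/funext => x; rewrite Q1E scaleN1r.
apply: (@blinearD_fun R rY rY (fun x => x) (fun x => (-1) *: (QT all2 x : rY))).
  exact: blinear_id.
exact: (@blinear_comp R rY rY rY (QT all2) _ (QT_blinear all2) (@blinear_scale R rY (-1))).
Qed.

Lemma PT_all T x : PT T (PT all2 x) = PT T x.
Proof. by rewrite PT_PT; apply: eq_chain_proj => i s _; rewrite andbT. Qed.
Lemma QT_all T y : QT T (QT all2 y) = QT T y.
Proof. by rewrite QT_QT; apply: eq_chain_proj => i s _; rewrite andbT. Qed.

Lemma PT_P1 T x : PT T (P1 S x) = 0.
Proof. by rewrite P1E (blinearB (PT_blinear T)) PT_all subrr. Qed.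
Lemma QT_Q1 T y : QT T (Q1 S y) = 0.
Proof. by rewrite Q1E (blinearB (QT_blinear T)) QT_all subrr. Qed.
Lemma P1_PT T x : P1 S (PT T x) = 0.
Proof. by rewrite P1E PT_PT subrr. Qed.
Lemma P1_idem x : P1 S (P1 S x) = P1 S x.
Proof. by rewrite {1}P1E PT_P1 subr0. Qed.
Lemma Q1_idem y : Q1 S (Q1 S y) = Q1 S y.
Proof. by rewrite {1}Q1E QT_Q1 subr0. Qed.

Lemma P1_dom x : dom S x -> dom S (P1 S x).
Proof. by move=> Dx; rewrite P1E; apply: domB_ => //; exact: PT_dom. Qed.

Lemma D1P x : D1 S x <-> dom S x /\ P1 S x = x.
Proof.
split=> [[y Dy <-]|[Dx <-]]; last by exists x.
by split; [exact: P1_dom|exact: P1_idem].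
Qed.
Lemma Y1P y : Y1 S y <-> Q1 S y = y.
Proof. by split=> [[z _ <-]|<-]; [exact: Q1_idem|exists y]. Qed.

Lemma D1_PT x T : D1 S x -> PT T x = 0.
Proof. by move=> /D1P[_ <-]; exact: PT_P1. Qed.
Lemma Y1_QT y T : Y1 S y -> QT T y = 0.
Proof. by move=> /Y1P <-; exact: QT_Q1. Qed.
Lemma D1_Bq x (i : 'I_n) j : (1 <= j <= m i)%N -> D1 S x -> Bq i j x = 0.
Proof.
case: j => // j jm D1x; have := @Bq_PT _ _ _ _ S _ all2 i j x jm.
rewrite D1_PT//= => <-; have [bq _] := Bq_dual jm.
by have := bq (-1) 0 0; rewrite scaler0 addr0 scaleN1r addNr.
Qed.

Lemma Q1_A x : dom S x -> Q1 S (A x) = A (P1 S x).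
Proof.
move=> Dx; rewrite Q1E P1E (lin_domB A_lin)//; last exact: PT_dom.
by rewrite A_PT QT_A.
Qed.
Lemma Q1_B x : dom S x -> Q1 S (B x) = B (P1 S x).
Proof.
move=> Dx; rewrite Q1E P1E (lin_domB B_lin) ?QT_B//.
exact: PT_dom.
Qed.

Lemma D1_A x : D1 S x -> Y1 S (A x).
Proof. by move=> /D1P[Dx xE]; apply/Y1P; rewrite Q1_A// xE. Qed.

Lemma D1_lin (a : R) (x y : rX) : D1 S x -> D1 S y -> D1 S (a *: x + y : rX).
Proof.
move=> /D1P[Dx xE] /D1P[Dy yE]; apply/D1P; split; first exact: dom_lin.
by rewrite P1_blinear.1 xE yE.
Qed.
Lemma D1_0 : D1 S 0.
Proof. by apply/D1P; split; [exact: dom0|exact: (blinear0 P1_blinear)]. Qed.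

(** The functionals B^* q_i^1 are dual to the basis phi_i^1 of the kernel. *)
Lemma ker_A x : dom S x -> A x = 0 -> (forall i : 'I_n, Bq i 1%N x = 0) -> x = 0.
Proof.
move=> Dx Ax0 Bx; have [_ _ [_ [_ _ _ H] _ _]] := HS.
have [a [xE _]] := H x Dx Ax0; rewrite xE; apply: big1 => i _.
have mi j : (1 <= 1 <= m j)%N by have /andP[-> _] := chain_bounds j.
suff ai : a i = 0 by rewrite ai scale0r.
have := Bx i; rewrite xE (dualD _ _ _ (Bq_dual (mi i))) (bigD1 i)//= big1 ?addr0.
  by rewrite (dualZ _ _ (Bq_dual (mi i))) Bq_phi// !eqxx /GRing.scale /= mulr1.
by move=> j ji; rewrite (dualZ _ _ (Bq_dual (mi i))) Bq_phi// (negbTE ji) scaler0.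
Qed.

Lemma A_inj_D1 x y : D1 S x -> D1 S y -> A x = A y -> x = y.
Proof.
move=> Dx Dy Axy; apply/eqP; rewrite -subr_eq0; apply/eqP.
have D1xy : D1 S (x - y).
  by have := D1_lin (-1) Dy Dx; rewrite scaleN1r addrC.
have [Dxd _] := (D1P x).1 Dx; have [Dyd _] := (D1P y).1 Dy.
apply: ker_A; first exact: domB_.
  by rewrite (lin_domB A_lin)// Axy subrr.
by move=> i; apply: D1_Bq => //; have /andP[-> _] := chain_bounds i.
Qed.

(** The image A(D_1). That it is all of Y_1 rests on the bounds established below, so the inverse is
    first studied on Z. *)
Let Z : set rY := [set y | exists2 x, D1 S x & A x = y].
Let Ainv0 (y : Y) : X := xget 0 [set x | D1 S x /\ A x = y].

Let Ainv0P y : Z y -> D1 S (Ainv0 y) /\ A (Ainv0 y) = y.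
Proof. by move=> [x D1x Ax]; rewrite /Ainv0; case: xgetP => [z _ //|/(_ x)[]]. Qed.

Let Ainv0A x : D1 S x -> Ainv0 (A x) = x.
Proof.
by move=> D1x; have [|h1 h2] := @Ainv0P (A x); [exists x|exact: A_inj_D1].
Qed.

Let blinear_approx (E F : normedModType R) (L : E -> F) (x : E) (y : F) : blinear L ->
  (forall e : R, 0 < e -> exists v, `|v - x| <= e /\ `|L v - y| <= e) -> L x = y.
Proof.
move=> bL H; have [C C0 HC] := blinear_bound bL.
apply/eqP; rewrite -subr_eq0 -normr_eq0 eq_le normr_ge0 andbT; apply/ler_addgt0Pr => e e0.
have [|v [vx vy]] := H (e / (1 + C)); first by rewrite divr_gt0// addr_gt0.
rewrite add0r (_ : L x - y = (L v - y) - L (v - x)); last by rewrite blinearB//; lmod_over R F.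
rewrite (le_trans (ler_normB _ _))// (le_trans (lerD vy (HC _)))//.
move: vx; rewrite !ler_pdivlMr ?addr_gt0// => vx.
have : C * `|v - x| <= C * (e / (1 + C)) by rewrite ler_wpM2l ?(ltW C0)// ler_pdivlMr ?addr_gt0.
move=> h; rewrite (le_trans (lerD (lexx _) h))//.
rewrite le_eqVlt; apply/orP; left; apply/eqP; field; lra.
Qed.

(** A limit z of such points is some A x by the closed range hypothesis, and the chain projector
    annihilates z by continuity; hence z = Q_1 A x = A P_1 x. *)
Let Zcl (z : rY) : (forall e : R, 0 < e -> exists2 v, Z v & `|v - z| <= e) -> Z z.
Proof.
move=> Hz; have [[_ _ rcl _] HdAB _] := HS.
have [x Ax xz] : [set A x | x in domA S] z.
  apply: (closed_approx rcl) => e /Hz[v [x D1x xv] vz]; exists v => //.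
  by exists x => //; have [] := (D1P x).1 D1x; rewrite domE.
have Dx : dom S x by rewrite domE.
have Q0 : QT all2 z = 0.
  apply: (@blinear_approx rY rY _ z 0 (QT_blinear all2)) => e e0.
  have [v [x' D1x' Ax'] vz] := Hz e e0; exists v; split => //.
  by rewrite subr0 -Ax' (Y1_QT _ (D1_A D1x')) normr0 ltW.
exists (P1 S x); first by exists x.
by rewrite -Q1_A// xz Q1E Q0 subr0.
Qed.

Let Z0 : Z 0.
Proof. by exists 0; [exact: D1_0|exact: lin_dom0 A_lin]. Qed.
Let Zlin (a : R) (x y : rY) : Z x -> Z y -> Z (a *: x + y).
Proof.
move=> [x' D1x <-] [y' D1y <-]; exists (a *: (x' : rX) + y'); first exact: D1_lin.
by rewrite A_lin//; [have [] := (D1P x').1 D1x|have [] := (D1P y').1 D1y].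
Qed.
Let Ainv0_lin (a : R) (x y : rY) : Z x -> Z y ->
  Ainv0 (a *: x + y) = a *: (Ainv0 x : rX) + (Ainv0 y : rX).
Proof.
move=> Zx Zy; have [h1 h2] := Ainv0P Zx; have [h3 h4] := Ainv0P Zy.
have [h5 h6] := Ainv0P (Zlin a Zx Zy); apply: A_inj_D1 => //; first exact: D1_lin.
by rewrite h6 A_lin ?h2 ?h4//; [have [] := (D1P _).1 h1|have [] := (D1P _).1 h3].
Qed.

Let Ainv0_bound : exists2 C : R, 0 <= C & forall z : rY, Z z -> `|Ainv0 z : rX| <= C * `|z|.
Proof.
apply: (@closed_graph R rY rX Z Ainv0 Z0 Zlin Zcl Ainv0_lin).
move=> z x Hzx; have [|Dx Ax] := A_closed (x := x) (y := z).
  move=> e /Hzx[v [Zv vz vx]]; have [h1 h2] := Ainv0P Zv.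
  by exists (Ainv0 v); split; [have [] := (D1P _).1 h1|exact: vx|rewrite h2; exact: vz].
have D1x : D1 S x.
  apply/D1P; split => //.
  apply: (@blinear_approx rX rX _ x x P1_blinear) => e /Hzx[v [Zv vz vx]].
  have [h1 h2] := Ainv0P Zv; have [_ h3] := (D1P _).1 h1.
  by exists (Ainv0 v); split => //; rewrite h3.
by rewrite -Ax Ainv0A.
Qed.

(** B is only closed, but A^{-1} is continuous on Z by now, so the graph of B A^{-1} is closed and
    the closed graph theorem applies a second time. *)
Let BAinv0_bound : exists2 C : R, 0 <= C & forall z : rY, Z z -> `|B (Ainv0 z) : rY| <= C * `|z|.
Proof.
have domAinv z : Z z -> dom S (Ainv0 z) by move=> /Ainv0P[/D1P[]].
apply: (@closed_graph R rY rY Z (B \o Ainv0) Z0 Zlin Zcl) => /=.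
  move=> a x y Zx Zy; rewrite Ainv0_lin// B_lin//; exact: domAinv.
move=> z y Hzy; have [C C0 HC] := Ainv0_bound.
have Zz : Z z by apply: Zcl => e /Hzy[v [Zv vz _]]; exists v.
apply: B_closed; first exact: domAinv.
move=> e e0; have [|v [Zv vz vy]] := Hzy (Num.min e (e / (C + 1))).
  by rewrite lt_min e0 divr_gt0// ltr_wpDl.
move: vz vy; rewrite !le_min => /andP[_ vz] /andP[vy _].
exists (Ainv0 v); split => //; first exact: domAinv.
have -> : Ainv0 v - Ainv0 z = Ainv0 ((v : rY) - z).
  have := Ainv0_lin (-1) Zz Zv; rewrite !scaleN1r [- z + v]addrC => ->.
  by rewrite addrC.
have Zvz : Z (v - z) by have := Zlin (-1) Zz Zv; rewrite scaleN1r addrC.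
apply: (le_trans (HC _ Zvz)).
move: vz; rewrite ler_pdivlMr ?ltr_wpDl// => vz.
apply: (le_trans _ vz); rewrite mulrC; apply: ler_wpM2l; first exact: (@normr_ge0 _ rY).
by rewrite lerDl.
Qed.

(** Solve (A + mu B) x = y and apply Q_1: with z = A P_1 x this reads y = z + mu B A^{-1} z. The
    bound on B A^{-1} gives |z| <= 2 |y|, so z -> y as mu -> 0, and Z is closed. *)
Lemma A_onto_Y1 y : Y1 S y -> exists2 x, D1 S x & A x = y.
Proof.
move=> Y1y; apply: Zcl => e e0.
have [r r0 Hr] := pencil_onto Hpencil; have [C C0 HC] := BAinv0_bound.
pose D := 2 * (C + 1) * (nrm y + 1).
have ny : 0 <= nrm y by exact: (@normr_ge0 _ rY).
have D0 : 0 < D by rewrite !mulr_gt0//; lra.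
(* Below r the pencil is onto; below (2 (C + 1))^-1 the norm of z is at most 2 |y|; below e / D the
   distance from z to y is at most e. *)
pose mu := Num.min (r / 2) (Num.min (2 * (C + 1))^-1 (e / D)).
have C10 : 0 < 2 * (C + 1) by lra.
have mu0 : 0 < mu by rewrite !lt_min !divr_gt0// invr_gt0 C10.
have [m1 m2 m3] : [/\ mu <= r / 2, mu <= (2 * (C + 1))^-1 & mu <= e / D].
  by split; rewrite /mu ?ge_min ?lexx ?orbT.
have mur : mu < r by lra.
have [x Dx xE] := Hr mu mu0 mur y.
have D1x : D1 S (P1 S x) by exists x.
pose z : rY := A (P1 S x); have Zz : Z z by exists (P1 S x).
have yE : y = z + mu *: (B (Ainv0 z) : rY).
  rewrite Ainv0A// /z -Q1_A// -Q1_B// -(blinearZ Q1_blinear) -(blinearD Q1_blinear) realZ xE.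
  by have /Y1P -> := Y1y.
have Bz := HC z Zz.
have h1 : `|mu *: (B (Ainv0 z) : rY)| <= mu * (C * `|z|).
  by rewrite normrZ gtr0_norm// ler_wpM2l ?(ltW mu0).
have muC : mu * (2 * (C + 1)) <= 1.
  by move: m2; rewrite -[X in _ <= X]mul1r ler_pdivlMr.
have h2 : `|z| <= 2 * nrm y.
  have : `|z| <= nrm y + mu * (C * `|z|).
    have zE : z = (y : rY) - mu *: (B (Ainv0 z) : rY) by rewrite {1}yE addrK.
    by rewrite {1}zE (le_trans (ler_normB _ _))// lerD.
  have := normr_ge0 z; have : mu * (C * `|z|) <= 2^-1 * `|z|.
    by rewrite mulrA ler_wpM2r//; lra.
  lra.
exists z => //; rewrite yE opprD addrA subrr add0r normrN (le_trans h1)//.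
move: m3; rewrite ler_pdivlMr// => m3; apply: le_trans m3; rewrite ler_wpM2l ?(ltW mu0)// /D.
have : C * `|z| <= C * (2 * nrm y) by rewrite ler_wpM2l.
have : 0 <= C * nrm y by rewrite mulr_ge0.
lra.
Qed.

Let YZ y : Y1 S y -> Z y. Proof. exact: A_onto_Y1. Qed.

Lemma At_D1 x : D1 S x -> At S x = A x.
Proof.
move=> D1x; rewrite /At big1 ?addr0// => i _.
by rewrite D1_Bq ?scale0r//; have /andP[-> _] := chain_bounds i.
Qed.

(** The functional q_k^{m_k} annihilates the range of A and reads off the coefficient of x at B^*
    q_k^1; once these coefficients agree, the finite-rank terms cancel and the difference lies in
    ker A. *)
Lemma At_inj x y : dom S x -> dom S y -> At S x = At S y -> x = y.
Proof.
move=> Dx Dy; rewrite /At => Axy; apply/eqP; rewrite -subr_eq0; apply/eqP.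
have Dxy : dom S (x - y) by exact: domB_.
have mi j : (1 <= m j <= m j)%N by rewrite leqnn andbT; have /andP[] := chain_bounds j.
have m1 j : (1 <= 1 <= m j)%N by have /andP[-> _] := chain_bounds j.
have Bq1 (k : 'I_n) : Bq k 1%N x = Bq k 1%N y.
  have := congr1 (q k (m k)) Axy.
  have qp z : dom S z -> q k (m k) (A z + \sum_(i < n) Bq i 1%N z *: B (φ i (m i))) = Bq k 1%N z.
    move=> Dz; have [ql _] := q_dual (mi k).
    have := ql 1 (A z) (\sum_(i < n) Bq i 1%N z *: B (φ i (m i))); rewrite !scale1r => ->.
    rewrite qA_last// add0r (dualD _ _ _ (q_dual (mi k))) (bigD1 k)//= big1 ?addr0.
      by rewrite (dualZ _ _ (q_dual (mi k))) q_Bphi// !eqxx /GRing.scale /= mulr1.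
    by move=> i ik; rewrite (dualZ _ _ (q_dual (mi k))) q_Bphi// (negbTE ik) scaler0.
  by rewrite !qp.
apply: ker_A => //.
  rewrite (lin_domB A_lin)//; apply/eqP; rewrite subr_eq0; apply/eqP.
  by move: Axy; under eq_bigr do rewrite Bq1; move/addIr.
move=> i; have [bl _] := Bq_dual (m1 i).
by have := bl (-1) y x; rewrite !scaleN1r [- y + x]addrC => ->; rewrite Bq1 addNr.
Qed.

Lemma At_invP y : Y1 S y -> D1 S (At_inv S y) /\ A (At_inv S y) = y.
Proof.
move=> /A_onto_Y1[x D1x Axy]; rewrite /At_inv; have [Dx _] := (D1P x).1 D1x.
case: xgetP => [z _ [Dz zE]|/(_ x)[]]; last by split => //; rewrite At_D1.
by have -> : z = x by apply: At_inj => //; rewrite zE At_D1.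
Qed.

Lemma At_invK x : D1 S x -> At_inv S (A x) = x.
Proof. by move=> D1x; have [h1 h2] := At_invP (D1_A D1x); exact: A_inj_D1. Qed.

(** Composing with Q_1 gives a bounded operator on all of Y, so that the reduced equation is posed
    in a complete space and not in the subspace Y_1. *)
Definition Ainv (y : Y) : X := At_inv S (Q1 S y).

Lemma Y1_Q1 y : Y1 S (Q1 S y). Proof. by exists y. Qed.

Let AinvE y : Ainv y = Ainv0 (Q1 S y).
Proof.
have [h1 h2] := At_invP (Y1_Q1 y); have [h3 h4] := Ainv0P (YZ (Y1_Q1 y)).
by apply: A_inj_D1 => //; rewrite h2 h4.
Qed.

Lemma AinvP y : D1 S (Ainv y) /\ A (Ainv y) = Q1 S y.
Proof. exact: At_invP (Y1_Q1 y). Qed.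

Lemma AinvA x : D1 S x -> Ainv (A x) = x.
Proof. by move=> D1x; rewrite /Ainv; have /Y1P -> := D1_A D1x; exact: At_invK. Qed.

Lemma Ainv_blinear : @blinear R rY rX Ainv.
Proof.
have [Q1l [C' C'0 HC']] := Q1_blinear; have [C C0 HC] := Ainv0_bound; split.
  by move=> a x y; rewrite !AinvE Q1l Ainv0_lin//; apply: YZ; exact: Y1_Q1.
exists (C * C') => [|y]; first exact: mulr_ge0.
rewrite AinvE (le_trans (HC _ _))//; first by apply: YZ; exact: Y1_Q1.
by rewrite -mulrA ler_wpM2l.
Qed.

Lemma BAinv_blinear : @blinear R rY rY (B \o Ainv).
Proof.
have [Q1l [C' C'0 HC']] := Q1_blinear; have [C C0 HC] := BAinv0_bound; split.
  move=> a x y /=; rewrite Ainv_blinear.1 B_lin//.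
    by have [/D1P[]] := AinvP x.
  by have [/D1P[]] := AinvP y.
exists (C * C') => [|y]; first exact: mulr_ge0.
rewrite /= AinvE (le_trans (HC _ _))//; first by apply: YZ; exact: Y1_Q1.
by rewrite -mulrA ler_wpM2l.
Qed.

(** If D = X, the closed graph theorem applies to A itself. *)
Lemma A_bounded : dom S = setT \/ bounded_on (domA S) A ->
  exists2 C : R, 0 <= C & forall x, dom S x -> nrm (A x) <= C * nrm x.
Proof.
move=> [DT|[C HC]]; last first.
  exists `|C| => // x Dx; apply: (le_trans (HC x _)); first by rewrite -domE.
  by rewrite ler_wpM2r ?ler_norm//; exact: (@normr_ge0 _ rX).
have domT x : dom S x by rewrite DT.
have Acl (z : rX) (y : rY) : (forall e : R, 0 < e ->
    exists v : rX, [/\ setT v, `|v - z| <= e & `|(A v : rY) - y| <= e]) -> A z = y.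
  move=> H; have [|_ //] := A_closed (x := z) (y := y).
  by move=> e /H[v [_ vz vy]]; exists v.
have Alin (a : R) (x y : rX) : setT x -> setT y -> A (a *: x + y) = a *: (A x : rY) + A y.
  by move=> _ _; exact: A_lin.
have [C C0 HC] := @closed_graph R rX rY setT A I (fun _ _ _ _ _ => I) (fun _ _ => I) Alin Acl.
by exists C => // x _; exact: HC.
Qed.
End ReducedOperator.

(** * Growth of a minimum of differentiable functions *)

Section MinimumGrowth.
Variable R : realType.
Local Notation mu := (@lebesgue_measure R).

Lemma deriv_on_derive1 (J : set R) (u : R -> R^o) (t l : R) : nbhs t J ->
  deriv_on J u t (l : R^o) -> derivable u t 1 /\ derive1 u t = l.
Proof.
move=> /nbhs_ballP[r /= r0 rJ] du.
have H : (fun h => h^-1 *: (u (h + t) - u t)) @ 0^' --> (l : R^o).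
  apply/cvgrPdist_le => e e0; have [d d0 Hd] := du e e0.
  exists (Num.min r d); first by rewrite /= lt_min r0.
  move=> h /=; rewrite sub0r normrN lt_min => /andP[hr hd] h0.
  have Jh : J (h + t).
    by apply: rJ; rewrite -ball_normE /ball_ /= opprD addrCA subrr addr0 normrN.
  have := Hd _ Jh; rewrite addrK => /(_ hd) {}Hd.
  have h0' : 0 < `|h| by rewrite normr_gt0.
  rewrite distrC -(ler_pM2l h0') -normrM mulrC [leRHS]mulrC.
  rewrite (_ : (_ - _) * h = u (h + t) - u t - h *: (l : R^o))//.
  by rewrite -![_ *: _]/(_ * _); field.
split; last exact: cvg_lim.
apply/cvg_ex; exists (l : R^o).
rewrite (_ : (fun h : R => _) = fun h => h^-1 *: (u (h + t) - u t))//.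
by apply/funext => h /=; rewrite [h *: 1]mulr1.
Qed.

Lemma deriv_on_continuous (J : set R) (u : R -> R^o) (t : R) : nbhs t J ->
  cont_on J u t -> {for t, continuous u}.
Proof.
move=> /nbhs_ballP[r /= r0 rJ] cu; apply/cvgrPdist_le => e e0.
have [d d0 Hd] := cu e e0; exists (Num.min r d); first by rewrite /= lt_min r0.
move=> s /=; rewrite lt_min => /andP[sr sd]; rewrite distrC; apply: Hd; last by rewrite distrC.
by apply: rJ; rewrite -ball_normE.
Qed.

(** For each t the lower limit of the forward quotients g n t is at least psi t: an index that does
    not attain the minimum stays above it for a short time. Truncated at psi, they converge to psi
    and are dominated by L + psi. Their integrals are at most those of g n, which are increments of
    the running mean F n of m and tend to m b - m a. The stretch from b to b1 leaves room for the
    forward step. *)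
Lemma min_growth (k : nat) (phi dphi : 'I_k -> R -> R^o) (m psi : R -> R) (a b b1 L : R) :
  a < b -> b < b1 ->
  (forall i t, a <= t <= b1 -> deriv_on `[a, b1] (phi i) t (dphi i t)) ->
  (forall i t, a <= t <= b1 -> `|dphi i t| <= L) ->
  (forall i t, a <= t <= b1 -> m t <= phi i t) ->
  (forall t, a <= t <= b1 -> exists i, m t = phi i t) ->
  (forall i t, a <= t <= b -> phi i t = m t -> psi t <= dphi i t) ->
  (forall t, a <= t <= b -> 0 <= psi t) ->
  mu.-integrable `[a, b] (EFin \o psi) ->
  (\int[mu]_(t in `[a, b]) (psi t)%:E <= (m b - m a)%:E)%E.
Proof.
move=> ab bb1 dp pL mle mex act psi0 ipsi.
have L0 : 0 <= L.
  have aab : a <= a <= b1 by lra.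
  by have [i _] := mex a aab; apply: le_trans (pL i a aab).
have plip i s t : a <= s <= b1 -> a <= t <= b1 -> `|phi i t - phi i s| <= L * `|t - s|.
  exact: mean_value_itv (dp i) (pL i).
have mlip1 s t : a <= s <= b1 -> a <= t <= b1 -> m t - m s <= L * `|t - s|.
  move=> sb tb; have [j ms] := mex s sb; have := mle j t tb.
  have := le_trans (ler_norm _) (plip j s t sb tb); lra.
have mlip s t : a <= s <= b1 -> a <= t <= b1 -> `|m t - m s| <= L * `|t - s|.
  move=> sb tb; rewrite ler_norml mlip1// andbT lerNl opprB distrC; exact: mlip1.
(* Clamping time to [a, b1] makes m Lipschitz on the whole line. *)
pose cl (t : R) := Num.max a (Num.min b1 t).
have clE t : a <= t <= b1 -> cl t = t.
  by move=> /andP[h1 h2]; rewrite /cl (min_idPr h2) (max_idPr h1).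
have clP t : a <= cl t <= b1.
  by rewrite /cl le_max lexx /= ge_max ge_min lexx /= andbT; lra.
have cllip s t : `|cl t - cl s| <= `|t - s|.
  wlog st : s t / s <= t => [W|].
    have [/W//|/ltW/W] := leP s t; by rewrite distrC (distrC s).
  rewrite (ger0_norm (_ : 0 <= t - s)) ?subr_ge0// /cl /Num.max /Num.min.
  by do ?case: ifPn; rewrite -?leNgt => *; rewrite ler_norml; lra.
pose M t : R^o := m (cl t).
have Mlip s t : `|M t - M s| <= L * `|t - s|.
  by rewrite /M (le_trans (mlip _ _ _ _))// ler_wpM2l.
have Mcont J t : cont_on J M t.
  move=> e e0; exists (e / (L + 1)); first by rewrite divr_gt0// ltr_wpDl.
  move=> s _; rewrite ltr_pdivlMr ?ltr_wpDl// => st; rewrite (le_trans (Mlip _ _))//.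
  by have := normr_ge0 (s - t); lra.
(* The primitive is taken on a larger interval, so that all points in use are interior and the
   derivatives are two-sided. *)
have [Phi [_ dPhi]] := @primitive_ex R R^o M (a - 1) (b1 + 1) ltac:(lra) (fun t _ => Mcont _ t).
pose h (n : nat) := (b1 - b) / n.+1%:R : R.
have h0 n : 0 < h n by rewrite divr_gt0// subr_gt0.
have hle n : h n <= b1 - b by rewrite ler_pdivrMr// ler_peMr ?ler1n// subr_ge0 ltW.
have hsmall e : 0 < e -> \forall n \near \oo, h n < e.
  move=> e0; have /cvgrPdist_lt/(_ _ e0) : (fun n => (b1 - b) * n.+1%:R^-1) @ \oo --> (b1 - b) * 0.
    by apply: cvgMl_tmp; exact: cvg_harmonic.
  rewrite mulr0; apply: filterS => n; rewrite sub0r normrN => /(le_lt_trans (ler_norm _)).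
  exact.
pose g n t : R^o := (h n)^-1 *: (M (t + h n) - M t).
have gL n t : `|g n t| <= L.
  rewrite /g normrZ gtr0_norm ?invr_gt0// mulrC ler_pdivrMr// (le_trans (Mlip _ _))//.
  by rewrite addrC addKr gtr0_norm.
have gcont n : continuous (g n : R -> R^o).
  move=> t; apply: (@deriv_on_continuous setT); first exact: filterT.
  move=> e e0; have he : 0 < e * h n / 2 by rewrite divr_gt0// mulr_gt0.
  have [d1 d10 H1] := Mcont setT (t + h n) _ he.
  have [d2 d20 H2] := Mcont setT t _ he.
  exists (Num.min d1 d2) => [|s _]; first by rewrite lt_min d10.
  rewrite lt_min => /andP[s1 s2]; rewrite /g -scalerBr normrZ gtr0_norm ?invr_gt0//.
  rewrite ler_pdivrMl// (_ : _ - _ = (M (s + h n) - M (t + h n)) - (M s - M t)); last by lmod_over R R^o.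
  rewrite (le_trans (ler_normB _ _))//.
  have /(H1 _ I) K1 : `|s + h n - (t + h n)| < d1 by rewrite opprD addrACA subrr addr0.
  by have K2 := H2 s I s2; rewrite mulrC; lra.
pose F n t : R^o := (h n)^-1 *: (Phi (t + h n) - Phi t).
have hbig n t : a <= t <= b -> [/\ nbhs t `](a - 1), (b1 + 1)[%classic,
    nbhs (t + h n) `](a - 1), (b1 + 1)[%classic, a - 1 <= t <= b1 + 1 & a - 1 <= t + h n <= b1 + 1].
  move=> tab; have := hle n; have := h0 n => k1 k2.
  by split; try (apply: near_in_itvoo; rewrite in_itv/=); lra.
have dF n t : a <= t <= b -> derivable (F n) t 1 /\ derive1 (F n) t = g n t.
  move=> tab; have [n1 n2 n3 n4] := hbig n t tab.
  have [r1 /= r10 R1] := (nbhs_ballP _ _).1 n1; have [r2 /= r20 R2] := (nbhs_ballP _ _).1 n2.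
  apply: (@deriv_on_derive1 (ball t (Num.min r1 r2))).
    by apply: nbhsx_ballx; rewrite lt_min r10.
  apply: (deriv_on_blinear (@blinear_scale R R^o (h n)^-1)
     (u := fun t => Phi (t + h n) - Phi t)).
  have d1 : deriv_on (ball t (Num.min r1 r2)) Phi t (M t).
    apply: deriv_on_sub (dPhi t n3) => s; rewrite -ball_normE /= lt_min => /andP[s1 _].
    by have := R1 s; rewrite -ball_normE /= => /(_ s1); rewrite /= !in_itv/=; lra.
  have d2 : deriv_on (ball t (Num.min r1 r2)) (fun s => Phi (s + h n)) t (M (t + h n)).
    move=> e e0; have [d d0 Hd] := dPhi _ n4 e e0; exists d => // s.
    rewrite -ball_normE /= lt_min => /andP[_ s2] sd.
    have := Hd (s + h n); rewrite opprD addrACA subrr addr0; apply => //.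
    have := R2 (s + h n); rewrite -ball_normE /= opprD addrACA subrr addr0 => /(_ s2).
    by rewrite /= !in_itv/=; lra.
  have := deriv_onD d2 (deriv_on_blinear (@blinear_scale R R^o (-1)) d1).
  rewrite scaleN1r; apply: eq_deriv_on; first by apply: ballxx; rewrite lt_min r10.
  by move=> s _ /=; rewrite scaleN1r.
have FTC n : (\int[mu]_(t in `[a, b]) (g n t)%:E = (F n b - F n a)%:E)%E.
  rewrite EFinB; apply: continuous_FTC2 => //.
  - by apply: continuous_subspaceT => x; exact: gcont.
  - have Fc t : a <= t <= b -> {for t, continuous (F n)}.
      by move=> tab; have [dFt _] := dF n t tab; apply: differentiable_continuous; apply/derivable1_diffP.
    split.
    + move=> t; rewrite in_itv/= => tab; have [] := dF n t; first by lra.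
      by [].
    + by apply: cvg_at_right_filter; apply: Fc; lra.
    + by apply: cvg_at_left_filter; apply: Fc; lra.
  - by move=> t; rewrite in_itv/= => tab; have [] := dF n t; first lra.
have Flim : (fun n => F n b - F n a) @ \oo --> (m b - m a : R^o).
  have one t : a <= t <= b -> (fun n => F n t) @ \oo --> (M t : R^o).
    move=> tab; have [n1 n2 n3 n4] := hbig 0%N t tab.
    apply/cvgrPdist_le => e e0; have [d d0 Hd] := dPhi t n3 e e0.
    near=> n; rewrite distrC.
    have hd : h n < d by near: n; exact: hsmall.
    have [_ _ _ n5] := hbig n t tab.
    have := Hd (t + h n); rewrite /= in_itv/= n5 addrC addKr gtr0_norm// => /(_ isT hd).
    move=> H; rewrite (_ : F n t - M t = (h n)^-1 *: (Phi (t + h n) - Phi t - h n *: M t)); last first.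
      by rewrite /F [RHS]scalerBr scalerA mulVf ?scale1r// gt_eqF.
    by rewrite normrZ gtr0_norm ?invr_gt0// ler_pdivrMl// mulrC.
  have -> : m b - m a = M b - M a by rewrite /M !clE//; lra.
  by apply: cvgB; apply: one; lra.
have gap t e : a <= t <= b -> 0 < e -> \forall n \near \oo, psi t - e <= g n t.
  move=> tab e0; have p0 := psi0 t tab.
  have tb1 : a <= t <= b1 by lra.
  have key j : \forall n \near \oo, h n * (psi t - e) <= phi j (t + h n) - m t.
    have [act_j|nact] := eqVneq (phi j t) (m t).
      have [d d0 Hd] := dp j t tb1 e e0; near=> n.
      have hd : h n < d by near: n; exact: hsmall.
      have hn := hle n; have hp := h0 n.
      have := Hd (t + h n); rewrite /= in_itv/= [t + h n - t]addrAC subrr add0r (gtr0_norm hp) => H.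
      have {}H := H ltac:(lra) hd; move: H; rewrite -[_ *: _]/(_ * _) => H.
      have := act j t tab act_j => H2.
      have : - (e * h n) <= phi j (t + h n) - phi j t - h n * dphi j t.
        by rewrite lerNl (le_trans _ H)// -normrN ler_norm.
      have : h n * psi t <= h n * dphi j t by rewrite ler_pM2l.
      rewrite -act_j mulrBr; lra.
    have gp : 0 < phi j t - m t by rewrite subr_gt0 lt_def nact mle.
    (* For a time step this short, the gap of an inactive [phi j] above m t outlasts both its own
       decrease at rate L and the required growth at rate psi t. *)
    have q0 : 0 < (phi j t - m t) / (L + psi t + 1) by rewrite divr_gt0//; lra.
    near=> n.
    have : h n < (phi j t - m t) / (L + psi t + 1) by near: n; exact: hsmall.
    rewrite ltr_pdivlMr; last by lra.
    have hn := hle n; have hp := h0 n => H1.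
    have := plip j t (t + h n) tb1 ltac:(lra); rewrite [t + h n - t]addrAC subrr add0r (gtr0_norm hp) ler_norml => /andP[H2 _].
    have : 0 <= h n * e by rewrite mulr_ge0// ltW.
    have := h0 n; move: H1 H2; rewrite !mulrDr mulrN [L * _]mulrC; lra.
  have key' : \forall n \near \oo, forall j, h n * (psi t - e) <= phi j (t + h n) - m t.
    exact: filter_forall.
  apply: filterS key' => n H; have hn := hle n; have hp := h0 n.
  have [i mi] := mex (t + h n) ltac:(lra).
  have := H i; rewrite -mi /g -[_ *: _]/(_ * _) /M !clE//; [|lra..].
  by rewrite -ler_pdivlMl.
pose hn n t : \bar R := (Num.min (g n t) (psi t))%:E.
have mpsi : measurable_fun `[a, b] psi.
  by apply/measurable_EFinP; exact: measurable_int ipsi.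
have mhn n : measurable_fun `[a, b] (hn n).
  apply/measurable_EFinP; apply: measurable_minr => //.
  by apply: measurable_funTS; apply: continuous_measurable_fun; exact: gcont.
have ab' : a <= b by exact: ltW.
have iL : mu.-integrable `[a, b] (fun t => (L + psi t)%:E).
  rewrite (_ : (fun t => _) = (EFin \o cst L) \+ (EFin \o psi))//.
  apply: integrableD => //; apply: continuous_compact_integrable; first exact: segment_compact.
  by apply: continuous_subspaceT => x; exact: cvg_cst.
have dom_hn n t : `[a, b]%classic t -> (`|hn n t| <= (L + psi t)%:E)%E.
  rewrite /= in_itv/= => tab; rewrite lee_fin /hn.
  have := gL n t; have := psi0 t tab; rewrite !ler_norml => p0 /andP[g1 g2].
  by rewrite /Num.min; case: ifP => _; lra.
have lim_hn t : `[a, b]%classic t -> hn ^~ t @ \oo --> (psi t)%:E.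
  rewrite /= in_itv/= => tab; apply/cvg_EFin; first by near=> n.
  apply/cvgrPdist_le => e e0; have := gap t e tab e0; apply: filterS => n Hn.
  rewrite /hn /= ger0_norm ?subr_ge0 ?ge_min ?lexx ?orbT//.
  by rewrite /Num.min; case: ifP => _; lra.
have [||_ _ cvh] := @dominated_convergence _ _ R mu `[a, b]%classic (measurable_itv _)
  hn (EFin \o psi) (fun t => (L + psi t)%:E) mhn (measurable_int _ ipsi) _ iL _.
- by apply: aeW => t; exact: lim_hn.
- by apply: aeW => t n; exact: dom_hn.
have igc n : mu.-integrable `[a, b] (EFin \o g n).
  apply: continuous_compact_integrable; first exact: segment_compact.
  by apply: continuous_subspaceT => x; exact: gcont.
have ihn n : mu.-integrable `[a, b] (hn n).
  apply: (@le_integrable _ _ _ mu `[a, b]%classic (measurable_itv _) (hn n)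
    (fun t => (L + psi t)%:E) (mhn n) _ iL) => t tab.
  by rewrite (le_trans (dom_hn n t tab))// lee_fin ler_norm.
have bnd n : (\int[mu]_(t in `[a, b]) hn n t <= (F n b - F n a)%:E)%E.
  rewrite -FTC; apply: (@le_integral _ _ _ mu `[a, b]%classic (measurable_itv _)
    (hn n) (fun t => (g n t)%:E) (ihn n) (igc n)) => t _.
  by rewrite lee_fin ge_min lexx.
have cF : (fun n => (F n b - F n a)%:E) @ \oo --> (m b - m a)%:E.
  by apply: cvg_EFin Flim; near=> n.
by apply: (lee_cvg_to cvh cF); near=> n; exact: bnd.
Unshelve. all: end_near.
Qed.
End MinimumGrowth.

(** * The algebraic components of a solution *)

Section LevelSpaces.
Variables (R : realType) (c : scalar_kind).
Local Notation K := (scalar_field R c).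
Variables (X Y : completeNormedModType K) (S : adae X Y).
Local Notation ν := (nu S).
Local Notation n := (nchains S).
Local Notation m := (@chain_len _ _ _ _ S).
Local Notation φ := (@root_vec _ _ _ _ S).
Local Notation rX := (realify X).
Local Notation PT := (@PT _ _ _ _ S).
Local Notation QT := (@QT _ _ _ _ S).
Context {HS : root_adae S}.
Local Notation PT_blinear := (@PT_blinear _ _ _ _ S HS).
Local Notation chain_bounds := (@chain_bounds _ _ _ _ S HS).
Local Notation Bq_dual := (@Bq_dual _ _ _ _ S HS).
Implicit Types (T : 'I_n -> nat -> bool).

(** The range of the projector, described by its fixed points so that membership is an equation. *)
Definition level T : set X := [set x | PT T x = x].

Lemma eq_PT T T' x : (forall (i : 'I_n) s, (s < m i)%N -> T i s = T' i s) -> PT T x = PT T' x.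
Proof. exact: eq_chain_proj. Qed.

Lemma eq_QT T T' y : (forall (i : 'I_n) s, (s < m i)%N -> T i s = T' i s) -> QT T y = QT T' y.
Proof. exact: eq_chain_proj. Qed.

Lemma level_PT T x : level T (PT T x).
Proof. exact: PT_idem. Qed.

Lemma level_dom T x : level T x -> dom S x.
Proof. by move=> <-; exact: PT_dom. Qed.

Lemma PT_image T : PT T @` dom S = level T.
Proof.
apply/seteqP; split => [x [y _ <-]|x Tx]; first exact: level_PT.
by exists x => //; exact: level_dom Tx.
Qed.

Lemma level_lin T (a : R) (x y : rX) : level T x -> level T y -> level T (a *: x + y : rX).
Proof.
rewrite /level /= => hx hy; have bP := PT_blinear T.
by rewrite (blinearD bP) (blinearZ bP) hx hy.
Qed.

Lemma level0 T : level T 0.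
Proof. exact: (blinear0 (PT_blinear T)). Qed.

Lemma levelD T x y : level T x -> level T y -> level T (x + y).
Proof.
move=> hx hy; have := @level_lin T 1 x y hx hy.
by rewrite (_ : (1 *: (x : rX) + y) = x + y)// scale1r.
Qed.

Lemma level_sum T (I : Type) (r : seq I) (P : pred I) (u : I -> X) :
  (forall i, P i -> level T (u i)) -> level T (\sum_(i <- r | P i) u i).
Proof. by move=> h; elim/big_ind: _ => //; [exact: level0|move=> x y; exact: levelD]. Qed.

Lemma level_sub T T' : (forall (i : 'I_n) s, (s < m i)%N -> T i s -> T' i s) ->
  level T `<=` level T'.
Proof.
move=> TT x; rewrite /level /= => <-; rewrite PT_PT; apply: eq_PT => i s si.
by have := TT i s si; case: (T i s) => [->|_]//; rewrite andbF.
Qed.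

Lemma PT_level0 T T' x : (forall (i : 'I_n) s, (s < m i)%N -> ~~ (T i s && T' i s)) ->
  level T x -> PT T' x = 0.
Proof.
move=> TT <-; rewrite PT_PT; apply: chain_proj_eq0 => i s si.
by rewrite andbC; apply/negbTE; exact: TT.
Qed.

Lemma realZP (E : normedModType K) (a : R) (x : E) : a *: (x : realify E) = of_real c a *: x.
Proof. by []. Qed.

Lemma scalar_split (E : normedModType K) (a : K) (v : E) :
  a *: v = \sum_(b : bool) of_real c (scalar_coord b a) *: (scalar_basis R c b *: v).
Proof. by rewrite big_bool /= addrC !scalerA -scalerDl -scalar_coordE. Qed.

(** Real coordinates of the coefficients at B^* q_i^{s+1}, with s running up to the common bound nu
    of the chain lengths. The vectors are projected by [PT T], so that even those with coefficient 0
    belong to the level. *)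
Lemma level_coordinates T : exists (N : nat) (e_ : 'I_N -> rX) (c_ : 'I_N -> rX -> R^o),
  coordinates (level T : set rX) e_ c_.
Proof.
pose I := ('I_n * 'I_ν * bool)%type.
pose cc (k : I) (x : X) : R^o := if (k.1.2 < m k.1.1)%N && T k.1.1 k.1.2
  then scalar_coord k.2 (Bq k.1.1 k.1.2.+1 x) else 0.
pose ee (k : I) : rX := PT T (scalar_basis R c k.2 *: φ k.1.1 k.1.2.+1).
exists #|{: I}|, (fun k => ee (enum_val k)), (fun k => cc (enum_val k)).
split; [exact: level0|exact: level_lin|by move=> k; exact: level_PT| |].
  move=> k; rewrite /cc; set k' := enum_val k.
  case E : ((k'.1.2 < m k'.1.1)%N && T k'.1.1 k'.1.2); last exact: blinear0_fun.
  have /andP[km _] := E.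
  by apply: dual_coord_blinear; apply: Bq_dual.
move=> x Tx; transitivity (\sum_(k : I) cc k x *: ee k); last first.
  exact: (reindex _ (onW_bij _ (@enum_val_bij I))).
have E : PT T x = \sum_(k : I) cc k x *: (scalar_basis R c k.2 *: φ k.1.1 k.1.2.+1 : rX).
  rewrite -(pair_bigA _ (fun p b => cc (p, b) x *: (scalar_basis R c b *: φ p.1 p.2.+1 : rX))) /=.
  rewrite -(pair_bigA _ (fun i s => \sum_(b : bool) cc (i, s, b) x *:
    (scalar_basis R c b *: φ i (s : 'I_ν).+1 : rX))) /=.
  apply: eq_bigr => i _; have /andP[_ mν] := chain_bounds i.
  rewrite (big_ord_widen_cond _ _ (fun s => Bq i s.+1 x *: φ i s.+1) mν) big_mkcond /=.
  apply: eq_bigr => s _; rewrite andbC /cc /=; case: ifP => _.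
    exact: scalar_split.
  by rewrite big1// => b _; rewrite scale0r.
have bP := PT_blinear T.
rewrite -{1}Tx -{1}Tx E (blinear_sum bP); apply: eq_bigr => k _.
by rewrite (blinearZ bP).
Qed.
End LevelSpaces.

(** Both maps are tested on r h with r small. The lemma identifies the derivative in an
    invertibility condition with the one furnished by [Ck] or by a continuous partial derivative. *)
Lemma approx_unique (R : realType) (E F : normedModType R) (S W : set E) (g : E -> F) (x : E)
    (L L' : E -> F) : (forall (a : R) y z, W y -> W z -> W (a *: y + z)) -> W x -> W 0 ->
  (forall (a : R) h, W h -> L (a *: h) = a *: L h) ->
  (forall (a : R) h, W h -> L' (a *: h) = a *: L' h) ->
  (exists2 d : R, 0 < d & forall y, W y -> `|y - x| < d -> S y) ->
  (forall e : R, 0 < e -> exists2 d : R, 0 < d & forall y, S y -> `|y - x| < d ->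
     `|g y - g x - L (y - x)| <= e * `|y - x|) ->
  (forall e : R, 0 < e -> exists2 d : R, 0 < d & forall y, S y -> `|y - x| < d ->
     `|g y - g x - L' (y - x)| <= e * `|y - x|) ->
  forall h, W h -> L h = L' h.
Proof.
move=> WP Wx W0 LZ LZ' [d d0 Sd] H H' h Wh.
apply/eqP; rewrite -subr_eq0 -normr_le0; apply/ler_addgt0Pr => e e0; rewrite add0r.
have q0 : 0 < `|h| + 1 by rewrite ltr_wpDl.
have e' : 0 < e / (`|h| + 1) / 2 by rewrite !divr_gt0.
have [d1 d10 H1] := H _ e'; have [d2 d20 H2] := H' _ e'.
pose r : R := Num.min d (Num.min d1 d2) / (`|h| + 1).
have r0 : 0 < r by rewrite divr_gt0// !lt_min d0 d10.
have rh : `|r *: h| < Num.min d (Num.min d1 d2).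
  rewrite normrZ gtr0_norm// /r mulrAC ltr_pdivrMr// ltr_pM2l ?ltrDl//.
  by rewrite !lt_min d0 d10.
move: rh; rewrite !lt_min => /andP[k0 /andP[k1 k2]].
have Wy : W (r *: h + x) by exact: WP.
have Sy : S (r *: h + x) by apply: Sd => //; rewrite addrK.
have := H1 _ Sy; have := H2 _ Sy; rewrite addrK => /(_ k2) Q2 /(_ k1) Q1.
have : `|r *: (L h - L' h)| <= e / (`|h| + 1) * (r * `|h|).
  rewrite scalerBr -LZ// -LZ'//.
  rewrite (_ : _ - _ = (g (r *: h + x) - g x - L' (r *: h)) - (g (r *: h + x) - g x - L (r *: h)));
    last by lmod_over R F.
  rewrite (le_trans (ler_normB _ _))// (le_trans (lerD Q2 Q1))//.
  by rewrite -mulrDl -splitr normrZ (gtr0_norm r0).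
rewrite normrZ (gtr0_norm r0) mulrCA ler_pM2l// => /le_trans; apply.
by rewrite mulrAC ler_pdivrMr// ler_pM2l// lerDl.
Qed.

Section ImplicitStep.
Variables (R : realType) (c : scalar_kind).
Local Notation K := (scalar_field R c).
Variables (X Y : completeNormedModType K) (S : adae X Y).
Local Notation B := (opB S).
Local Notation n := (nchains S).
Local Notation m := (@chain_len _ _ _ _ S).
Local Notation φ := (@root_vec _ _ _ _ S).
Local Notation f := (rhs S).
Local Notation rX := (realify X).
Local Notation rY := (realify Y).
Local Notation PT := (@PT _ _ _ _ S).
Local Notation QT := (@QT _ _ _ _ S).
Local Notation level := (@level _ _ _ _ S).
Context {HS : root_adae S}.
Local Notation QT_blinear := (@QT_blinear _ _ _ _ S HS).
Local Notation Bq_dual := (@Bq_dual _ _ _ _ S HS).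
Local Notation B_lin := (@B_lin _ _ _ _ S HS).
Local Notation phi_dom := (@phi_dom _ _ _ _ S HS).
Local Notation level_coordinates := (@level_coordinates _ _ _ _ S HS).
Implicit Types (T : 'I_n -> nat -> bool).

(** The range of a chain projector is finite-dimensional, so a map linear on D becomes bounded after
    it; this is how the unbounded A and B enter the implicit equations. *)
Lemma lin_PT_blinear (L : X -> Y) T :
  (forall (a : K) x y, dom S x -> dom S y -> L (a *: x + y) = a *: L x + L y) ->
  @blinear R rX rY (fun x => L (PT T x)).
Proof.
move=> Ll; rewrite (_ : (fun x => _) = fun x : rX =>
    \sum_(i < n) \sum_(s < m i | T i s) (Bq i s.+1 x *: L (φ i s.+1) : rY)).
  by apply: blinear_sum_fun => i _; apply: blinear_sum_fun => s _; apply: dual_blinear; apply: Bq_dual; exact: ltn_ord.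
apply/funext => x; rewrite /PT /chain_proj.
have d1 (i : 'I_n) (s : 'I_(m i)) : dom S (φ i s.+1) by apply: phi_dom; exact: ltn_ord.
have d2 (i : 'I_n) (s : 'I_(m i)) : dom S (Bq i s.+1 x *: φ i s.+1) by apply: domZ.
rewrite (lin_dom_sum Ll) => [|i _]; last by apply: dom_sum.
apply: eq_bigr => i _; rewrite (lin_dom_sum Ll) => [|s _//].
by apply: eq_bigr => s _; rewrite (lin_domZ Ll).
Qed.

Definition open_in (W M : set X) := forall x, M x -> exists2 d : R, 0 < d &
  forall y, W y -> nrm (y - x) < d -> M y.

(** Common form of the pairs of conditions 1.a, 2.a up to 1.d, 2.d: [u] gathers the components
    already known, [a] is the image under A of known derivatives, and [T1] selects the component
    sought. *)
Lemma implicit_step (k : nat) (Sd M : set X) T T1 (u : R -> rX) (a : R -> rY) :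
  (0 < k)%N -> (forall (i : 'I_n) s, (s < m i)%N -> T1 i s -> T i s) ->
  Sd `<=` level T -> open_in (level T) Sd ->
  M `<=` level T1 -> open_in (level T1) M ->
  Ck k Sd (level T) (fun t x => QT T1 (f t x)) ->
  (forall t, 0 <= t -> level T (u t)) -> smooth k u -> smooth k a ->
  (forall t, 0 <= t -> QT T1 (a t) = a t) ->
  (forall t z, 0 <= t -> M z -> Sd ((u t : X) + z)) ->
  (forall t, 0 <= t -> exists! z, M z /\ QT T1 (f t ((u t : X) + z)) - B z - a t = 0) ->
  (forall t z, 0 <= t -> M z -> QT T1 (f t ((u t : X) + z)) - B z - a t = 0 ->
     exists2 L, is_frechet Sd (level T) (QT T1 \o f t) ((u t : X) + z) L &
       has_bounded_inverse (level T1) (range (QT T1))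
         (fun h => L (PT T1 h) - QT T1 (B (PT T1 h)))) ->
  exists v : R -> rX, smooth k v /\ forall t, 0 <= t ->
    M (v t) /\ QT T1 (f t ((u t : X) + v t)) - B (v t) - a t = 0.
Proof.
move=> k0 T1T SdT Sdo MT1 Mo [G GP] Wu su sa Qa MS ex1 inv.
have [N [e_ [c_ HW]]] := level_coordinates T.
have [N1 [e1 [c1 HW1]]] := level_coordinates T1.
have W1W : level T1 `<=` level T by exact: level_sub.
have [v vP] : {v : R -> rX & forall t, 0 <= t ->
    (M (v t) /\ QT T1 (f t ((u t : X) + v t)) - B (v t) - a t = 0) /\
    forall z, M z -> QT T1 (f t ((u t : X) + z)) - B z - a t = 0 -> z = v t}.
  pose z0 t z := QT T1 (f t ((u t : X) + z)) - B z - a t = 0.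
  apply: (@choice R rX (fun t z => 0 <= t -> (M z /\ z0 t z) /\
    forall z', M z' -> z0 t z' -> z' = z)) => t.
  have [t0|t0] := leP 0 t; last by exists 0.
  by have [z [zP zu]] := ex1 t t0; exists z => _; split=> // z' Mz' hz'; rewrite (zu z').
exists v; split; last by move=> t t0; have [] := vP t t0.
pose g t (x : rX) : rY := QT T1 (f t x).
have GP' : @derivatives R rX rY k Sd (level T) g G := GP.
(* B is composed with the projector to be bounded on the whole space; on M nothing changes. *)
pose BB (x : rX) : rY := B (PT T1 x).
have BM z : M z -> BB z = B z by move=> /MT1; rewrite /BB => ->.
have QB (z : X) : QT T1 (B (PT T1 z)) = B (PT T1 z) by rewrite QT_B ?PT_idem//; exact: PT_dom.
have W0 : level T 0 by exact: level0.
have WP (b : R) (x y : rX) : level T x -> level T y -> level T (b *: x + y : rX) by exact: level_lin.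
have key t : 0 <= t -> exists Ti : rY -> rX, [/\ blinear Ti, forall y, level T1 (Ti y),
    forall h, level T1 h -> Ti (G 1%N t (u t + v t) [:: (0, h)] - BB h) = h &
    forall y, QT T1 y = y -> G 1%N t (u t + v t) [:: (0, Ti y)] - BB (Ti y) = y].
  move=> t0; have [[Mv v0] _] := vP t t0.
  have [L [Llin [CL Lb] Lap] [Lmap [Ti [Tlin [C Tb] Tmap [TL LT]]]]] := inv t _ t0 Mv v0.
  have Suv : Sd (u t + v t) by exact: MS.
  have LG h : level T h -> L h = G 1%N t (u t + v t) [:: (0, h)].
    apply: (@approx_unique R rX rY Sd (level T) (g t) (u t + v t) L
      (fun h => G 1%N t (u t + v t) [:: (0, h)])) => //.
    - exact: SdT.
    - move=> b y Wy; have := Llin b y 0 Wy W0; rewrite addr0 => ->.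
      have := Llin (-1) 0 0 W0 W0; rewrite scaler0 addr0 => L0.
      have := realZP (E := Y) (-1) (L 0).
      by rewrite scaleN1r => L1; rewrite L0 -L1 addNr addr0.
    - move=> b y Wy.
      have := deriv_family1_lin GP' k0 b t0 Suv Wy W0.
      rewrite addr0 => ->.
      have := deriv_family1_lin GP' k0 (-1) t0 Suv W0 W0.
      by rewrite scaler0 addr0 scaleN1r addNr => ->; rewrite addr0.
    - exact: Sdo.
    - move=> e e0; have [d d0 Hd] := strictly_differentiable HW SdT GP' k0 Sdo t0 Suv e0.
      exists d => // y Sy yd; apply: Hd => //; rewrite ?subrr ?normr0//; exact: SdT.
  exists (fun y => Ti (QT T1 y)).
  have Qr y : range (QT T1) (QT T1 y) by exists y.
  have bQ := QT_blinear T1.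
  split.
  - split=> [b x y|]; first by rewrite (blinearD bQ) (blinearZ bQ); exact: Tlin.
    have [CQ CQ0 HQ] := blinear_bound bQ.
    exists (`|C| * CQ) => [|x]; first by rewrite mulr_ge0// ltW.
    rewrite (le_trans (Tb _ (Qr x)))// -mulrA (le_trans (_ : _ <= `|C| * `|QT T1 x : rY|))//.
      by apply: ler_wpM2r; [exact: (normr_ge0 (QT T1 x : rY))|exact: ler_norm].
    exact: ler_wpM2l.
  - by move=> y; apply: Tmap.
  - move=> h Wh; have Wh' : level T h by exact: W1W.
    rewrite -LG// /BB -QB -{1}Wh; have [y _ yE] := Lmap h Wh.
    by rewrite -yE QT_idem yE TL.
  - move=> y Qy; have ry : range (QT T1) y by exists y.
    have Wt := Tmap _ ry; rewrite Qy -LG; last exact: W1W.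
    by rewrite /BB -QB -{1}Wt LT.
have [Ti TiP] : {Ti : R -> rY -> rX & forall t, 0 <= t -> [/\ blinear (Ti t), forall y, level T1 (Ti t y),
    forall h, level T1 h -> Ti t (G 1%N t (u t + v t) [:: (0, h)] - BB h) = h &
    forall y, QT T1 y = y -> G 1%N t (u t + v t) [:: (0, Ti t y)] - BB (Ti t y) = y]}.
  apply: (@choice R (rY -> rX) (fun t Ti => 0 <= t -> [/\ blinear Ti, forall y, level T1 (Ti y),
    forall h, level T1 h -> Ti (G 1%N t (u t + v t) [:: (0, h)] - BB h) = h &
    forall y, QT T1 y = y -> G 1%N t (u t + v t) [:: (0, Ti y)] - BB (Ti y) = y])) => t.
  have [t0|t0] := leP 0 t; last by exists (fun=> 0).
  by have [Ti HTi] := key t t0; exists Ti.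
apply: (@implicit_smooth R rX rY k Sd (level T) (level T1) g G N N1 e_ c_ e1 c1 HW HW1 W1W SdT GP' k0
  Sdo M BB (QT T1) u v a Ti) => //.
- exact: lin_PT_blinear B_lin.
- exact: QT_blinear.
- by move=> t t0; have [[]] := vP t t0.
- by move=> t t0; have [[Mv v0] _] := vP t t0; rewrite BM.
- by move=> t z t0 Mz; rewrite BM//; have [_] := vP t t0; exact.
- by move=> t x t0 _; exact: QT_idem.
- by move=> z _; exact: QB.
- by move=> t t0; have [] := TiP t t0.
- by move=> t y t0; have [] := TiP t t0.
- by move=> t h t0; have [_ _ + _] := TiP t t0; exact.
- by move=> t y t0; have [_ _ _ +] := TiP t t0; exact.
Qed.
End ImplicitStep.

Section LevelSums.
Variables (R : realType) (c : scalar_kind).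
Local Notation K := (scalar_field R c).
Variables (X Y : completeNormedModType K) (S : adae X Y).
Local Notation n := (nchains S).
Local Notation m := (@chain_len _ _ _ _ S).
Local Notation rX := (realify X).
Local Notation PT := (@PT _ _ _ _ S).
Local Notation level := (@level _ _ _ _ S).
Context {HS : root_adae S}.
Local Notation PT_blinear := (@PT_blinear _ _ _ _ S HS).
Implicit Types (T : 'I_n -> nat -> bool) (M : set X).

Lemma rel_openP (W M : set X) : rel_open W M -> M `<=` W /\ open_in W M.
Proof.
case=> O oO ->; split=> [x []//|x [Ox Wx]].
have : nbhs (x : rX) O by exact: (open_nbhs_nbhs (conj oO Ox)).
move=> /nbhs_ballP[d /= d0 dO]; exists d => // y Wy yx; split=> //; apply: dO.
by rewrite -ball_normE /ball_ /= distrC.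
Qed.

Lemma open_in_PT T M : open_in (level T) M -> forall x, M (PT T x) ->
  exists2 d : R, 0 < d & forall y, nrm (y - x) < d -> M (PT T y).
Proof.
move=> oM x Mx; have [d d0 Hd] := oM _ Mx; have bP := PT_blinear T.
have [C C0 HC] := blinear_bound bP.
exists (d / C) => [|y yx]; first exact: divr_gt0.
apply: Hd; first exact: level_PT.
have -> : PT T y - PT T x = PT T (y - x) by rewrite (blinearB bP).
by rewrite (le_lt_trans (HC _))// mulrC -ltr_pdivlMr.
Qed.

Lemma sumset_level lo hi (b : 'I_n -> nat -> bool) (M : nat -> set X) :
  (forall j, (lo <= j < hi)%N -> M j `<=` level (fun i s => (s == j) && b i s)) ->
  sumset lo hi M = [set x | level (fun i s => (lo <= s < hi)%N && b i s) x /\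
    forall j, (lo <= j < hi)%N -> M j (PT (fun i s => (s == j) && b i s) x)].
Proof.
move=> Ml; apply/seteqP; split=> [_ [u Mu ->]|x [lx Mx]].
  split=> [|j jr].
    rewrite big_nat; apply: level_sum => j jr; apply: (level_sub _ (Ml j jr _ (Mu j jr))).
    by move=> i s _ /andP[/eqP -> ->]; rewrite jr.
  have bP := PT_blinear (fun i s => (s == j) && b i s).
  rewrite (blinear_sum bP) (bigD1_seq j) ?mem_index_iota ?iota_uniq//=.
  rewrite big_nat_cond big1 => [|k /andP[kr kj]].
    by rewrite (Ml j jr _ (Mu j jr)) addr0; exact: Mu.
  apply: PT_level0 (Ml k kr _ (Mu k kr)) => i s _.
  by apply/negP => /andP[/andP[/eqP -> _] /andP[/eqP jk _]]; rewrite jk eqxx in kj.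
exists (fun j => PT (fun i s => (s == j) && b i s) x) => //.
rewrite -[LHS]lx; symmetry.
exact: (@chain_proj_sum _ _ _ _ _ _ _ (fun _ s => s) b).
Qed.

Lemma addset_level T T' T0 M M' : M `<=` level T -> M' `<=` level T' ->
  (forall (i : 'I_n) s, (s < m i)%N -> ~~ (T i s && T' i s)) ->
  (forall (i : 'I_n) s, (s < m i)%N -> T0 i s = T i s || T' i s) ->
  addset M M' = [set x | [/\ level T0 x, M (PT T x) & M' (PT T' x)]].
Proof.
move=> MT MT' TT' TT0.
have PTD x : PT T x + PT T' x = PT T0 x.
  by rewrite (eq_PT _ TT0); exact: chain_projD.
apply/seteqP; split=> [_ [x [y [Mx My ->]]]|x [lx Mx Mx']]; last first.
  by exists (PT T x), (PT T' x); split => //; rewrite PTD.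
have Tx : PT T x = x by exact: MT.
have Ty : PT T' y = y by exact: MT'.
have e1 : PT T (x + y) = x.
  rewrite (blinearD (PT_blinear T)) (PT_level0 _ (MT' _ My)) ?Tx ?addr0// => i s si.
  by rewrite andbC TT'.
have e2 : PT T' (x + y) = y.
  by rewrite (blinearD (PT_blinear T')) (PT_level0 _ (MT _ Mx)) ?Ty ?add0r.
split; rewrite ?e1 ?e2//; apply: levelD.
  by apply: level_sub (MT _ Mx) => i s si Ti; rewrite TT0// Ti.
by apply: level_sub (MT' _ My) => i s si Ti; rewrite TT0// Ti orbT.
Qed.

Lemma open_in_sumset lo hi (b : 'I_n -> nat -> bool) (M : nat -> set X) :
  (forall j, (lo <= j < hi)%N -> M j `<=` level (fun i s => (s == j) && b i s)) ->
  (forall j, (lo <= j < hi)%N -> open_in (level (fun i s => (s == j) && b i s)) (M j)) ->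
  open_in (level (fun i s => (lo <= s < hi)%N && b i s)) (sumset lo hi M).
Proof.
move=> Ml Mo; rewrite (sumset_level Ml) => x [lx Mx].
suff [d d0 Hd] : exists2 d : R, 0 < d & forall y, nrm (y - x) < d ->
    forall j, j \in index_iota lo hi -> M j (PT (fun i s => (s == j) && b i s) y).
  by exists d => // y Wy yx; split=> // j jr; apply: Hd => //; rewrite mem_index_iota.
have : {subset index_iota lo hi <= index_iota lo hi} by [].
elim: {1 3}(index_iota lo hi) => [|j r IH] jr; first by exists 1.
have [k kr|d d0 Hd] := IH; first by apply: jr; rewrite inE kr orbT.
have jr' : (lo <= j < hi)%N by rewrite -mem_index_iota; apply: jr; rewrite mem_head.
have [d' d'0 Hd'] := open_in_PT (Mo j jr') (Mx j jr').
exists (Num.min d d') => [|y]; first by rewrite lt_min d0.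
by rewrite lt_min => /andP[y1 y2] k; rewrite inE => /predU1P[->|]; [exact: Hd'|exact: Hd].
Qed.

Lemma open_in_addset T T' T0 M M' : M `<=` level T -> M' `<=` level T' ->
  (forall (i : 'I_n) s, (s < m i)%N -> ~~ (T i s && T' i s)) ->
  (forall (i : 'I_n) s, (s < m i)%N -> T0 i s = T i s || T' i s) ->
  open_in (level T) M -> open_in (level T') M' -> open_in (level T0) (addset M M').
Proof.
move=> MT MT' TT' TT0 oM oM'; rewrite (addset_level MT MT' TT' TT0) => x [lx Mx Mx'].
have [d d0 Hd] := open_in_PT oM Mx; have [d' d'0 Hd'] := open_in_PT oM' Mx'.
exists (Num.min d d') => [|y Wy]; first by rewrite lt_min d0.
by rewrite lt_min => /andP[y1 y2]; split => //; [exact: Hd|exact: Hd'].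
Qed.
End LevelSums.

Section Curves.
Variables (R : realType) (c : scalar_kind).
Local Notation K := (scalar_field R c).
Variables (X Y : completeNormedModType K) (S : adae X Y).
Local Notation A := (opA S).
Local Notation B := (opB S).
Local Notation ν := (nu S).
Local Notation n := (nchains S).
Local Notation m := (@chain_len _ _ _ _ S).
Local Notation f := (rhs S).
Local Notation rX := (realify X).
Local Notation rY := (realify Y).
Local Notation PT := (@PT _ _ _ _ S).
Local Notation QT := (@QT _ _ _ _ S).
Local Notation level := (@level _ _ _ _ S).
Context {HS : root_adae S}.
Local Notation QT_blinear := (@QT_blinear _ _ _ _ S HS).
Local Notation chain_bounds := (@chain_bounds _ _ _ _ S HS).
Local Notation A_lin := (@A_lin _ _ _ _ S HS).

(** Index sets of P_{2j}^{(j+1)}, P_{2 wedge, j} and P_{2j}. [Tds lo] and [Tws lo] belong to the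
    sums of the first two kinds over levels from lo on, and [Tdw lo] joins [Tds 1] with [Tws lo];
    [Tdw 1] is the index set of P_{2 Sigma}. *)
Definition Td (j : nat) : 'I_n -> nat -> bool := fun i s => (s == j) && (m i == s.+1).
Definition Tw (j : nat) : 'I_n -> nat -> bool := fun i s => (s == j) && (s.+1 < m i)%N.
Definition Ts (j : nat) : 'I_n -> nat -> bool := fun _ s => s == j.
Definition Tds lo : 'I_n -> nat -> bool := fun i s => (lo <= s < ν)%N && (m i == s.+1).
Definition Tws lo : 'I_n -> nat -> bool := fun i s => (lo <= s < ν.-1)%N && (s.+1 < m i)%N.
Definition Tdw lo : 'I_n -> nat -> bool := fun i s => Tds 1 i s || Tws lo i s.

Lemma P2d_PT s x : P2d S s x = PT (Td s) x.
Proof. by rewrite P2dE; apply: eq_PT => i s' _; rewrite /Td; case: (s' =P s) => // ->. Qed.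
Lemma Q2d_QT s y : Q2d S s y = QT (Td s) y.
Proof. by rewrite Q2dE; apply: eq_QT => i s' _; rewrite /Td; case: (s' =P s) => // ->. Qed.
Lemma P2w_PT s x : P2w S s x = PT (Tw s) x.
Proof. by rewrite P2wE; apply: eq_PT => i s' _; rewrite /Tw; case: (s' =P s) => // ->. Qed.
Lemma Q2S_QT s y : Q2S S s y = QT (Tw s) y.
Proof. by rewrite Q2SE; apply: eq_QT => i s' _; rewrite /Tw; case: (s' =P s) => // ->. Qed.

(** A chain that reaches level nu - 1 has the maximal length nu, so P_{2(nu-1)} is already
    P_{2(nu-1)}^{(nu)}. *)
Lemma last_level (i : 'I_n) s : (2 <= ν)%N -> (s < m i)%N -> (s == ν.-1) = Td ν.-1 i s.
Proof.
move=> ν2 si; rewrite /Td; case: (s =P ν.-1) => //= sE; have /andP[_ mν] := chain_bounds i.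
by symmetry; apply/eqP/anti_leq; rewrite si andbT sE prednK// (ltn_trans _ ν2).
Qed.
Lemma P2last_PT x : (2 <= ν)%N -> P2s S ν.-1 x = PT (Td ν.-1) x.
Proof. by move=> ν2; rewrite P2sE; apply: eq_PT => i s; exact: last_level. Qed.
Lemma Q2last_QT y : (2 <= ν)%N -> Q2s S ν.-1 y = QT (Td ν.-1) y.
Proof. by move=> ν2; rewrite Q2sE; apply: eq_QT => i s; exact: last_level. Qed.

Lemma D2d_level s : D2d S s = level (Td s).
Proof. by rewrite -PT_image; congr (_ @` _); apply/funext => x; exact: P2d_PT. Qed.
Lemma D2w_level s : D2w S s = level (Tw s).
Proof. by rewrite -PT_image; congr (_ @` _); apply/funext => x; exact: P2w_PT. Qed.
Lemma D2s_level s : D2s S s = level (Ts s).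
Proof. by rewrite -PT_image; congr (_ @` _); apply/funext => x; exact: P2sE. Qed.
Lemma D2last_level : (2 <= ν)%N -> D2s S ν.-1 = level (Td ν.-1).
Proof. by move=> ν2; rewrite -PT_image; congr (_ @` _); apply/funext => x; exact: P2last_PT. Qed.
Lemma Y2d_range s : Y2d S s = range (QT (Td s)).
Proof. by congr (_ @` _); apply/funext => x; exact: Q2d_QT. Qed.
Lemma Y2S_range s : Y2S S s = range (QT (Tw s)).
Proof. by congr (_ @` _); apply/funext => x; exact: Q2S_QT. Qed.
Lemma Y2last_range : (2 <= ν)%N -> Y2s S ν.-1 = range (QT (Td ν.-1)).
Proof. by move=> ν2; congr (_ @` _); apply/funext => x; exact: Q2last_QT. Qed.

Lemma sumset_D2d lo : sumset lo ν (D2d S) = level (Tds lo).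
Proof.
rewrite (@sumset_level _ _ _ _ S _ lo ν (fun i s => m i == s.+1)) => [|j _]; last by rewrite D2d_level.
apply/seteqP; split=> x; first by case.
by move=> lx; split=> // j _; rewrite D2d_level; exact: level_PT.
Qed.

Lemma sumset_D2w lo : sumset lo ν.-1 (D2w S) = level (Tws lo).
Proof.
rewrite (@sumset_level _ _ _ _ S _ lo ν.-1 (fun i s => s.+1 < m i)%N) => [|j _]; last by rewrite D2w_level.
apply/seteqP; split=> x; first by case.
by move=> lx; split=> // j _; rewrite D2w_level; exact: level_PT.
Qed.

Lemma Tds_Tws lo lo' (i : 'I_n) s : (s < m i)%N -> ~~ (Tds lo i s && Tws lo' i s).
Proof.
by move=> _; apply/negP => /andP[/andP[_ /eqP mi] /andP[_]]; rewrite mi ltnn.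
Qed.

Lemma addset_D lo : addset (sumset 1 ν (D2d S)) (sumset lo ν.-1 (D2w S)) = level (Tdw lo).
Proof.
rewrite sumset_D2d sumset_D2w (@addset_level _ _ _ _ S _ (Tds 1) (Tws lo) (Tdw lo))//.
  apply/seteqP; split=> x; first by case.
  by move=> lx; split => //; exact: level_PT.
exact: Tds_Tws.
Qed.

Variables (M20 : set X) (M2d M2w : nat -> set X).
Hypothesis HMo : M_open S M20 M2d M2w.

Lemma M20_open : M20 `<=` level (Ts 0) /\ open_in (level (Ts 0)) M20.
Proof. by have [/rel_openP + _ _] := HMo; rewrite D2s_level. Qed.
Lemma M2d_open j : (1 <= j < ν)%N -> M2d j `<=` level (Td j) /\ open_in (level (Td j)) (M2d j).
Proof. by move=> jr; have [_ /(_ j jr)/rel_openP + _] := HMo; rewrite D2d_level. Qed.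
Lemma M2w_open j : (1 <= j < ν.-1)%N -> M2w j `<=` level (Tw j) /\ open_in (level (Tw j)) (M2w j).
Proof. by move=> jr; have [_ _ /(_ j jr)/rel_openP] := HMo; rewrite D2w_level. Qed.

Lemma sumset_M2d_open lo : (1 <= lo)%N ->
  sumset lo ν M2d `<=` level (Tds lo) /\ open_in (level (Tds lo)) (sumset lo ν M2d).
Proof.
move=> lo1.
have H j : (lo <= j < ν)%N -> M2d j `<=` level (Td j) /\ open_in (level (Td j)) (M2d j).
  by move=> /andP[j1 j2]; apply: M2d_open; rewrite j2 (leq_trans lo1).
split; last by apply: (@open_in_sumset _ _ _ _ S _ lo ν (fun i s => m i == s.+1)) => j /H[].
by rewrite (@sumset_level _ _ _ _ S _ lo ν (fun i s => m i == s.+1)) => [x []//|j /H[]].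
Qed.

Lemma sumset_M2w_open lo : (1 <= lo)%N ->
  sumset lo ν.-1 M2w `<=` level (Tws lo) /\ open_in (level (Tws lo)) (sumset lo ν.-1 M2w).
Proof.
move=> lo1.
have H j : (lo <= j < ν.-1)%N -> M2w j `<=` level (Tw j) /\ open_in (level (Tw j)) (M2w j).
  by move=> /andP[j1 j2]; apply: M2w_open; rewrite j2 (leq_trans lo1).
split; last by apply: (@open_in_sumset _ _ _ _ S _ lo ν.-1 (fun i s => s.+1 < m i)%N) => j /H[].
by rewrite (@sumset_level _ _ _ _ S _ lo ν.-1 (fun i s => s.+1 < m i)%N) => [x []//|j /H[]].
Qed.

Lemma addset_M_open lo : (1 <= lo)%N ->
  addset (sumset 1 ν M2d) (sumset lo ν.-1 M2w) `<=` level (Tdw lo) /\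
  open_in (level (Tdw lo)) (addset (sumset 1 ν M2d) (sumset lo ν.-1 M2w)).
Proof.
move=> lo1; have [d1 d2] := sumset_M2d_open (leqnn 1); have [w1 w2] := sumset_M2w_open lo1.
split; last by apply: (open_in_addset d1 w1) => //; exact: Tds_Tws.
by rewrite (addset_level d1 w1 _ (T0 := Tdw lo)) => [x []//| |//]; exact: Tds_Tws.
Qed.

Lemma level_deriv T l (u : R -> rX) : (forall t, 0 <= t -> level T (u t)) -> smooth l.+1 u ->
  exists u' : R -> rX, [/\ forall t, 0 <= t -> deriv_on half_line u t (u' t), smooth l u' &
    forall t, level T (u' t)].
Proof.
move=> Tu su; have [N [e_ [c_ [h1 h2 h3 h4 h5]]]] := @level_coordinates _ _ _ _ S HS T.
exact: (smooth_in_W h1 h2 h3 h4 h5 Tu su).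
Qed.

Hypothesis Hsm : rhs_smooth S M2d M2w.
Hypotheses (H1a : condition_1a S M2d) (H1b : condition_1b S M2d).
Hypotheses (H1c : condition_1c S M2d M2w) (H1d : condition_1d S M2d M2w).
Hypotheses (H2a : condition_2a S M2d) (H2b : condition_2b S M2d).
Hypotheses (H2c : condition_2c S M2d M2w) (H2d : condition_2d S M2d M2w).

Lemma sum_with (E : zmodType) s hi (u : nat -> E) v : (s < hi)%N ->
  \sum_(s <= j < hi) [eta u with s |-> v] j = \sum_(s.+1 <= j < hi) u j + v.
Proof.
move=> sh; rewrite big_ltn//= eqxx addrC (@eq_big_nat _ _ _ _ _ _ u)//.
by move=> j /andP[sj _] /=; rewrite gtn_eqF.
Qed.

Lemma F2d_with s t (u : nat -> X) v : (s < ν)%N ->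
  F2d S s t [eta u with s |-> v] = QT (Td s) (f t (\sum_(s.+1 <= j < ν) u j + v)) - B v.
Proof. by move=> sν; rewrite /F2d sum_with//= eqxx Q2d_QT. Qed.

Lemma last_curve : (2 <= ν)%N -> exists v : R -> rX, smooth ν.-1 v /\
  forall t, 0 <= t -> M2d ν.-1 (v t) /\ QT (Td ν.-1) (f t (v t)) - B (v t) = 0.
Proof.
move=> ν2; have rg : (1 <= ν.-1 < ν)%N by move: (ν) ν2; case=> [|[|k]] //= _; rewrite leqnn.
have [Ml Mo] := M2d_open rg.
have [_ _ Hck] := Hsm; have {}Hck := Hck ν2.
have eqQ : (fun t x => Q2s S ν.-1 (f t x)) = (fun t x => QT (Td ν.-1) (f t x)).
  by apply/funext => t; apply/funext => x; rewrite Q2last_QT.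
have F0 t z : QT (Td ν.-1) (f t (0 + z)) - B z - 0 = F2last S t z.
  by rewrite add0r subr0 /F2last Q2last_QT.
have [|||||v [sv Hv]] := @implicit_step _ _ _ _ S HS ν.-1 (M2d ν.-1) (M2d ν.-1) (Td ν.-1) (Td ν.-1)
  (fun=> 0) (fun=> 0) _ (fun _ _ _ h => h) Ml Mo Ml Mo _ (fun _ _ => level0 _)
  (smooth_cst _ 0) (smooth_cst _ 0) (fun _ _ => blinear0 (QT_blinear _)).
- by have /andP[] := rg.
- by rewrite -eqQ -D2last_level.
- by move=> t z _; rewrite add0r.
- by move=> t t0; have [z [Mz zu]] := H1a ν2 t0; exists z; split=> [|z']; rewrite F0//; exact: zu.
- move=> t z t0 Mz; rewrite F0 add0r => /(H2a ν2 t0 Mz)[L HL1 HL2]; exists L.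
    rewrite -D2last_level// (_ : _ \o f t = Q2s S ν.-1 \o f t)//.
    by apply/funext => x /=; rewrite Q2last_QT.
  rewrite -D2last_level// -Y2last_range//.
  rewrite (_ : (fun h => _) = fun h => L (P2s S ν.-1 h) - Q2s S ν.-1 (B (P2s S ν.-1 h)))//.
  by apply/funext => h; rewrite Q2last_QT// P2last_PT.
exists v; split=> // t t0; have [Mv] := Hv t t0.
by rewrite add0r subr0.
Qed.

Lemma d_curve_step s (u : nat -> R -> rX) : (1 <= s < ν.-1)%N ->
  (forall j, (s < j < ν)%N -> smooth (ν - 2) (u j) /\ forall t, 0 <= t -> M2d j (u j t)) ->
  exists v : R -> rX, smooth (ν - 2) v /\ forall t, 0 <= t ->
    M2d s (v t) /\ F2d S s t [eta (fun j => u j t : X) with s |-> v t] = 0.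
Proof.
move=> sr uP; have /andP[s1 sν1] := sr.
have sν : (s < ν)%N by rewrite (leq_trans sν1)// leq_pred.
have rg : (1 <= s < ν)%N by rewrite s1.
have Mu t j : 0 <= t -> (s < j < ν)%N -> M2d j (u j t) by move=> t0 /uP[_]; exact.
have [Ml Mo] := M2d_open rg; have [Sl So] := sumset_M2d_open s1.
have [/(_ s sr) Hck _ _] := Hsm.
pose b t : rX := \sum_(s.+1 <= j < ν) u j t.
have sub j (i : 'I_n) s' : (s <= j < ν)%N -> Td j i s' -> Tds s i s'.
  by move=> jr /andP[/eqP -> /eqP mi]; rewrite /Tds jr mi eqxx.
have F0 t z : QT (Td s) (f t ((b t : X) + z)) - B z - 0 =
    F2d S s t [eta (fun j => u j t : X) with s |-> z].
  by rewrite subr0 F2d_with.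
have bz t z : 0 <= t -> M2d s z -> forall j, (s <= j < ν)%N ->
    M2d j ([eta (fun j => u j t : X) with s |-> z] j).
  move=> t0 Mz j /andP[sj jν] /=; have [->//|js] := eqVneq j s.
  by apply: Mu => //; move/eqP: js; lia.
have [||||||||v [sv Hv]] := @implicit_step _ _ _ _ S HS (ν - 2) (sumset s ν M2d) (M2d s) (Tds s) (Td s)
  b (fun=> 0) _ _ Sl So Ml Mo _ _ _ (smooth_cst _ 0) (fun _ _ => blinear0 (QT_blinear _)).
- lia.
- by move=> i s' _; apply: sub; rewrite leqnn.
- move: Hck; rewrite sumset_D2d; congr (Ck _ _ _ _).
  by apply/funext => t; apply/funext => x; rewrite Q2d_QT.
- move=> t t0; rewrite /b big_nat; apply: level_sum => j /andP[sj jν].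
  have [|Ml' _] := @M2d_open j; first by rewrite jν andbT (leq_trans _ sj).
  apply: (level_sub _ (Ml' _ (Mu t j t0 _))); last by rewrite sj.
  by move=> i s' _; apply: sub; rewrite jν (ltnW sj).
- apply: (@eq_smooth _ _ _ (fun t => \sum_(s.+1 <= j < ν | (s < j < ν)%N) u j t)).
    by move=> t _; rewrite -big_nat.
  by apply: smooth_sum => j /uP[].
- move=> t z t0 Mz; exists [eta (fun j => u j t : X) with s |-> z]; first exact: bz.
  by rewrite sum_with.
- move=> t t0; have [z [Mz zu]] := H1b sr t0 (fun j => @Mu t j t0).
  by exists z; split=> [|z']; rewrite F0//; exact: zu.
- move=> t z t0 Mz; rewrite F0 => /(H2b sr t0 (bz t z t0 Mz))[L HL1 HL2]; exists L.
    move: HL1; rewrite sumset_D2d sum_with//.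
    rewrite (_ : _ \o f t = QT (Td s) \o f t)//.
    by apply/funext => x /=; rewrite Q2d_QT.
  rewrite -D2d_level// -Y2d_range//.
  rewrite (_ : (fun h => _) = fun h => L (P2d S s h) - Q2d S s (B (P2d S s h)))//.
  by apply/funext => h; rewrite Q2d_QT// P2d_PT.
exists v; split=> // t t0; have [Mv] := Hv t t0.
by rewrite F0.
Qed.

Lemma eq_F2d s t (u v : nat -> X) : (s < ν)%N -> (forall j, (s <= j)%N -> u j = v j) ->
  F2d S s t u = F2d S s t v.
Proof.
move=> sν uv; rewrite /F2d (uv s)//; congr (Q2d _ _ (f t _) - _).
by apply: eq_big_nat => j /andP[sj _]; exact: uv.
Qed.

Lemma F2d_last t (u : nat -> X) : (2 <= ν)%N ->
  F2d S ν.-1 t u = QT (Td ν.-1) (f t (u ν.-1)) - B (u ν.-1).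
Proof.
move=> ν2; rewrite /F2d Q2d_QT big_ltn; last lia.
by rewrite big_geq ?addr0//; lia.
Qed.

Lemma d_curves : exists u : nat -> R -> rX, forall j, (1 <= j < ν)%N ->
  smooth (maxn j (ν - 2)) (u j) /\
  forall t, 0 <= t -> M2d j (u j t) /\ F2d S j t (fun j => u j t) = 0.
Proof.
have [ν1|ν2] := leqP ν 1; first by exists (fun _ _ => 0) => j jr; exfalso; lia.
suff [u uP] : exists u : nat -> R -> rX, forall j, (ν - ν.-1 <= j < ν)%N ->
    [/\ smooth (ν - 2) (u j), j = ν.-1 -> smooth ν.-1 (u j) &
      forall t, 0 <= t -> M2d j (u j t) /\ F2d S j t (fun j => u j t) = 0].
  exists u => j jr; have [|h2 h3 h4] := uP j; first lia.
  split=> //; have [jl|jl] := eqVneq j ν.-1; first by apply: smooth_le (h3 jl); lia.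
  by apply: smooth_le h2; move/eqP: jl; lia.
have : (1 <= ν.-1 <= ν.-1)%N by lia.
(* Induction on the number k of top levels already treated, which are those with j >= nu - k. *)
elim: {1 2 4}(ν.-1) => [|k IH] //; rewrite ltnS leq0n /= => kν.
have [->|k0] := posnP k.
  have [v [sv Hv]] := last_curve ν2; exists (fun _ => v) => j jr.
  have -> : j = ν.-1 by lia.
  split=> //; first by apply: smooth_le sv; lia.
  by move=> t t0; have [h1 h2] := Hv t t0; rewrite F2d_last.
have [|u uP] := IH; first lia.
pose s := (ν - k.+1)%N.
have sk : (s.+1 = ν - k)%N by rewrite /s; lia.
have sr : (1 <= s < ν.-1)%N by rewrite /s; lia.
have [j jr|v [sv Hv]] := @d_curve_step s u sr.
  have [|h2 _ h4] := uP j; first by rewrite -sk.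
  by split => // t /h4[].
exists [eta u with s |-> v] => j /andP[sj jν] /=; have [-> |js] := eqVneq j s.
  split => //; first lia.
  move=> t t0; have [Mv v0] := Hv t t0; split=> //; rewrite -[RHS]v0.
  apply: eq_F2d => [|i _ /=]; last by case: ifP.
    lia.
have jr : (ν - k <= j < ν)%N by move/eqP: js; lia.
have [h2 h3 h4] := uP j jr; split=> // t t0; have [h5 h6] := h4 t t0.
split=> //; rewrite -[RHS]h6; apply: eq_F2d => // i ji /=.
by rewrite gtn_eqF//; lia.
Qed.

Lemma level_Tw_last j x : (ν.-1 <= j)%N -> level (Tw j) x -> x = 0.
Proof.
move=> jl <-; apply: chain_proj_eq0 => i s si; have := chain_bounds i.
by apply: contraTF => /andP[/eqP -> jm]; lia.
Qed.

Lemma sumset_one (E : normedModType K) lo hi (M : nat -> set E) : hi = lo.+1 -> sumset lo hi M = M lo.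
Proof.
move=> ->; apply/seteqP; split=> [_ [u Mu ->]|x Mx].
  by rewrite big_nat1; apply: Mu; rewrite leqnn ltnSn.
by exists (fun=> x); [move=> j jr; have -> : j = lo by lia|rewrite big_nat1].
Qed.

Section WConditions.
Variables (s : nat) (t : R) (u w : nat -> X) (d dw : X).
Hypotheses (sr : (1 <= s < ν.-1)%N) (t0 : 0 <= t).
Hypotheses (Mu : forall j, (1 <= j < ν)%N -> M2d j (u j)).
Hypotheses (Mw : forall i, (s < i < ν.-1)%N -> M2w i (w i)).
Hypotheses (Dd : level (Td s.+1) d) (Ddw : level (Tw s.+1) dw).

Let Fw v := QT (Tw s) (f t (\sum_(1 <= j < ν) u j + \sum_(s.+1 <= i < ν.-1) w i + v))
  - B v - A (d + dw).

Let FwE v : F2S S s t u [eta w with s |-> v] d dw = Fw v.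
Proof.
rewrite /F2S /Fw sum_with ?addrA /= ?eqxx ?Q2S_QT//; last by case/andP: sr.
Qed.

Let last_eq : ~~ (s < ν - 2)%N -> [/\ s = (ν - 2)%N, ν.-1 = s.+1,
  \sum_(s.+1 <= i < ν.-1) w i = 0, dw = 0 & D2s S ν.-1 d].
Proof.
move=> ns; have sE : s = (ν - 2)%N by lia.
have lE : ν.-1 = s.+1 by lia.
split => //; [by rewrite lE big_geq|by apply: level_Tw_last Ddw; rewrite lE|].
by rewrite D2last_level; [rewrite lE|lia].
Qed.

Let Fw_last v : ~~ (s < ν - 2)%N -> F2S_last S t u v d = Fw v.
Proof.
by move=> /last_eq[sE _ sw dw0 _]; rewrite /F2S_last /Fw sw dw0 !addr0 -sE Q2S_QT.
Qed.

(** Conditions 1.c and 1.d in one: at s = nu - 2 the wedge components of level s + 1 vanish because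
    no chain is longer than nu, and F_{2 Sigma, nu-2} takes the general form. *)
Lemma w_zero_ex : exists! v, M2w s v /\ Fw v = 0.
Proof.
have [sl|/negP/negP sl] := boolP (s < ν - 2)%N.
  have [| | |v [Mv vu]] := H1d _ t0 Mu Mw (d := d) (dw := dw).
  - by case/andP: sr => ->.
  - by rewrite D2w_level.
  - by rewrite D2d_level.
  by exists v; split=> [|v']; rewrite -FwE//; exact: vu.
have [sE lE sw dw0 Ds] := last_eq sl; have ν3 : (3 <= ν)%N by lia.
have [v [Mv vu]] := H1c ν3 t0 Mu Ds.
by exists v; split=> [|v']; rewrite -Fw_last// sE//; exact: vu.
Qed.

Lemma w_zero_inv v : M2w s v -> Fw v = 0 ->
  exists2 L, is_frechet (addset (sumset 1 ν M2d) (sumset s ν.-1 M2w)) (level (Tdw s)) (QT (Tw s) \o f t)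
      (\sum_(1 <= j < ν) u j + \sum_(s.+1 <= i < ν.-1) w i + v) L &
    has_bounded_inverse (level (Tw s)) (range (QT (Tw s)))
      (fun h => L (PT (Tw s) h) - QT (Tw s) (B (PT (Tw s) h))).
Proof.
move=> Mv v0.
have eqL s' L : (fun h => L (P2w S s' h) - Q2S S s' (B (P2w S s' h))) =
    (fun h => L (PT (Tw s') h) - QT (Tw s') (B (PT (Tw s') h))).
  by apply/funext => h; rewrite Q2S_QT// P2w_PT.
have eqf s' : Q2S S s' \o f t = QT (Tw s') \o f t by apply/funext => x /=; rewrite Q2S_QT.
have [sl|/negP/negP sl] := boolP (s < ν - 2)%N.
  have [| | | | |L HL1 HL2] := H2d (s := s) _ t0 Mu (w := [eta w with s |-> v]) (d := d) (dw := dw).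
  - by case/andP: sr => ->.
  - move=> i ir /=; have [->//|is_] := eqVneq i s; apply: Mw; move/eqP: is_; lia.
  - by rewrite D2w_level.
  - by rewrite D2d_level.
  - by rewrite FwE.
  exists L; last by rewrite -eqL -D2w_level -Y2S_range.
  by move: HL1; rewrite addset_D eqf sum_with ?addrA//; case/andP: sr.
have [sE lE sw dw0 Ds] := last_eq sl; have ν3 : (3 <= ν)%N by lia.
have [||L HL1 HL2] := H2c ν3 t0 Mu (w := v) (d := d) _ Ds; first by rewrite -sE.
  by rewrite Fw_last.
move: HL1 HL2; rewrite -sE => HL1 HL2.
exists L; last by rewrite -eqL -D2w_level -Y2S_range.
by move: HL1; rewrite -(sumset_one M2w lE) -(sumset_one (D2w S) lE) addset_D eqf sw addr0.
Qed.
End WConditions.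

(** The equation F_{2 Sigma, j} = 0 along curves, with the derivatives of the components of level j
    + 1 in place of the free variables d. *)
Definition w_zero (u du w dw : nat -> R -> rX) j t :=
  QT (Tw j) (f t (\sum_(1 <= i < ν) (u i t : X) + \sum_(j.+1 <= i < ν.-1) (w i t : X) + w j t))
  - B (w j t) - A ((du j.+1 t : X) + dw j.+1 t) = 0.

Section WCurves.
Variables (u du : nat -> R -> rX).
Hypothesis uP : forall j, (1 <= j < ν)%N -> smooth (maxn j (ν - 2)) (u j) /\
  forall t, 0 <= t -> M2d j (u j t) /\ F2d S j t (fun j => u j t) = 0.
Hypothesis duP : forall j, (1 <= j < ν)%N -> [/\ forall t, 0 <= t -> deriv_on half_line (u j) t (du j t),
  smooth j.-1 (du j) & forall t, level (Td j) (du j t)].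

(** A is bounded on the finite-dimensional level s + 1 and the derivatives there are C^s, so the
    term A (du + dw) is a C^s perturbation of the implicit equation. *)
Lemma w_curve_step s (w dw : nat -> R -> rX) : (1 <= s < ν.-1)%N ->
  (forall j, (s < j < ν.-1)%N -> smooth j (w j) /\ forall t, 0 <= t -> M2w j (w j t)) ->
  smooth s (dw s.+1) -> (forall t, level (Tw s.+1) (dw s.+1 t)) ->
  exists v : R -> rX, smooth s v /\ forall t, 0 <= t -> M2w s (v t) /\
    QT (Tw s) (f t (\sum_(1 <= i < ν) (u i t : X) + \sum_(s.+1 <= i < ν.-1) (w i t : X) + v t))
    - B (v t) - A ((du s.+1 t : X) + dw s.+1 t) = 0.
Proof.
move=> sr wP sdw Ldw; have /andP[s1 sν1] := sr.
have [Ml Mo] := M2w_open sr; have [Sl So] := addset_M_open s1.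
have [_ /(_ s sr) Hck _] := Hsm.
have s1r : (1 <= s.+1 < ν)%N by lia.
have [_ sdu Ldu] := duP s1r.
have Mu t j : 0 <= t -> (1 <= j < ν)%N -> M2d j (u j t) by move=> t0 /uP[_ /(_ t t0)[]].
have Mw t j : 0 <= t -> (s < j < ν.-1)%N -> M2w j (w j t) by move=> t0 /wP[_ /(_ t t0)].
pose b t : rX := (\sum_(1 <= i < ν) (u i t : X)) + \sum_(s.+1 <= i < ν.-1) (w i t : X).
pose a t : rY := A ((du s.+1 t : X) + dw s.+1 t).
have La t : level (Ts s.+1) ((du s.+1 t : X) + dw s.+1 t).
  by apply: levelD; [apply: level_sub (Ldu t)|apply: level_sub (Ldw t)] => i s' _ /andP[].
have [|||||||||v [sv Hv]] := @implicit_step _ _ _ _ S HS s _ (M2w s) (Tdw s) (Tw s)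
  b a s1 _ Sl So Ml Mo _ _ _ _ _.
- move=> i s' _ /andP[/eqP -> mi]; rewrite /Tdw /Tws leqnn sν1 mi; exact: orbT.
- move: Hck; rewrite addset_D; congr (Ck _ _ _ _).
  by apply/funext => t; apply/funext => x; rewrite Q2S_QT.
- move=> t t0; apply: levelD; rewrite big_nat; apply: level_sum => j jr.
    have [Ml' _] := M2d_open jr; apply: (level_sub _ (Ml' _ (Mu t j t0 jr))).
    by move=> i s' _ /andP[/eqP -> mi]; rewrite /Tdw /Tds jr mi.
  have jr' : (1 <= j < ν.-1)%N by lia.
  have [Ml' _] := M2w_open jr'; apply: (level_sub _ (Ml' _ (Mw t j t0 jr))).
  move=> i s' _ /andP[/eqP -> mi]; rewrite /Tdw /Tws mi andbT; apply/orP; right; lia.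
- apply: smoothD.
    apply: (@eq_smooth _ _ _ (fun t => \sum_(1 <= j < ν | (1 <= j < ν)%N) u j t)).
      by move=> t _; rewrite -big_nat.
    by apply: smooth_sum => j jr; have [sj _] := uP jr; apply: smooth_le sj; lia.
  apply: (@eq_smooth _ _ _ (fun t => \sum_(s.+1 <= j < ν.-1 | (s < j < ν.-1)%N) w j t)).
    by move=> t _; rewrite -big_nat.
  by apply: smooth_sum => j jr; have [sj _] := wP j jr; apply: smooth_le sj; lia.
- have bA := @lin_PT_blinear _ _ _ _ S HS _ (Ts s.+1) A_lin.
  apply: (@eq_smooth R rY s ((fun x : rX => A (PT (Ts s.+1) x) : rY) \o (fun t => du s.+1 t + dw s.+1 t)) a).
    by move=> t _ /=; rewrite La.
  exact: (@smooth_blinear R rX rY s _ _ bA (smoothD sdu sdw)).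
- move=> t t0; rewrite /a QT_A; last exact: level_dom (La t).
  congr A; rewrite -[RHS](La t) -[in LHS](La t) PT_PT; apply: eq_PT => i s' s'm.
  by rewrite /Tw /Ts; case: (s' =P s.+1) => [E|]; rewrite ?andbF// E /= eqxx -E s'm.
- move=> t z t0 Mz; exists (\sum_(1 <= i < ν) (u i t : X)).
  exists (\sum_(s.+1 <= i < ν.-1) (w i t : X) + z); split; last by rewrite /b addrA.
    by exists (fun j => u j t : X) => // j; exact: Mu.
  exists [eta (fun j => w j t : X) with s |-> z]; last by rewrite sum_with.
  move=> j jr /=; have [->//|js] := eqVneq j s; apply: Mw => //; move/eqP: js; lia.
- move=> t t0; exact: (w_zero_ex sr t0 (fun j => @Mu t j t0) (fun j => @Mw t j t0) (Ldu t) (Ldw t)).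
- move=> t z t0 Mz z0.
  exact: (w_zero_inv sr t0 (fun j => @Mu t j t0) (fun j => @Mw t j t0) (Ldu t) (Ldw t) Mz z0).
by exists v.
Qed.
Lemma eq_w_zero (w dw w' dw' : nat -> R -> rX) j t :
  (forall i, (j <= i)%N -> w i t = w' i t) -> dw j.+1 t = dw' j.+1 t ->
  w_zero u du w dw j t -> w_zero u du w' dw' j t.
Proof.
move=> ww dd; rewrite /w_zero (ww j)// dd
  (@eq_big_nat _ _ _ j.+1 ν.-1 (fun i => w i t : X) (fun i => w' i t : X))//.
by move=> i /andP[ji _]; apply: ww; exact: ltnW.
Qed.

Lemma w_curves : exists w dw : nat -> R -> rX, forall j, (1 <= j)%N ->
  [/\ (j < ν.-1)%N -> forall t, 0 <= t -> M2w j (w j t) /\ w_zero u du w dw j t,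
      (ν.-1 <= j)%N -> forall t, w j t = 0,
      smooth j (w j),
      forall t, 0 <= t -> deriv_on half_line (w j) t (dw j t) &
      smooth j.-1 (dw j) /\ forall t, level (Tw j) (dw j t)].
Proof.
suff [w [dw H]] : exists w dw : nat -> R -> rX, forall j, (1 <= j)%N -> (ν.-1 - ν.-2 <= j)%N ->
  [/\ (j < ν.-1)%N -> forall t, 0 <= t -> M2w j (w j t) /\ w_zero u du w dw j t,
      (ν.-1 <= j)%N -> forall t, w j t = 0,
      smooth j (w j),
      forall t, 0 <= t -> deriv_on half_line (w j) t (dw j t) &
      smooth j.-1 (dw j) /\ forall t, level (Tw j) (dw j t)].
  by exists w, dw => j j1; apply: H => //; lia.
have : (ν.-2 <= ν.-2)%N by [].
elim: {1 3}(ν.-2) => [|k IH] kν.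
  (* The wedge levels from nu - 1 on are trivial, and the zero curve starts the descent. *)
  exists (fun _ _ => 0), (fun _ _ => 0) => j _; rewrite subn0 => jl; split=> //.
  - lia.
  - exact: smooth_cst.
  - by move=> t _; exact: deriv_on_cst.
  - by split=> [|t]; [exact: smooth_cst|exact: level0].
have [|w [dw H]] := IH; first exact: ltnW.
pose s := (ν.-1 - k.+1)%N.
have sk : (s.+1 = ν.-1 - k)%N by rewrite /s; lia.
have sr : (1 <= s < ν.-1)%N by rewrite /s; lia.
have [s1 sν] := andP sr.
have [|_ _ _ _ [sdw Ldw]] := H s.+1 (ltn0Sn _); first by rewrite sk.
have [j jr|v [sv Hv]] := w_curve_step sr _ sdw Ldw (w := w).
- have [| |h1 _ h3 _ _] := H j; [lia|lia|].
  by split=> // t t0; have /andP[_ jl] := jr; have [] := h1 jl t t0.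
have Lv t : 0 <= t -> level (Tw s) (v t).
  by move=> t0; have [Mv _] := Hv t t0; have [Ml _] := M2w_open sr; exact: Ml.
have [v' [dv sv' Lv']] : exists u' : R -> rX, [/\ forall t, 0 <= t -> deriv_on half_line v t (u' t),
    smooth s.-1 u' & forall t, level (Tw s) (u' t)].
  by apply: level_deriv => //; rewrite prednK.
exists [eta w with s |-> v], [eta dw with s |-> v'] => j j1 jk.
have [js|js] := eqVneq j s.
  rewrite js /= eqxx; split=> //; last lia.
  move=> _ t t0; have [Mv v0] := Hv t t0; split=> //; rewrite /w_zero /= eqxx gtn_eqF//.
  rewrite -[RHS]v0; congr (QT _ (f t (_ + _ + _)) - _ - _).
  by apply: eq_big_nat => i /andP[si _]; rewrite gtn_eqF.
have sj : (s < j)%N by move/eqP: js; lia.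
have [|h1 h2 h3 h4 h5] := H j j1; first by rewrite -sk.
rewrite /= (negbTE js); split=> // jl t t0; have [Mj zj] := h1 jl t t0; split=> //.
apply: eq_w_zero zj => [i ji|] /=; rewrite gtn_eqF//; lia.
Qed.
End WCurves.

Theorem level_curves : exists u du w dw : nat -> R -> rX,
  [/\ forall j t, (1 <= j < ν)%N -> 0 <= t -> [/\ M2d j (u j t),
        deriv_on half_line (u j) t (du j t) & F2d S j t (fun j => u j t) = 0],
      forall j t, (1 <= j < ν.-1)%N -> 0 <= t -> M2w j (w j t) /\ w_zero u du w dw j t,
      forall j t, (1 <= j)%N -> 0 <= t -> deriv_on half_line (w j) t (dw j t),
      forall j t, (1 <= j)%N -> level (Td j) (du j t) /\ level (Tw j) (dw j t) &
      forall j, (1 <= j)%N -> smooth 0 (du j) /\ smooth 0 (dw j)].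
Proof.
have [u uP] := d_curves.
have [du duP] : {du : nat -> R -> rX & forall j,
    [/\ (1 <= j < ν)%N -> forall t, 0 <= t -> deriv_on half_line (u j) t (du j t),
      smooth j.-1 (du j) & forall t, level (Td j) (du j t)]}.
  apply: (@choice _ _ (fun j u' =>
    [/\ (1 <= j < ν)%N -> forall t, 0 <= t -> deriv_on half_line (u j) t (u' t),
      smooth j.-1 u' & forall t, level (Td j) (u' t)])) => j.
  have [jr|jr] := boolP (1 <= j < ν)%N; last first.
    exists (fun=> 0); split; [by []|exact: smooth_cst|by move=> t; exact: level0].
  have [sj uj] := uP j jr; have [Ml _] := M2d_open jr.
  have [|u' [d1 d2 d3]] := @level_deriv (Td j) j.-1 (u j) (fun t t0 => Ml _ (uj t t0).1).
    by apply: smooth_le sj; lia.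
  by exists u'.
have [|w [dw H]] := @w_curves u du uP.
  by move=> j jr; have [h1 h2 h3] := duP j; split=> //; exact: h1.
exists u, du, w, dw; split.
- by move=> j t jr t0; have [_ /(_ t t0)[]] := uP j jr; have [h1 _ _] := duP j; split=> //; exact: h1.
- by move=> j t /andP[j1 jν] t0; have [h1 _ _ _ _] := H j j1; exact: h1.
- by move=> j t j1 t0; have [_ _ _ h1 _] := H j j1; exact: h1.
- by move=> j t j1; have [_ _ _ _ [_ h1]] := H j j1; have [_ _ h2] := duP j.
- move=> j j1; have [_ _ _ _ [h1 _]] := H j j1; have [_ h2 _] := duP j.
  by split; [apply: smooth_le h2|apply: smooth_le h1].
Qed.
End Curves.

Record admissible (R : realType) (c : scalar_kind)
    (X Y : completeNormedModType (scalar_field R c)) (S : adae X Y)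
    (M20 : set X) (M2d M2w : nat -> set X) : Prop := {
  ad_pencil : regular_pencil (dom S) (opA S) (opB S) (nu S);
  ad_cont : rhs_continuous S;
  ad_structure : rhs_structure S;
  ad_open : M_open S M20 M2d M2w;
  ad_smooth : rhs_smooth S M2d M2w;
  ad_1a : condition_1a S M2d;
  ad_1b : condition_1b S M2d;
  ad_1c : condition_1c S M2d M2w;
  ad_1d : condition_1d S M2d M2w;
  ad_1e : condition_1e S M20 M2d M2w;
  ad_2a : condition_2a S M2d;
  ad_2b : condition_2b S M2d;
  ad_2c : condition_2c S M2d M2w;
  ad_2d : condition_2d S M2d M2w;
  ad_2e : condition_2e_i S M20 M2d M2w \/ condition_2e_ii S M20 M2d M2w;
  ad_3 : condition_3 S M20 M2d M2w }.

Section AlgebraicPart.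
Variables (R : realType) (c : scalar_kind).
Local Notation K := (scalar_field R c).
Variables (X Y : completeNormedModType K) (S : adae X Y).
Local Notation A := (opA S).
Local Notation B := (opB S).
Local Notation ν := (nu S).
Local Notation n := (nchains S).
Local Notation m := (@chain_len _ _ _ _ S).
Local Notation f := (rhs S).
Local Notation rX := (realify X).
Local Notation PT := (@PT _ _ _ _ S).
Local Notation QT := (@QT _ _ _ _ S).
Local Notation level := (@level _ _ _ _ S).
Local Notation Td := (@Td _ _ _ _ S).
Local Notation Tw := (@Tw _ _ _ _ S).
Local Notation Ts := (@Ts _ _ _ _ S).
Local Notation Tds := (@Tds _ _ _ _ S).
Local Notation Tws := (@Tws _ _ _ _ S).
Local Notation Tdw := (@Tdw _ _ _ _ S).
Context {HS : root_adae S}.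
Local Notation PT_blinear := (@PT_blinear _ _ _ _ S HS).
Local Notation QT_blinear := (@QT_blinear _ _ _ _ S HS).
Local Notation chain_bounds := (@chain_bounds _ _ _ _ S HS).
Local Notation P1_blinear := (@P1_blinear _ _ _ _ S HS).
Variables (M20 : set X) (M2d M2w : nat -> set X).
Hypothesis Had : admissible S M20 M2d M2w.
Local Notation MM := (MM S M20 M2d M2w).
Local Notation MS := (MS S M2d M2w).

Lemma Tdw1 (i : 'I_n) s : (s < m i)%N -> Tdw 1 i s = (0 < s)%N.
Proof. by rewrite /Tdw /Tds /Tws; have := chain_bounds i; lia. Qed.

Lemma P2S_PT x : P2S S x = PT (Tdw 1) x.
Proof. by rewrite P2SE; apply: eq_PT => i s si; rewrite Tdw1. Qed.

Lemma MS_level : MS `<=` level (Tdw 1) /\ open_in (level (Tdw 1)) MS.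
Proof. exact: (addset_M_open (ad_open Had)). Qed.

Lemma MS_M z : MS z -> (forall j, (1 <= j < ν)%N -> M2d j (PT (Td j) z)) /\
  (forall j, (1 <= j < ν.-1)%N -> M2w j (PT (Tw j) z)).
Proof.
have Ho := ad_open Had.
have [d1 _] := sumset_M2d_open Ho (leqnn 1); have [w1 _] := sumset_M2w_open Ho (leqnn 1).
rewrite /Pilot.Defs.MS (@addset_level _ _ _ _ S _ _ _ (Tdw 1) _ _ d1 w1)//; last exact: Tds_Tws.
rewrite (@sumset_level _ _ _ _ S _ 1 ν (fun i s => m i == s.+1)); last by move=> j /(M2d_open Ho)[].
rewrite (@sumset_level _ _ _ _ S _ 1 ν.-1 (fun i s => s.+1 < m i)%N); last by move=> j /(M2w_open Ho)[].
move=> [_ [_ Hd] [_ Hw]]; split=> j jr.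
  have := Hd j jr; rewrite PT_PT; congr (M2d _ _); apply: eq_PT => i s _.
  by rewrite /Tds /Td; case: (s =P j) => // ->; rewrite jr /=; case: eqP.
have := Hw j jr; rewrite PT_PT; congr (M2w _ _); apply: eq_PT => i s _.
by rewrite /Tws /Tw; case: (s =P j) => // ->; rewrite jr /=; case: leqP.
Qed.

Lemma decomposition x : x = P1 S x + PT (Ts 0) x + P2S S x.
Proof.
rewrite P2S_PT P1E -addrA; set T := (fun=> _).
suff -> : PT (Ts 0) x + PT (Tdw 1) x = PT T x by rewrite subrK.
rewrite /PT chain_projD => [|i s si]; last first.
  by rewrite Tdw1// /Ts; case: s {si}.
by apply: eq_PT => i s si; rewrite Tdw1// /Ts; case: s {si}.
Qed.

Lemma MM_P x : MM x <-> [/\ dom S x, M20 (PT (Ts 0) x) & MS (P2S S x)].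
Proof.
have [M0l _] := M20_open (ad_open Had); have [Ml _] := MS_level.
have bP0 := PT_blinear (Ts 0); have bPS := PT_blinear (Tdw 1).
split; last first.
  move=> [dx h0 hS]; exists (P1 S x + PT (Ts 0) x), (P2S S x).
  split=> //; last exact: decomposition.
  by exists (P1 S x), (PT (Ts 0) x); split=> //; exists x.
move=> [_ [z [[x1 [x0 [Dx1 Mx0 ->]]] Mz ->]]].
have [dx1 _] := (D1P x1).1 Dx1; have lx0 := M0l _ Mx0; have lz := Ml _ Mz.
have e1 : PT (Ts 0) (x1 + x0 + z) = x0.
  rewrite !(blinearD bP0) (D1_PT _ Dx1) lx0 (PT_level0 _ lz) ?add0r ?addr0// => i s si.
  by rewrite Tdw1// /Ts; case: s {si}.
have e2 : P2S S (x1 + x0 + z) = z.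
  rewrite P2S_PT !(blinearD bPS) (D1_PT _ Dx1) lz (PT_level0 _ lx0) ?add0r// => i s si.
  by rewrite Tdw1// /Ts; case: s {si}.
rewrite e1 e2; split=> //.
by apply: domD; [apply: domD => //; exact: level_dom lx0|exact: level_dom lz].
Qed.

Lemma MM_dom x : MM x -> dom S x. Proof. by case/MM_P. Qed.

Lemma MM_sum x1 x0 z : D1 S x1 -> M20 x0 -> MS z -> MM (x1 + x0 + z).
Proof. by move=> D M0 Mz; exists (x1 + x0), z; split=> //; exists x1, x0. Qed.

Lemma P1_sum x1 x0 z : D1 S x1 -> level (Ts 0) x0 -> level (Tdw 1) z -> P1 S (x1 + x0 + z) = x1.
Proof.
move=> /D1P[_ e1] l0 lz; rewrite !(blinearD P1_blinear) e1 -[x0]l0 -[z]lz !P1_PT.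
by rewrite !addr0.
Qed.

Lemma MM_open : open_in (dom S) MM.
Proof.
move=> x /MM_P[dx M0 Mz]; rewrite P2S_PT in Mz.
have [_ o0] := M20_open (ad_open Had); have [_ oS] := MS_level.
have [d d0 Hd] := open_in_PT o0 M0; have [d' d'0 Hd'] := open_in_PT oS Mz.
exists (Num.min d d') => [|y dy]; first by rewrite lt_min d0.
rewrite lt_min => /andP[y1 y2]; apply/MM_P; rewrite P2S_PT.
by split=> //; [exact: Hd|exact: Hd'].
Qed.

Lemma MM_M x : MM x -> (forall j, (1 <= j < ν)%N -> M2d j (P2d S j x)) /\
  (forall j, (1 <= j < ν.-1)%N -> M2w j (P2w S j x)).
Proof.
move=> /MM_P[_ _ /MS_M[Hd Hw]]; split=> j jr; have /andP[j1 _] := jr.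
  have := Hd j jr; rewrite P2d_PT P2S_PT PT_PT; congr (M2d _ _); apply: eq_PT => i s si.
  by rewrite Tdw1// /Td; case: (s =P j) => //= ->; rewrite j1 andbT.
have := Hw j jr; rewrite P2w_PT P2S_PT PT_PT; congr (M2w _ _); apply: eq_PT => i s si.
by rewrite Tdw1// /Tw; case: (s =P j) => //= ->; rewrite j1 andbT.
Qed.

Lemma P2S_sum x : P2S S x = \sum_(1 <= j < ν) P2d S j x + \sum_(1 <= j < ν.-1) P2w S j x.
Proof.
rewrite P2S_PT sum_P2dE sum_P2wE /PT chain_projD// => i s si.
by have := @Tds_Tws _ _ _ _ S 1 1 i s si.
Qed.

Lemma QT_disjoint T T' y : (forall (i : 'I_n) s, (s < m i)%N -> ~~ (T i s && T' i s)) ->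
  QT T (QT T' y) = 0.
Proof. by move=> TT; rewrite QT_QT; apply: chain_proj_eq0 => i s /TT /negbTE. Qed.

(** The projector annihilates every other term of the structure hypothesis, their index sets being
    disjoint from its own. The structure of f enters through this identity and the next one. *)
Lemma rhs_Q2d s t x : (1 <= s < ν)%N -> 0 <= t -> dom S x ->
  Q2d S s (f t x) = Q2d S s (f t (\sum_(s <= j < ν) P2d S j x)).
Proof.
move=> sr t0 dx; rewrite {1}(ad_structure Had t0 dx) Q2d_QT.
have bQ := QT_blinear (Td s).
rewrite 3!(blinearD bQ) QT_Q1 Q2sE QT_disjoint => [|i k _]; last first.
  by rewrite /Td /Ts; lia.
rewrite add0r !(blinear_sum bQ) big1 ?add0r => [|j _]; last first.
  rewrite Q2S_QT QT_disjoint// => i k _; rewrite /Td /Tw.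
  by apply/negP => /andP[/andP[_ /eqP ->] /andP[_]]; rewrite ltnn.
rewrite (bigD1_seq s) ?mem_index_iota ?iota_uniq//= [X in _ + X = _]big1 => [|j js].
  by rewrite addr0 Q2d_QT QT_idem.
rewrite Q2d_QT QT_disjoint// => i k _; rewrite /Td.
by apply/negP => /andP[/andP[/eqP -> _] /andP[/eqP sj _]]; rewrite sj eqxx in js.
Qed.

Lemma rhs_Q2S s t x : (1 <= s < ν.-1)%N -> 0 <= t -> dom S x ->
  Q2S S s (f t x) =
  Q2S S s (f t (\sum_(1 <= j < ν) P2d S j x + \sum_(s <= j < ν.-1) P2w S j x)).
Proof.
move=> sr t0 dx; rewrite {1}(ad_structure Had t0 dx) Q2S_QT.
have bQ := QT_blinear (Tw s).
rewrite 3!(blinearD bQ) QT_Q1 Q2sE QT_disjoint => [|i k _]; last first.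
  by rewrite /Tw /Ts; lia.
rewrite !add0r !(blinear_sum bQ) [X in _ + X]big1 ?addr0 => [|j _]; last first.
  rewrite Q2d_QT QT_disjoint// => i k _; rewrite /Td /Tw.
  by apply/negP => /andP[/andP[_ km] /andP[_ /eqP mE]]; rewrite mE ltnn in km.
rewrite (bigD1_seq s) ?mem_index_iota ?iota_uniq//= [X in _ + X = _]big1 => [|j js].
  by rewrite addr0 Q2S_QT QT_idem.
rewrite Q2S_QT QT_disjoint// => i k _; rewrite /Tw.
by apply/negP => /andP[/andP[/eqP -> _] /andP[/eqP sj _]]; rewrite sj eqxx in js.
Qed.

(** Conditions 1.a and 1.b in one, the former being the case s = nu - 1. *)
Lemma d_unique s t (p : nat -> X) v v' : (1 <= s < ν)%N -> 0 <= t ->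
  (forall j, (s < j < ν)%N -> M2d j (p j)) -> M2d s v -> M2d s v' ->
  F2d S s t [eta p with s |-> v] = 0 -> F2d S s t [eta p with s |-> v'] = 0 -> v = v'.
Proof.
move=> sr t0 Mp Mv Mv' v0 v'0; have [sl|sl] := boolP (s < ν.-1)%N.
  have [|z [_ zu]] := ad_1b Had (s := s) _ t0 Mp; first by case/andP: sr => ->.
  by rewrite -(zu v)// -(zu v').
have sE : s = ν.-1 by lia.
have ν2 : (2 <= ν)%N by lia.
have [z [_ zu]] := ad_1a Had ν2 t0.
have last0 z' : F2d S s t [eta p with s |-> z'] = F2last S t z'.
  by rewrite sE F2d_last//= eqxx /F2last Q2last_QT.
move: v0 v'0 Mv Mv'; rewrite !last0 sE => v0 v'0 Mv Mv'.
by rewrite -(zu v)// -(zu v').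
Qed.

Variables (u du w dw : nat -> R -> rX).
Hypothesis uP : forall j t, (1 <= j < ν)%N -> 0 <= t -> [/\ M2d j (u j t),
  deriv_on half_line (u j) t (du j t) & F2d S j t (fun j => u j t) = 0].
Hypothesis wP : forall j t, (1 <= j < ν.-1)%N -> 0 <= t ->
  M2w j (w j t) /\ @w_zero _ _ _ _ S u du w dw j t.
Hypothesis dP : forall j t, (1 <= j)%N -> level (Td j) (du j t) /\ level (Tw j) (dw j t).

(** Descent through the levels: once the components above s agree with the curves, uniqueness in the
    equation of level s forces agreement at s. *)
Lemma d_part_unique t x : 0 <= t -> MM x ->
  (forall s, (1 <= s < ν)%N -> Q2d S s (f t x) = B (P2d S s x)) ->
  forall s, (1 <= s < ν)%N -> P2d S s x = u s t.
Proof.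
move=> t0 Mx Hx; have [Hd _] := MM_M Mx; have dx := MM_dom Mx.
suff H k s : (ν - k <= s)%N -> (1 <= s < ν)%N -> P2d S s x = u s t.
  by move=> s sr; apply: (H ν) => //; rewrite subnn.
elim: k s => [|k IH] s sk sr; first lia.
have Mu j : (1 <= j < ν)%N -> M2d j (u j t) by move=> jr; have [] := uP jr t0.
have [_ _ u0] := uP sr t0.
apply: (@d_unique s t (fun j => u j t)) => //; [by move=> j jr; apply: Mu; lia|exact: Hd|exact: Mu| |].
  rewrite F2d_with; last lia.
  have -> : \sum_(s.+1 <= j < ν) (u j t : X) + P2d S s x = \sum_(s <= j < ν) P2d S j x.
    rewrite [RHS]big_ltn; last lia.
    rewrite addrC; congr (_ + _); apply: eq_big_nat => j jr; rewrite IH//; lia.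
  by rewrite -Q2d_QT -rhs_Q2d// Hx// subrr.
rewrite -[RHS]u0; apply: eq_F2d => [|j _ /=]; [lia|by case: eqP => [->|]].
Qed.

Lemma w_part_step s t x : (1 <= s < ν.-1)%N -> 0 <= t -> MM x ->
  (forall j, (1 <= j < ν)%N -> P2d S j x = u j t) ->
  (forall j, (s < j < ν.-1)%N -> P2w S j x = w j t) ->
  Q2S S s (f t x) = B (P2w S s x) + A ((du s.+1 t : X) + dw s.+1 t) ->
  P2w S s x = w s t.
Proof.
move=> sr t0 Mx Pu IH Hx; have [_ Hw] := MM_M Mx; have dx := MM_dom Mx.
have Mu j : (1 <= j < ν)%N -> M2d j (u j t) by move=> jr; have [] := uP jr t0.
have Mw j : (s < j < ν.-1)%N -> M2w j (w j t).
  by move=> jr; have [|] := @wP j t _ t0; first lia.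
have [Ld _] := dP t (ltn0Sn s); have [_ Lw] := dP t (ltn0Sn s).
have [z [_ zu]] := w_zero_ex (ad_1c Had) (ad_1d Had) sr t0 Mu Mw Ld Lw.
have [Mws w0] := wP sr t0.
rewrite -(zu (w s t))// -(zu (P2w S s x))//; split; first exact: Hw.
have -> : \sum_(1 <= j < ν) (u j t : X) + \sum_(s.+1 <= i < ν.-1) (w i t : X) + P2w S s x =
    \sum_(1 <= j < ν) P2d S j x + \sum_(s <= j < ν.-1) P2w S j x.
  have -> : \sum_(s <= j < ν.-1) P2w S j x = \sum_(s.+1 <= j < ν.-1) P2w S j x + P2w S s x.
    by rewrite [LHS]big_ltn 1?addrC//; case/andP: sr.
  rewrite [RHS]addrA; congr (_ + _); congr (_ + _); apply: eq_big_nat => j jr; first by rewrite Pu.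
  by rewrite IH//; lia.
by rewrite -Q2S_QT -rhs_Q2S// Hx// [X in X - _ - _ = _]addrC addrK subrr.
Qed.

(* The component x_{2 Sigma} of every solution with values in M. *)
Definition sigma_part (t : R) : rX :=
  \sum_(1 <= j < ν) (u j t : X) + \sum_(1 <= j < ν.-1) (w j t : X).

Lemma sigma_part_MS t : 0 <= t -> MS (sigma_part t).
Proof.
move=> t0; exists (\sum_(1 <= j < ν) (u j t : X)), (\sum_(1 <= j < ν.-1) (w j t : X)).
split=> //; [exists (fun j => u j t : X)|exists (fun j => w j t : X)] => // j jr.
  by have [] := uP jr t0.
by have [] := wP jr t0.
Qed.

Lemma sigma_components t x : 0 <= t -> P2S S x = sigma_part t ->
  (forall s, (1 <= s < ν)%N -> P2d S s x = u s t) /\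
  (forall s, (1 <= s < ν.-1)%N -> P2w S s x = w s t).
Proof.
move=> t0 xE; have Ho := ad_open Had.
have lu j : (1 <= j < ν)%N -> level (Td j) (u j t).
  by move=> jr; have [Mu _ _] := uP jr t0; have [Ml _] := M2d_open Ho jr; exact: Ml.
have lw j : (1 <= j < ν.-1)%N -> level (Tw j) (w j t).
  by move=> jr; have [Mw _] := wP jr t0; have [Ml _] := M2w_open Ho jr; exact: Ml.
have PS (T : 'I_n -> nat -> bool) : (forall (i : 'I_n) s, (s < m i)%N -> T i s -> (0 < s)%N) ->
    PT T x = PT T (sigma_part t).
  move=> T0; rewrite -xE P2S_PT PT_PT; apply: eq_PT => i s si; rewrite Tdw1//.
  by have := T0 i s si; case: (T i s) => // ->.
split=> s sr; [rewrite P2d_PT PS|rewrite P2w_PT PS]; try by move=> i k _ /andP[/eqP -> _]; lia.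
  have bP := PT_blinear (Td s).
  rewrite /sigma_part (blinearD bP) !(blinear_sum bP).
  rewrite (bigD1_seq s) ?mem_index_iota ?iota_uniq//= (lu s sr) big_nat_cond big1 => [|j /andP[jr js]].
    rewrite addr0 big_nat big1 ?addr0// => j jr; apply: PT_level0 (lw j jr) => i k _.
    by rewrite /Tw /Td; lia.
  by apply: PT_level0 (lu j jr) => i k _; rewrite /Td; lia.
have bP := PT_blinear (Tw s).
rewrite /sigma_part (blinearD bP) !(blinear_sum bP) addrC.
rewrite (bigD1_seq s) ?mem_index_iota ?iota_uniq//= (lw s sr) big_nat_cond big1 => [|j /andP[jr js]].
  rewrite addr0 big_nat big1 ?addr0// => j jr; apply: PT_level0 (lu j jr) => i k _.
  by rewrite /Tw /Td; lia.
by apply: PT_level0 (lw j jr) => i k _; rewrite /Tw; lia.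
Qed.

(** Converse direction: the curves were built from these equations, and the structure of f leaves
    the components x_1 and x_{20} of x free. *)
Lemma sigma_zeros t x : 0 <= t -> dom S x -> P2S S x = sigma_part t ->
  (forall s, (1 <= s < ν)%N -> Q2d S s (f t x) = B (P2d S s x)) /\
  (forall s, (1 <= s < ν.-1)%N ->
     Q2S S s (f t x) = B (P2w S s x) + A ((du s.+1 t : X) + dw s.+1 t)).
Proof.
move=> t0 dx xE; have [Pu Pw] := sigma_components t0 xE.
split=> s sr.
  have [_ _ u0] := uP sr t0; rewrite rhs_Q2d// (Pu s sr).
  apply/eqP; rewrite -subr_eq0 -u0; apply/eqP; congr (Q2d _ _ (f t _) - _).
  by apply: eq_big_nat => j jr; rewrite Pu//; lia.
have [_ w0] := wP sr t0; rewrite rhs_Q2S// (Pw s sr).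
apply/eqP; rewrite -subr_eq0 opprD addrA -w0; apply/eqP.
rewrite Q2S_QT; congr (QT _ (f t _) - _ - _).
have -> : \sum_(s <= j < ν.-1) P2w S j x = \sum_(s.+1 <= j < ν.-1) P2w S j x + P2w S s x.
  by rewrite [LHS]big_ltn 1?addrC//; case/andP: sr.
rewrite [LHS]addrA (Pw s sr); congr (_ + _); congr (_ + _); apply: eq_big_nat => j jr.
  by rewrite Pu.
by rewrite Pw//; lia.
Qed.
End AlgebraicPart.

(** * The component x_{20} as a function of time and x_1 *)

Section StrictPartials.
Variable R : realType.

(** Only the derivative in x is available, so both points are taken at the same time s, and the
    segment between them is handled by the mean value estimate. *)
Lemma partial_strict (E F : normedModType R) (S W : set E) (g : R -> E -> F)
    (dg : R -> E -> E -> F) (t : R) (x : E) (e : R) :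
  (forall (a : R) y z, W y -> W z -> W (a *: y + z)) -> S `<=` W ->
  (forall y, S y -> exists2 d : R, 0 < d & forall z, W z -> `|z - y| < d -> S z) ->
  (forall s y, 0 <= s -> S y ->
     (forall (a : R) h, W h -> dg s y (a *: h) = a *: dg s y h) /\
     forall e : R, 0 < e -> exists2 d : R, 0 < d & forall z, S z -> `|z - y| < d ->
       `|g s z - g s y - dg s y (z - y)| <= e * `|z - y|) ->
  (forall e : R, 0 < e -> exists2 d : R, 0 < d & forall s y, 0 <= s -> `|s - t| < d ->
     S y -> `|y - x| < d -> forall h, W h -> `|dg s y h - dg t x h| <= e * `|h|) ->
  0 <= t -> S x -> 0 < e ->
  exists2 d : R, 0 < d & forall s y y', 0 <= s -> `|s - t| < d -> W y -> W y' ->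
    `|y - x| < d -> `|y' - x| < d ->
    [/\ S y, S y' & `|g s y - g s y' - dg t x (y - y')| <= e * `|y - y'|].
Proof.
move=> WP SW So Dg Cg t0 Sx e0; have [d1 d10 H1] := So x Sx; have [d2 d20 H2] := Cg e e0.
have W0 : W 0 by have := WP (-1) x x (SW x Sx) (SW x Sx); rewrite scaleN1r addNr.
exists (Num.min d1 d2) => [|s y y' s0]; first by rewrite lt_min d10.
rewrite !lt_min => /andP[_ sd] Wy Wy' /andP[y1 y2] /andP[y'1 y'2].
pose h := y - y'; have Wh : W h.
  by have := WP (-1) y' y Wy' Wy; rewrite scaleN1r addrC.
have seg (d : R) r : `|y - x| < d -> `|y' - x| < d -> 0 <= r <= 1 -> `|y' + r *: h - x| < d.
  move=> k1 k2 /andP[r0 r1].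
  rewrite (_ : _ - x = r *: (y - x) + (1 - r) *: (y' - x)); last first.
    rewrite /h; lmod_over R E.
  rewrite (le_lt_trans (ler_normD _ _))// !normrZ (ger0_norm r0) (@ger0_norm _ (1 - r)) ?subr_ge0//.
  have := normr_ge0 (y - x); have := normr_ge0 (y' - x) => q1 q2.
  pose mx := Num.max `|y - x| `|y' - x|.
  have m1 : `|y - x| <= mx by rewrite le_max lexx.
  have m2 : `|y' - x| <= mx by rewrite le_max lexx orbT.
  have md : mx < d by rewrite gt_max k1.
  have p1 : r * `|y - x| <= r * mx by exact: ler_wpM2l.
  have p2 : (1 - r) * `|y' - x| <= (1 - r) * mx by apply: ler_wpM2l; rewrite ?subr_ge0.
  lra.
have Wseg r : W (y' + r *: h) by rewrite addrC; exact: WP.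
have Sseg r : 0 <= r <= 1 -> S (y' + r *: h) by move=> r01; apply: H1 => //; exact: seg.
have e1 : y' + 1 *: h = y by rewrite scale1r addrC subrK.
have e2 : y' + 0 *: h = y' by rewrite scale0r addr0.
split; [by rewrite -e1; apply: Sseg; rewrite ler01 lexx|by rewrite -e2; apply: Sseg; rewrite ler01 lexx|].
have := @mean_value01 R F (fun r => g s (y' + r *: h)) (fun r => dg s (y' + r *: h) h)
  (dg t x h) (e * `|h|).
rewrite e1 e2; apply => r r01; last by apply: H2 => //; [exact: Sseg|exact: seg].
have [lin ap] := Dg s (y' + r *: h) s0 (Sseg r r01).
move=> e' e'0; have q0 : 0 < e' / (`|h| + 1) by rewrite divr_gt0// ltr_wpDl.
have [d d0 Hd] := ap _ q0; exists (d / (`|h| + 1)) => [|p]; first by rewrite divr_gt0// ltr_wpDl.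
rewrite /= in_itv/= => p01; rewrite ltr_pdivlMr ?ltr_wpDl// => pr.
have E1 : y' + p *: h - (y' + r *: h) = (p - r) *: h by lmod_over R E.
have := Hd _ (Sseg p p01); rewrite E1 normrZ lin//.
have hle : `|p - r| * `|h| <= `|p - r| * (`|h| + 1) by apply: ler_wpM2l => //; rewrite lerDl.
move=> /(_ (le_lt_trans hle pr)) /le_trans; apply.
rewrite mulrAC ler_pdivrMr ?ltr_wpDl// -mulrA; apply: ler_wpM2l; first exact: ltW.
exact: hle.
Qed.
End StrictPartials.

Section OperatorNorm.
Variables (R : realType) (c : scalar_kind).
Local Notation K := (scalar_field R c).
Variables E F : normedModType K.

Lemma nrm_0 (G : normedModType K) : nrm (0 : G) = 0.
Proof. exact: (@normr0 _ (realify G)). Qed.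

Lemma nrm_ge0 (G : normedModType K) (x : G) : 0 <= nrm x.
Proof. exact: (@normr_ge0 _ (realify G) x). Qed.

Lemma nrm_gt0 (G : normedModType K) (x : G) : (0 < nrm x) = (x != 0).
Proof. exact: (@normr_gt0 _ (realify G) x). Qed.

Lemma opnorm_bound (W : set E) (T : E -> F) : W 0 ->
  (forall (a : R) x, W x -> W (of_real c a *: x)) -> rlinear_on W T -> bounded_on W T ->
  0 <= opnorm W T /\ forall x, W x -> nrm (T x) <= opnorm W T * nrm x.
Proof.
move=> W0 WZ Tl [C HC].
have TZ a x : W x -> T (of_real c a *: x) = of_real c a *: T x.
  move=> Wx; have := Tl (-1) 0 0 W0 W0; rewrite scaler0 addr0 => T0.
  have T00 : T 0 = 0.
    by have := realZP (E := F) (-1) (T 0); rewrite scaleN1r => T1; rewrite T0 -T1 addNr.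
  by have := Tl a x 0 Wx W0; rewrite T00 !addr0.
pose A := [set nrm (T x) | x in [set x | W x /\ nrm x <= 1]].
have ubA : has_ubound A.
  exists `|C| => _ [x [Wx x1] <-]; rewrite (le_trans (HC x Wx))//.
  rewrite (le_trans (_ : _ <= `|C| * nrm x))//.
    by apply: ler_wpM2r; [exact: nrm_ge0|exact: ler_norm].
  by rewrite -[leRHS]mulr1; apply: ler_wpM2l.
have A0 : A (nrm (T 0)) by exists 0 => //; split=> //; rewrite nrm_0.
have op0 : 0 <= opnorm W T.
  by apply: le_trans (ub_le_sup ubA A0); exact: nrm_ge0.
split=> // x Wx; have [->|x0] := eqVneq x 0.
  rewrite nrm_0 mulr0.
  by have := HC 0 W0; rewrite nrm_0 mulr0.
have nx0 : 0 < nrm x by rewrite nrm_gt0.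
rewrite mulrC -ler_pdivrMl//; have : A (nrm (T (of_real c (nrm x)^-1 *: x))).
  exists (of_real c (nrm x)^-1 *: x) => //; split; first exact: WZ.
  by rewrite nrmZ ger0_norm ?invr_ge0 ?(ltW nx0)// mulVf// gt_eqF.
move=> /(ub_le_sup ubA); rewrite TZ// nrmZ ger0_norm ?invr_ge0 ?(ltW nx0)//.
Qed.
End OperatorNorm.

Lemma sub3 (R : realType) (V : normedModType R) (a b d a' d' : V) :
  a - b - d - (a' - b - d') = (a - a') - (d - d').
Proof. by lmod_over R V. Qed.

Lemma norm_sub_bound (R : realType) (V : normedModType R) (a b : V) :
  `|a| <= `|- b - a| + `|b|.
Proof.
have E : - (- b - a) - b = a by lmod_over R V.
by rewrite -{1}E (le_trans (ler_normB _ _))// normrN.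
Qed.

Lemma sub_shift (R : realType) (V : normedModType R) (a a' b d : V) :
  a + b + d - (a' + b + d) = a - a'.
Proof. by lmod_over R V. Qed.

Lemma sub4 (R : realType) (V : normedModType R) (a a' b b' d l : V) :
  a - b - d - (a' - b' - d) - (l - (b - b')) = a - a' - l.
Proof. by lmod_over R V. Qed.

Section ImplicitZeroLevel.
Variables (R : realType) (c : scalar_kind).
Local Notation K := (scalar_field R c).
Variables (X Y : completeNormedModType K) (S : adae X Y).
Local Notation A := (opA S).
Local Notation B := (opB S).
Local Notation f := (rhs S).
Local Notation rX := (realify X).
Local Notation rY := (realify Y).
Local Notation PT := (@PT _ _ _ _ S).
Local Notation QT := (@QT _ _ _ _ S).
Local Notation level := (@level _ _ _ _ S).
Local Notation Td := (@Td _ _ _ _ S).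
Local Notation Tw := (@Tw _ _ _ _ S).
Local Notation Ts := (@Ts _ _ _ _ S).
Local Notation Tdw := (@Tdw _ _ _ _ S).
Context {HS : root_adae S}.
Local Notation PT_blinear := (@PT_blinear _ _ _ _ S HS).
Local Notation QT_blinear := (@QT_blinear _ _ _ _ S HS).
Local Notation A_lin := (@A_lin _ _ _ _ S HS).
Local Notation B_lin := (@B_lin _ _ _ _ S HS).
Variables (M20 : set X) (M2d M2w : nat -> set X).
Hypothesis Had : admissible S M20 M2d M2w.
Local Notation MM := (MM S M20 M2d M2w).
Local Notation MS := (MS S M2d M2w).
Local Notation domB_ := (@domB_ _ _ _ _ S HS).
Local Notation MM_dom := (@MM_dom _ _ _ _ S HS M20 M2d M2w).
Local Notation MM_open := (@MM_open _ _ _ _ S HS M20 M2d M2w).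
Local Notation M20_open := (@M20_open _ _ _ _ S HS M20 M2d M2w).
Local Notation MS_level := (@MS_level _ _ _ _ S HS M20 M2d M2w).

Lemma rhs_cont_eps (t : R) (x : X) (e : R) : 0 <= t -> dom S x -> 0 < e ->
  exists2 d : R, 0 < d & forall s y, 0 <= s -> dom S y -> `|s - t| < d -> nrm (y - x) < d ->
    nrm (f s y - f t x) <= e.
Proof.
move=> t0 dx e0; have := ad_cont Had; rewrite /rhs_continuous subspace_continuousP.
move=> /(_ (t, x) (conj t0 dx)); set F := (X in X --> _) => Fc.
have : F [set y : Y | nrm (y - f t x) <= e].
  have N : nbhs (f t x : rY) [set y : rY | `|y - (f t x : rY)| <= e].
    by apply/nbhs_ballP; exists e => //= y; rewrite -ball_normE /ball_ /= distrC => /ltW.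
  exact: (Fc _ N).
rewrite /F /= /nbhs /= => -[[P1 P2] /= [n1 n2] HP].
have [d1 /= d10 H1] := (nbhs_ballP _ _).1 n1.
have [d2 /= d20 H2] := (@nbhs_ballP _ rX _ _).1 n2.
exists (Num.min d1 d2) => [|s y s0 dy]; first by rewrite lt_min d10.
rewrite !lt_min => /andP[k1 _] /andP[_ k2].
apply: (HP (s, y)) => //; split; [apply: H1|apply: H2]; rewrite -ball_normE /ball_ /= distrC//.
Qed.

Lemma dom_linR (a : R) (x y : rX) : dom S x -> dom S y -> dom S (a *: x + y : rX).
Proof. exact: (@dom_lin _ _ _ _ S HS). Qed.

Lemma continuous_partial_strict (g : R -> X -> Y) dg (t : R) (x : X) (e : R) :
  (forall (t : R) x, 0 <= t -> MM x -> is_frechet MM (dom S) (g t) x (dg t x)) ->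
  opnorm_continuous_t MM (dom S) dg -> 0 <= t -> MM x -> 0 < e ->
  exists2 d : R, 0 < d & forall s y y', 0 <= s -> `|s - t| < d -> dom S y -> dom S y' ->
    nrm (y - x) < d -> nrm (y' - x) < d ->
    [/\ MM y, MM y' & nrm (g s y - g s y' - dg t x (y - y')) <= e * nrm (y - y')].
Proof.
move=> Hg Cg t0 Mx e0.
apply: (@partial_strict R rX rY MM (dom S) g dg t x e) => //.
- exact: dom_linR.
- exact: (MM_dom Had).
- exact: (MM_open Had).
- move=> s y s0 My; have [Ll _ Hap] := Hg s y s0 My; split=> // a h dh.
  have d0 := @dom0 _ _ _ _ S HS.
  have T0 := Ll (-1) 0 0 d0 d0; rewrite scaler0 addr0 in T0.
  have T1 := realZP (E := Y) (-1) (dg s y 0); rewrite scaleN1r in T1.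
  have T00 : dg s y 0 = 0 by rewrite T0 -T1 addNr.
  by have := Ll a h 0 dh d0; rewrite T00 !addr0.
- move=> e' e'0; have [d d0 Hd] := Cg t x t0 Mx e' e'0; by exists d.
Qed.

(** A continuous partial derivative is locally bounded in norm; alternative (ii) of condition 2.e
    thus provides the Lipschitz part of (i). *)
Lemma partial_lipschitz (g : R -> X -> Y) :
  continuous_partial MM (dom S) g -> locally_lipschitz_x1_x20 S M20 M2d M2w g.
Proof.
move=> [dg [Hg Cg]] t x t0 Mx.
have [d d0 Hd] := continuous_partial_strict Hg Cg t0 Mx ltr01.
have [_ [C HC] _] := Hg t x t0 Mx.
exists d, (`|C| + 1); split=> // s y y' s0 st My My' yx y'x _.
have dy := MM_dom Had My; have dy' := MM_dom Had My'.
have [_ _ H] := Hd s y y' s0 st dy dy' yx y'x.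
have dyy : dom S (y - y') by exact: domB_.
rewrite -[X in nrm X](subrK (dg t x (y - y'))) (le_trans (nrm_triangle _ _))// mulrDl addrC.
apply: lerD H; rewrite (le_trans (HC _ dyy))//; apply: ler_wpM2r; first exact: nrm_ge0.
exact: ler_norm.
Qed.

Lemma components_lipschitz :
  locally_lipschitz_x1_x20 S M20 M2d M2w (fun t x => Q1 S (f t x)) /\
  locally_lipschitz_x1_x20 S M20 M2d M2w (fun t x => Q2s S 0 (f t x)).
Proof.
have [[h1 h2 _]|[h1 h2 _]] := ad_2e Had; first by [].
by split; exact: partial_lipschitz.
Qed.

Variables (z g1 g2 : R -> rX).
Hypotheses (Mz : forall t, 0 <= t -> MS (z t)) (zc : forall t, 0 <= t -> cont_on half_line z t).
Hypotheses (lg1 : forall t, level (Td 1) (g1 t)) (lg2 : forall t, level (Tw 1) (g2 t)).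
Hypotheses (cg1 : forall t, 0 <= t -> cont_on half_line g1 t)
  (cg2 : forall t, 0 <= t -> cont_on half_line g2 t).

(** F_{20} with the known curves inserted: [z] for x_{2 Sigma}, [g1] and [g2] for the derivatives of
    the level 1 components. *)
Definition Phi (t : R) (x1 y : X) : Y := F20 S t x1 y (z t) (g1 t) (g2 t).

Local Notation L0 := (level (Ts 0)).

Lemma PhiE t x1 y : Phi t x1 y =
  QT (Ts 0) (f t (x1 + y + z t)) - B y - A (PT (Ts 1) ((g1 t : X) + g2 t)).
Proof.
have l1 : level (Ts 1) ((g1 t : X) + g2 t).
  by apply: levelD; [apply: level_sub (lg1 t)|apply: level_sub (lg2 t)] => i s _ /andP[].
rewrite /Phi /F20 !Q2sE QT_A; last exact: level_dom l1.
congr (_ - _ - A _); rewrite -[in LHS]l1 PT_PT; apply: eq_PT => i s _.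
by rewrite /Ts; case: s => [|[|s]].
Qed.

Lemma B_level T y : level T y -> B y = QT T (B y).
Proof. by move=> ly; rewrite QT_B ?ly//; exact: level_dom ly. Qed.

Lemma QT_Phi t x1 y : L0 y -> QT (Ts 0) (Phi t x1 y) = Phi t x1 y.
Proof.
move=> ly; have bQ := QT_blinear (Ts 0).
rewrite /Phi /F20 !Q2sE (B_level ly).
by rewrite !(blinearB bQ) !QT_idem.
Qed.

Let M0l : M20 `<=` L0. Proof. by have [] := M20_open (ad_open Had). Qed.

Let dom_sum3 t x1 y : 0 <= t -> D1 S x1 -> L0 y -> dom S (x1 + y + z t).
Proof.
move=> t0 /D1P[dx _] ly; apply: domD; first by apply: domD => //; exact: level_dom ly.
by have [Ml _] := MS_level Had; exact: level_dom (Ml _ (Mz t0)).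
Qed.

Let shift3 t t0 (x1 x10 y y0 : X) : nrm (x1 + y + z t - (x10 + y0 + z t0)) <=
  nrm (x1 - x10) + nrm (y - y0) + nrm ((z t : X) - z t0).
Proof.
rewrite (_ : _ - _ = (x1 - x10) + (y - y0) + ((z t : X) - z t0)); last first.
  by rewrite !opprD !addrA; lmod_over (scalar_field R c : comNzRingType) X.
apply: le_trans (nrm_triangle _ _) _; rewrite lerD2r; exact: nrm_triangle.
Qed.

Lemma sum3_cont (t x1 y : _) (e : R) : 0 <= t -> D1 S x1 -> L0 y -> 0 < e ->
  exists2 d : R, 0 < d & forall s x1' y', 0 <= s -> `|s - t| < d -> D1 S x1' ->
    nrm (x1' - x1) < d -> L0 y' -> nrm (y' - y) < d ->
    nrm (f s (x1' + y' + z s) - f t (x1 + y + z t)) <= e.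
Proof.
move=> t0 Dx ly e0; have [d d0 Hd] := rhs_cont_eps t0 (dom_sum3 t0 Dx ly) e0.
have d3 : 0 < d / 4 by rewrite divr_gt0.
have [d' d'0 Hd'] := zc t0 d3.
exists (Num.min d' (d / 4)) => [|s x1' y' s0]; first by rewrite lt_min d'0.
rewrite !lt_min => /andP[k1 k2] Dx' /andP[_ k3] ly' /andP[_ k4]; apply: Hd => //.
- exact: dom_sum3.
- lra.
- rewrite (le_lt_trans (shift3 _ _ _ _ _ _))//.
  have := Hd' s s0 k1; rewrite (_ : `|z s - z t| = nrm ((z s : X) - z t))// => k5; lra.
Qed.

Lemma Phi_cont (t x1 y : _) (e : R) : 0 <= t -> D1 S x1 -> L0 y -> 0 < e ->
  exists2 d : R, 0 < d & forall s x1', 0 <= s -> `|s - t| < d -> D1 S x1' ->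
    nrm (x1' - x1) < d -> nrm (Phi s x1' y - Phi t x1 y) <= e.
Proof.
move=> t0 Dx ly e0; have bQ := QT_blinear (Ts 0); have [C C0 HC] := blinear_bound bQ.
have bA := @lin_PT_blinear _ _ _ _ S HS _ (Ts 1) A_lin.
have e1 : 0 < e / 2 / C by rewrite !divr_gt0.
have [d d0 Hd] := sum3_cont t0 Dx ly e1.
have e2 : 0 < e / 2 by rewrite divr_gt0.
have [d' d'0 Hd'] := cont_on_blinear bA (contD_on (cg1 t0) (cg2 t0)) e2.
exists (Num.min d d') => [|s x1' s0]; first by rewrite lt_min d0.
rewrite !lt_min => /andP[k1 k2] Dx' /andP[k3 _].
have y0 : nrm (y - y) < d by rewrite subrr nrm_0.
have := Hd s x1' y s0 k1 Dx' k3 ly y0 => H1.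
have := Hd' s s0 k2 => H2; rewrite !PhiE.
have HB : QT (Ts 0) (f s (x1' + y + z s) - f t (x1 + y + z t)) =
    QT (Ts 0) (f s (x1' + y + z s)) - QT (Ts 0) (f t (x1 + y + z t)) by exact: (blinearB bQ).
rewrite (@sub3 R rY) -HB.
rewrite (le_trans (@ler_normB _ rY _ _))// (splitr e); apply: lerD => //.
apply: le_trans (HC _) _; rewrite -ler_pdivlMl// mulrC; exact: H1.
Qed.

(** Common ground of the two alternatives of condition 2.e, so that Newton's iteration is run once.
    Under (i) the bound k is close to its limit on small neighbourhoods; under (ii) Z is the
    derivative itself, and strict differentiability allows any positive k. *)
Lemma zero_approx (t : R) (x1 y : X) : 0 <= t -> D1 S x1 -> M20 y -> Phi t x1 y = 0 ->
  exists (Z : X -> Y) (Zi : Y -> X) (k : R),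
    [/\ is_bounded_inverse (D2s S 0) (Y2s S 0) Z Zi, maps_to (D2s S 0) (Y2s S 0) Z,
        opnorm (Y2s S 0) Zi * k < 1 &
      exists2 d : R, 0 < d & forall s x1' v v', 0 <= s -> `|s - t| < d -> D1 S x1' ->
        nrm (x1' - x1) < d -> L0 v -> nrm (v - y) < d -> L0 v' -> nrm (v' - y) < d ->
        nrm (Phi s x1' v - Phi s x1' v' - Z (v - v')) <= k * nrm (v - v')].
Proof.
move=> t0 Dx My P0.
have Mzt := Mz t0.
have D1g : D2d S 1 (g1 t) by rewrite D2d_level; exact: lg1.
have D2g : D2w S 1 (g2 t) by rewrite D2w_level; exact: lg2.
have Y0 : Y2s S 0 0 by exists 0 => //; rewrite Q2sE (blinear0 (QT_blinear _)).
have YZ (a : R) (v : Y) : Y2s S 0 v -> Y2s S 0 (of_real c a *: v).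
  move=> [v' _ <-]; exists (of_real c a *: v') => //; rewrite !Q2sE.
  exact: (blinearZ (QT_blinear _)).
have [[_ _ /(_ t x1 y (z t) (g1 t) (g2 t) t0 Dx My Mzt D1g D2g P0)]|
    [_ [dg [Hg Cg]] /(_ t x1 y (z t) (g1 t) (g2 t) t0 Dx My Mzt D1g D2g P0)]] := ad_2e Had.
- move=> [Z [Zi [k [b [kl /= [[_ _ Zm Zinv] b0 Hk Hlim kl1]]]]]].
  have [Til Tib _ _] := Zinv; have [op0 _] := opnorm_bound Y0 YZ Til Tib.
  set op := opnorm _ _ in kl1 op0 *.
  (* Half the gap between the limit of k and the inverse norm of Z^{-1}. *)
  pose eta := (op^-1 - kl) / 2; have eta0 : 0 < eta by rewrite divr_gt0// subr_gt0.
  have [r r0 Hr] := Hlim eta eta0.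
  have [q [q0 qr qb]] : exists q, [/\ 0 < q, q <= r & q <= b].
    by exists (Num.min r b); rewrite lt_min r0 b0 !ge_min !lexx orbT.
  exists Z, Zi, (k q q q q q q); split=> //.
    have := Hr q q q q q q; rewrite q0 qr /= => /(_ (conj (And3 isT isT isT) (And3 isT isT isT))) H.
    have kq : k q q q q q q < op^-1 by have := ler_norm (k q q q q q q - kl); rewrite /eta in H; lra.
    (* The degenerate case of a zero operator norm is treated apart, since there the inverse of the
       norm is 0 by convention. *)
    rewrite -/op; have [->|opn0] := eqVneq op 0; first by rewrite mul0r.
    have op1 : 0 < op by rewrite lt_def opn0.
    by rewrite mulrC -ltr_pdivlMr// mul1r.
  have q2 : 0 < q / 2 by rewrite divr_gt0.
  have [d1 d10 H1] := zc t0 q2; have [d2 d20 H2] := cg1 t0 q2; have [d3 d30 H3] := cg2 t0 q2.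
  exists (Num.min q (Num.min d1 (Num.min d2 d3))) => [|s x1' v v' s0]; first by rewrite !lt_min q0 d10 d20.
  rewrite !lt_min => /andP[k0 /andP[k1 /andP[k2 k3]]] Dx' /andP[j0 _] lv /andP[i0 _] lv' /andP[i0' _].
  have q2q : q / 2 < q by lra.
  apply: (Hk q q q q q q); rewrite ?q0 ?qb //.
  + have -> : D2S S = level (Tdw 1).
      by rewrite -PT_image; congr (_ @` _); apply/funext => ?; rewrite P2S_PT.
    by have [Ml _] := MS_level Had; exact: Ml (Mz s0).
  + by apply: le_lt_trans q2q; exact: (H1 s s0 k1).
  + by rewrite D2d_level; exact: lg1.
  + by apply: le_lt_trans q2q; exact: (H2 s s0 k2).
  + by rewrite D2w_level; exact: lg2.
  + by apply: le_lt_trans q2q; exact: (H3 s s0 k3).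
  + by rewrite D2s_level.
  + by rewrite D2s_level.
- move=> [L [Ll Lb Lap] [Zm [Zi Zinv]]].
  set Z := (fun h => _) in Zm Zinv.
  have [Til Tib _ _] := Zinv; have [op0 _] := opnorm_bound Y0 YZ Til Tib.
  set op := opnorm _ _ in op0 *.
  (* Small enough for a product below 1 with [op]; the summand 1 keeps the denominator positive. *)
  have k0 : 0 < (2 * (op + 1))^-1 by rewrite invr_gt0 mulr_gt0// ltr_wpDl.
  exists Z, Zi, (2 * (op + 1))^-1; split=> //.
    by rewrite -/op ltr_pdivrMr ?mul1r ?mulr_gt0 ?ltr_wpDl//; lra.
  have Mx : MM (x1 + y + z t) by exact: MM_sum.
  have [d d0 Hd] := continuous_partial_strict Hg Cg t0 Mx k0.
  have LZ (T : X -> Y) : rlinear_on (dom S) T -> forall (a : R) (h : rX), dom S h ->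
      T (a *: h) = (a *: (T h : rY)).
    move=> Tl a h dh; have dm0 := @dom0 _ _ _ _ S HS.
    have T0 := Tl (-1) 0 0 dm0 dm0; rewrite scaler0 addr0 in T0.
    have T1 := realZP (E := Y) (-1) (T 0); rewrite scaleN1r in T1.
    have T00 : T 0 = 0 by rewrite T0 -T1 addNr.
    by have := Tl a h 0 dh dm0; rewrite T00 !addr0.
  have LE h : dom S h -> L h = dg t (x1 + y + z t) h.
    have [gl _ gap] := Hg t _ t0 Mx.
    apply: (@approx_unique R rX rY MM (dom S) (Q2s S 0 \o f t) (x1 + y + z t) L (dg t (x1 + y + z t))) => //.
    - exact: dom_linR.
    - exact: (MM_dom Had).
    - exact: dom0.
    - exact: LZ.
    - exact: LZ.
    - exact: (MM_open Had).
  have d3 : 0 < d / 4 by rewrite divr_gt0.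
  have [d' d'0 Hd'] := zc t0 d3.
  exists (Num.min d' (d / 4)) => [|s x1' v v' s0]; first by rewrite lt_min d'0.
  rewrite !lt_min => /andP[k1 k2] Dx' /andP[_ k3] lv /andP[_ k4] lv' /andP[_ k5].
  have lvv : L0 (v - v') by have bP := PT_blinear (Ts 0); rewrite /level /= (blinearB bP) lv lv'.
  have zs : nrm ((z s : X) - z t) <= d / 4 by exact: (Hd' s s0 k1).
  have := Hd s (x1' + v + z s) (x1' + v' + z s) s0 _ _ _ _ _.
  have -> : x1' + v + z s - (x1' + v' + z s) = v - v' by lmod_over (scalar_field R c : comNzRingType) X.
  move=> /(_ _ _ _ _ _)[|||||_ _ H].
  + lra.
  + exact: dom_sum3.
  + exact: dom_sum3.
  + by rewrite (le_lt_trans (shift3 _ _ _ _ _ _))//; lra.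
  + by rewrite (le_lt_trans (shift3 _ _ _ _ _ _))//; lra.
  move: H; rewrite -LE; last exact: level_dom lvv.
  have BE : B (v - v') = B v - B v'.
    by rewrite (lin_domB B_lin)//; [exact: level_dom lv|exact: level_dom lv'].
  have PE : P2s S 0 (v - v') = v - v' by rewrite P2sE.
  have QE : Q2s S 0 (B (v - v')) = B v - B v' by rewrite -BE [RHS](B_level lvv) Q2sE.
  by rewrite /Z PE QE /Phi /F20 (@sub4 R rY).
Qed.

Lemma P2S_sum3 x1 y v : D1 S x1 -> L0 y -> MS v -> P2S S (x1 + y + v) = v.
Proof.
move=> Dx ly Mv; have [Ml _] := MS_level Had; have lv := Ml _ Mv; have bP := PT_blinear (Tdw 1).
rewrite P2S_PT !(blinearD bP) (D1_PT _ Dx) lv (PT_level0 _ ly) ?add0r// => i s si.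
by rewrite Tdw1// /Ts; case: s {si}.
Qed.

(** For (s, y) near (t, x1), Newton's iteration with the inverse frozen at (t, x1) converges near
    eta t x1, and condition 1.e identifies its limit with eta s y. Continuity follows from the
    residual of the old value, the Lipschitz bound from applying the contraction estimate to two
    zeros. *)
Theorem implicit_zero_level : exists eta : R -> X -> rX,
  [/\ forall t x1, 0 <= t -> D1 S x1 -> [/\ M20 (eta t x1), Phi t x1 (eta t x1) = 0 &
        forall y, M20 y -> Phi t x1 y = 0 -> y = eta t x1],
      forall t x1 e, 0 <= t -> D1 S x1 -> 0 < e -> exists2 d : R, 0 < d &
        forall s y, 0 <= s -> `|s - t| < d -> D1 S y -> nrm (y - x1) < d ->
          `|eta s y - eta t x1| <= e &
      forall t x1, 0 <= t -> D1 S x1 -> exists d L : R, [/\ 0 < d, 0 <= L &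
        forall s y y', 0 <= s -> `|s - t| < d -> D1 S y -> D1 S y' -> nrm (y - x1) < d ->
          nrm (y' - x1) < d -> `|eta s y - eta s y'| <= L * nrm (y - y')]].
Proof.
have [eta etaP] : {eta : R * X -> rX & forall p, 0 <= p.1 -> D1 S p.2 ->
    [/\ M20 (eta p), Phi p.1 p.2 (eta p) = 0 &
        forall y, M20 y -> Phi p.1 p.2 y = 0 -> y = eta p]}.
  apply: (@choice (R * X)%type rX (fun p v => 0 <= p.1 -> D1 S p.2 ->
    [/\ M20 v, Phi p.1 p.2 v = 0 & forall y, M20 y -> Phi p.1 p.2 y = 0 -> y = v])) => -[t x1] /=.
  have [[t0 Dx]|h] := pselect (0 <= t /\ D1 S x1); last by exists 0 => t0 Dx; case: h.
  have [||v [[Mv v0] vu]] := ad_1e Had (x1 := x1) (dw1 := g2 t) (d21 := g1 t) t0 Dx (Mz t0).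
  - by rewrite D2w_level; exact: lg2.
  - by rewrite D2d_level; exact: lg1.
  by exists v => _ _; split=> // y My y0; rewrite (vu y).
pose et t x1 : rX := eta (t, x1).
have eP t x1 : 0 <= t -> D1 S x1 -> [/\ M20 (et t x1), Phi t x1 (et t x1) = 0 &
    forall y, M20 y -> Phi t x1 y = 0 -> y = et t x1] by move=> t0 Dx; exact: (etaP (t, x1)).
have L0lin (a : R) (x y : rX) : L0 x -> L0 y -> L0 (a *: x + y : rX) by exact: level_lin.
have L00 : L0 0 by exact: level0.
have [N [e_ [c_ HW]]] := @level_coordinates _ _ _ _ S HS (Ts 0).
have L0cl := coordinates_closed HW.
have bQ := QT_blinear (Ts 0).
have Y20 y : QT (Ts 0) y = y -> Y2s S 0 y by move=> yE; exists y => //; rewrite Q2sE.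
have Y20E y : Y2s S 0 y -> QT (Ts 0) y = y by move=> [v _ <-]; rewrite Q2sE QT_idem.
have main t x1 : 0 <= t -> D1 S x1 -> exists (Zi : rY -> rX) (q d e : R),
    [/\ blinear Zi, 0 <= q < 1, 0 < d, 0 < e &
     forall s w, 0 <= s -> `|s - t| < d -> D1 S w -> nrm (w - x1) < d ->
      [/\ `|et s w - et t x1| <= e,
         (1 - q) * `|et s w - et t x1| <= `|Zi (Phi s w (et t x1))| &
        forall v v', L0 v -> L0 v' -> nrm (v - et t x1) <= e -> nrm (v' - et t x1) <= e ->
        `|Zi (Phi s w v) - Zi (Phi s w v') - (v - v' : rX)| <= q * nrm (v - v')]].
  move=> t0 Dx; have [My P0 _] := eP t x1 t0 Dx; set y := et t x1 in My P0 *.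
  have ly := M0l My.
  have [Z [Zi [k [[Til Tib Tim [TL TR]] Zm opk [d1 d10 Hap]]]]] := zero_approx t0 Dx My P0.
  have Y0 : Y2s S 0 0 by apply: Y20; rewrite (blinear0 bQ).
  have YZ (a : R) (v : Y) : Y2s S 0 v -> Y2s S 0 (of_real c a *: v).
    by move=> /Y20E vE; apply: Y20; rewrite -[in RHS]vE; exact: (blinearZ bQ a v).
  have [op0 opb] := opnorm_bound Y0 YZ Til Tib; set op := opnorm _ _ in op0 opb opk.
  pose Zi' (v : rY) : rX := Zi (QT (Ts 0) v).
  have Yq v : Y2s S 0 (QT (Ts 0) v) by apply: Y20; exact: QT_idem.
  have [CQ CQ0 HCQ] := blinear_bound bQ.
  have bZ : blinear Zi'.
    split=> [a v v'|]; first by rewrite /Zi' (blinearD bQ) (blinearZ bQ); exact: Til.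
    exists (op * CQ) => [|v]; first by rewrite mulr_ge0// ltW.
    rewrite (le_trans (opb _ (Yq v)))// -mulrA; apply: ler_wpM2l => //; exact: HCQ.
  (* k may be negative, a contraction constant may not. *)
  pose q := Num.max 0 (op * k).
  have q01 : 0 <= q < 1 by rewrite /q le_max lexx gt_max ltr01.
  have [q0 q1] := andP q01.
  have [_ o0] := M20_open (ad_open Had); have [d0 d00 Hd0] := o0 y My.
  pose e := Num.min d0 d1 / 2.
  have e0 : 0 < e by rewrite divr_gt0// lt_min d00.
  have ed : e < Num.min d0 d1 by rewrite /e ltr_pdivrMr// ltr_pMr ?ltr1n// lt_min d00.
  move: ed; rewrite lt_min => /andP[ed0 ed1].
  have contr s w v v' : 0 <= s -> `|s - t| < d1 -> D1 S w -> nrm (w - x1) < d1 ->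
      L0 v -> L0 v' -> nrm (v - y) <= e -> nrm (v' - y) <= e ->
      `|Zi' (Phi s w v) - Zi' (Phi s w v') - (v - v' : rX)| <= q * nrm (v - v').
    move=> s0 st Dw wx lv lv' vy v'y.
    have H := Hap s w v v' s0 st Dw wx lv (le_lt_trans vy ed1) lv' (le_lt_trans v'y ed1).
    have lvv : D2s S 0 (v - v').
      by rewrite D2s_level /level /= (blinearB (PT_blinear (Ts 0))) lv lv'.
    have ZE : Zi' (Z (v - v')) = v - v' by rewrite /Zi' Y20E ?TL//; exact: Zm.
    rewrite -[X in _ - X]ZE -!(blinearB bZ) /Zi'.
    rewrite (le_trans (opb _ (Yq _)))//.
    rewrite (Y20E (_ - _ - _)); last first.
      by apply: Y20; rewrite 2!(blinearB bQ) !QT_Phi// Y20E//; exact: Zm.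
    rewrite (le_trans (ler_wpM2l op0 H))// mulrA; apply: ler_wpM2r; first exact: nrm_ge0.
    by rewrite /q le_max lexx orbT.
  have [CZ CZ0 HCZ] := blinear_bound bZ.
  have eps0 : 0 < (1 - q) * e / CZ by rewrite divr_gt0// mulr_gt0// subr_gt0.
  have [d2 d20 H2] := Phi_cont t0 Dx ly eps0.
  exists Zi', q, (Num.min d1 d2), e; split=> //; first by rewrite lt_min d10.
  move=> s w s0; rewrite !lt_min => /andP[s1 s2] Dw /andP[w1 w2].
  have PC : `|Zi' (Phi s w y)| <= (1 - q) * e.
    apply: le_trans (HCZ _) _; rewrite mulrC -ler_pdivlMr//.
    by have := H2 s w s0 s2 Dw w2; rewrite P0 subr0.
  have [|||v [lv v0 vy]] := @newton_zero R rX rY L0 (Phi s w) Zi' y e q `|Zi' (Phi s w y)| L00 L0lin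
    L0cl _ _ _ q01 ly (lexx _) PC.
  - by move=> v lv _; have := Tim _ (Yq (Phi s w v)); rewrite D2s_level.
  - by move=> v v' lv lv' h1 h2; exact: contr.
  - move=> v lv _ Z0; have := TR _ (Yq (Phi s w v)); rewrite -/(Zi' _) Z0 QT_Phi// => <-.
    have <- : Zi 0 = 0 by have := blinear0 bZ; rewrite /Zi' (blinear0 bQ).
    exact: TR.
  have vye : `|v - y| <= e.
    by apply: le_trans vy _; rewrite ler_pdivrMr ?subr_gt0// mulrC.
  have [_ _ wu] := eP s w s0 Dw.
  have <- : (v : rX) = et s w by apply: wu => //; apply: Hd0 => //; exact: le_lt_trans vye ed0.
  split=> //; last by move=> v1 v2 l1 l2 h1 h2; exact: contr.
  by rewrite mulrC -ler_pdivlMr ?subr_gt0.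
have cont t x1 e : 0 <= t -> D1 S x1 -> 0 < e -> exists2 d : R, 0 < d &
    forall s y, 0 <= s -> `|s - t| < d -> D1 S y -> nrm (y - x1) < d ->
      `|et s y - et t x1| <= e.
  move=> t0 Dx e0; have [Zi [q [d [e' [bZ /andP[q0 q1] d0 e'0 H]]]]] := main t x1 t0 Dx.
  have [My P0 _] := eP t x1 t0 Dx; have ly := M0l My.
  have [CZ CZ0 HCZ] := blinear_bound bZ.
  have eps0 : 0 < (1 - q) * e / CZ by rewrite divr_gt0// mulr_gt0// subr_gt0.
  have [d2 d20 H2] := Phi_cont t0 Dx ly eps0.
  exists (Num.min d d2) => [|s w s0]; first by rewrite lt_min d0.
  rewrite !lt_min => /andP[s1 s2] Dw /andP[w1 w2].
  have [_ K _] := H s w s0 s1 Dw w1.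
  rewrite -(@ler_pM2l _ (1 - q)) ?subr_gt0//; apply: le_trans K _.
  apply: le_trans (HCZ _) _; rewrite mulrC -ler_pdivlMr//.
  by have := H2 s w s0 s2 Dw w2; rewrite P0 subr0.
exists et; split=> // t x1 t0 Dx.
have [Zi [q [d [e [bZ /andP[q0 q1] d0 e0 H]]]]] := main t x1 t0 Dx.
have [My P0 _] := eP t x1 t0 Dx.
have [CZ CZ0 HCZ] := blinear_bound bZ.
have [_ lip] := components_lipschitz.
have Mx : MM (x1 + et t x1 + z t) by apply: MM_sum => //; exact: Mz.
have [d4 [L [d40 L0' HL]]] := lip t _ t0 Mx.
have d44 : 0 < d4 / 4 by rewrite divr_gt0.
have [d5 d50 H5] := cont t x1 _ t0 Dx d44; have [d6 d60 H6] := zc t0 d44.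
have [dd [dd0 m1 m2 m3 m4]] : exists dd, [/\ 0 < dd, dd <= d, dd <= d4 / 4, dd <= d5 & dd <= d6].
  exists (Num.min d (Num.min (d4 / 4) (Num.min d5 d6))).
  by rewrite !lt_min d0 d44 d50 d60 !ge_min !lexx !orbT.
exists dd, (CZ * L / (1 - q)); split=> //; first by rewrite divr_ge0 ?mulr_ge0// ?subr_ge0 ltW.
move=> s w w' s0 st Dw Dw' wx w'x.
have [Mv v0 _] := eP s w s0 Dw; have [Mv' v'0 _] := eP s w' s0 Dw'.
have [v1 _ K] := H s w s0 (lt_le_trans st m1) Dw (lt_le_trans wx m1).
have [v'1 _ _] := H s w' s0 (lt_le_trans st m1) Dw' (lt_le_trans w'x m1).
have {K} := K _ _ (M0l Mv) (M0l Mv') v1 v'1.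
have k6 : nrm ((z s : X) - z t) <= d4 / 4 by exact: (H6 s s0 (lt_le_trans st m4)).
have k5 : nrm ((et s w' : X) - et t x1) <= d4 / 4.
  exact: (H5 s w' s0 (lt_le_trans st m3) Dw' (lt_le_trans w'x m3)).
have near4 w1 : nrm (w1 - x1) < dd -> nrm (w1 + et s w' + z s - (x1 + et t x1 + z t)) < d4.
  by move=> h; rewrite (le_lt_trans (shift3 _ _ _ _ _ _))//; lra.
(* Inserting the zero for w' into the equation for w leaves only a difference of Q_{20} f at two
   states with the same x_{2 Sigma}, where the local Lipschitz condition applies. *)
have PP : nrm (Phi s w (et s w')) <= L * nrm (w - w').
  rewrite -[Phi s w _]subr0 -v'0 /Phi /F20 (@sub3 R rY) subrr subr0.
  have std4 : `|s - t| < d4 by lra.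
  have Mzs := Mz s0.
  have lv' := M0l Mv'.
  have E1 : P2S S (w + et s w' + z s) = z s by exact: P2S_sum3.
  have E2 : P2S S (w' + et s w' + z s) = z s by exact: P2S_sum3.
  have M1 : MM (w + et s w' + z s) by exact: MM_sum.
  have M2 : MM (w' + et s w' + z s) by exact: MM_sum.
  have := HL s _ _ s0 std4 M1 M2 (near4 w wx) (near4 w' w'x) (etrans E1 (esym E2)).
  rewrite (_ : w + et s w' + z s - (w' + et s w' + z s) = w - w')//.
  exact: (@sub_shift R rX).
rewrite v0 (blinear0 bZ) sub0r => K.
have : (1 - q) * `|et s w - et s w'| <= CZ * L * nrm (w - w').
  rewrite -mulrA (le_trans _ (ler_wpM2l (ltW CZ0) PP))//.
  apply: le_trans (HCZ _).
  have T : `|et s w - et s w'| <= `|- Zi (Phi s w (et s w')) - (et s w - et s w')| +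
      `|Zi (Phi s w (et s w'))|.
    exact: norm_sub_bound.
  move: K T; rewrite (_ : nrm _ = `|et s w - et s w'|)// mulrBl mul1r; lra.
by move=> T; rewrite mulrAC ler_pdivlMr ?subr_gt0// mulrC.
Qed.
End ImplicitZeroLevel.

(** * Reduction to a differential equation in Y_1 *)

Section Conversions.
Variables (R : realType) (c : scalar_kind).
Local Notation K := (scalar_field R c).

Lemma within_contP (E : normedModType K) (J : set R) (g : R -> E) :
  {within J, continuous g} <-> forall t, J t -> cont_on J (g : R -> realify E) t.
Proof.
rewrite subspace_continuousP; split => H t Jt.
  move=> e e0; have : nbhs (g t : realify E) [set y : realify E | `|y - (g t : realify E)| <= e].
    by apply/nbhs_ballP; exists e => //= y; rewrite -ball_normE /ball_ /= distrC => /ltW.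
  move=> /(H t Jt) /nbhs_ballP[d /= d0 Hd]; exists d => // s Js st.
  by apply: Hd => //; rewrite -ball_normE /ball_ /= distrC.
move=> U /(@nbhs_ballP _ (realify E))[e /= e0 eU].
have e2 : 0 < e / 2 by rewrite divr_gt0.
have [d d0 Hd] := H t Jt _ e2; apply/nbhs_ballP; exists d => // s; rewrite -ball_normE /ball_ /= distrC => st Js.
apply: eU; rewrite -ball_normE /ball_ /= distrC (le_lt_trans (Hd s Js st))//; lra.
Qed.

Lemma tderivP (E : normedModType K) (J : set R) (g : R -> E) (t : R) (l : E) :
  @is_tderiv R c E J g t l <-> deriv_on J (g : R -> realify E) t l.
Proof.
pose q s : realify E := (s - t)^-1 *: ((g s : realify E) - g t).
have qE s : q s = of_real c (s - t)^-1 *: (g s - g t) by [].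
split => [H e e0|H].
  have : nbhs (l : realify E) [set y : realify E | `|y - (l : realify E)| <= e].
    by apply/nbhs_ballP; exists e => //= y; rewrite -ball_normE /ball_ /= distrC => /ltW.
  move=> /H /nbhs_ballP[d /= d0 Hd]; exists d => // s Js st.
  have [->|ts] := eqVneq s t; first by rewrite !subrr scale0r subr0 !normr0 mulr0.
  have := Hd s; rewrite -ball_normE /ball_ /= distrC => /(_ st ts Js) K1.
  have n0 : s - t != 0 by rewrite subr_eq0.
  rewrite (_ : _ - _ = (s - t) *: (q s - l)); last by rewrite scalerBr /q scalerA mulfV// scale1r.
  by rewrite normrZ mulrC; apply: ler_wpM2r => //; exact: K1.
move=> U /(@nbhs_ballP _ (realify E))[e /= e0 eU].
have e2 : 0 < e / 2 by rewrite divr_gt0.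
have [d d0 Hd] := H _ e2; apply/nbhs_ballP; exists d => // s; rewrite -ball_normE /ball_ /= distrC => st ts Js.
suff : `|q s - l| < e by move=> qe; apply: eU; rewrite -ball_normE /ball_ /= distrC.
have n0 : s - t != 0 by rewrite subr_eq0.
have n1 : 0 < `|s - t| by rewrite normr_gt0.
have := Hd s Js st; rewrite (_ : _ - _ = (s - t) *: (q s - l)); last first.
  by rewrite scalerBr /q scalerA mulfV// scale1r.
rewrite normrZ mulrC ler_pM2r// => /le_lt_trans; apply; lra.
Qed.
End Conversions.

Section LimitEquality.
Variables (R : realType) (E : normedModType R).

Lemma cont_on_unique (J : set R) (u v : R -> E) t : clusters J t ->
  cont_on J u t -> cont_on J v t -> (forall s, J s -> s != t -> u s = v s) -> u t = v t.
Proof.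
move=> Jt cu cv uv; apply/eqP; rewrite -subr_eq0 -normr_le0; apply/ler_addgt0Pr => e e0.
have e2 : 0 < e / 2 by rewrite divr_gt0.
have [d1 d10 H1] := cu _ e2; have [d2 d20 H2] := cv _ e2.
have [|s [Js st]] := Jt (Num.min d1 d2); first by rewrite lt_min d10.
rewrite lt_min => /andP[s1 s2]; rewrite add0r.
have := H1 s Js s1; have := H2 s Js s2; rewrite (uv s)// => k2 k1.
rewrite (_ : u t - v t = (v s - v t) - (v s - u t)); last by lmod_over R E.
by rewrite (le_trans (ler_normB _ _))// (splitr e) lerD.
Qed.

Lemma interval_clusters (J : set R) t : is_interval J -> J t -> (exists2 s, J s & s != t) ->
  clusters J t.
Proof.
move=> iJ Jt [s Js st] d d0; pose a := Num.min 1 (d / 2 / `|s - t|).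
have n0 : 0 < `|s - t| by rewrite normr_gt0 subr_eq0.
have a0 : 0 < a by rewrite lt_min ltr01 !divr_gt0.
have a1 : a <= 1 by rewrite ge_min lexx.
have ad : a * `|s - t| < d.
  apply: (@le_lt_trans _ _ (d / 2)); last lra.
  by rewrite -ler_pdivlMr// ge_min lexx orbT.
exists (t + a * (s - t)); split.
- have [ts|ts] := leP t s; [apply: (iJ t s)|apply: (iJ s t)] => //.
    have := mulr_ge0 (ltW a0) (_ : 0 <= s - t); rewrite subr_ge0 => /(_ ts) h1.
    have := ler_wpM2r (_ : 0 <= s - t) a1; rewrite subr_ge0 => /(_ ts) h2; lra.
  have h0 : 0 <= t - s by rewrite subr_ge0 ltW.
  have h1 := mulr_ge0 (ltW a0) h0; have h2 := ler_wpM2r h0 a1; lra.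
- by rewrite -subr_eq0 addrAC subrr add0r; apply: mulf_neq0; [rewrite gt_eqF|rewrite subr_eq0].
- by rewrite addrAC subrr add0r normrM gtr0_norm.
Qed.
End LimitEquality.

(* The curves u, w carry the components x_{2s}^{(s+1)}, x_{2 wedge, s} of every
   solution (du, dw are their derivatives); [eta] gives x_{20} in terms of t and x_1. *)
Record reduction (R : realType) (c : scalar_kind)
    (X Y : completeNormedModType (scalar_field R c)) (S : adae X Y)
    (M20 : set X) (M2d M2w : nat -> set X)
    (u du w dw : nat -> R -> realify X) (eta : R -> X -> realify X) : Prop := {
  red_u : forall j t, (1 <= j < nu S)%N -> 0 <= t -> [/\ M2d j (u j t),
    deriv_on half_line (u j) t (du j t) & F2d S j t (fun j => u j t) = 0];
  red_w : forall j t, (1 <= j < (nu S).-1)%N -> 0 <= t ->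
    M2w j (w j t) /\ w_zero S u du w dw j t;
  red_dw : forall j t, (1 <= j)%N -> 0 <= t -> deriv_on half_line (w j) t (dw j t);
  red_level : forall j t, (1 <= j)%N ->
    level (@Td _ _ _ _ S j) (du j t) /\ level (@Tw _ _ _ _ S j) (dw j t);
  red_cont : forall j, (1 <= j)%N -> smooth 0 (du j) /\ smooth 0 (dw j);
  red_eta : forall t x1, 0 <= t -> D1 S x1 -> [/\ M20 (eta t x1),
      Phi S (sigma_part S u w) (du 1) (dw 1) t x1 (eta t x1) = 0 &
      forall y, M20 y -> Phi S (sigma_part S u w) (du 1) (dw 1) t x1 y = 0 -> y = eta t x1];
  red_eta_cont : forall t x1 e, 0 <= t -> D1 S x1 -> 0 < e -> exists2 d : R, 0 < d &
      forall s y, 0 <= s -> `|s - t| < d -> D1 S y -> nrm (y - x1) < d ->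
        `|eta s y - eta t x1| <= e;
  red_eta_lip : forall t x1, 0 <= t -> D1 S x1 -> exists d L : R, [/\ 0 < d, 0 <= L &
      forall s y y', 0 <= s -> `|s - t| < d -> D1 S y -> D1 S y' -> nrm (y - x1) < d ->
        nrm (y' - x1) < d -> `|eta s y - eta s y'| <= L * nrm (y - y')] }.

Lemma deriv_on_sum (R : realType) (E : normedModType R) (J : set R) (I : Type) (r : seq I)
    (P : pred I) (u : I -> R -> E) (u' : I -> E) t : (forall i, P i -> deriv_on J (u i) t (u' i)) ->
  deriv_on J (fun s => \sum_(i <- r | P i) u i s) t (\sum_(i <- r | P i) u' i).
Proof.
move=> H; elim: r => [|i r IH].
  rewrite big_nil (_ : (fun s => _) = fun=> 0); first exact: deriv_on_cst.
  by apply/funext => s; rewrite big_nil.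
rewrite big_cons (_ : (fun s => _) = fun s => (if P i then u i s else 0) + \sum_(j <- r | P j) u j s).
  case: ifP => [/H Pi|_]; first exact: deriv_onD.
  rewrite (_ : (fun s => _) = fun s => \sum_(j <- r | P j) u j s)//.
  by apply/funext => s; rewrite add0r.
by apply/funext => s; rewrite big_cons; case: ifP; rewrite ?add0r.
Qed.

Lemma sub_sub (R : realType) (V : normedModType R) (a b a' b' : V) :
  a - b - (a' - b') = (a - a') - (b - b').
Proof. by lmod_over R V. Qed.

Lemma sub_add (R : realType) (V : normedModType R) (a b a' b' d : V) :
  a + b + d - (a' + b' + d) = (a - a') + (b - b').
Proof. by lmod_over R V. Qed.

Section Reduction.
Variables (R : realType) (c : scalar_kind).
Local Notation K := (scalar_field R c).
Variables (X Y : completeNormedModType K) (S : adae X Y).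
Local Notation B := (opB S).
Local Notation ν := (nu S).
Local Notation n := (nchains S).
Local Notation f := (rhs S).
Local Notation rX := (realify X).
Local Notation rY := (realify Y).
Local Notation PT := (@PT _ _ _ _ S).
Local Notation level := (@level _ _ _ _ S).
Local Notation Td := (@Td _ _ _ _ S).
Local Notation Tw := (@Tw _ _ _ _ S).
Local Notation Ts := (@Ts _ _ _ _ S).
Local Notation Tdw := (@Tdw _ _ _ _ S).
Local Notation Ainv := (@Ainv _ _ _ _ S).
Context {HS : root_adae S}.
Local Notation PT_blinear := (@PT_blinear _ _ _ _ S HS).
Local Notation chain_bounds := (@chain_bounds _ _ _ _ S HS).
Local Notation Q1_blinear := (@Q1_blinear _ _ _ _ S HS).
Variables (M20 : set X) (M2d M2w : nat -> set X).
Hypothesis Had : admissible S M20 M2d M2w.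
Local Notation Hpencil := (ad_pencil Had).
Local Notation MM := (MM S M20 M2d M2w).
Local Notation MS := (MS S M2d M2w).
Local Notation MM_dom := (@MM_dom _ _ _ _ S HS M20 M2d M2w Had).
Local Notation MS_level := (@MS_level _ _ _ _ S HS M20 M2d M2w Had).
Local Notation AinvP := (@AinvP _ _ _ _ S HS Hpencil).
Local Notation Ainv_blinear := (@Ainv_blinear _ _ _ _ S HS Hpencil).
Local Notation BAinv_blinear := (@BAinv_blinear _ _ _ _ S HS Hpencil).
Variables (u du w dw : nat -> R -> rX) (eta : R -> X -> rX).
Hypothesis Hred : reduction S M20 M2d M2w u du w dw eta.
Local Notation z := (sigma_part S u w).

(** The wedge term of level nu - 1 vanishes; it is included so that each level j contributes [du j]
    + [dw j]. *)
Definition sigma_deriv t : rX := \sum_(1 <= j < ν) ((du j t : rX) + dw j t).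

Lemma level_Td_last j x : (ν <= j)%N -> level (Td j) x -> x = 0.
Proof.
move=> jl <-; apply: chain_proj_eq0 => i s si; have := chain_bounds i.
by apply: contraTF => /andP[/eqP -> jm]; lia.
Qed.

Lemma sigma_has_deriv t : 0 <= t -> deriv_on half_line z t (sigma_deriv t).
Proof.
move=> t0; rewrite /sigma_deriv big_split /=.
have -> : \sum_(1 <= j < ν) dw j t = \sum_(1 <= j < ν.-1) dw j t.
  have [ν1|ν2] := leqP ν 1; first by rewrite !big_geq//; lia.
  rewrite (big_cat_nat (n := ν.-1)) /=; [|lia|lia].
  rewrite [X in _ + X]big_nat [X in _ + X]big1 ?addr0// => j jr.
  have j1 : (1 <= j)%N by lia.
  by have [_ l] := red_level Hred t j1; apply: level_Tw_last l; lia.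
rewrite /sigma_part; apply: deriv_onD; rewrite big_nat.
  apply: (@eq_deriv_on _ _ _ (fun s => \sum_(1 <= j < ν | (1 <= j < ν)%N) u j s)) => //.
    by move=> s _; rewrite -big_nat.
  by apply: deriv_on_sum => j jr; have [] := red_u Hred jr t0.
apply: (@eq_deriv_on _ _ _ (fun s => \sum_(1 <= j < ν.-1 | (1 <= j < ν.-1)%N) w j s)) => //.
  by move=> s _; rewrite -big_nat.
by apply: deriv_on_sum => j /andP[j1 _]; exact: (red_dw Hred).
Qed.

Lemma sigma_cont t : 0 <= t -> cont_on half_line z t.
Proof. by move=> /sigma_has_deriv; exact: deriv_on_cont. Qed.

Lemma sigma_deriv_cont : smooth 0 sigma_deriv.
Proof.
apply: (@eq_smooth _ _ _ (fun t => \sum_(1 <= j < ν | (1 <= j < ν)%N) ((du j t : rX) + dw j t))).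
  by move=> t _; rewrite -big_nat.
apply: smooth_sum => j /andP[j1 _]; have [h1 h2] := red_cont Hred j1; exact: (@smoothD _ _ 0).
Qed.

Lemma sigma_MS t : 0 <= t -> MS (z t).
Proof. move=> t0; exact: (sigma_part_MS (red_u Hred) (red_w Hred)). Qed.

Lemma sigma_level t : 0 <= t -> level (Tdw 1) (z t).
Proof. by move=> t0; have [Ml _] := MS_level; exact: Ml (sigma_MS t0). Qed.

Lemma PT_Ts j x : PT (Ts j) x = P2d S j x + P2w S j x.
Proof.
rewrite P2d_PT P2w_PT /PT chain_projD => [|i s _]; rewrite ?/Td ?/Tw; last lia.
by apply: eq_PT => i s si; rewrite /Td /Tw /Ts; lia.
Qed.

Lemma PT_Ts_deriv j t : (1 <= j)%N -> PT (Ts j) (sigma_deriv t) = (du j t : X) + dw j t.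
Proof.
move=> j1; have [lu lw] := red_level Hred t j1.
have ls i : (1 <= i)%N -> level (Ts i) ((du i t : X) + dw i t).
  move=> i1; have [l1 l2] := red_level Hred t i1.
  by apply: levelD; [apply: level_sub l1|apply: level_sub l2] => k s _ /andP[].
have bP := PT_blinear (Ts j).
have [jν|jν] := ltnP j ν; last first.
  rewrite (level_Td_last jν lu) (level_Tw_last _ lw) ?addr0; last lia.
  rewrite PT_Ts P2d_PT P2w_PT (level_Td_last jν (level_PT _ _)).
  by rewrite (level_Tw_last _ (level_PT _ _)) ?addr0//; lia.
rewrite /sigma_deriv (blinear_sum bP) (bigD1_seq j) ?mem_index_iota ?iota_uniq ?j1//=.
rewrite (ls j j1) big_nat_cond big1 ?addr0// => i /andP[ir ij].
apply: PT_level0 (ls i _) => [k s _|]; last by case/andP: ir.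
by rewrite /Ts; lia.
Qed.

Lemma PT_Ts_sigma j t x : (1 <= j)%N -> 0 <= t -> ((j < ν)%N -> P2d S j x = u j t) ->
  ((j < ν.-1)%N -> P2w S j x = w j t) -> PT (Ts j) x = PT (Ts j) (z t).
Proof.
move=> j1 t0 Pu Pw.
have zz : P2S S (z t) = z t by rewrite P2S_PT; exact: sigma_level.
have [zu zw] := sigma_components Had (red_u Hred) (red_w Hred) t0 zz.
rewrite !PT_Ts; congr (_ + _).
  have [jν|jν] := ltnP j ν; first by rewrite Pu// zu// j1.
  by rewrite !P2d_PT !(level_Td_last jν (level_PT _ _)).
have [jν|jν] := ltnP j ν.-1; first by rewrite Pw// zw// j1.
by rewrite !P2w_PT !(level_Tw_last jν (level_PT _ _)).
Qed.

(** The only state in M compatible with the constraints at time t and with A x_1 = W. *)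
Definition consistent_state (t : R) (W : Y) : X := Ainv W + eta t (Ainv W) + z t.

(** Time is frozen at 0 for negative t, and W enters through [Ainv], hence through Q_1 W: the field
    is defined on the whole line and on the whole of Y, as the existence theory demands, and takes
    values in Y_1. *)
Definition reduced_field (t : R) (W : rY) : rY :=
  Q1 S (f (Num.max t 0) (consistent_state (Num.max t 0) W)) - Q1 S (B (Ainv W)).

Lemma eta_level t x1 : 0 <= t -> D1 S x1 -> level (Ts 0) (eta t x1).
Proof.
by move=> t0 Dx; have [Me _ _] := red_eta Hred t0 Dx; have [Ml _] := M20_open (ad_open Had); exact: Ml.
Qed.

Lemma state_MM t W : 0 <= t -> MM (consistent_state t W).
Proof.
move=> t0; have [Da _] := AinvP W; have [Me _ _] := red_eta Hred t0 Da.
by apply: MM_sum => //; exact: sigma_MS.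
Qed.

Lemma P1_state t W : 0 <= t -> P1 S (consistent_state t W) = Ainv W.
Proof.
move=> t0; have [Da _] := AinvP W.
by apply: P1_sum => //; [exact: eta_level|exact: sigma_level].
Qed.

Lemma P2S_state t W : 0 <= t -> P2S S (consistent_state t W) = z t.
Proof.
move=> t0; have [Da _] := AinvP W.
by apply: (P2S_sum3 Had) => //; [exact: eta_level|exact: sigma_MS].
Qed.

Lemma state_cont t W (e : R) : 0 <= t -> 0 < e -> exists2 d : R, 0 < d &
  forall s V, 0 <= s -> `|s - t| < d -> nrm (V - W) < d -> nrm (consistent_state s V - consistent_state t W) <= e.
Proof.
move=> t0 e0; have [C C0 HC] := blinear_bound Ainv_blinear.
have e4 : 0 < e / 4 by rewrite divr_gt0.
have [DW _] := AinvP W.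
have [d1 d10 H1] := red_eta_cont Hred t0 DW e4; have [d2 d20 H2] := sigma_cont t0 e4.
have [d [d0 l1 l2 l3 l4]] : exists d, [/\ 0 < d, d <= d1, d <= d2, d <= d1 / C & d <= e / 4 / C].
  exists (Num.min (Num.min d1 d2) (Num.min (d1 / C) (e / 4 / C))).
  by rewrite !lt_min d10 d20 !divr_gt0// !ge_min !lexx ?orbT.
move: l3 l4; rewrite !ler_pdivlMr// ![d * C]mulrC => l3 l4.
exists d => // s V s0 st VW; have [DV _] := AinvP V.
have AVW : nrm (Ainv V - Ainv W) <= C * nrm (V - W).
  have -> : Ainv V - Ainv W = Ainv (V - W) by rewrite (blinearB Ainv_blinear).
  exact: HC.
have CVW : C * nrm (V - W) < C * d by rewrite ltr_pM2l.
have k1 : nrm ((eta s (Ainv V) : X) - eta t (Ainv W)) <= e / 4 by apply: H1 => //; lra.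
have k2 : nrm ((z s : X) - z t) <= e / 4 by apply: H2 => //; lra.
rewrite (_ : consistent_state s V - consistent_state t W =
  (Ainv V - Ainv W) + ((eta s (Ainv V) : X) - eta t (Ainv W)) + ((z s : X) - z t)); last first.
  by rewrite /consistent_state !opprD; lmod_over (scalar_field R c : comNzRingType) X.
apply: le_trans (nrm_triangle _ _) _.
have := nrm_triangle (Ainv V - Ainv W) ((eta s (Ainv V) : X) - eta t (Ainv W)); lra.
Qed.

Lemma max0_dist (s t : R) : `|Num.max s 0 - Num.max t 0| <= `|s - t|.
Proof.
by rewrite /Num.max; do 2 (case: ifPn; rewrite -?leNgt => ?); rewrite ler_norml;
  have := ler_norm (s - t); have := ler_norm (t - s); rewrite (distrC t); lra.
Qed.

Lemma reduced_rhs_cont : jointly_cont reduced_field.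
Proof.
move=> t W e e0; pose t' := Num.max t 0; have t'0 : 0 <= t' by rewrite le_max lexx orbT.
have [C1 C10 HC1] := blinear_bound Q1_blinear.
have [C2 C20 HC2] := blinear_bound (blinear_comp BAinv_blinear Q1_blinear).
have e1 : 0 < e / 2 / C1 by rewrite !divr_gt0.
have [d d0 Hd] := @rhs_cont_eps _ _ _ _ S M20 M2d M2w Had t' _ _ t'0 (MM_dom (state_MM W t'0)) e1.
have d2 : 0 < d / 2 by rewrite divr_gt0.
have [d' d'0 Hd'] := state_cont W t'0 d2.
have e2 : 0 < e / 2 / C2 by rewrite !divr_gt0.
exists (Num.min d (Num.min d' (e / 2 / C2))) => [|s V]; first by rewrite !lt_min d0 d'0.
rewrite !lt_min => /andP[s1 /andP[s2 _]] /andP[_ /andP[v2 v3]].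
have s'0 : 0 <= Num.max s 0 by rewrite le_max lexx orbT.
have st' := max0_dist s t.
have K1 : nrm (f (Num.max s 0) (consistent_state (Num.max s 0) V) - f t' (consistent_state t' W)) <= e / 2 / C1.
  apply: Hd => //; [exact: MM_dom (state_MM V s'0)|exact: le_lt_trans st' s1|].
  apply: (@le_lt_trans _ _ (d / 2)); last lra.
  by apply: Hd' => //; exact: le_lt_trans st' s2.
rewrite /reduced_field -/t'.
rewrite (_ : _ - _ = (Q1 S (f (Num.max s 0) (consistent_state (Num.max s 0) V) - f t' (consistent_state t' W) : rY) : rY)
  - ((Q1 S \o (B \o Ainv)) (V - W) : rY)); last first.
  rewrite (blinearB Q1_blinear) (blinearB (blinear_comp BAinv_blinear Q1_blinear)) /=.
  exact: (@sub_sub R rY).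
rewrite (le_trans (ler_normB _ _))// (splitr e) lerD//.
  by apply: le_trans (HC1 _) _; rewrite mulrC -ler_pdivlMr//; exact: K1.
by apply: le_trans (HC2 _) _; rewrite mulrC -ler_pdivlMr//; exact: ltW.
Qed.

(** Two states at one time share the component x_{2 Sigma}, so a Lipschitz condition with respect to
    x_1 + x_{20} is exactly what is required. *)
Lemma reduced_rhs_lip : loc_lipschitz reduced_field.
Proof.
move=> t W; pose t' := Num.max t 0; have t'0 : 0 <= t' by rewrite le_max lexx orbT.
have [C1 C10 HC1] := blinear_bound Ainv_blinear.
have [C2 C20 HC2] := blinear_bound (blinear_comp BAinv_blinear Q1_blinear).
have [lip _] := components_lipschitz Had.
have [d [L [d0 L0 HL]]] := lip t' _ t'0 (state_MM W t'0).
have [DW _] := AinvP W.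
have [d1 [L1 [d10 L10 HL1]]] := red_eta_lip Hred t'0 DW.
have d2 : 0 < d / 2 by rewrite divr_gt0.
have [d' d'0 Hd'] := state_cont W t'0 d2.
have [r [r0 l1 l2 l3 l4]] : exists r, [/\ 0 < r, r <= d, r <= d', r <= d1 & r <= d1 / C1].
  exists (Num.min (Num.min d d') (Num.min d1 (d1 / C1))).
  by rewrite !lt_min d0 d'0 d10 divr_gt0// !ge_min !lexx ?orbT.
move: l4; rewrite ler_pdivlMr// [r * C1]mulrC => l4.
exists r, (L * (C1 + L1 * C1) + C2); split=> //.
  by rewrite addr_ge0// ?mulr_ge0 ?addr_ge0 ?mulr_ge0// ltW.
move=> s V V' st VW V'W; have [DV _] := AinvP V; have [DV' _] := AinvP V'.
have s'0 : 0 <= Num.max s 0 by rewrite le_max lexx orbT.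
set s' := Num.max s 0 in s'0 *.
have st' : `|s' - t'| < r by exact: le_lt_trans (max0_dist s t) st.
have AB V1 V2 : nrm (Ainv V1 - Ainv V2) <= C1 * nrm (V1 - V2).
  have -> : Ainv V1 - Ainv V2 = Ainv (V1 - V2) by rewrite (blinearB Ainv_blinear).
  exact: HC1.
have nearA V1 : nrm (V1 - W) < r -> nrm (Ainv V1 - Ainv W) < d1.
  by move=> h; rewrite (le_lt_trans (AB _ _))// (lt_le_trans _ l4)// ltr_pM2l.
have sV V1 : nrm (V1 - W) < r -> nrm (consistent_state s' V1 - consistent_state t' W) < d.
  move=> h; apply: (@le_lt_trans _ _ (d / 2)); last lra.
  apply: Hd' => //; [exact: lt_le_trans st' l2|exact: lt_le_trans h l2].
have E : nrm ((eta s' (Ainv V) : X) - eta s' (Ainv V')) <= L1 * (C1 * nrm (V - V')).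
  apply: (@le_trans _ _ (L1 * nrm (Ainv V - Ainv V'))); last by apply: ler_wpM2l.
  by apply: HL1 => //; [exact: lt_le_trans st' l3|exact: nearA|exact: nearA].
have SS : nrm (consistent_state s' V - consistent_state s' V') <= (C1 + L1 * C1) * nrm (V - V').
  rewrite (_ : consistent_state s' V - consistent_state s' V' =
    (Ainv V - Ainv V') + ((eta s' (Ainv V) : X) - eta s' (Ainv V'))); last first.
    exact: (@sub_add R rX).
  by rewrite (le_trans (nrm_triangle _ _))// mulrDl lerD// -mulrA.
have QQ : nrm (Q1 S (f s' (consistent_state s' V)) - Q1 S (f s' (consistent_state s' V'))) <=
    L * ((C1 + L1 * C1) * nrm (V - V')).
  apply: (@le_trans _ _ (L * nrm (consistent_state s' V - consistent_state s' V'))); last by apply: ler_wpM2l.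
  apply: HL => //; [exact: lt_le_trans st' l1|exact: state_MM|exact: state_MM|exact: sV|exact: sV|].
  by rewrite !P2S_state.
rewrite /reduced_field -/s'.
rewrite (_ : _ - _ = ((Q1 S (f s' (consistent_state s' V)) : rY) - Q1 S (f s' (consistent_state s' V')))
  - ((Q1 S \o (B \o Ainv)) (V - V') : rY)); last first.
  by rewrite (blinearB (blinear_comp BAinv_blinear Q1_blinear)); exact: (@sub_sub R rY).
apply: le_trans (ler_normB _ _) _; rewrite mulrDl; apply: lerD; last exact: HC2.
by rewrite -mulrA; exact: QQ.
Qed.

Lemma Ainv_Q1 W : Ainv (Q1 S W) = Ainv W.
Proof. by rewrite /Ainv Q1_idem. Qed.

Lemma reduced_rhs_Q1 t W : reduced_field t (Q1 S W) = reduced_field t W.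
Proof. by rewrite /reduced_field /consistent_state Ainv_Q1. Qed.

Lemma Q1_reduced_rhs t W : Q1 S (reduced_field t W) = reduced_field t W.
Proof. by rewrite /reduced_field (blinearB Q1_blinear) !Q1_idem. Qed.

(** The field depends on Q_1 W alone and has values in Y_1. By uniqueness, a solution that starts in
    Y_1 will therefore remain there. *)
Lemma sol_Q1 (J : set R) (W : R -> rY) : sol_on reduced_field J W ->
  sol_on reduced_field J (fun t => Q1 S (W t)).
Proof.
move=> sW t Jt; rewrite reduced_rhs_Q1 -Q1_reduced_rhs.
exact: (deriv_on_blinear Q1_blinear (sW t Jt)).
Qed.

Lemma Q1_rhs_bound (a r : R) : exists2 C : R, 0 <= C &
  forall t x, 0 <= t <= a -> MM x -> nrm (P1 S x) <= r -> nrm (Q1 S (f t x)) <= C.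
Proof.
have a0 : 0 < Num.max a 1 by rewrite lt_max ltr01 orbT.
have r0 : 0 < Num.max r 1 by rewrite lt_max ltr01 orbT.
have := ad_3 Had a0 r0; set Sup := ereal_sup _ => Soo.
have ub t x : 0 <= t <= a -> MM x -> nrm (P1 S x) <= r -> ((nrm (Q1 S (f t x)))%:E <= Sup)%E.
  move=> /andP[t0 ta] Mx xr; apply: ereal_sup_ubound; exists (t, x) => //=.
  by rewrite t0 !le_max ta xr.
move: Soo ub; case: Sup => [C|//|] _ ub; last first.
  by exists 0 => // t x ta Mx xr; have := ub t x ta Mx xr.
exists (Num.max C 0) => [|t x ta Mx xr]; first by rewrite le_max lexx orbT.
by have := ub t x ta Mx xr; rewrite lee_fin le_max => ->.
Qed.

Lemma reduced_rhs_bound (a r : R) : exists M : R, forall t W, 0 <= t <= a -> `|W| <= r ->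
  `|reduced_field t W| <= M.
Proof.
have [C1 C10 HC1] := blinear_bound Ainv_blinear.
have [C2 C20 HC2] := blinear_bound (blinear_comp BAinv_blinear Q1_blinear).
have [C C0 HC] := Q1_rhs_bound a (C1 * r).
exists (C + C2 * r) => t W /andP[t0 ta] Wr; rewrite /reduced_field (max_idPl t0).
rewrite (le_trans (ler_normB _ _))// lerD//.
  apply: (HC t) => //; [by rewrite t0|exact: state_MM|rewrite P1_state//].
  by apply: (le_trans (HC1 W)); rewrite ler_pM2l.
by apply: (le_trans (HC2 W)); rewrite ler_pM2l.
Qed.
End Reduction.

Lemma add_sub_sub (R : realType) (V : normedModType R) (a b : V) : a + b - a - b = 0.
Proof. by lmod_over R V. Qed.

(** * Equivalence of the original problem with the reduced equation *)

Section Equivalence.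
Variables (R : realType) (c : scalar_kind).
Local Notation K := (scalar_field R c).
Variables (X Y : completeNormedModType K) (S : adae X Y).
Local Notation A := (opA S).
Local Notation B := (opB S).
Local Notation ν := (nu S).
Local Notation n := (nchains S).
Local Notation m := (@chain_len _ _ _ _ S).
Local Notation f := (rhs S).
Local Notation rX := (realify X).
Local Notation rY := (realify Y).
Local Notation PT := (@PT _ _ _ _ S).
Local Notation QT := (@QT _ _ _ _ S).
Local Notation level := (@level _ _ _ _ S).
Local Notation Td := (@Td _ _ _ _ S).
Local Notation Tw := (@Tw _ _ _ _ S).
Local Notation Ts := (@Ts _ _ _ _ S).
Local Notation Tdw := (@Tdw _ _ _ _ S).
Context {HS : root_adae S}.
Local Notation PT_blinear := (@PT_blinear _ _ _ _ S HS).
Local Notation QT_blinear := (@QT_blinear _ _ _ _ S HS).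
Local Notation chain_bounds := (@chain_bounds _ _ _ _ S HS).
Local Notation A_lin := (@A_lin _ _ _ _ S HS).
Local Notation P1_blinear := (@P1_blinear _ _ _ _ S HS).
Local Notation Q1_blinear := (@Q1_blinear _ _ _ _ S HS).
Variables (M20 : set X) (M2d M2w : nat -> set X).
Hypothesis Had : admissible S M20 M2d M2w.
Local Notation Hpencil := (ad_pencil Had).
Local Notation MM := (MM S M20 M2d M2w).
Local Notation MM_dom := (@MM_dom _ _ _ _ S HS M20 M2d M2w Had).
Local Notation AinvP := (@AinvP _ _ _ _ S HS Hpencil).
Local Notation AinvA := (@AinvA _ _ _ _ S HS Hpencil).
Local Notation BAinv_blinear := (@BAinv_blinear _ _ _ _ S HS Hpencil).
Variables (u du w dw : nat -> R -> rX) (eta : R -> X -> rX).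
Hypothesis Hred : reduction S M20 M2d M2w u du w dw eta.
Local Notation z := (sigma_part S u w).
Local Notation zd := (sigma_deriv S du dw).
Local Notation state := (consistent_state S u w eta).
Local Notation reduced_rhs := (reduced_field S u w eta).
Local Notation sigma_level := (@sigma_level _ _ _ _ S HS _ _ _ Had _ _ _ _ _ Hred).
Local Notation eta_level := (@eta_level _ _ _ _ S HS _ _ _ Had _ _ _ _ _ Hred).
Local Notation state_MM := (@state_MM _ _ _ _ S HS _ _ _ Had _ _ _ _ _ Hred).
Local Notation state_cont := (@state_cont _ _ _ _ S HS _ _ _ Had _ _ _ _ _ Hred).
Local Notation reduced_rhs_cont := (@reduced_rhs_cont _ _ _ _ S HS _ _ _ Had _ _ _ _ _ Hred).
Local Notation sigma_has_deriv := (@sigma_has_deriv _ _ _ _ S HS _ _ _ _ _ _ _ _ Hred).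
Local Notation sigma_cont := (@sigma_cont _ _ _ _ S HS _ _ _ _ _ _ _ _ Hred).

(** The set on which [solution] imposes the equation; the point 0 is dropped only for the full
    half-line. *)
Definition open_part (J : set R) : set R := [set t | J t /\ (J = [set s | 0 <= s] -> 0 < t)].

Lemma open_part_sub J : open_part J `<=` J. Proof. by move=> t []. Qed.

Lemma interval_from_sub (t0 : R) (J : set R) : interval_from t0 J -> J `<=` half_line.
Proof. by move=> [_ t00 _ Jt0 _] t /Jt0; exact: le_trans. Qed.

Lemma interval_from_clusters (t0 : R) (J : set R) t : interval_from t0 J -> J t -> clusters J t.
Proof.
move=> [iJ _ Jt0 _ [t1 Jt1 t01]] Jt; apply: interval_clusters => //.
by have [E|n0] := eqVneq t0 t; [exists t1 => //; rewrite -E gt_eqF|exists t0].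
Qed.

Lemma open_part_clusters (t0 : R) (J : set R) t : interval_from t0 J -> open_part J t -> clusters (open_part J) t.
Proof.
move=> HJ [Jt tp] d d0; have [JE|JN] := pselect (J = [set s | 0 <= s]).
  have t_0 := tp JE; have Jt2 : J (t + d / 2) by rewrite JE /=; lra.
  exists (t + d / 2); split.
  - by split=> [|_]; [exact: Jt2|lra].
  - by rewrite -subr_eq0 addrAC subrr add0r gt_eqF// divr_gt0.
  - by rewrite addrAC subrr add0r gtr0_norm ?divr_gt0//; lra.
have [s [Js st sd]] := interval_from_clusters HJ Jt d0.
by exists s; split.
Qed.

(** At most the point 0 is missing from [open_part J], and it is a limit of other points of J. *)
Lemma open_part_eq (E : normedModType R) (t0 : R) (J : set R) (g h : R -> E) : interval_from t0 J ->
  (forall t, J t -> cont_on J g t) -> (forall t, J t -> cont_on J h t) ->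
  (forall t, open_part J t -> g t = h t) -> forall t, J t -> g t = h t.
Proof.
move=> HJ cg ch gh t Jt; have [op|nop] := pselect (open_part J t); first exact: gh.
apply: (cont_on_unique (interval_from_clusters HJ Jt) (cg t Jt) (ch t Jt)) => s Js st.
apply: gh; split=> // JE; apply: contrapT => /negP; rewrite -leNgt => s0; apply: nop.
split=> // _; rewrite lt_neqAle; have t00 := interval_from_sub HJ Jt.
have s00 := interval_from_sub HJ Js; rewrite t00 andbT.
have -> : 0 = s by apply/eqP; rewrite eq_le s0 s00.
exact: st.
Qed.

(** A lowers the level by one, and a chain of length s + 1 has no level s + 1. *)
Lemma QT_Td_A s x : dom S x -> QT (Td s) (A x) = 0.
Proof.
move=> dx; rewrite QT_A//.
have -> : PT (fun i s' => (0 < s')%N && Td s i s'.-1) x = 0.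
  by apply: chain_proj_eq0 => i k ki; rewrite /Td; lia.
exact: (lin_dom0 A_lin).
Qed.

Lemma QT_Tw_A s x : dom S x -> QT (Tw s) (A x) = A (PT (Ts s.+1) x).
Proof.
by move=> dx; rewrite QT_A//; congr A; apply: eq_PT => i k ki; rewrite /Tw /Ts; lia.
Qed.

Lemma QT_Ts_A x : dom S x -> QT (Ts 0) (A x) = A (PT (Ts 1) x).
Proof.
by move=> dx; rewrite QT_A//; congr A; apply: eq_PT => i k ki; rewrite /Ts; lia.
Qed.

Lemma A_Ts_sigma_deriv (J : set R) j t : J `<=` half_line -> 0 <= t ->
  deriv_on J (fun s => A (PT (Ts j) (z s)) : rY) t (A (PT (Ts j) (zd t))).
Proof.
move=> JH t0; have bA := @lin_PT_blinear _ _ _ _ S HS _ (Ts j) A_lin.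
exact: deriv_on_sub JH (deriv_on_blinear bA (sigma_has_deriv t0)).
Qed.

Section FromSolution.
Variables (t0 : R) (J : set R) (x : R -> X).
Hypotheses (HJ : interval_from t0 J) (Hx : solution_in S MM J x).
Local Notation J' := (open_part J).

Let JH : J `<=` half_line. Proof. exact: interval_from_sub HJ. Qed.
Let J'J := @open_part_sub J.
Let Mx t : J t -> MM (x t). Proof. by move=> Jt; have [_ /(_ t Jt)] := Hx. Qed.
Let dx t : J t -> dom S (x t). Proof. by move=> /Mx/MM_dom. Qed.
Let xc t : J t -> cont_on J (x : R -> rX) t.
Proof. by move=> Jt; have [[/within_contP xc _ _] _] := Hx; exact: xc. Qed.

Let Ax_deriv t : J' t -> deriv_on J' (fun s => A (x s) : rY) t (f t (x t) - B (x t)).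
Proof.
move=> J't; have [[_ _ [y' [H1 _ H3]]] _] := Hx.
have := H1 t J't; rewrite tderivP; congr (deriv_on _ _ _ _).
by rewrite -(H3 t J't) addrK.
Qed.

Let QT_deriv T t : J' t -> deriv_on J' (fun s => QT T (A (x s)) : rY) t
  (QT T (f t (x t)) - B (PT T (x t))).
Proof.
move=> J't; have := deriv_on_blinear (QT_blinear T) (Ax_deriv J't).
by rewrite (blinearB (QT_blinear T)) QT_B//; exact/dx/J'J.
Qed.

(** Once the projection of A x is known as an explicit curve, uniqueness of derivatives turns the
    projected differential equation into an algebraic one. *)
Let QT_value T (g : R -> rY) t l : J' t -> (forall s, J' s -> QT T (A (x s)) = g s) ->
  deriv_on J' g t l -> QT T (f t (x t)) = B (PT T (x t)) + (l : Y).
Proof.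
move=> J't E dg.
have H : deriv_on J' g t (QT T (f t (x t)) - B (PT T (x t))) by exact: eq_deriv_on (QT_deriv T J't).
have := deriv_on_unique (open_part_clusters HJ J't) H dg => <-.
by rewrite addrC subrK.
Qed.

Lemma solution_d_part t : J' t -> forall s, (1 <= s < ν)%N -> P2d S s (x t) = u s t.
Proof.
move=> J't s sr; have Jt := J'J J't.
apply: (d_part_unique Had (red_u Hred)) sr => [| |k kr]; [exact: JH|exact: Mx|].
rewrite Q2d_QT P2d_PT; have := @QT_value (Td k) (fun=> 0) t 0 J't _ (@deriv_on_cst _ _ _ _ _).
by rewrite addr0; apply => r J'r; apply: QT_Td_A; exact/dx/J'J.
Qed.

(** Downwards in s: with the components of level s + 1 known at all times, the derivative in the
    projected equation is that of a known curve, and uniqueness in condition 1.c or 1.d applies. *)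
Lemma solution_w_part t : J' t -> forall s, (1 <= s < ν.-1)%N -> P2w S s (x t) = w s t.
Proof.
suff H k s : (ν.-1 - k <= s)%N -> (1 <= s < ν.-1)%N -> forall t, J' t -> P2w S s (x t) = w s t.
  by move=> J't s sr; apply: (H ν s) => //; lia.
elim: k s => [|k IH] s sk sr r J'r; first lia.
have Jr := J'J J'r; have r0 : 0 <= r by exact: JH.
apply: (w_part_step Had (red_u Hred) (red_w Hred) (fun j t => red_level Hred (j := j) t) sr r0 (Mx Jr)).
- exact: solution_d_part.
- by move=> j jr; apply: IH => //; lia.
rewrite Q2S_QT P2w_PT -(PT_Ts_deriv Hred)//.
apply: (@QT_value (Tw s) (fun q => A (PT (Ts s.+1) (z q)) : rY) r _ J'r); last first.
  by apply: A_Ts_sigma_deriv => // q /J'J/JH.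
move=> q J'q; have Jq := J'J J'q; rewrite QT_Tw_A; last exact: dx.
congr A; apply: (PT_Ts_sigma Had Hred) => //; first exact: JH.
  by move=> sν; apply: solution_d_part.
by move=> sν; apply: IH => //; lia.
Qed.

Lemma solution_sigma t : J t -> P2S S (x t) = z t.
Proof.
apply: (@open_part_eq rX t0 J (fun t => P2S S (x t)) z HJ) => r Jr.
- rewrite (_ : (fun t => _) = PT (Tdw 1) \o x); last by apply/funext => q; rewrite P2S_PT.
  exact: (cont_on_blinear (PT_blinear _) (xc Jr)).
- exact: cont_on_sub JH (sigma_cont (JH Jr)).
rewrite P2S_sum /sigma_part; congr (_ + _); apply: eq_big_nat => j jr.
  exact: solution_d_part.
exact: solution_w_part.
Qed.

Lemma P1_D1 v : dom S v -> D1 S (P1 S v). Proof. by move=> dv; exists v. Qed.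

Lemma solution_eta t : J t -> PT (Ts 0) (x t) = eta t (P1 S (x t)).
Proof.
apply: (@open_part_eq rX t0 J (fun t => PT (Ts 0) (x t)) (fun t => eta t (P1 S (x t))) HJ) => r Jr.
- exact: (cont_on_blinear (PT_blinear _) (xc Jr)).
- move=> e e0; have D1r := P1_D1 (dx Jr).
  have [d d0 Hd] := red_eta_cont Hred (JH Jr) D1r e0.
  have d2 : 0 < d / 2 by rewrite divr_gt0.
  have [d' d'0 Hd'] := cont_on_blinear P1_blinear (xc Jr) d2.
  exists (Num.min d d') => [|s Js]; first by rewrite lt_min d0.
  rewrite lt_min => /andP[s1 s2]; apply: Hd => //; [exact: JH|exact: P1_D1 (dx Js)|].
  by apply: (le_lt_trans (Hd' s Js s2)); lra.
have Jr' := J'J Jr; have r0 := JH Jr'; have D1r := P1_D1 (dx Jr').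
have [_ _] := red_eta Hred r0 D1r; apply.
  by have /(MM_P Had)[_ h _] := Mx Jr'.
have lev1 q : level (Td 1) (du 1 q) by have [] := red_level Hred q (ltn0Sn 0).
have lev2 q : level (Tw 1) (dw 1 q) by have [] := red_level Hred q (ltn0Sn 0).
rewrite PhiE//.
have xE : P1 S (x r) + PT (Ts 0) (x r) + z r = x r.
  by rewrite -(solution_sigma Jr') -decomposition.
rewrite xE -(PT_Ts_deriv Hred)// PT_idem.
rewrite (@QT_value (Ts 0) (fun q => A (PT (Ts 1) (z q)) : rY) r (A (PT (Ts 1) (zd r))) Jr).
- exact: (@add_sub_sub R rY).
- move=> q J'q; have Jq := J'J J'q; rewrite QT_Ts_A; last exact: dx.
  congr A; apply: (PT_Ts_sigma Had Hred) => //; first exact: JH.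
    by move=> sν; apply: solution_d_part.
  by move=> sν; apply: solution_w_part.
- by apply: A_Ts_sigma_deriv => // q /J'J/JH.
Qed.

Local Notation W := (fun t => A (P1 S (x t)) : rY).

Lemma solution_state t : J t -> x t = state t (W t).
Proof.
move=> Jt; rewrite /state AinvA; last exact: P1_D1 (dx Jt).
by rewrite -solution_eta// -solution_sigma// -decomposition.
Qed.

Let W_deriv' t : J' t -> deriv_on J' W t (reduced_rhs t (W t)).
Proof.
move=> J't; have Jt := J'J J't; have := deriv_on_blinear Q1_blinear (Ax_deriv J't).
have -> : Q1 S (f t (x t) - B (x t)) = reduced_rhs t (W t).
  rewrite /reduced_rhs (max_idPl (JH Jt)) -solution_state// AinvA; last exact: P1_D1 (dx Jt).
  rewrite (blinearB Q1_blinear) Q1_B; last exact: dx.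
  by rewrite Q1_B ?P1_idem//; exact: P1_dom (dx Jt).
apply: eq_deriv_on => // s J's /=.
by rewrite Q1_A//; exact/dx/J'J.
Qed.

(* At t = 0 the equation is not required when J = [0, +oo); the boundedness condition 3
   makes W Lipschitz near 0, and closedness of A identifies its limit. *)
Let W_cont0 : J = [set s | 0 <= s] -> cont_on J W 0.
Proof.
move=> JE; have J0 : J 0 by rewrite JE /=.
have Jp t : 0 < t -> J' t by move=> tp; split=> //; rewrite JE /= ltW.
have sub01 : [set` `[0, 1]] `<=` J by move=> t; rewrite /= in_itv/= JE => /andP[].
have [r Hr] : exists r, forall t, 0 <= t <= 1 -> nrm (P1 S (x t)) <= r.
  apply: (@cont_on_bounded R rX (fun t => P1 S (x t))) => // t t01.
  have Jt : J t by rewrite JE /=; lra.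
  exact: cont_on_sub sub01 (cont_on_blinear P1_blinear (xc Jt)).
have [C C0 HC] := Q1_rhs_bound Had 1 r.
have [Kb Kb0 HK] := blinear_bound (blinear_comp BAinv_blinear Q1_blinear).
have K0 := ltW Kb0.
have gb t : 0 < t <= 1 -> `|reduced_rhs t (W t)| <= Kb * `|W t| + C.
  move=> t01; have Jt : J t by rewrite JE /=; lra.
  rewrite /reduced_rhs (max_idPl (JH Jt)) -solution_state//.
  rewrite (le_trans (ler_normB _ _))// addrC; apply: lerD; first exact: HK.
  by apply: (HC t) => //; [lra|exact: Mx|apply: Hr; lra].
have K1 : 0 < 2 * Kb + 1 by lra.
pose h := (2 * Kb + 1)^-1; have h0 : 0 < h by rewrite invr_gt0.
have h1 : h <= 1 by rewrite invf_le1//; lra.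
have Kh : Kb * h <= 2^-1 by rewrite /h ler_pdivrMr//; lra.
have subah a : 0 < a -> [set` `[a, h]] `<=` J'.
  by move=> a0 t; rewrite /= in_itv/= => /andP[a1 _]; apply: Jp; exact: lt_le_trans a0 a1.
have dW a t : 0 < a -> a <= t <= h -> deriv_on `[a, h] W t (reduced_rhs t (W t)).
  move=> a0 tah; apply: deriv_on_sub (subah a a0) _; apply: W_deriv'; apply: Jp; lra.
pose Bd := 2 * (`|W h| + C * h).
have Wb t : 0 < t <= h -> `|W t| <= Bd.
  move=> th; have [tp th'] := andP th.
  (* Gronwall's estimate runs backwards from h, so the bound is uniform as t tends to 0. *)
  have H : `|W t| <= 2 * (`|W h| + C * (h - t)).
    apply: (@short_gronwall R rY W (fun t => reduced_rhs t (W t)) t h h Kb C K0 C0).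
    - by apply: le_trans Kh; apply: ler_wpM2l => //; lra.
    - by rewrite th' lexx.
    - by move=> s sh; exact: dW.
    - by move=> s sh; apply: gb; lra.
    - by rewrite lexx.
  rewrite (le_trans H)// ler_pM2l// lerD2l; apply: ler_wpM2l => //; lra.
have [M M0 HM] : exists2 M, 0 <= M & forall t, 0 < t <= h -> `|reduced_rhs t (W t)| <= M.
  exists (Kb * Bd + C).
    by rewrite addr_ge0// mulr_ge0// mulr_ge0// addr_ge0// mulr_ge0// ltW.
  move=> t th; apply: (le_trans (gb t _)); first lra.
  by rewrite lerD2r; apply: ler_wpM2l => //; exact: Wb.
have lip s t : 0 < s <= h -> 0 < t <= h -> `|W t - W s| <= M * `|t - s|.
  move=> sh th; pose a := Num.min s t; have a0 : 0 < a by rewrite lt_min; lra.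
  have as_ : a <= s by rewrite ge_min lexx.
  have at_ : a <= t by rewrite ge_min lexx orbT.
  apply: (@mean_value_itv R rY W (fun t => reduced_rhs t (W t)) a h); [|move=> q qh; apply: HM; lra|lra|lra].
  by move=> q qh; exact: dW.
pose tn (k : nat) := h * 2^-1 ^+ k.
have tn0 k : 0 < tn k by rewrite mulr_gt0// exprn_gt0// invr_gt0.
have tnS k j : (k <= j)%N -> tn j <= tn k.
  move=> kj; rewrite ler_pM2l// ler_wiXn2l//; lra.
have tnh k : 0 < tn k <= h by rewrite tn0 /=; have := tnS 0%N k (leq0n _); rewrite /tn expr0 mulr1.
have [|l Hl] := @cauchy_bound R rY (fun k => W (tn k)) (fun k => M * h * 2^-1 ^+ k) _ (fun e => @half_pow_small R (M * h) e).
  move=> k j kj; rewrite (le_trans (lip _ _ (tnh k) (tnh j)))// -mulrA; apply: ler_wpM2l => //.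
  by have := tnS k j kj; have := tn0 j; rewrite -/(tn k) ler_norml; lra.
have small e : 0 < e -> exists k, M * tn k <= e /\ tn k < e.
  move=> e0; have e2 : 0 < e / 2 by lra.
  have [N1 H1] := @half_pow_small R (M * h) e e0; have [N2 H2] := @half_pow_small R h _ e2.
  exists (maxn N1 N2); split; first by rewrite /tn mulrA; apply: H1; exact: leq_maxl.
  by apply: (le_lt_trans (H2 _ (leq_maxr N1 N2))); lra.
have lW : A (P1 S (x 0)) = l.
  have [_ E] : dom S (P1 S (x 0)) /\ A (P1 S (x 0)) = l; last exact: E.
  apply: A_closed => e e0.
  have [d d0 Hd] := cont_on_blinear P1_blinear (xc J0) e0.
  have [k [k1 k2]] := small (Num.min e d) ltac:(by rewrite lt_min e0).
  have Jk : J (tn k) by exact/J'J/Jp.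
  exists (P1 S (x (tn k))); split; first exact: P1_dom (dx Jk).
    apply: (Hd (tn k) Jk); rewrite subr0 gtr0_norm//; apply: lt_le_trans k2 _.
    by rewrite ge_min lexx orbT.
  have := Hl k => /= H; rewrite -[X in nrm X]opprB.
  have -> : nrm (- (l - W (tn k) : Y)) = `|l - W (tn k)| by exact: (@normrN _ rY).
  apply: (le_trans H); rewrite -mulrA (le_trans k1)// ge_min lexx //.
move=> e e0; have M1 : 0 < M + 1 by lra.
have e1 : 0 < e / 2 / (M + 1) by rewrite !divr_gt0.
exists (Num.min h (e / 2 / (M + 1))) => [|s]; first by rewrite lt_min h0.
rewrite {1}JE /= subr0 => s0; rewrite (ger0_norm s0) lt_min => /andP[sh se].
have [->|sn] := eqVneq s 0; first by rewrite subrr normr0 ltW.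
have sp : 0 < s by rewrite lt_def sn.
rewrite lW; have [k [k1 k2]] := small (Num.min s (e / 2)) ltac:(by rewrite lt_min sp divr_gt0).
have ts : tn k < s by apply: lt_le_trans k2 _; rewrite ge_min lexx.
have H1 := Hl k; have H2 := lip (tn k) s (tnh k) ltac:(by rewrite sp ltW).
rewrite (_ : _ - _ = (W s - W (tn k)) - (l - W (tn k))); last by rewrite opprB addrA subrK.
apply: le_trans (ler_normB _ _) _.
have k3 : M * tn k <= e / 2 by apply: le_trans k1 _; rewrite ge_min lexx orbT.
have H3 : `|l - W (tn k)| <= e / 2 by apply: le_trans H1 _; rewrite -mulrA.
have H4 : M * `|s - tn k| <= (M + 1) * s.
  have t_0 := tn0 k; rewrite gtr0_norm ?subr_gt0//.
  have p1 : M * (s - tn k) <= M * s by apply: ler_wpM2l => //; lra.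
  lra.
have H5 : (M + 1) * s < e / 2 by rewrite mulrC -ltr_pdivlMr.
lra.
Qed.

Theorem solution_reduced : sol_on reduced_rhs J W.
Proof.
move=> t Jt; have t_0 : 0 <= t := JH Jt.
have [JE|JN] := pselect (J = [set s | 0 <= s]); last first.
  have JJ : J = J' by apply/seteqP; split=> [s Js|s]; [split|exact: J'J].
  by rewrite {1}JJ; apply: W_deriv'; rewrite -JJ.
have [t00|tn0] := eqVneq t 0; last first.
  have tp : 0 < t by rewrite lt_def tn0.
  apply: (deriv_on_local tp _ (W_deriv' (conj Jt (fun _ => tp)))) => s Js st.
  by split=> // _; move: st; rewrite ltr_norml; lra.
rewrite t00; have J0 : J 0 by rewrite -t00.
have [iJ _ _ _ _] := HJ.
(* At t = 0 on the full half-line the derivative is obtained as the limit of the derivatives at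
   positive times. *)
apply: (@deriv_on_limit R rY J W (fun t => reduced_rhs t (W t))) => //.
- exact: W_cont0.
- move=> s Js sn; have J's : J' s.
    by split=> // _; rewrite lt_def sn; exact: JH.
  apply: deriv_on_sub (W_deriv' J's) => q [Jq qn]; split=> // _.
  by rewrite lt_def (JH Jq) andbT; apply/eqP.
move=> e e0; have [d d0 Hd] := comp_cont_on (reduced_rhs_cont) (W_cont0 JE) e0.
by exists d => // s Js sn sd; apply: Hd.
Qed.
End FromSolution.

Section ToSolution.
Variables (t0 : R) (J : set R) (W : R -> rY).
Hypotheses (HJ : interval_from t0 J) (sW : sol_on reduced_rhs J W).
Hypothesis WY : forall t, J t -> Q1 S (W t) = W t.
Local Notation x := (fun t => state t (W t)).
Let JH : J `<=` half_line. Proof. exact: interval_from_sub HJ. Qed.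

Lemma A_state t V : 0 <= t -> A (state t V) = Q1 S V + A (PT (Tdw 1) (z t)).
Proof.
move=> t_0; have [DV AV] := AinvP V; have [dV _] := (D1P _).1 DV.
have le := eta_level t_0 DV; have lz := sigma_level t_0.
rewrite /state (lin_domD A_lin); [|by apply: domD => //; exact: level_dom le|exact: level_dom lz].
rewrite (lin_domD A_lin)//; last exact: level_dom le.
rewrite AV lz -[X in A X]le A_PT (_ : PT _ _ = 0).
  by rewrite (lin_dom0 A_lin) addr0.
by apply: chain_proj_eq0 => i k _; rewrite /Ts; lia.
Qed.

(** Q_1 and all the functionals q_i^j annihilate the difference of the two sides: each level of each
    chain is covered by the equation for x_{20}, for a component x_{2s}^{(s+1)} or for a wedge
    component. *)
Let residual t : 0 <= t ->
  f t (state t (W t)) - B (state t (W t)) = reduced_rhs t (W t) + A (PT (Tdw 1) (zd t)).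
Proof.
move=> t_0; set v := state t (W t); have Mv : MM v by exact: state_MM.
have dv := MM_dom Mv.
have vE : P2S S v = z t by exact: (P2S_state Had Hred).
have [Qd Qw] : (forall s, (1 <= s < ν)%N -> Q2d S s (f t v) = B (P2d S s v)) /\
    (forall s, (1 <= s < ν.-1)%N ->
     Q2S S s (f t v) = B (P2w S s v) + A ((du s.+1 t : X) + dw s.+1 t)).
  exact: (sigma_zeros Had (red_u Hred) (red_w Hred)).
have [DV _] := AinvP (W t); have [_ P0 _] := red_eta Hred t_0 DV.
set D := f t v - B v; apply/eqP; rewrite -subr_eq0 opprD addrA; apply/eqP.
have pd y : dom S (PT (Tdw 1) y) by exact: PT_dom.
have QTD T : QT T (D - (reduced_rhs t (W t) : Y) - A (PT (Tdw 1) (zd t))) =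
    QT T (f t v) - B (PT T v) - QT T (A (PT (Tdw 1) (zd t))).
  have bQ := QT_blinear T.
  rewrite 2!(blinearB bQ) /D (blinearB bQ) QT_B// -(Q1_reduced_rhs u w eta t (W t)) QT_Q1.
  by rewrite subr0.
have TsTdw j : (1 <= j)%N -> PT (Ts j) (PT (Tdw 1) (zd t)) = PT (Ts j) (zd t).
  by move=> j1; rewrite PT_PT; apply: eq_PT => i k ki; rewrite Tdw1// /Ts; lia.
have Q0 : QT (Ts 0) (D - (reduced_rhs t (W t) : Y) - A (PT (Tdw 1) (zd t))) = 0.
  rewrite QTD QT_Ts_A// TsTdw// (PT_Ts_deriv Hred)//.
  have lev1 q : level (Td 1) (du 1 q) by have [] := red_level Hred q (ltn0Sn 0).
  have lev2 q : level (Tw 1) (dw 1 q) by have [] := red_level Hred q (ltn0Sn 0).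
  move: P0; rewrite PhiE// -(PT_Ts_deriv Hred)// PT_idem => P0.
  rewrite -[RHS]P0; congr (_ - B _ - _).
  have lz := sigma_level t_0.
  have le := eta_level t_0 DV; have bP := PT_blinear (Ts 0).
  rewrite /v /state 2!(blinearD bP) (D1_PT _ DV) le (PT_level0 _ lz) ?add0r ?addr0// => i k ki.
  by rewrite Tdw1// /Ts; lia.
have Qdd s : (1 <= s < ν)%N -> QT (Td s) (D - (reduced_rhs t (W t) : Y) - A (PT (Tdw 1) (zd t))) = 0.
  by move=> sr; rewrite QTD QT_Td_A// subr0 -Q2d_QT Qd// P2d_PT subrr.
have Qww s : (1 <= s < ν.-1)%N ->
    QT (Tw s) (D - (reduced_rhs t (W t) : Y) - A (PT (Tdw 1) (zd t))) = 0.
  move=> sr; rewrite QTD QT_Tw_A// TsTdw// (PT_Ts_deriv Hred)// -Q2S_QT Qw// P2w_PT.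
  by rewrite [X in X - _ - _]addrC addrK subrr.
set E := D - _ - _ in Q0 Qdd Qww *.
have Q1E0 : Q1 S E = 0.
  rewrite /E 2!(blinearB Q1_blinear) Q1_A// P1_PT (lin_dom0 A_lin) subr0.
  rewrite Q1_reduced_rhs// /reduced_rhs (max_idPl t_0) /D (blinearB Q1_blinear) Q1_B//.
  rewrite (P1_state Had Hred)// Q1_B; last by have [] := (D1P _).1 DV.
  by have [_ ->] := (D1P _).1 DV; rewrite subrr.
have coef (i : 'I_n) s : (s < m i)%N -> root_fun i s.+1 E = 0.
  move=> si; have mi := chain_bounds i.
  have use (T : 'I_n -> nat -> bool) : T i s -> QT T E = 0 -> root_fun i s.+1 E = 0.
    move=> Ti QE; have := @q_QT _ _ _ _ S HS T i s E si; rewrite Ti QE => <-.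
    have := @dualZ _ _ _ (root_fun i s.+1) 0 0 (@q_dual _ _ _ _ S HS i s.+1 si).
    by rewrite !scale0r.
  have [s0|s0] := posnP s; first by apply: (use (Ts 0)) Q0; rewrite /Ts s0.
  have [sE|sN] := eqVneq (m i) s.+1.
    by apply: (use (Td s)); [rewrite /Td; lia|apply: Qdd; lia].
  by apply: (use (Tw s)); [rewrite /Tw; lia|apply: Qww; lia].
move: Q1E0; rewrite Q1E (_ : QT _ E = 0) ?subr0//.
rewrite /QT /chain_proj big1// => i _; rewrite big1// => s _.
by rewrite coef ?scale0r.
Qed.

Let x_cont t : J t -> cont_on J (x : R -> rX) t.
Proof.
move=> Jt e e0; have [d d0 Hd] := state_cont (W t) (JH Jt) e0.
have d2 : 0 < d / 2 by rewrite divr_gt0.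
have [d' d'0 Hd'] := deriv_on_cont (sW Jt) d2.
exists (Num.min d d') => [|s Js]; first by rewrite lt_min d0.
rewrite lt_min => /andP[s1 s2]; apply: Hd => //; first exact: JH.
by apply: le_lt_trans (Hd' s Js s2) _; lra.
Qed.

Theorem reduced_solution : solution_in S MM J x /\ forall t, J t -> A (P1 S (x t)) = W t.
Proof.
have P1x t : J t -> A (P1 S (x t)) = W t.
  by move=> Jt; rewrite (P1_state Had Hred)//; [have [_ ->] := AinvP (W t); exact: WY|exact: JH].
split=> //; split; last by move=> t Jt; apply: state_MM => //; exact: JH.
have bA := @lin_PT_blinear _ _ _ _ S HS _ (Tdw 1) A_lin.
split; first by apply/within_contP.
  by move=> t Jt; apply: MM_dom; apply: state_MM => //; exact: JH.
exists (fun t => f t (x t) - B (x t)); split; last by move=> t _; rewrite subrK.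
  move=> t J't; have Jt : J t by case: J't.
  apply/tderivP; rewrite residual; last exact: JH.
  apply: (@deriv_on_sub _ _ J); first exact: open_part_sub.
  apply: (@eq_deriv_on _ _ _ (fun s => W s + (A (PT (Tdw 1) (z s)) : rY))) => //.
    by move=> s Js /=; rewrite A_state ?WY//; exact: JH.
  apply: deriv_onD; first exact: sW.
  exact: deriv_on_sub JH (deriv_on_blinear bA (sigma_has_deriv (JH Jt))).
apply/within_contP => t J't; have Jt : J t by case: J't.
apply: (@cont_on_sub _ _ J); first exact: open_part_sub.
apply: (@eq_cont_on _ _ _ (fun s => reduced_rhs s (W s) + (A (PT (Tdw 1) (zd s)) : rY))) => //.
  by move=> s Js; rewrite residual//; exact: JH.
apply: contD_on; first exact: (@comp_cont_on R rY reduced_rhs reduced_rhs_cont J W t (deriv_on_cont (sW Jt))).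
exact: cont_on_sub JH (cont_on_blinear bA (sigma_deriv_cont Hred (JH Jt))).
Qed.
End ToSolution.
End Equivalence.

(** * Absence of global solutions *)

Section FiniteTime.
Variable R : realType.
Local Notation mu := (@lebesgue_measure R).

Lemma bigmin_attained (k : nat) (F : 'I_k.+1 -> R) :
  (forall i, \big[Order.min/F ord0]_(j < k.+1) F j <= F i) /\
  exists i, \big[Order.min/F ord0]_(j < k.+1) F j = F i.
Proof.
split; first by move=> i; exact: bigmin_le_cond.
elim/big_ind: _ => [|x y [i ->] [j ->]|i _]; [by exists ord0| |by exists i].
by rewrite /Order.min; case: ifP => _; [exists i|exists j].
Qed.

Lemma uniform_bound (k : nat) (F : 'I_k -> R -> R^o) (a b : R) : a <= b ->
  (forall i t, a <= t <= b -> cont_on `[a, b] (F i) t) ->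
  exists2 L : R, 0 <= L & forall i t, a <= t <= b -> `|F i t| <= L.
Proof.
move=> ab cF.
have [Bf HB] : {Bf : 'I_k -> R & forall i t, a <= t <= b -> `|F i t| <= Bf i}.
  apply: (@choice _ _ (fun i B => forall t, a <= t <= b -> `|F i t| <= B)) => i.
  exact: cont_on_bounded ab (cF i).
exists (\sum_i `|Bf i|) => [|i t tab]; first exact: sumr_ge0.
rewrite (bigD1 i)//= (le_trans (HB i t tab))// (le_trans (ler_norm _))// lerDl.
exact: sumr_ge0.
Qed.

Lemma primitive_integral (h G : R -> R^o) (a b : R) : a < b -> continuous (h : R -> R^o) ->
  (forall t, a - 1 <= t <= b + 1 -> deriv_on `[a - 1, b + 1] G t (h t)) ->
  (\int[mu]_(t in `[a, b]) (h t)%:E = (G b - G a)%:E)%E.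
Proof.
move=> ab ch dG.
have nb t : a <= t <= b -> nbhs t `[a - 1, b + 1]%classic.
  move=> tab; have : nbhs t `](a - 1), (b + 1)[%classic.
    by apply: near_in_itvoo; rewrite in_itv/=; lra.
  by apply: filterS => s; rewrite /= !in_itv/=; lra.
have d1 t : a <= t <= b -> derivable G t 1 /\ derive1 G t = h t.
  by move=> tab; apply: (deriv_on_derive1 (nb t tab)); apply: dG; lra.
have c1 t : a <= t <= b -> {for t, continuous G}.
  by move=> tab; apply: (deriv_on_continuous (nb t tab)); apply: deriv_on_cont (dG t _); lra.
rewrite EFinB; apply: continuous_FTC2 => //.
- by apply: continuous_subspaceT => x; exact: ch.
- split.
  + by move=> t; rewrite in_itv/= => tab; have [] := d1 t; first lra.
  + by apply: cvg_at_right_filter; apply: c1; lra.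
  + by apply: cvg_at_left_filter; apply: c1; lra.
- by move=> t; rewrite in_itv/= => tab; have [] := d1 t; first lra.
Qed.

(** The middle slope (c0 + C) / 2 is subtracted, after which the mean value estimate, a bound on
    norms, yields a one-sided inequality. *)
Lemma primitive_increasing (h G : R -> R^o) (a b c0 C : R) : a <= b -> 0 < c0 ->
  (forall t, a <= t <= b -> deriv_on `[a, b] G t (h t)) ->
  (forall t, a <= t <= b -> c0 <= h t <= C) -> c0 * (b - a) <= G b - G a.
Proof.
move=> ab c00 dG hb.
have dH t : a <= t <= b -> deriv_on `[a, b] (fun s => G s + (- ((c0 + C) / 2)) *: (s : R^o)) t
    (h t + (- ((c0 + C) / 2)) *: (1 : R^o)).
  move=> tab; apply: deriv_onD; first exact: dG.
  apply: (deriv_on_blinear (@blinear_scale R R^o (- ((c0 + C) / 2))) (u := fun s => s)).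
  move=> e e0; exists 1 => // s _ _; rewrite [_ *: _]mulr1 subrr normr0.
  by rewrite mulr_ge0// ltW.
have := mean_value ab dH (M := (C - c0) / 2).
have E : forall x y : R, x *: (y : R^o) = x * y by [].
rewrite !E !mulr1 => /(_ _)/ler_normlP[|H _].
  by move=> t tab; have := hb t tab; rewrite ler_norml; lra.
by move: H; rewrite mulrBr !mulNr; lra.
Qed.

Lemma deriv_on_comp (J I : set R) (p G : R -> R^o) (t : R) (p' g' : R) :
  (forall s, J s -> I (p s)) -> J t -> deriv_on J p t (p' : R^o) -> deriv_on I G (p t) (g' : R^o) ->
  deriv_on J (fun s => G (p s)) t (g' * p' : R^o).
Proof.
move=> JI Jt dp dG e e0.
have e1 : 0 < e / 2 / (`|p'| + 1) by rewrite !divr_gt0// ltr_wpDl.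
have [d1 d10 H1] := dG _ e1.
have e2 : 0 < Num.min 1 (e / 2 / (`|g'| + 1)) by rewrite lt_min ltr01 !divr_gt0// ltr_wpDl.
have [d2 d20 H2] := dp _ e2; have [d3 d30 H3] := deriv_on_cont dp (e := d1 / 2) ltac:(lra).
exists (Num.min d2 d3) => [|s Js]; first by rewrite lt_min d20.
rewrite lt_min => /andP[s2 s3].
have K3 := H3 s Js s3; have K2 := H2 s Js s2.
have K1 := H1 (p s) (JI s Js) ltac:(lra).
have E (x y : R) : x *: (y : R^o) = x * y by [].
rewrite !E in K1 K2 *.
have n0 := normr_ge0 (s - t).
have m1 : Num.min 1 (e / 2 / (`|g'| + 1)) <= 1 by rewrite ge_min lexx.
have m2 : Num.min 1 (e / 2 / (`|g'| + 1)) <= e / 2 / (`|g'| + 1) by rewrite ge_min lexx orbT.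
have P1 : `|p s - p t| <= (`|p'| + 1) * `|s - t|.
  rewrite (_ : p s - p t = (p s - p t - (s - t) * p') + (s - t) * p'); last by rewrite subrK.
  apply: le_trans (ler_normD _ _) _; rewrite normrM.
  have := ler_wpM2r n0 m1; lra.
rewrite (_ : _ - _ = (G (p s) - G (p t) - (p s - p t) * g') + (p s - p t - (s - t) * p') * g'); last first.
  by ring.
apply: le_trans (ler_normD _ _) _; rewrite normrM.
have -> : e * `|s - t| = e / 2 * `|s - t| + e / 2 * `|s - t| by rewrite -mulrDl -splitr.
apply: lerD.
  apply: (le_trans K1); apply: (le_trans (ler_wpM2l (ltW e1) P1)).
  by rewrite mulrA divfK// gt_eqF// ltr_wpDl.
have g0 := normr_ge0 g'.
apply: (le_trans (ler_wpM2r g0 K2)); rewrite mulrAC; apply: ler_wpM2r => //.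
apply: (le_trans (ler_wpM2r g0 m2)); rewrite mulrAC ler_pdivrMr ?ltr_wpDl//.
by apply: ler_wpM2l; [lra|rewrite lerDl].
Qed.

(** G is a primitive of 1/U and increasing, so G of the minimum is the minimum of the G (phi i), and
    the derivative of an active G (phi i) is at least psi. Over [a, b] this bounds the integral of
    psi by that of 1/U over [m a, m b], hence by a constant independent of b. *)
Theorem no_global_growth (k : nat) (phi dphi : 'I_k.+1 -> R -> R^o) (U psi : R -> R) (a : R) :
  let m t := \big[Order.min/phi ord0 t]_(i < k.+1) phi i t in
  0 <= a ->
  (forall i t, a <= t -> deriv_on [set t | a <= t] (phi i) t (dphi i t)) ->
  (forall i t, a <= t -> cont_on [set t | a <= t] (dphi i) t) ->
  (forall t, a <= t -> 0 < m t) ->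
  {within [set u : R | 0 < u], continuous U} -> (forall u : R, 0 < u -> 0 < U u) ->
  (forall t, 0 <= t -> 0 <= psi t) ->
  (forall s t : R, 0 <= s <= t -> mu.-integrable `[s, t] (EFin \o psi)) ->
  (forall i t, a <= t -> phi i t = m t -> U (m t) * psi t <= dphi i t) ->
  (\int[mu]_(u in `[m a, +oo[) ((U u)^-1)%:E < +oo)%E ->
  (\int[mu]_(t in `[a, +oo[) (psi t)%:E = +oo)%E -> False.
Proof.
move=> m a0 dphi_ cdphi m0 Uc U0 psi0 ipsi act Ufin psioo.
have mle i t : m t <= phi i t by have [H _] := bigmin_attained (phi ^~ t); exact: H.
have mex t : exists i, m t = phi i t by have [_] := bigmin_attained (phi ^~ t).
pose v0 := m a; have v00 : 0 < v0 by exact: m0.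
(* 1/U is frozen below m a to be continuous on the whole line; along m the freezing is never felt,
   by [mono]. *)
pose h (u : R) : R^o := (U (Num.max u v0))^-1.
have hp u : 0 < h u by rewrite invr_gt0 U0// lt_max v00 orbT.
have Ucont (u : R) : 0 < u -> cont_on [set u : R | 0 < u] (U : R -> R^o) u.
  move: Uc; rewrite subspace_continuousP => Uc u0 e e0.
  have /cvgrPdist_le/(_ e e0)/nbhs_ballP[d /= d0 Hd] := Uc u u0.
  by exists d => // s s0 su; rewrite distrC; apply: Hd => //; rewrite -ball_normE /ball_ /= distrC.
have hc : continuous h.
  move=> u; apply: (@deriv_on_continuous R setT); first exact: filterT.
  have mv0 : 0 < Num.max u v0 by rewrite lt_max v00 orbT.
  apply: cont_on_inv; first by rewrite gt_eqF// U0.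
  move=> e e0; have [d d0 Hd] := Ucont _ mv0 e e0; exists d => // s _ su.
  apply: Hd; first by rewrite /= lt_max v00 orbT.
  apply: le_lt_trans su; rewrite /Num.max.
  by do 2 (case: ifPn; rewrite -?leNgt => ?); rewrite ler_norml;
    have := ler_norm (s - u); have := ler_norm (u - s); rewrite (distrC u); lra.
have hcont J u : cont_on J h u.
  move=> e e0; have /cvgrPdist_le/(_ e e0)/nbhs_ballP[d /= d0 Hd] := hc u.
  by exists d => // s _ su; rewrite distrC; apply: Hd; rewrite -ball_normE /ball_ /= distrC.
pose I := (\int[mu]_(u in `[v0, +oo[) ((U u)^-1)%:E)%E.
have I0 : (0 <= I)%E.
  by apply: integral_ge0 => u; rewrite /= in_itv/= andbT => uv; rewrite lee_fin invr_ge0 ltW// U0// (lt_le_trans v00).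
have subJ b : [set` `[a, b]] `<=` [set t | a <= t] by move=> t; rewrite /= in_itv/= => /andP[].
have dph b i t : a <= t <= b -> deriv_on `[a, b] (phi i) t (dphi i t).
  by move=> /andP[t1 _]; apply: deriv_on_sub (subJ b) _; exact: dphi_.
have cdph b i t : a <= t <= b -> cont_on `[a, b] (dphi i) t.
  by move=> /andP[t1 _]; apply: cont_on_sub (subJ b) _; exact: cdphi.
(* The growth estimate with psi replaced by 0: the minimum never falls below its initial value. *)
have mono t : a <= t -> v0 <= m t.
  move=> at_; have [->|ta] := eqVneq t a; first exact: lexx.
  have at' : a < t by rewrite lt_neqAle eq_sym ta.
  have tb1 : t < t + 1 by rewrite ltrDl.
  have ab1 : a <= t + 1 by lra.
  have [L L0 HL] := uniform_bound ab1 (cdph (t + 1)).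
  suff : (\int[mu]_(s in `[a, t]) 0%:E <= (m t - m a)%:E)%E by rewrite integral0 lee_fin subr_ge0.
  apply: (@min_growth R k.+1 phi dphi m (fun=> 0) a t (t + 1) L) => //.
  - exact: dph.
  - move=> i s /andP[sa _] pm; apply: le_trans (act i s sa pm).
    have Us := U0 _ (m0 s sa); have ps := psi0 s (le_trans a0 sa).
    by rewrite mulr_ge0// ltW.
  - exact: integrable0.
have main b : a < b -> (\int[mu]_(t in `[a, b]) (psi t)%:E <= I)%E.
  move=> ab; pose b1 := b + 1; have bb1 : b < b1 by rewrite ltrDl.
  have ab1 : a <= b1 by lra.
  have [L L0 HL] := uniform_bound ab1 (cdph b1).
  have [Bd Bd0 HBd] := uniform_bound ab1 (fun i t tab => deriv_on_cont (dph b1 i t tab)).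
  have rng i t : a <= t <= b1 -> v0 <= phi i t <= Bd.
    move=> tab; have := HBd i t tab; have := mle i t; have := mono t; rewrite ler_norml.
    by have /andP[at_ _] := tab => /(_ at_); lra.
  have mrng t : a <= t <= b1 -> v0 <= m t <= Bd by move=> tab; have [i ->] := mex t; exact: rng.
  have vB : v0 <= Bd by have := mrng a; rewrite lexx ab1 => /(_ isT); lra.
  have vB1 : v0 - 1 <= Bd + 1 by lra.
  have [G [_ dG]] := @primitive_ex R R^o h (v0 - 1) (Bd + 1) vB1 (fun t _ => hcont _ t).
  have [C HC] := cont_on_bounded vB1 (fun t _ => hcont [set` `[v0 - 1, Bd + 1]] t).
  have [Ci HCi] := @cont_on_bounded R R^o (fun u => (h u)^-1) _ _ vB1
    (fun t _ => cont_on_inv (lt0r_neq0 (hp t)) (hcont [set` `[v0 - 1, Bd + 1]] t)).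
  have Ci0 : 0 < Ci + 1.
    have := HCi v0 ltac:(lra); have := normr_ge0 ((h v0)^-1 : R); rewrite /=; lra.
  have hb u : v0 - 1 <= u <= Bd + 1 -> (Ci + 1)^-1 <= h u <= C.
    move=> ur; have hu := hp u; have hi : 0 < (h u)^-1 by rewrite invr_gt0.
    have := HC u ur; have := HCi u ur; rewrite (gtr0_norm hu) (gtr0_norm hi) => h1 ->.
    rewrite andbT -[h u]invrK lef_pV2 ?posrE//; lra.
  have C0 : 0 <= C by have := HC v0 ltac:(lra); have := normr_ge0 (h v0); lra.
  have Ginc x y : v0 - 1 <= x -> x <= y -> y <= Bd + 1 -> (Ci + 1)^-1 * (y - x) <= G y - G x.
    move=> x1 xy y1; apply: (@primitive_increasing h G x y (Ci + 1)^-1 C xy).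
    - by rewrite invr_gt0.
    - move=> t txy; apply: (deriv_on_sub _ (dG t _)); last lra.
      by move=> s; rewrite /= !in_itv/=; lra.
    - by move=> t txy; apply: hb; lra.
  have Gle x y : v0 <= x -> x <= y -> y <= Bd -> G x <= G y.
    move=> x1 xy y1; have := Ginc x y ltac:(lra) xy ltac:(lra).
    have : 0 <= (Ci + 1)^-1 * (y - x) by rewrite mulr_ge0 ?subr_ge0// invr_ge0 ltW.
    lra.
  (* An index that is active for the G (phi i) is thereby active for the phi i. *)
  have Ginj x y : v0 <= x -> x <= y -> y <= Bd -> G y = G x -> y = x.
    move=> x1 xy y1 E; have := Ginc x y ltac:(lra) xy ltac:(lra).
    rewrite E subrr pmulr_rle0 ?invr_gt0// subr_le0 => yx.
    by apply/eqP; rewrite eq_le yx xy.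
  have hm t : a <= t -> h (m t) = (U (m t))^-1.
    by move=> at_; rewrite /h (max_idPl (mono t at_)).
  have P : (\int[mu]_(t in `[a, b]) (psi t)%:E <= (G (m b) - G (m a))%:E)%E.
    apply: (@min_growth R k.+1 (fun i t => G (phi i t)) (fun i t => h (phi i t) * dphi i t)
      (fun t => G (m t)) psi a b b1 (C * L) ab bb1).
    - move=> i t tab; apply: (@deriv_on_comp _ [set` `[v0 - 1, Bd + 1]]) (dph b1 i t tab) _.
      + by move=> s; rewrite /= !in_itv/= => /(rng i); lra.
      + by rewrite /= in_itv/=.
      + by apply: dG; have := rng i t tab; lra.
    - move=> i t tab; rewrite normrM; apply: ler_pM => //; last exact: HL.
      by apply: HC; have := rng i t tab; lra.
    - move=> i t tab; have := rng i t tab; have := mrng t tab => q1 q2.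
      by apply: Gle; [lra|exact: mle|lra].
    - by move=> t tab; have [i mi] := mex t; exists i; rewrite mi.
    - move=> i t tab E; have at_ : a <= t by lra.
      have tab1 : a <= t <= b1 by lra.
      have q1 := rng i t tab1; have q2 := mrng t tab1.
      have pm : phi i t = m t by apply: Ginj; [lra|exact: mle|lra|exact: E].
      have Um := U0 _ (m0 t at_).
      by rewrite pm hm// mulrC ler_pdivlMr// mulrC; exact: act.
    - by move=> t tab; apply: psi0; lra.
    - by apply: ipsi; rewrite a0 ltW.
  apply: le_trans P _; have := mrng b; rewrite ltW//= ltW// => /(_ isT)/andP[vb bB].
  have [->|bv] := eqVneq (m b) v0; first by rewrite subrr.
  have vb' : v0 < m b by rewrite lt_neqAle eq_sym bv.
  rewrite -(@primitive_integral h G v0 (m b) vb' hc); last first.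
    move=> t txy; apply: (deriv_on_sub _ (dG t _)); last lra.
    by move=> s; rewrite /= !in_itv/=; lra.
  rewrite /I (@eq_integral _ _ _ mu `[v0, +oo[%classic (fun u => (h u)%:E)); last first.
    by move=> u; rewrite inE /= in_itv/= andbT => uv; rewrite /h (max_idPl uv).
  apply: ge0_subset_integral => //.
  - by apply/measurable_EFinP; apply: measurable_funTS; exact: continuous_measurable_fun.
  - by move=> u _; rewrite lee_fin ltW.
  - by move=> u; rewrite /= !in_itv/= => /andP[-> _].
suff : (\int[mu]_(t in `[a, +oo[) (psi t)%:E <= I)%E.
  by rewrite psioo leye_eq => /eqP IE; move: Ufin; rewrite -/I IE.
rewrite itv_bndy_bigcup_BRight.
have cv : (fun n : nat => (\int[mu]_(t in `[a, (a + n%:R)%R]) (psi t)%:E)%E) @ \oo -->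
    (\int[mu]_(t in \bigcup_(n in setT) `[a, (a + n%:R)%R]%classic) (psi t)%:E)%E.
  apply: ge0_nondecreasing_set_cvg_integral.
  - apply/nondecreasing_seqP => n; apply/subsetPset => t; rewrite /= !in_itv/= => /andP[-> h1].
    by rewrite (le_trans h1)// lerD2l ler_nat.
  - by move=> n; exact: measurable_itv.
  - by move=> n; apply: measurable_int; apply: ipsi; rewrite a0 lerDl ler0n.
  - by move=> n t; rewrite /= in_itv/= => /andP[t1 _]; rewrite lee_fin psi0// (le_trans a0).
apply: (cvge_to_le cv).
near=> n; apply: main; rewrite ltrDl ltr0n; near: n; exact: nbhs_infty_gt.
Unshelve. all: end_near.
Qed.
End FiniteTime.

(** * Growth of V along solutions of the reduced equation *)

Section Lyapunov.
Variables (R : realType) (c : scalar_kind).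
Local Notation K := (scalar_field R c).
Variables (X Y : completeNormedModType K) (S : adae X Y).
Local Notation ν := (nu S).
Local Notation rX := (realify X).
Local Notation rY := (realify Y).
Local Notation Ainv := (@Ainv _ _ _ _ S).
Context {HS : root_adae S}.
Local Notation Q1_blinear := (@Q1_blinear _ _ _ _ S HS).
Variables (M20 : set X) (M2d M2w : nat -> set X).
Hypothesis Had : admissible S M20 M2d M2w.
Local Notation Hpencil := (ad_pencil Had).
Local Notation AinvP := (@AinvP _ _ _ _ S HS Hpencil).

Theorem reduction_exists : exists (u du w dw : nat -> R -> rX) (eta : R -> X -> rX),
  reduction S M20 M2d M2w u du w dw eta.
Proof.
have [u [du [w [dw [uP wP dwP lP cP]]]]] := @level_curves _ _ _ _ S HS M20 M2d M2w (ad_open Had)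
  (ad_smooth Had) (ad_1a Had) (ad_1b Had) (ad_1c Had) (ad_1d Had) (ad_2a Had) (ad_2b Had)
  (ad_2c Had) (ad_2d Had).
have su j t : (1 <= j < ν)%N -> 0 <= t -> cont_on half_line (u j) t.
  by move=> jr t0; have [_ h _] := uP j t jr t0; exact: deriv_on_cont h.
have sw j t : (1 <= j)%N -> 0 <= t -> cont_on half_line (w j) t.
  by move=> j1 t0; exact: deriv_on_cont (dwP j t j1 t0).
have zc : smooth 0 (sigma_part S u w).
  apply: (@smoothD R rX 0).
    apply: (@eq_smooth R rX 0 (fun t => \sum_(1 <= j < ν | (1 <= j < ν)%N) u j t)).
      by move=> t _; rewrite -big_nat.
    by apply: smooth_sum => j jr t; exact: su.
  apply: (@eq_smooth R rX 0 (fun t => \sum_(1 <= j < ν.-1 | (1 <= j < ν.-1)%N) w j t)).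
    by move=> t _; rewrite -big_nat.
  by apply: smooth_sum => j /andP[j1 _] t; exact: sw.
have [c1 c2] := cP 1%N (leqnn 1).
have [|||eta [e1 e2 e3]] := @implicit_zero_level _ _ _ _ S HS M20 M2d M2w Had (sigma_part S u w) (du 1%N) (dw 1%N)
  _ zc _ _ c1 c2.
- by move=> t t0; exact: (sigma_part_MS uP wP).
- by move=> t; have [] := lP 1%N t (leqnn 1).
- by move=> t; have [] := lP 1%N t (leqnn 1).
by exists u, du, w, dw, eta.
Qed.

Variables (u du w dw : nat -> R -> rX) (eta : R -> X -> rX).
Hypothesis Hred : reduction S M20 M2d M2w u du w dw eta.
Local Notation reduced_rhs := (reduced_field S u w eta).

(** V is differentiable along Y_1 only, so the remainder of W is checked to lie in Y_1 before the
    derivative of V is applied to it. *)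
Lemma frechet_chain (O : set Y) (V : Y -> (R^o : normedModType R)) (L : Y -> (R^o : normedModType R))
    (J : set R) (W : R -> rY) t (l : rY) :
  @is_frechet R c RealScalars Y (R^o : normedModType R) O (Y1 S) V (W t) L ->
  (forall s, J s -> O (W s)) -> O `<=` Y1 S -> J t -> Y1 S l -> deriv_on J W t l ->
  deriv_on J (fun s => V (W s) : R^o) t (L l).
Proof.
move=> [Ll [C HC] HL] OW OY Jt Yl dW e e0.
have YB (y y' : rY) : Y1 S y -> Y1 S y' -> Y1 S (y - y' : rY).
  by move=> /Y1P h /Y1P h'; apply/Y1P; rewrite (blinearB Q1_blinear) h h'.
have YZ (a : R) (y : rY) : Y1 S y -> Y1 S (a *: y : rY).
  by move=> /Y1P h; apply/Y1P; rewrite (blinearZ Q1_blinear) h.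
have n0 := normr_ge0 l.
have e1 : 0 < e / 2 / (`|l| + 1) by rewrite !divr_gt0// ltr_wpDl.
have [d1 d10 H1] := HL _ e1.
have e2 : 0 < Num.min 1 (e / 2 / (`|C| + 1)) by rewrite lt_min ltr01 !divr_gt0// ltr_wpDl.
have [d2 d20 H2] := dW _ e2; have [d3 d30 H3] := deriv_on_cont dW (e := d1 / 2) ltac:(lra).
exists (Num.min d2 d3) => [|s Js]; first by rewrite lt_min d20.
rewrite lt_min => /andP[s2 s3].
have K3 : nrm ((W s : Y) - W t) <= d1 / 2 := H3 s Js s3; have K2 := H2 s Js s2.
have K1 := H1 (W s) (OW s Js) ltac:(lra).
have m1 : Num.min 1 (e / 2 / (`|C| + 1)) <= 1 by rewrite ge_min lexx.
have m2 : Num.min 1 (e / 2 / (`|C| + 1)) <= e / 2 / (`|C| + 1) by rewrite ge_min lexx orbT.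
have st0 := normr_ge0 (s - t).
have P1 : `|W s - W t| <= (`|l| + 1) * `|s - t|.
  rewrite (_ : W s - W t = (W s - W t - (s - t) *: l) + (s - t) *: l); last by rewrite subrK.
  apply: le_trans (ler_normD _ _) _; rewrite normrZ; have := ler_wpM2r st0 m1; lra.
have Yst : Y1 S ((s - t) *: l : rY) by exact: YZ.
have Yws : Y1 S (W s - W t : rY) by apply: YB; apply: OY; exact: OW.
pose r : rY := W s - W t - (s - t) *: l.
have Yr : Y1 S r by exact: YB.
have Lr : L (W s - W t : rY) = (s - t) *: (L l : R^o) + L r.
  have := Ll (s - t) l r Yl Yr.
  rewrite (_ : of_real c (s - t) *: (l : Y) + r = (W s - W t : rY)) => [->//|].
  by rewrite /r -[of_real c (s - t) *: (l : Y)]/((s - t) *: l : rY) addrC subrK.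
rewrite (_ : _ - _ = ((V (W s) : R^o) - V (W t) - L (W s - W t : rY)) + L r); last first.
  by rewrite Lr opprD addrA subrK.
apply: le_trans (ler_normD _ _) _.
have -> : e * `|s - t| = e / 2 * `|s - t| + e / 2 * `|s - t| by rewrite -mulrDl -splitr.
apply: lerD.
  apply: (le_trans K1); apply: (le_trans (ler_wpM2l (ltW e1) P1)).
  by rewrite mulrA divfK// gt_eqF// ltr_wpDl.
apply: (le_trans (HC r Yr)); apply: (@le_trans _ _ (`|C| * (e / 2 / (`|C| + 1) * `|s - t|))).
  apply: (@le_trans _ _ (`|C| * nrm (r : Y))).
    by apply: ler_wpM2r; [exact: nrm_ge0|exact: ler_norm].
  by apply: ler_wpM2l => //; apply: (le_trans K2); apply: ler_wpM2r.
rewrite mulrA; apply: ler_wpM2r => //; rewrite mulrCA ler_piMr//; first by lra.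
by rewrite ler_pdivrMr ?ltr_wpDl// mul1r lerDl.
Qed.

Lemma gradient_cont (O : set Y) (V : Y -> (R^o : normedModType R))
    (dV : Y -> Y -> (R^o : normedModType R)) (J : set R) (W g : R -> rY) t :
  (forall y, O y -> @is_frechet R c RealScalars Y (R^o : normedModType R) O (Y1 S) V y (dV y)) ->
  @opnorm_continuous R c RealScalars Y (R^o : normedModType R) O (Y1 S) dV ->
  (forall s, J s -> O (W s)) -> (forall s, J s -> Y1 S (g s)) -> J t ->
  cont_on J W t -> cont_on J g t -> cont_on J (fun s => dV (W s) (g s) : R^o) t.
Proof.
move=> HV cV OW Yg Jt cW cg e e0.
have [Ll [C HC] _] := HV _ (OW t Jt).
have YB (y y' : rY) : Y1 S y -> Y1 S y' -> Y1 S (y - y' : rY).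
  by move=> /Y1P h /Y1P h'; apply/Y1P; rewrite (blinearB Q1_blinear) h h'.
have n0 := normr_ge0 (g t).
have e1 : 0 < e / 2 / (`|g t| + 1) by rewrite !divr_gt0// ltr_wpDl.
have [d1 d10 H1] := cV _ (OW t Jt) _ e1.
have e2 : 0 < Num.min 1 (e / 2 / (`|C| + 1)) by rewrite lt_min ltr01 !divr_gt0// ltr_wpDl.
have [d2 d20 H2] := cg _ e2; have [d3 d30 H3] := cW (d1 / 2) ltac:(lra).
exists (Num.min d2 d3) => [|s Js]; first by rewrite lt_min d20.
rewrite lt_min => /andP[s2 s3].
have m1 : Num.min 1 (e / 2 / (`|C| + 1)) <= 1 by rewrite ge_min lexx.
have m2 : Num.min 1 (e / 2 / (`|C| + 1)) <= e / 2 / (`|C| + 1) by rewrite ge_min lexx orbT.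
have K3 : nrm ((W s : Y) - W t) <= d1 / 2 := H3 s Js s3; have K2 := H2 s Js s2.
have K1 := H1 (W s) (OW s Js) ltac:(lra) (g s) (Yg s Js).
have gs : `|g s| <= `|g t| + 1.
  rewrite -[g s](subrK (g t)) (le_trans (ler_normD _ _))// addrC lerD2l; exact: le_trans K2 m1.
have Yd : Y1 S (g s - g t : rY) by apply: YB; exact: Yg.
have Ld : dV (W t) (g s) = (dV (W t) (g s - g t : rY) : R^o) + dV (W t) (g t).
  have := Ll 1 (g s - g t : rY) (g t) Yd (Yg t Jt); rewrite of_real1 !scale1r.
  by rewrite (_ : (g s - g t : rY) + g t = g s) ?subrK// => ->; rewrite -[of_real RealScalars 1]/(1 : R) scale1r.
rewrite (_ : _ - _ = ((dV (W s) (g s) : R^o) - dV (W t) (g s)) + dV (W t) (g s - g t : rY)); last first.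
  by rewrite Ld opprD [- dV _ _ - _]addrC addrA subrK.
apply: le_trans (ler_normD _ _) _; rewrite (splitr e); apply: lerD.
  apply: (le_trans K1); apply: (le_trans (ler_wpM2l (ltW e1) gs)).
  by rewrite divfK// gt_eqF// ltr_wpDl.
apply: (le_trans (HC _ Yd)); apply: (@le_trans _ _ (`|C| * (e / 2 / (`|C| + 1)))).
  apply: (@le_trans _ _ (`|C| * nrm ((g s : Y) - g t))).
    by apply: ler_wpM2r; [exact: nrm_ge0|exact: ler_norm].
  by apply: ler_wpM2l => //; exact: le_trans K2 m2.
rewrite mulrCA ler_piMr//; first by lra.
by rewrite ler_pdivrMr ?ltr_wpDl// mul1r lerDl.
Qed.

Theorem no_global_solution (O : set Y) (t0 : R) (W : R -> rY) :
  condition_5 S M20 M2d M2w O -> O `<=` Y1 S -> 0 <= t0 ->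
  sol_on reduced_rhs [set t | t0 <= t] W -> (forall t, t0 <= t -> O (W t)) -> False.
Proof.
move=> [k [V [dV [U [psi [HV HdV [Uc U0 psi0 ipsi] Hint Hgrow]]]]]] OY t00 sW OW.
(* The integrals in condition 5 start at positive times, while t0 may be 0. *)
pose a := t0 + 1; have a0 : 0 < a by rewrite /a; lra.
pose J := [set t : R | a <= t].
have J0 t : J t -> t0 <= t by rewrite /J /= /a; lra.
have YU t : Y1 S (reduced_rhs t (W t)) by apply/Y1P; exact: Q1_reduced_rhs.
have dW t : J t -> deriv_on J W t (reduced_rhs t (W t)).
  by move=> Jt; apply: deriv_on_sub (sW t (J0 t Jt)) => s /J0.
pose phi i t : R^o := V i (W t).
pose dphi i t : R^o := dV i (W t) (reduced_rhs t (W t)).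
have Vpos t : J t -> 0 < \big[Order.min/phi ord0 t]_(i < k.+1) phi i t.
  move=> Jt; have [_ [i ->]] := bigmin_attained (phi ^~ t).
  by have [_ _] := HV i; apply; apply: OW; exact: J0.
apply: (@no_global_growth R k phi dphi U psi a (ltW a0)) => //.
- move=> i t Jt; apply: (@frechet_chain O) => //; last exact: dW.
  + by have [H _] := HdV i; apply: H; apply: OW; exact: J0.
  + by move=> s Js; apply: OW; exact: J0.
- move=> i t Jt; have [H1 H2] := HdV i; apply: (@gradient_cont O (V i)) => //.
  + by move=> s Js; apply: OW; exact: J0.
  + exact: deriv_on_cont (dW t Jt).
  + exact: (@comp_cont_on R rY reduced_rhs (reduced_rhs_cont Had Hred) J W t (deriv_on_cont (dW t Jt))).
- move=> i t Jt E; have t_0 : 0 <= t by move: Jt; rewrite /a; lra.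
  have Wt : O (W t) by apply: OW; exact: J0.
  have [DV _] := AinvP (W t); have [Me _ _] := red_eta Hred t_0 DV.
  have Mz := sigma_part_MS (red_u Hred) (red_w Hred) t_0.
  have := Hgrow t _ _ (W t) t_0 Me Mz Wt i E.
  have QW : Q1 S (W t) = W t by apply/Y1P; exact: OY.
  by rewrite /dphi /reduced_field /consistent_state /Ainv QW (max_idPl t_0).
- by have [] := Hint _ (Vpos a (lexx a)).
- by have [] := Hint a a0.
Qed.
End Lyapunov.

(** * Maximal interval, uniqueness and blow-up of the solution *)

Theorem theorem4p11 (R : realType) (c : scalar_kind)
    (X Y : completeNormedModType (scalar_field R c)) (S : adae X Y)
    (M20 : set X) (M2d M2w : nat -> set X) (tOmega1 : set Y) :
  standing_assumptions S ->
  domA S `<=` domB S ->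
  regular_pencil (dom S) (opA S) (opB S) (nu S) ->
  root_system S ->
  rhs_continuous S ->
  rhs_structure S ->
  M_open S M20 M2d M2w ->
  rhs_smooth S M2d M2w ->
  condition_1a S M2d ->
  condition_1b S M2d ->
  condition_1c S M2d M2w ->
  condition_1d S M2d M2w ->
  condition_1e S M20 M2d M2w ->
  condition_2a S M2d ->
  condition_2b S M2d ->
  condition_2c S M2d M2w ->
  condition_2d S M2d M2w ->
  condition_2e_i S M20 M2d M2w \/ condition_2e_ii S M20 M2d M2w ->
  condition_3 S M20 M2d M2w ->
  rel_open (Y1 S) tOmega1 ->
  condition_4 S M20 M2d M2w tOmega1 ->
  condition_5 S M20 M2d M2w tOmega1 ->
  forall (t0 : R) (x01 : X), 0 <= t0 -> Omega1 S tOmega1 x01 ->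
  exists (tmax : R) (x : R -> X),
    [/\ maximal_solution_in S (MM S M20 M2d M2w) t0 `[t0, tmax[ x,
        P1 S (x t0) = x01,
        forall (J : set R) (y : R -> X), interval_from t0 J ->
          solution_in S (MM S M20 M2d M2w) J y -> P1 S (y t0) = x01 ->
          (J `<=` `[t0, tmax[) /\ (forall t, J t -> y t = x t),
        (nrm (opA S (P1 S (x t))) @[t --> tmax^'-] --> +oo)
      & dom S = setT \/ bounded_on (domA S) (opA S) ->
        (nrm (x t) @[t --> tmax^'-] --> +oo)].
Proof.
move=> hst hAB hpen hroot hcont hstr hMo hsm h1a h1b h1c h1d h1e h2a h2b h2c h2d h2e h3 hO h4 h5
  t0 x01 t00 HO.
have HS : root_adae S by split.
have Had : admissible S M20 M2d M2w by split.
have [OY _] := rel_openP hO.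
have [u [du [w [dw [eta Hred]]]]] := @reduction_exists _ _ _ _ S HS _ _ _ Had.
pose Ups := reduced_field S u w eta.
have cU : jointly_cont Ups by exact: (reduced_rhs_cont Had Hred).
have lU : loc_lipschitz Ups by exact: (reduced_rhs_lip Had Hred).
have [y0 Oy0 yx] := HO.
have [Dx01 Ax01] := @At_invP _ _ _ _ S HS hpen y0 (OY y0 Oy0); rewrite yx in Dx01 Ax01.
have [W [W0 HW]] := ode_maximal cU lU t0 (y0 : realify Y).
(* The reduced equation lives in all of Y; since Q_1 W solves it with the same initial value, W has
   values in Y_1. *)
have QW (J : set R) : sol_on Ups J W -> is_interval J -> J t0 -> forall t, J t -> t0 <= t ->
    Q1 S (W t) = W t.
  move=> sW iJ Jt0 t Jt tt0.
  have sub : [set` `[t0, t]] `<=` J by move=> s; rewrite /= in_itv/=; exact: iJ.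
  have s1 : sol_on Ups `[t0, t] W by move=> s st; apply: deriv_on_sub sub (sW s (sub s st)).
  have s2 := @sol_Q1 _ _ _ _ S HS u w eta _ W s1.
  apply: (@sol_unique R (realify Y) Ups lU t0 t (fun t => Q1 S (W t)) W) => //.
    by rewrite W0; apply/Y1P; exact: OY.
  by rewrite tt0 lexx.
have stateW0 : P1 S (consistent_state S u w eta t0 (W t0)) = x01.
  rewrite (P1_state Had Hred)// W0 /Ainv (_ : Q1 S y0 = y0)//.
  by apply/Y1P; exact: OY.
case: HW => [sW|[T [t0T sW nT]]].
  (* A solution on [t0, oo) is trivially maximal, so condition 4 keeps it in Omega_1, where
     condition 5 excludes it. *)
  exfalso; pose J := [set t : R | t0 <= t].
  have HJ : interval_from t0 J.
    split=> //; first by move=> a b; rewrite /J /= => ta tb s /andP[sa _]; exact: le_trans ta sa.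
    - by rewrite /J /=.
    - by exists (t0 + 1); rewrite /J /=; lra.
  have WY t : J t -> Q1 S (W t) = W t.
    by move=> Jt; have [iJ _ Jt0 _ _] := HJ; exact: (QW J).
  have [sx AW] := @reduced_solution _ _ _ _ S HS _ _ _ Had _ _ _ _ _ Hred t0 J W HJ sW WY.
  have OW t : t0 <= t -> tOmega1 (W t).
    move=> tt; have := h4 t0 J _ (And3 HJ sx _) _ t tt.
    rewrite stateW0 => /(_ _ HO)[].
      move=> J' x' [_ _ _ J't0 _] JJ' _ _; apply/seteqP; split=> // s; exact: J't0.
    move=> y Oy yE; rewrite -AW// -yE.
    by have [_ ->] := @At_invP _ _ _ _ S HS hpen y (OY y Oy).
  exact: (@no_global_solution _ _ _ _ S HS _ _ _ Had _ _ _ _ _ Hred tOmega1 t0 W h5 OY t00 sW OW).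
pose J : set R := `[t0, T[%classic.
have inJ t : J t = (t0 <= t < T) by rewrite /J /= in_itv.
have HJ : interval_from t0 J.
  split=> //; first exact: interval_is_interval.
  - by rewrite inJ lexx.
  - by move=> t; rewrite inJ => /andP[].
  - by exists ((t0 + T) / 2); rewrite ?inJ; lra.
have WY t : J t -> Q1 S (W t) = W t.
  by move=> Jt; have [iJ _ Jt0 Jle _] := HJ; apply: (QW J) => //; exact: Jle.
have [sx AW] := @reduced_solution _ _ _ _ S HS _ _ _ Had _ _ _ _ _ Hred t0 J W HJ sW WY.
pose x t := consistent_state S u w eta t (W t).
(* Every competing solution yields a solution of the reduced equation with the same initial value;
   its interval cannot contain T, and uniqueness for that equation identifies the two on the common
   interval. *)
have uniq (J' : set R) (y : R -> X) : interval_from t0 J' ->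
    solution_in S (MM S M20 M2d M2w) J' y -> P1 S (y t0) = x01 ->
    (J' `<=` J) /\ (forall t, J' t -> y t = x t).
  move=> HJ' sy Py; pose V t : realify Y := opA S (P1 S (y t)).
  have sV : sol_on Ups J' V.
    exact: (@solution_reduced _ _ _ _ S HS _ _ _ Had _ _ _ _ _ Hred t0 J' y HJ' sy).
  have V0 : V t0 = y0 by rewrite /V Py.
  have [iJ' _ J't0 J'le _] := HJ'.
  have sub t : J' t -> [set` `[t0, t]] `<=` J'.
    by move=> Jt s; rewrite /= in_itv/=; exact: iJ'.
  have sub' : J' `<=` J.
    move=> t J't; rewrite inJ J'le//= ltNge; apply/negP => Tt; apply: nT; split; first exact: ltW.
    have J'T : J' T by apply: (sub t J't); rewrite /= in_itv/= Tt ltW.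
    by exists V; split=> // s sT; apply: deriv_on_sub (sub T J'T) (sV s (sub T J'T s sT)).
  split=> // t J't; have Jt := sub' t J't.
  rewrite (@solution_state _ _ _ _ S HS _ _ _ Had _ _ _ _ _ Hred t0 J' y HJ' sy t J't).
  have -> : opA S (P1 S (y t)) = W t; last by [].
  apply: (@sol_unique R (realify Y) Ups lU t0 t V W) => //; first by rewrite W0.
  - by move=> s st; apply: deriv_on_sub (sub t J't) (sV s (sub t J't s st)).
  - have subJ : [set` `[t0, t]] `<=` J.
      by move=> s; rewrite /= in_itv/= inJ; move: Jt; rewrite inJ; lra.
    by move=> s st; apply: deriv_on_sub subJ (sW s (subJ s st)).
  - by rewrite J'le// lexx.
have blow r : \forall t \near T^'-, r < nrm (opA S (P1 S (x t))).
  have [M0 HM] : exists M0 : R -> R, forall r t, t0 <= t < T -> `|W t| <= r -> `|Ups t (W t)| <= M0 r.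
    have [M0 HM] : {M0 : R -> R & forall r, forall t, t0 <= t < T -> `|W t| <= r -> `|Ups t (W t)| <= M0 r}.
      apply: (@choice _ _ (fun r M => forall t, t0 <= t < T -> `|W t| <= r -> `|Ups t (W t)| <= M)) => q.
      have [M HM] := @reduced_rhs_bound _ _ _ _ S HS _ _ _ Had _ _ _ _ _ Hred T q.
      by exists M => t tT Wt; apply: HM => //; lra.
    by exists M0.
  have [s sT Hs] := sol_blowup cU W0 t0T sW nT (fun r => ex_intro _ (M0 r) (HM r)) r.
  have [ts0 sT'] := andP sT; near=> t.
  have st : s < t by near: t; exact: nbhs_left_gt.
  have tT : t < T by near: t; exact: nbhs_left_lt.
  have Jt : J t by rewrite inJ tT andbT; lra.
  by rewrite AW//; apply: Hs; rewrite st.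
exists T, x; split=> //.
- split=> // J' x' HJ' JJ' sx' xx'.
  have Jt0 : J t0 by rewrite inJ lexx.
  have [|J'J _] := uniq J' x' HJ' sx'; first by rewrite xx'.
  by apply/seteqP; split.
- by apply/cvgryPgt => r; exact: blow.
(* The norm of A P_1 x is at most a multiple of the norm of x, so the latter diverges with the
   former. *)
- move=> HA; have [C C0 HC] := @A_bounded _ _ _ _ S HS HA.
  have [C1 C10 HC1] := blinear_bound (@P1_blinear _ _ _ _ S HS).
  apply/cvgryPgt => r; near=> t.
  have tT : t < T by near: t; exact: nbhs_left_lt.
  have tt0 : t0 < t by near: t; exact: nbhs_left_gt.
  have Jt : J t by rewrite inJ tT ltW.
  have B1 : C * C1 * `|r| < nrm (opA S (P1 S (x t))) by near: t; exact: blow.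
  have [_ Mx] := sx; have dx : dom S (x t) by apply: (MM_dom Had); exact: Mx.
  rewrite ltNge; apply/negP => xr; move: B1; rewrite ltNge => /negP; apply.
  have dP : dom S (P1 S (x t)) by exact: P1_dom.
  apply: (le_trans (HC _ dP)); rewrite -mulrA; apply: ler_wpM2l => //.
  apply: (le_trans (HC1 (x t))); apply: ler_wpM2l; first exact: ltW.
  exact: le_trans xr (ler_norm r).
Unshelve. all: end_near.
Qed.
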